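(* The integral $I_N$ satisfies the $(N-1)$-th order linear $q$-difference equation $$\sum_{i=0}^{N-1} g_i(a_1)\, I_N(q^i a_1,a_2,\ldots,a_{2N})=0,$$ where $g_i(a)$ is given by $$g_i(a)=a q^i\sum_{j=0}^{i}\sum_{m=0}^{2N}(-1)^{j+m}(\sigma_m-\sigma_{2N-m})\,\frac{(q^j a)^{m-N}\,q^{\binom{j+1}{2}}}{(q;q)_{i-j}\,(q;q)_j\,(q^{2j}a^2;q)_{i-j+1}\,(q^j a^2;q)_j}.$$
   Context: Let $N\ge 2$ be an integer and $|q|<1$. Notation: $(a;q)_n=\prod_{k=0}^{n-1}(1-aq^k)$, $(a;q)_\infty=\prod_{k\ge0}(1-aq^k)$, $(az^{\pm1};q)_\infty=(az;q)_\infty(az^{-1};q)_\infty$, $(z^{\pm N};q^{N/2})_\infty=(z^{N};q^{N/2})_\infty(z^{-N};q^{N/2})_\infty$, and $\sigma_m$ is the $m$-th elementary symmetric function of $a_1,\ldots,a_{2N}$. The parameters are $a_j=q^{s_j}$ with $|a_j|<1$. Put $$\Phi(z)=\frac{z-z^{-1}}{z^{N/2}-z^{-N/2}}\,\frac{(z^{\pm N};q^{N/2})_\infty}{\prod_{j=1}^{2N}(a_jz^{\pm1};q)_\infty},\qquad I_N=I_N(a_1,\ldots,a_{2N})=\int_C\frac{dz}{2\pi\sqrt{-1}\,z}\,\Phi(z).$$ For $N$ even, $C$ is the unit circle $\mathbb T$ traversed anticlockwise. For $N$ odd, the integrand has a branch cut, conventionally taken to be $(-\infty,0)$, and $C=\mathbb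 T\cup\mathbb H$ is a contour of Hankel type with a tail $\mathbb H$, starting at $\infty e^{-\pi i}$ and finishing at $\infty e^{+\pi i}$; the tail contributes an integral over $[1,\infty)$, which (using an asymptotic expansion of the integrand valid for $|\arg(a_j)|\le\pi$) converges under the additional condition $\sum_{j=1}^{2N}\mathrm{Re}(s_j)<N-1$.
   Formalization: For odd N, q is taken real with 0<q<1 and |arg(a_j)|<π strictly, and terms I_N(q^i a_1,…) whose tail integral diverges (always i=N-1) are read as the analytic continuation in s_1; the equation is asserted only where such values exist. *)

(* Defs.v *)
From Stdlib Require Import Reals List Arith.
From Coquelicot Require Export Coquelicot.
Import ListNotations.
Open Scope C_scope.

(* Conventions.
   - [lq] is a logarithm of q, so that q^c = exp (c log q) is single-valued;
     0 < |q| < 1 is [Re lq < 0], and every branch of q^(N/2) is covered.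
   - Parameters are 0-based: a_(j+1) is [a j], and only j < 2N is used. *)

Definition Cexp (w : C) : C :=
  (exp (Re w) * cos (Im w), exp (Re w) * sin (Im w))%R.

Definition qpow (lq c : C) : C := Cexp (lq * c).

Fixpoint Cprod (f : nat -> C) (n : nat) : C :=
  match n with
  | O => 1
  | S k => Cprod f k * f k
  end.

Definition qpoch (a q : C) (n : nat) : C := Cprod (fun k => 1 - a * q ^ k) n.

Definition qpoch_inf (a q : C) : C :=
  (real (Lim_seq (fun n => Re (qpoch a q n))),
   real (Lim_seq (fun n => Im (qpoch a q n)))).

(* The increasing m-tuples of entries of a list. *)
Fixpoint combs {A : Type} (m : nat) (l : list A) : list (list A) :=
  match m, l with
  | O, _ => [[]]
  | S _, [] => []
  | S m', x :: l' => map (cons x) (combs m' l') ++ combs m l'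
  end.

Definition sigma (N : nat) (a : nat -> C) (m : nat) : C :=
  fold_right Cplus 0
    (map (fun js => fold_right Cmult 1 (map a js)) (combs m (seq 0 (2 * N)))).

(* x ^ m / x ^ N is x^(m-N). *)
Definition g (N : nat) (q : C) (a : nat -> C) (i : nat) (x : C) : C :=
  x * q ^ i *
  sum_n (fun j => sum_n (fun m =>
    (- (1)) ^ (j + m) * (sigma N a m - sigma N a (2 * N - m))
    * ((q ^ j * x) ^ m / (q ^ j * x) ^ N * q ^ (j * (j + 1) / 2)
       / (qpoch q q (i - j) * qpoch q q j
          * qpoch (q ^ (2 * j) * x ^ 2) q (i - j + 1)
          * qpoch (q ^ j * x ^ 2) q j))) (2 * N)) i.

(* The integrand at z = exp w. Using w = log z as the variable fixes the branch
   of z^(N/2): the two sides of the cut are Im w = PI and Im w = - PI.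
   At z^N = 1 the quotient has a removable singularity; [Cinv 0 = 0] only
   alters finitely many values on the contour. *)
Definition Phi (N : nat) (lq : C) (a : nat -> C) (w : C) : C :=
  let z := Cexp w in
  let q := Cexp lq in
  let p := qpow lq (INR N / 2) in
  (z - / z) / (Cexp (INR N * w / 2) - Cexp (- (INR N * w / 2)))
  * (qpoch_inf (z ^ N) p * qpoch_inf (/ z ^ N) p)
  / Cprod (fun j => qpoch_inf (a j * z) q * qpoch_inf (a j / z) q) (2 * N).

Definition int_circle (N : nat) (lq : C) (a : nat -> C) : C :=
  RInt (V := C_R_CompleteNormedModule)
    (fun t => Phi N lq a (0%R, t)) (- PI) PI / (2 * PI).

(* The Hankel tail comes in along z = x e^(- i PI) and leaves along
   z = x e^(i PI), with x in [1, oo) and dz / z = dx / x. *)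
Definition tail_side (N : nat) (lq : C) (a : nat -> C) (t : R) : C :=
  RInt_gen (V := C_R_CompleteNormedModule)
    (fun x => Phi N lq a (ln x, t) / x) (at_point 1%R) (Rbar_locally p_infty).

Definition int_tail (N : nat) (lq : C) (a : nat -> C) : C :=
  (tail_side N lq a PI - tail_side N lq a (- PI)) / (2 * PI * Ci).

Definition I_int (N : nat) (lq : C) (a : nat -> C) : C :=
  if Nat.even N then int_circle N lq a
  else int_circle N lq a + int_tail N lq a.

(* The exponents s_j with the first one replaced. *)
Definition set_first (s : nat -> C) (t : C) (j : nat) : C :=
  match j with
  | O => t
  | S _ => s j
  end.

Definition params (lq : C) (s : nat -> C) (j : nat) : C := qpow lq (s j).

Definition tail_converges (N : nat) (s : nat -> C) : Prop :=
  (sum_n (fun j => Re (s j)) (2 * N - 1) < INR N - 1)%R.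

Definition connected (D : C -> Prop) : Prop :=
  forall U V : C -> Prop,
    open U -> open V ->
    (forall x, D x -> U x \/ V x) ->
    (exists x, D x /\ U x) -> (exists x, D x /\ V x) ->
    exists x, D x /\ U x /\ V x.

Definition analytic_on (D : C -> Prop) (f : C -> C) : Prop :=
  forall x, D x -> exists (c : nat -> C) (r : posreal),
    forall y, Cmod (y - x) < r ->
      is_pseries (K := C_AbsRing) (V := C_NormedModule) c (y - x) (f y).

(* [f] on [D] is an analytic continuation of t |-> I_N(q^t, q^(s_2), ...) from
   the region where the tail converges, inside the domain |q^t| < 1 with q^t
   off the cut. *)
Definition I_continuation (N : nat) (lq : C) (s : nat -> C)
    (D : C -> Prop) (f : C -> C) : Prop :=
  open D /\ connected D /\
  (forall t, D t -> Cmod (qpow lq t) < 1 /\ Rabs (Im (lq * t)) < PI)%R /\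
  (exists t, D t /\ tail_converges N (set_first s t)) /\
  analytic_on D f /\
  (forall t, D t -> tail_converges N (set_first s t) ->
     f t = I_int N lq (params lq (set_first s t))).

(* [v] is the value of I_N at a_j = q^(s_j): the integral itself when N is even
   or the tail converges, and otherwise its analytic continuation in s_1.
   For odd N the largest shift i = N - 1 always needs the latter: there
   sum_j Re s_j + i >= N - 1 because Re s_j > 0. *)
Definition I_value (N : nat) (lq : C) (s : nat -> C) (v : C) : Prop :=
  ((Nat.Even N \/ tail_converges N s) /\ v = I_int N lq (params lq s)) \/
  (Nat.Odd N /\ exists (D : C -> Prop) (f : C -> C),
     I_continuation N lq s D f /\ D (s O) /\ v = f (s O)).

(* Main.v *)
Require Import Defs.
From Stdlib Require Import Reals ZArith Arith Lra Lia List ClassicalEpsilon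
  FunctionalExtensionality.
From Coquelicot Require Import Coquelicot.
Open Scope C_scope.

(** Let [x] be the first parameter, [z = e^w], and let [Phi] stand for the
    integrand.

    The sum as one integral. Replacing [x] by [q^i x] multiplies the integrand
    by [(x z; q)_i (x / z; q)_i] ([Phi_reg_shift]). In the variable
    [X = z + 1/z] these products are, up to constants, the Newton basis with
    nodes [q^j x + 1 / (q^j x)], and [g_i] is the corresponding divided
    difference of the polynomial [P] of degree less than [N] with
    [(z - 1/z) P(z + 1/z) = z^N prod_j (1 - a_j / z) - z^-N prod_j (1 - a_j z)].
    By Newton interpolation the sum over [i] of [g_i] times the shifted
    integrands is [Phi(z) P(z + 1/z)] ([g_interpolation]). This is a first
    difference [F(z) - F(q z)] of an explicit function [F]
    ([primitive], [primitive_difference]).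

    The circle. [F] has no pole for [|q| <= |z| <= 1], so by Cauchy's theorem
    the integral of [F(z) - F(q z)] over the circle reduces to integrals of [F]
    along the two sides of the cut, over the moduli between [|q|] and 1
    ([g_sum_circle]). For even [N], [F] is single-valued and they cancel
    ([g_sum_even]).

    The tail. For odd [N], [F] changes sign across the cut, the two integrals
    add up, and the tail has to cancel them. Along the cut the integrand is
    [Q(y) B(e^-y)] with [Q(y - log q) = kappa Q(y)],
    [kappa = q^(N-1) / prod_j a_j], and [B] analytic beyond the unit disc.
    Cutting the half-line into periods and summing geometric series writes the
    tail as [sum_m b_m M_m / (1 - kappa q^m)], where the [b_m] are the Taylor
    coefficients of [B] and the [M_m] integrals over one period
    ([tail_limit]). It converges when [|kappa| < 1], which is the condition on
    the exponents; the series is defined for all [kappa] outside the powers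
    [q^-m], and gives the meromorphic continuation of the integral in the first
    exponent ([I_cont], [I_cont_meromorphic]). Compared coefficientwise in
    [1/z], the difference equation for [B] shows that the tails sum up to the
    missing integral of [F] ([g_sum_tail], [g_sum_I_cont]). Any continuation
    agrees with this one by the identity theorem ([continuation_unique]), and
    at a pole of the formula the equation follows by a limit ([g_sum_odd]).

    Complex analysis. Analytic functions enter as uniform limits of polynomials
    in two variables on bounded sets ([approx]). *)

(** * The complex exponential *)

Lemma Cexp_plus (v w : C) : Cexp (v + w) = Cexp v * Cexp w.
Proof.
  unfold Cexp, Re, Im; apply injective_projections; simpl;
    rewrite exp_plus, ?cos_plus, ?sin_plus; ring.
Qed.

Lemma Cexp_0 : Cexp 0 = 1.
Proof.
  unfold Cexp, Re, Im; apply injective_projections; simpl;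
    rewrite exp_0, ?cos_0, ?sin_0; ring.
Qed.

Lemma exp_le_exp (x y : R) : (x <= y)%R -> (exp x <= exp y)%R.
Proof. intros [H| ->]; [left; apply exp_increasing, H|lra]. Qed.

Lemma pow_unit (x : R) (k : nat) : (0 <= x <= 1)%R -> (0 <= x ^ k <= 1)%R.
Proof.
  intros H; split; [apply pow_le; lra|].
  rewrite <- (pow1 k); apply pow_incr, H.
Qed.

Lemma Cmod_pow_unit (z : C) (k : nat) :
  (Cmod z < 1)%R -> (0 <= Cmod z ^ k <= 1)%R.
Proof. intros H; apply pow_unit; split; [apply Cmod_ge_0|lra]. Qed.

Lemma Cmod_Cexp (w : C) : Cmod (Cexp w) = exp (Re w).
Proof.
  unfold Cmod, Cexp; simpl fst; simpl snd.
  replace ((exp (Re w) * cos (Im w)) ^ 2 + (exp (Re w) * sin (Im w)) ^ 2)%R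
    with ((exp (Re w))²)%R.
  - apply sqrt_Rsqr, Rlt_le, exp_pos.
  - pose proof (sin2_cos2 (Im w)) as H; unfold Rsqr in *.
    replace ((exp (Re w) * cos (Im w)) ^ 2 + (exp (Re w) * sin (Im w)) ^ 2)%R
      with (exp (Re w) * exp (Re w) *
            (sin (Im w) * sin (Im w) + cos (Im w) * cos (Im w)))%R by ring.
    rewrite H; ring.
Qed.

Lemma Cexp_neq_0 (w : C) : Cexp w <> 0.
Proof. apply Cmod_gt_0; rewrite Cmod_Cexp; apply exp_pos. Qed.

Lemma Cexp_opp (w : C) : Cexp (- w) = / Cexp w.
Proof.
  pose proof (Cexp_neq_0 w) as Hw.
  assert (H : Cexp (- w) * Cexp w = 1).
  { rewrite <- Cexp_plus; replace (- w + w) with (RtoC 0) by ring; apply Cexp_0. }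
  rewrite <- (Cmult_1_r (Cexp (- w))), <- (Cinv_r (Cexp w)) by assumption.
  rewrite Cmult_assoc, H; ring.
Qed.

Lemma Cexp_INR (n : nat) (w : C) : Cexp (INR n * w) = Cexp w ^ n.
Proof.
  induction n as [|n IH].
  - simpl; replace (RtoC 0 * w) with (RtoC 0) by ring; apply Cexp_0.
  - rewrite S_INR, RtoC_plus.
    replace ((INR n + 1) * w) with (w + INR n * w) by ring.
    rewrite Cexp_plus, IH; reflexivity.
Qed.

Lemma Cexp_RtoC (x : R) : Cexp x = RtoC (exp x).
Proof.
  unfold Cexp, Re, Im; apply injective_projections; simpl;
    rewrite ?cos_0, ?sin_0; ring.
Qed.

Lemma Cexp_PI : Cexp (Ci * PI) = - (1).
Proof.
  replace (Ci * PI) with (0%R, PI) by (apply injective_projections; simpl; ring).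
  unfold Cexp, Re, Im; apply injective_projections; simpl;
    rewrite exp_0, ?cos_PI, ?sin_PI; ring.
Qed.

Lemma Cmod_le_Re_Im (z : C) : (Cmod z <= Rabs (Re z) + Rabs (Im z))%R.
Proof.
  replace z with (RtoC (Re z) + Ci * RtoC (Im z)) at 1.
  - eapply Rle_trans; [apply Cmod_triangle|].
    rewrite Cmod_mult, Cmod_Ci, !Cmod_R; lra.
  - apply injective_projections; unfold Re, Im; simpl; ring.
Qed.

Lemma Im_le_Cmod (z : C) : (Rabs (Im z) <= Cmod z)%R.
Proof.
  eapply Rle_trans; [|apply Rmax_Cmod]; apply Rmax_r.
Qed.

Lemma Cmod_minus_sym (x y : C) : Cmod (x - y) = Cmod (y - x).
Proof. rewrite <- Cmod_opp; f_equal; ring. Qed.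

Lemma Cmod_triangle_inv (x y : C) : (Cmod x - Cmod y <= Cmod (x - y))%R.
Proof.
  pose proof (Cmod_triangle (x - y) y) as H.
  replace (x - y + y) with x in H by ring; lra.
Qed.

Lemma exp_minus_1_bound (x : R) :
  (Rabs x <= 1 -> Rabs (exp x - 1) <= 3 * Rabs x)%R.
Proof.
  intros Hx.
  destruct (MVT_gen exp 0 x exp) as [c [Hc He]].
  - intros y _; apply is_derive_exp.
  - intros y _; apply derivable_continuous_pt, derivable_pt_exp.
  - rewrite exp_0 in He; rewrite He, Rabs_mult, Rminus_0_r.
    apply Rmult_le_compat_r; [apply Rabs_pos|].
    rewrite Rabs_pos_eq by (left; apply exp_pos).
    apply Rle_trans with (exp 1); [|apply exp_le_3].
    apply exp_le_exp; unfold Rmin, Rmax in Hc; unfold Rabs in Hx.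
    destruct (Rle_dec 0 x), (Rcase_abs x); lra.
Qed.

Lemma exp_minus_1_minus_bound (x : R) :
  (Rabs x <= 1 -> Rabs (exp x - 1 - x) <= 3 * x ^ 2)%R.
Proof.
  intros Hx.
  destruct (MVT_gen (fun y => exp y - y)%R 0 x (fun y => exp y - 1)%R)
    as [c [Hc He]].
  - intros y _; auto_derive; [trivial|ring].
  - intros y _; apply derivable_continuous_pt; reg.
  - rewrite exp_0 in He.
    replace (exp x - 1 - x)%R with ((exp c - 1) * (x - 0))%R by lra.
    assert (Hcx : (Rabs c <= Rabs x)%R).
    { unfold Rmin, Rmax in Hc; unfold Rabs in *.
      destruct (Rle_dec 0 x), (Rcase_abs x), (Rcase_abs c); lra. }
    rewrite Rabs_mult, Rminus_0_r.
    assert (Rabs (exp c - 1) <= 3 * Rabs x)%R.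
    { eapply Rle_trans; [apply exp_minus_1_bound; lra|lra]. }
    rewrite <- (pow2_abs x).
    pose proof (Rabs_pos x); nra.
Qed.

Lemma Rabs_sin_le (x : R) : (Rabs (sin x) <= Rabs x)%R.
Proof.
  destruct (MVT_gen sin 0 x cos) as [c [Hc He]].
  - intros y _; apply is_derive_sin.
  - intros y _; apply derivable_continuous_pt, derivable_pt_sin.
  - rewrite sin_0, !Rminus_0_r in He; rewrite He, Rabs_mult.
    pose proof (COS_bound c); pose proof (Rabs_pos x).
    assert (Rabs (cos c) <= 1)%R by (apply Rabs_le; lra).
    nra.
Qed.

Lemma cos_minus_1_bound (x : R) : (Rabs (cos x - 1) <= x ^ 2)%R.
Proof.
  replace x with (2 * (x / 2))%R at 1 by lra.
  rewrite cos_2a_sin.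
  replace (1 - 2 * sin (x / 2) * sin (x / 2) - 1)%R
    with (- (2 * (sin (x / 2)) ^ 2))%R by ring.
  rewrite Rabs_Ropp, Rabs_pos_eq by nra.
  rewrite <- pow2_abs, <- (pow2_abs x).
  pose proof (Rabs_sin_le (x / 2)) as H.
  assert (Hx : (Rabs (x / 2) = Rabs x / 2)%R).
  { unfold Rdiv; rewrite Rabs_mult, (Rabs_pos_eq (/ 2)); lra. }
  rewrite Hx in H.
  pose proof (Rabs_pos (sin (x / 2))); pose proof (Rabs_pos x); nra.
Qed.

Lemma sin_minus_bound (x : R) : (Rabs x <= 1 -> Rabs (sin x - x) <= x ^ 2)%R.
Proof.
  intros Hx.
  destruct (MVT_gen (fun y => sin y - y)%R 0 x (fun y => cos y - 1)%R)
    as [c [Hc He]].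
  - intros y _; auto_derive; [trivial|ring].
  - intros y _; apply derivable_continuous_pt; reg.
  - rewrite sin_0 in He.
    replace (sin x - x)%R with ((cos c - 1) * (x - 0))%R by lra.
    assert (Hcx : (Rabs c <= Rabs x)%R).
    { unfold Rmin, Rmax in Hc; unfold Rabs in *.
      destruct (Rle_dec 0 x), (Rcase_abs x), (Rcase_abs c); lra. }
    rewrite Rabs_mult, Rminus_0_r.
    pose proof (cos_minus_1_bound c) as H.
    rewrite <- pow2_abs in H.
    rewrite <- (pow2_abs x).
    pose proof (Rabs_pos x); pose proof (Rabs_pos c).
    assert (Rabs c ^ 2 <= Rabs x)%R by nra.
    pose proof (Rabs_pos (cos c - 1)); nra.
Qed.

(** Only the order of the error is used; 14 is what crude bounds on the two
    components give. *)
Lemma Cexp_quadratic (v : C) :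
  (Cmod v <= 1 -> Cmod (Cexp v - 1 - v) <= 14 * Cmod v ^ 2)%R.
Proof.
  intros Hv.
  pose proof (re_le_Cmod v) as Hr; pose proof (Im_le_Cmod v) as Hi.
  set (x := Re v) in *; set (y := Im v) in *.
  eapply Rle_trans; [apply Cmod_le_Re_Im|].
  assert (E1 : Re (Cexp v - 1 - v) =
    ((exp x - 1 - x) * cos y + (1 + x) * (cos y - 1))%R).
  { unfold x, y, Cexp, Re, Im; simpl; ring. }
  assert (E2 : Im (Cexp v - 1 - v) =
    ((exp x - 1) * sin y + (sin y - y))%R).
  { unfold x, y, Cexp, Re, Im; simpl; ring. }
  rewrite E1, E2; clear E1 E2.
  pose proof (exp_minus_1_minus_bound x ltac:(lra)) as B1.
  pose proof (exp_minus_1_bound x ltac:(lra)) as B2.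
  pose proof (cos_minus_1_bound y) as B3.
  pose proof (sin_minus_bound y ltac:(lra)) as B4.
  pose proof (Rabs_sin_le y) as B5.
  rewrite <- pow2_abs in B1, B3, B4.
  assert (B6 : (Rabs (cos y) <= 1)%R)
    by (pose proof (COS_bound y); apply Rabs_le; lra).
  assert (B7 : (Rabs (1 + x) <= 2)%R).
  { eapply Rle_trans; [apply Rabs_triang|]; rewrite Rabs_R1; lra. }
  eapply Rle_trans; [apply Rplus_le_compat; apply Rabs_triang|].
  rewrite !Rabs_mult.
  pose proof (Rabs_pos x); pose proof (Rabs_pos y).
  pose proof (Rabs_pos (cos y)); pose proof (Rabs_pos (sin y)).
  pose proof (Rabs_pos (exp x - 1)); pose proof (Rabs_pos (exp x - 1 - x)).
  pose proof (Rabs_pos (cos y - 1)); pose proof (Rabs_pos (1 + x)).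
  set (m := Cmod v) in *.
  assert (S1 : (Rabs (exp x - 1 - x) * Rabs (cos y) <= 3 * m ^ 2)%R) by nra.
  assert (S2 : (Rabs (1 + x) * Rabs (cos y - 1) <= 2 * m ^ 2)%R).
  { apply Rmult_le_compat; nra. }
  assert (S3 : (Rabs (exp x - 1) * Rabs (sin y) <= 3 * m ^ 2)%R).
  { apply Rle_trans with ((3 * m) * m)%R; [|nra].
    apply Rmult_le_compat; nra. }
  assert (S4 : (Rabs (sin y - y) <= m ^ 2)%R) by nra.
  nra.
Qed.

Lemma Copp_neq_0 (z : C) : z <> 0 -> - z <> 0.
Proof. intros Hz E; apply Hz; replace z with (- - z) by ring; rewrite E; ring. Qed.

Lemma Cdiff_neq_0 (a b : C) : a <> b -> a - b <> 0.
Proof.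
  intros H Z; apply H; replace a with (a - b + b) by ring; rewrite Z; ring.
Qed.

Lemma Im_add_real (c : C) (y : R) : Im (c + y) = Im c.
Proof. unfold Im; simpl; ring. Qed.

(** [1] and [e^c] lie in the half-plane around the bisector of the
    directions 0 and [phi]; this bounds away from 0 the sum [1 + e^c], which
    vanishes at [c = i PI]. *)
Lemma Cexp_half_plane (c : C) (phi : R) :
  (Rabs phi < PI)%R -> (Rabs (Im c - phi) <= (PI - Rabs phi) / 2)%R ->
  (cos (phi / 2) <= Re (Cexp (- (Ci * RtoC (phi / 2)%R)) * (1 + Cexp c)))%R.
Proof.
  intros Hphi Hc.
  replace (Cexp (- (Ci * RtoC (phi / 2)%R)) * (1 + Cexp c)) with
    (Cexp (- (Ci * RtoC (phi / 2)%R)) + Cexp (c - Ci * RtoC (phi / 2)%R))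
    by (unfold Cminus; rewrite (Cexp_plus c); ring).
  set (h := (phi / 2)%R).
  assert (E1 : Re (Cexp (- (Ci * h))) = cos h).
  { replace (- (Ci * h)) with (0%R, (- h)%R)
      by (apply injective_projections; simpl; ring).
    unfold Cexp, Re, Im; simpl; rewrite exp_0, cos_neg; ring. }
  assert (E2 : Re (Cexp (c - Ci * h)) = (exp (Re c) * cos (Im c - h))%R).
  { replace (c - Ci * h) with (Re c, (Im c - h)%R)
      by (apply injective_projections; unfold Re, Im; simpl; ring).
    reflexivity. }
  change (Re (Cexp (- (Ci * h)) + Cexp (c - Ci * h)))
    with (Re (Cexp (- (Ci * h))) + Re (Cexp (c - Ci * h)))%R.
  rewrite E1, E2.
  assert (0 <= cos (Im c - h))%R.
  { apply cos_ge_0; unfold h; unfold Rabs in *;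
      destruct (Rcase_abs phi), (Rcase_abs (Im c - phi)); lra. }
  pose proof (exp_pos (Re c)); nra.
Qed.

(** * Finite sums and products, limits of complex sequences *)

Fixpoint Csum (f : nat -> C) (n : nat) : C :=
  match n with
  | O => 0
  | S k => Csum f k + f k
  end.

Lemma Csum_ext (f g : nat -> C) (n : nat) :
  (forall k, (k < n)%nat -> f k = g k) -> Csum f n = Csum g n.
Proof.
  induction n as [|n IH]; intros H; simpl; [reflexivity|].
  rewrite IH, H by (intros; try apply H; lia); reflexivity.
Qed.

Lemma Csum_plus (f g : nat -> C) (n : nat) :
  Csum (fun k => f k + g k) n = Csum f n + Csum g n.
Proof. induction n as [|n IH]; simpl; [ring|rewrite IH; ring]. Qed.

Lemma Csum_scal (c : C) (f : nat -> C) (n : nat) :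
  Csum (fun k => c * f k) n = c * Csum f n.
Proof. induction n as [|n IH]; simpl; [ring|rewrite IH; ring]. Qed.

Lemma Csum_0 (n : nat) : Csum (fun _ => 0) n = 0.
Proof. induction n as [|n IH]; simpl; [reflexivity|rewrite IH; ring]. Qed.

Lemma Csum_Sl (f : nat -> C) (n : nat) :
  Csum f (S n) = f O + Csum (fun k => f (S k)) n.
Proof.
  induction n as [|n IH]; [simpl; ring|].
  change (Csum f (S (S n))) with (Csum f (S n) + f (S n)).
  rewrite IH; simpl; ring.
Qed.

Lemma Csum_add (f : nat -> C) (n k : nat) :
  Csum f (n + k) = Csum f n + Csum (fun m => f (n + m)%nat) k.
Proof.
  induction k as [|k IH]; [rewrite Nat.add_0_r; simpl; ring|].
  rewrite Nat.add_succ_r; simpl; rewrite IH; ring.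
Qed.

Lemma Csum_rev (f : nat -> C) (n : nat) :
  Csum f n = Csum (fun k => f (n - 1 - k)%nat) n.
Proof.
  induction n as [|n IH]; [reflexivity|].
  rewrite (Csum_Sl (fun k => f (S n - 1 - k)%nat)); simpl Csum at 1.
  rewrite IH, Cplus_comm; f_equal.
  - f_equal; lia.
  - apply Csum_ext; intros k Hk; f_equal; lia.
Qed.

Lemma Csum_swap (f : nat -> nat -> C) (n m : nat) :
  Csum (fun i => Csum (fun j => f i j) m) n =
  Csum (fun j => Csum (fun i => f i j) n) m.
Proof.
  induction n as [|n IH]; simpl.
  - rewrite Csum_0; reflexivity.
  - rewrite IH, Csum_plus; reflexivity.
Qed.

Lemma sum_n_Csum (f : nat -> C) (n : nat) : sum_n f n = Csum f (S n).
Proof.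
  induction n as [|n IH].
  - rewrite sum_O; simpl; ring.
  - rewrite sum_Sn, IH; reflexivity.
Qed.

Lemma Cprod_ext (f g : nat -> C) (n : nat) :
  (forall k, (k < n)%nat -> f k = g k) -> Cprod f n = Cprod g n.
Proof.
  induction n as [|n IH]; intros H; simpl; [reflexivity|].
  rewrite IH, H by (intros; try apply H; lia); reflexivity.
Qed.

Lemma Cprod_mult (f g : nat -> C) (n : nat) :
  Cprod (fun k => f k * g k) n = Cprod f n * Cprod g n.
Proof. induction n as [|n IH]; simpl; [ring|rewrite IH; ring]. Qed.

Lemma Cprod_Sl (f : nat -> C) (n : nat) :
  Cprod f (S n) = f O * Cprod (fun k => f (S k)) n.
Proof.
  induction n as [|n IH]; [simpl; ring|].
  change (Cprod f (S (S n))) with (Cprod f (S n) * f (S n)).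
  rewrite IH; simpl; ring.
Qed.

Lemma Cprod_neq_0 (f : nat -> C) (n : nat) :
  (forall k, (k < n)%nat -> f k <> 0) -> Cprod f n <> 0.
Proof.
  induction n as [|n IH]; intros H; simpl.
  - apply C1_nz.
  - apply Cmult_neq_0; [apply IH; intros; apply H; lia|apply H; lia].
Qed.

Lemma Cprod_inv (f : nat -> C) (n : nat) :
  (forall k, (k < n)%nat -> f k <> 0) ->
  Cprod (fun k => / f k) n = / Cprod f n.
Proof.
  induction n as [|n IH]; intros H; simpl.
  - field.
  - rewrite IH by (intros; apply H; lia).
    field; split; [apply H; lia|apply Cprod_neq_0; intros; apply H; lia].
Qed.

Lemma Cprod_const (c : C) (n : nat) : Cprod (fun _ => c) n = c ^ n.
Proof. induction n as [|n IH]; simpl; [reflexivity|rewrite IH; ring]. Qed.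

Lemma Cprod_remove (f : nat -> C) (n m : nat) :
  (m < n)%nat ->
  Cprod (fun k => if Nat.eq_dec k m then 1 else f k) n * f m = Cprod f n.
Proof.
  intros Hm; induction n as [|n IH]; [lia|]; simpl.
  destruct (Nat.eq_dec n m) as [->|E].
  - rewrite Cmult_1_r; f_equal; apply Cprod_ext; intros k Hk.
    destruct (Nat.eq_dec k m); [lia|reflexivity].
  - rewrite <- IH by lia; ring.
Qed.

Lemma Cprod_rev (f : nat -> C) (n : nat) :
  Cprod f n = Cprod (fun k => f (n - 1 - k)%nat) n.
Proof.
  induction n as [|n IH]; [reflexivity|].
  rewrite (Cprod_Sl (fun k => f (S n - 1 - k)%nat)); simpl Cprod at 1.
  rewrite IH, Cmult_comm; f_equal.
  - f_equal; lia.
  - apply Cprod_ext; intros k Hk; f_equal; lia.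
Qed.

Lemma Cprod_qpow_triangle (q : C) (j : nat) :
  Cprod (fun k => q ^ S k) j = q ^ (j * (j + 1) / 2).
Proof.
  induction j as [|j IH]; [reflexivity|].
  change (Cprod (fun k => q ^ S k) (S j))
    with (Cprod (fun k => q ^ S k) j * q ^ S j).
  rewrite IH, <- Cpow_add_r.
  f_equal.
  replace (S j * (S j + 1))%nat with (j * (j + 1) + S j * 2)%nat by lia.
  rewrite Nat.div_add by lia; reflexivity.
Qed.

Definition Climit (u : nat -> C) (l : C) : Prop :=
  forall eps, (0 < eps)%R ->
    exists n0, forall n, (n0 <= n)%nat -> (Cmod (u n - l) < eps)%R.

Definition Clim (u : nat -> C) : C :=
  (real (Lim_seq (fun n => Re (u n))), real (Lim_seq (fun n => Im (u n)))).

Lemma Climit_Clim (u : nat -> C) (l : C) : Climit u l -> Clim u = l.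
Proof.
  intros H; unfold Clim.
  assert (Hr : is_lim_seq (fun n => Re (u n)) (Re l)).
  { apply is_lim_seq_Reals; intros eps He.
    destruct (H eps He) as [n0 Hn]; exists n0; intros n Hn0.
    unfold Rdist; eapply Rle_lt_trans; [|apply (Hn n); lia].
    apply (re_le_Cmod (u n - l)). }
  assert (Hi : is_lim_seq (fun n => Im (u n)) (Im l)).
  { apply is_lim_seq_Reals; intros eps He.
    destruct (H eps He) as [n0 Hn]; exists n0; intros n Hn0.
    unfold Rdist; eapply Rle_lt_trans; [|apply (Hn n); lia].
    apply (Im_le_Cmod (u n - l)). }
  rewrite (is_lim_seq_unique _ _ Hr), (is_lim_seq_unique _ _ Hi); simpl.
  symmetry; apply surjective_pairing.
Qed.

Lemma Climit_unique (u : nat -> C) (l1 l2 : C) :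
  Climit u l1 -> Climit u l2 -> l1 = l2.
Proof. intros H1 H2; rewrite <- (Climit_Clim _ _ H1); apply Climit_Clim, H2. Qed.

Lemma Climit_ext (u v : nat -> C) (l : C) :
  (forall n, u n = v n) -> Climit u l -> Climit v l.
Proof.
  intros E H eps He; destruct (H eps He) as [n0 Hn]; exists n0; intros n Hn0.
  rewrite <- E; apply Hn, Hn0.
Qed.

Lemma Climit_plus (u v : nat -> C) (l m : C) :
  Climit u l -> Climit v m -> Climit (fun n => u n + v n) (l + m).
Proof.
  intros Hu Hv eps He.
  destruct (Hu (eps / 2)%R ltac:(lra)) as [n1 H1].
  destruct (Hv (eps / 2)%R ltac:(lra)) as [n2 H2].
  exists (max n1 n2); intros n Hn.
  replace (u n + v n - (l + m)) with ((u n - l) + (v n - m)) by ring.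
  eapply Rle_lt_trans; [apply Cmod_triangle|].
  pose proof (H1 n ltac:(lia)); pose proof (H2 n ltac:(lia)); lra.
Qed.

Lemma Climit_const (c : C) : Climit (fun _ => c) c.
Proof.
  intros eps He; exists O; intros n _.
  replace (c - c) with (RtoC 0) by ring; rewrite Cmod_0; assumption.
Qed.

Lemma Climit_bounded (u : nat -> C) (l : C) :
  Climit u l -> exists n0, forall n, (n0 <= n)%nat -> (Cmod (u n) <= Cmod l + 1)%R.
Proof.
  intros H; destruct (H 1%R ltac:(lra)) as [n0 Hn]; exists n0; intros n Hn0.
  pose proof (Hn n Hn0); pose proof (Cmod_triangle_inv (u n) l); lra.
Qed.

Lemma Climit_mult (u v : nat -> C) (l m : C) :
  Climit u l -> Climit v m -> Climit (fun n => u n * v n) (l * m).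
Proof.
  intros Hu Hv eps He.
  destruct (Climit_bounded v m Hv) as [n0 H0].
  set (A := (Cmod m + 1)%R) in *; set (B := (Cmod l + 1)%R).
  assert (HA : (0 < A)%R) by (pose proof (Cmod_ge_0 m); unfold A; lra).
  assert (HB : (0 < B)%R) by (pose proof (Cmod_ge_0 l); unfold B; lra).
  destruct (Hu (eps / 2 / A)%R) as [n1 H1].
  { repeat apply Rdiv_lt_0_compat; lra. }
  destruct (Hv (eps / 2 / B)%R) as [n2 H2].
  { repeat apply Rdiv_lt_0_compat; lra. }
  exists (max n0 (max n1 n2)); intros n Hn.
  replace (u n * v n - l * m) with ((u n - l) * v n + l * (v n - m)) by ring.
  eapply Rle_lt_trans; [apply Cmod_triangle|]; rewrite !Cmod_mult.
  pose proof (H0 n ltac:(lia)) as E0; pose proof (H1 n ltac:(lia)) as E1;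
    pose proof (H2 n ltac:(lia)) as E2.
  pose proof (Cmod_ge_0 (u n - l)); pose proof (Cmod_ge_0 (v n)).
  pose proof (Cmod_ge_0 (v n - m)); pose proof (Cmod_ge_0 l).
  assert (F1 : (Cmod (u n - l) * Cmod (v n) <= Cmod (u n - l) * A)%R) by nra.
  assert (F2 : (Cmod (u n - l) * A < eps / 2)%R).
  { apply Rmult_lt_reg_r with (/ A)%R; [apply Rinv_0_lt_compat; lra|].
    rewrite Rmult_assoc, Rinv_r, Rmult_1_r by lra; exact E1. }
  assert (F3 : (Cmod l * Cmod (v n - m) <= B * Cmod (v n - m))%R)
    by (unfold B; nra).
  assert (F4 : (B * Cmod (v n - m) < eps / 2)%R).
  { rewrite Rmult_comm.
    apply Rmult_lt_reg_r with (/ B)%R; [apply Rinv_0_lt_compat; lra|].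
    rewrite Rmult_assoc, Rinv_r, Rmult_1_r by lra; exact E2. }
  lra.
Qed.

Lemma Climit_scal (c : C) (u : nat -> C) (l : C) :
  Climit u l -> Climit (fun n => c * u n) (c * l).
Proof. intros H; apply Climit_mult; [apply Climit_const|exact H]. Qed.

Lemma Climit_Csum (u : nat -> nat -> C) (l : nat -> C) (M : nat) :
  (forall i, (i < M)%nat -> Climit (u i) (l i)) ->
  Climit (fun n => Csum (fun i => u i n) M) (Csum l M).
Proof.
  induction M as [|M IH]; intros H; simpl; [apply Climit_const|].
  apply Climit_plus; [apply IH; intros|]; apply H; lia.
Qed.

Lemma Climit_shift (u : nat -> C) (l : C) (k : nat) :
  Climit (fun n => u (n + k)%nat) l <-> Climit u l.
Proof.
  split; intros H eps He; destruct (H eps He) as [n0 Hn].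
  - exists (n0 + k)%nat; intros n Hn0.
    replace n with ((n - k) + k)%nat by lia; apply Hn; lia.
  - exists n0; intros n Hn0; apply Hn; lia.
Qed.

Lemma Climit_le (u : nat -> C) (l a : C) (B : R) :
  Climit u l -> (forall n, (Cmod (u n - a) <= B)%R) -> (Cmod (l - a) <= B)%R.
Proof.
  intros H HB; apply Rnot_lt_le; intros Hlt.
  destruct (H (Cmod (l - a) - B)%R ltac:(lra)) as [n0 Hn].
  pose proof (Hn n0 (le_n _)) as H1; pose proof (HB n0) as H2.
  pose proof (Cmod_triangle (l - u n0) (u n0 - a)) as H3.
  replace (l - u n0 + (u n0 - a)) with (l - a) in H3 by ring.
  rewrite (Cmod_minus_sym l (u n0)) in H3; lra.
Qed.

Lemma pow_small (rho K eps : R) :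
  (0 <= rho < 1 -> 0 < eps ->
   exists n0, forall n, (n0 <= n)%nat -> K * rho ^ n < eps)%R.
Proof.
  intros Hr He.
  destruct (pow_lt_1_zero rho ltac:(rewrite Rabs_pos_eq; lra)
              (eps / (Rabs K + 1))%R) as [n0 Hn].
  - apply Rdiv_lt_0_compat; [lra|]; pose proof (Rabs_pos K); lra.
  - exists n0; intros n Hn0; specialize (Hn n Hn0).
    assert (Hp : (0 <= rho ^ n)%R) by (apply pow_le; lra).
    rewrite (Rabs_pos_eq _ Hp) in Hn.
    pose proof (Rabs_pos K); pose proof (Rle_abs K).
    apply Rle_lt_trans with ((Rabs K + 1) * rho ^ n)%R; [nra|].
    apply Rmult_lt_reg_r with (/ (Rabs K + 1))%R;
      [apply Rinv_0_lt_compat; lra|].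
    replace ((Rabs K + 1) * rho ^ n * / (Rabs K + 1))%R with (rho ^ n)%R
      by (field; lra); exact Hn.
Qed.

Lemma Climit_geom (u : nat -> C) (l : C) (K rho : R) :
  (0 <= rho < 1)%R -> (forall n, (Cmod (u n - l) <= K * rho ^ n)%R) ->
  Climit u l.
Proof.
  intros Hr H eps He; destruct (pow_small rho K eps Hr He) as [n0 Hn].
  exists n0; intros n Hn0; eapply Rle_lt_trans; [apply H|apply Hn, Hn0].
Qed.

Lemma Climit_inv_nat (t0 : C) : Climit (fun n => t0 + (/ (INR n + 1))%R) t0.
Proof.
  intros eps He.
  destruct (nfloor_ex (/ eps)) as [n0 [_ Hn0]].
  { left; apply Rinv_0_lt_compat, He. }
  exists n0; intros n Hn; replace (t0 + (/ (INR n + 1))%R - t0)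
    with (RtoC (/ (INR n + 1))) by ring.
  pose proof (pos_INR n).
  rewrite Cmod_R, Rabs_pos_eq by (left; apply Rinv_0_lt_compat; lra).
  rewrite <- (Rinv_inv eps); apply le_INR in Hn.
  apply Rinv_lt_contravar; [|lra].
  apply Rmult_lt_0_compat; [apply Rinv_0_lt_compat, He|lra].
Qed.

Lemma Climit_Cauchy_geom (u : nat -> C) (K rho : R) :
  (0 <= rho < 1)%R ->
  (forall n m, (n <= m)%nat -> (Cmod (u m - u n) <= K * rho ^ n)%R) ->
  Climit u (Clim u) /\ forall n, (Cmod (u n - Clim u) <= K * rho ^ n)%R.
Proof.
  intros Hr H.
  assert (Hc : forall eps, (0 < eps)%R -> exists n0, forall n m,
    (n0 <= n)%nat -> (n0 <= m)%nat -> (Cmod (u n - u m) < eps)%R).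
  { intros eps He; destruct (pow_small rho K eps Hr He) as [n0 Hn].
    exists n0; intros n m H1 H2; destruct (le_ge_dec n m) as [Hl|Hl].
    - rewrite Cmod_minus_sym; eapply Rle_lt_trans; [apply H, Hl|apply Hn, H1].
    - eapply Rle_lt_trans; [apply H, Hl|apply Hn, H2]. }
  assert (Hr' : ex_finite_lim_seq (fun n => Re (u n))).
  { apply ex_lim_seq_cauchy_corr; intros eps.
    destruct (Hc eps (cond_pos eps)) as [n0 Hn]; exists n0; intros n m H1 H2.
    eapply Rle_lt_trans; [|apply (Hn n m H1 H2)].
    apply (re_le_Cmod (u n - u m)). }
  assert (Hi' : ex_finite_lim_seq (fun n => Im (u n))).
  { apply ex_lim_seq_cauchy_corr; intros eps.
    destruct (Hc eps (cond_pos eps)) as [n0 Hn]; exists n0; intros n m H1 H2.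
    eapply Rle_lt_trans; [|apply (Hn n m H1 H2)].
    apply (Im_le_Cmod (u n - u m)). }
  destruct Hr' as [x Hx], Hi' as [y Hy].
  assert (Hl : Climit u (x, y)).
  { intros eps He.
    apply is_lim_seq_Reals in Hx; apply is_lim_seq_Reals in Hy.
    destruct (Hx (eps / 2)%R ltac:(lra)) as [n1 H1].
    destruct (Hy (eps / 2)%R ltac:(lra)) as [n2 H2].
    exists (max n1 n2); intros n Hn.
    eapply Rle_lt_trans; [apply Cmod_le_Re_Im|].
    pose proof (H1 n ltac:(lia)) as E1; pose proof (H2 n ltac:(lia)) as E2.
    change (Rabs (Re (u n) - x) < eps / 2)%R in E1.
    change (Rabs (Im (u n) - y) < eps / 2)%R in E2.
    change (Rabs (Re (u n) - x) + Rabs (Im (u n) - y) < eps)%R; lra. }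
  rewrite (Climit_Clim _ _ Hl); split; [exact Hl|].
  intros n; rewrite Cmod_minus_sym.
  apply (Climit_le (fun m => u (m + n)%nat)).
  - apply Climit_shift, Hl.
  - intros m; apply H; lia.
Qed.

Lemma geom_sum_bound (f : nat -> C) (K rho : R) (n d : nat) :
  (0 <= rho < 1)%R -> (forall k, (Cmod (f k) <= K * rho ^ k)%R) ->
  (Cmod (Csum f (n + d) - Csum f n) <= K / (1 - rho) * (rho ^ n - rho ^ (n + d)))%R.
Proof.
  intros Hr H; induction d as [|d IH].
  - rewrite Nat.add_0_r; replace (Csum f n - Csum f n) with (RtoC 0) by ring.
    rewrite Cmod_0; right; field; lra.
  - rewrite Nat.add_succ_r; simpl Csum.
    replace (Csum f (n + d) + f (n + d)%nat - Csum f n)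
      with ((Csum f (n + d) - Csum f n) + f (n + d)%nat) by ring.
    eapply Rle_trans; [apply Cmod_triangle|].
    eapply Rle_trans; [apply Rplus_le_compat; [apply IH|apply H]|].
    right; simpl; field; lra.
Qed.

Definition Cseries (f : nat -> C) : C := Clim (Csum f).

Lemma Cseries_geom (f : nat -> C) (K rho : R) :
  (0 <= rho < 1)%R -> (forall k, (Cmod (f k) <= K * rho ^ k)%R) ->
  Climit (Csum f) (Cseries f) /\
  forall n, (Cmod (Csum f n - Cseries f) <= K / (1 - rho) * rho ^ n)%R.
Proof.
  intros Hr H; apply Climit_Cauchy_geom; [exact Hr|].
  intros n m Hnm; replace m with (n + (m - n))%nat by lia.
  eapply Rle_trans; [apply (geom_sum_bound f K rho); assumption|].
  assert (HK : (0 <= K)%R).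
  { pose proof (H O) as H0; simpl in H0; pose proof (Cmod_ge_0 (f O)); lra. }
  apply Rmult_le_compat_l.
  - apply Rmult_le_pos; [exact HK|left; apply Rinv_0_lt_compat; lra].
  - assert (0 <= rho ^ (n + (m - n)))%R by (apply pow_le; lra); lra.
Qed.

Lemma Cseries_unique (f : nat -> C) (l : C) : Climit (Csum f) l -> Cseries f = l.
Proof. apply Climit_Clim. Qed.

Lemma RtoC_neq_0 (x : R) : (x <> 0)%R -> RtoC x <> 0.
Proof. intros H E; apply H; apply (f_equal Re) in E; exact E. Qed.

Lemma finite_max (f : nat -> R) (n : nat) (M : R) :
  (forall j, (j < n)%nat -> f j < M)%R ->
  exists m, (m < M)%R /\ forall j, (j < n)%nat -> (f j <= m)%R.
Proof.
  induction n as [|n IH]; intros H.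
  - exists (M - 1)%R; split; [lra|intros; lia].
  - destruct IH as [m [Hm Hf]]; [intros; apply H; lia|].
    exists (Rmax m (f n)); split.
    + apply Rmax_lub_lt; [exact Hm|apply H; lia].
    + intros j Hj; destruct (Nat.eq_dec j n) as [->|E]; [apply Rmax_r|].
      eapply Rle_trans; [apply Hf; lia|apply Rmax_l].
Qed.

Lemma finite_bound (f : nat -> R) (n : nat) :
  exists M, (0 <= M)%R /\ forall j, (j < n)%nat -> (f j <= M)%R.
Proof.
  induction n as [|n [M [HM IH]]].
  - exists 0%R; split; [lra|intros; lia].
  - exists (Rmax M (f n)); split; [eapply Rle_trans; [exact HM|apply Rmax_l]|].
    intros j Hj; destruct (Nat.eq_dec j n) as [->|E]; [apply Rmax_r|].
    eapply Rle_trans; [apply IH; lia|apply Rmax_l].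
Qed.

Lemma finite_radius (P : nat -> C -> Prop) (n : nat) :
  (forall i, (i < n)%nat -> exists r, (0 < r)%R /\
     forall y, (Cmod y < r)%R -> P i y) ->
  exists r, (0 < r)%R /\ forall i y, (i < n)%nat -> (Cmod y < r)%R -> P i y.
Proof.
  induction n as [|n IH]; intros H.
  - exists 1%R; split; [lra|intros; lia].
  - destruct IH as [r1 [Hr1 H1]]; [intros; apply H; lia|].
    destruct (H n ltac:(lia)) as [r2 [Hr2 H2]].
    exists (Rmin r1 r2); split; [apply Rmin_pos; lra|]; intros i y Hi Hy.
    pose proof (Rmin_l r1 r2); pose proof (Rmin_r r1 r2).
    destruct (Nat.eq_dec i n) as [->|E]; [apply H2; lra|apply H1; [lia|lra]].
Qed.

(** All but finitely many of the denominators are within 1/2 of 1. *)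
Lemma inv_one_minus_pow_bound (k q : C) :
  (Cmod q < 1)%R -> (forall m, 1 - k * q ^ m <> 0) ->
  exists M, (0 <= M)%R /\ forall m, (Cmod (/ (1 - k * q ^ m)) <= M)%R.
Proof.
  intros Hq Hnz.
  destruct (pow_small (Cmod q) (Cmod k) (/ 2)) as [n Hn].
  { split; [apply Cmod_ge_0|exact Hq]. }
  { lra. }
  destruct (finite_bound (fun m => Cmod (/ (1 - k * q ^ m))) n) as [M [HM H]].
  exists (M + 2)%R; split; [lra|]; intros m.
  destruct (lt_dec m n) as [Hm|Hm]; [specialize (H m Hm); lra|].
  specialize (Hn m ltac:(lia)).
  rewrite Cmod_inv by apply Hnz.
  pose proof (Cmod_triangle_inv 1 (k * q ^ m)) as Ht.
  rewrite Cmod_1, Cmod_mult, Cmod_pow in Ht.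
  apply Rle_trans with (/ / 2)%R; [apply Rinv_le_contravar; lra|].
  rewrite Rinv_inv; lra.
Qed.

(** * Integrals of complex functions of a real variable *)

Notation is_CInt := (is_RInt (V := C_R_NormedModule)).
Notation CInt := (RInt (V := C_R_CompleteNormedModule)).

Lemma is_CInt_unique (f : R -> C) (a b : R) (l : C) :
  is_CInt f a b l -> CInt f a b = l.
Proof. apply (is_RInt_unique (V := C_R_CompleteNormedModule)). Qed.

Lemma is_CInt_eq (f : R -> C) (a b : R) (l m : C) :
  is_CInt f a b l -> is_CInt f a b m -> l = m.
Proof.
  intros H1 H2; rewrite <- (is_CInt_unique _ _ _ _ H1).
  apply is_CInt_unique, H2.
Qed.

Lemma is_CInt_plus (f g : R -> C) (a b : R) (l m : C) :
  is_CInt f a b l -> is_CInt g a b m ->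
  is_CInt (fun x => f x + g x) a b (l + m).
Proof. apply (is_RInt_plus (V := C_R_NormedModule)). Qed.

Lemma is_CInt_scal (c : C) (f : R -> C) (a b : R) (l : C) :
  is_CInt f a b l -> is_CInt (fun x => c * f x) a b (c * l).
Proof.
  intros H.
  pose proof (is_RInt_fct_extend_fst (U := R_NormedModule)
    (V := R_NormedModule) f a b l H) as H1.
  pose proof (is_RInt_fct_extend_snd (U := R_NormedModule)
    (V := R_NormedModule) f a b l H) as H2.
  apply (is_RInt_fct_extend_pair (U := R_NormedModule) (V := R_NormedModule)).
  - simpl.
    apply (is_RInt_minus (V := R_NormedModule)); apply (is_RInt_scal (V := R_NormedModule));
      assumption.
  - simpl.
    apply (is_RInt_plus (V := R_NormedModule)); apply (is_RInt_scal (V := R_NormedModule));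
      assumption.
Qed.

Lemma is_CInt_minus (f g : R -> C) (a b : R) (l m : C) :
  is_CInt f a b l -> is_CInt g a b m ->
  is_CInt (fun x => f x - g x) a b (l - m).
Proof. apply (is_RInt_minus (V := C_R_NormedModule)). Qed.

Lemma is_CInt_0 (a b : R) : is_CInt (fun _ => RtoC 0) a b (RtoC 0).
Proof.
  pose proof (is_RInt_const (V := C_R_NormedModule) a b (RtoC 0)) as H.
  rewrite (scal_zero_r (V := C_R_NormedModule)) in H; exact H.
Qed.

Lemma is_CInt_ext (f g : R -> C) (a b : R) (l : C) :
  (a <= b)%R -> (forall x, (a < x < b)%R -> f x = g x) ->
  is_CInt f a b l -> is_CInt g a b l.
Proof.
  intros Hab H; apply (is_RInt_ext (V := C_R_NormedModule)).
  intros x; rewrite Rmin_left, Rmax_right by assumption; apply H.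
Qed.

Lemma is_CInt_Csum (f : nat -> R -> C) (l : nat -> C) (a b : R) (n : nat) :
  (forall k, (k < n)%nat -> is_CInt (f k) a b (l k)) ->
  is_CInt (fun x => Csum (fun k => f k x) n) a b (Csum l n).
Proof.
  induction n as [|n IH]; intros H; simpl.
  - apply is_CInt_0.
  - apply is_CInt_plus; [apply IH; intros|]; apply H; lia.
Qed.

Lemma norm_Cmod (z : C) : norm (V := C_R_NormedModule) z = Cmod z.
Proof.
  change (sqrt (Rabs (fst z) ^ 2 + Rabs (snd z) ^ 2) = Cmod z)%R.
  rewrite !pow2_abs; reflexivity.
Qed.

Lemma is_CInt_norm (f : R -> C) (a b M : R) (l : C) :
  (a <= b)%R -> (forall x, (a <= x <= b)%R -> (Cmod (f x) <= M)%R) ->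
  is_CInt f a b l -> (Cmod l <= M * (b - a))%R.
Proof.
  intros Hab HM Hl.
  pose proof (norm_RInt_le (V := C_R_NormedModule) f (fun _ => M) a b l
    (scal (K := R_AbsRing) (V := R_ModuleSpace) (b - a)%R M) Hab) as H.
  rewrite norm_Cmod in H.
  rewrite Rmult_comm; apply H; [|exact Hl|].
  - intros x Hx; rewrite norm_Cmod; apply HM, Hx.
  - apply (is_RInt_const (V := R_NormedModule)).
Qed.

(** Balls of the product uniform structure are squares. *)
Lemma ball_Cmod (x y : C) (eps : R) :
  (Cmod (y - x) < eps)%R ->
  ball (M := C_R_NormedModule) x eps y.
Proof.
  intros H; split.
  - eapply Rle_lt_trans; [apply (re_le_Cmod (y - x))|exact H].
  - eapply Rle_lt_trans; [apply (Im_le_Cmod (y - x))|exact H].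
Qed.

Lemma is_CInt_uniform (f : R -> C) (a b : R) :
  (a <= b)%R ->
  (forall eps, (0 < eps)%R -> exists (g : R -> C) (l : C),
     is_CInt g a b l /\
     forall x, (a <= x <= b)%R -> (Cmod (f x - g x) <= eps)%R) ->
  exists l, is_CInt f a b l.
Proof.
  intros Hab H.
  (* Convergence must be uniform on the whole line, so everything is extended
     by 0 outside the interval. *)
  assert (Hc : forall n : nat, exists g : R -> C, exists l : C,
    is_CInt g a b l /\
    forall x, (Cmod ((if Rle_dec a x then if Rle_dec x b then f x else RtoC 0 else RtoC 0)
      - g x) <= / (INR n + 1))%R).
  { intros n; destruct (H (/ (INR n + 1))%R) as [g [l [Hg Hfg]]].
    { apply Rinv_0_lt_compat; pose proof (pos_INR n); lra. }
    exists (fun x => if Rle_dec a x then if Rle_dec x b then g x else RtoC 0 else RtoC 0), l.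
    split.
    - eapply is_CInt_ext; [exact Hab| |exact Hg].
      intros x Hx; destruct (Rle_dec a x), (Rle_dec x b); try lra; reflexivity.
    - intros x; destruct (Rle_dec a x) as [H1|H1]; [destruct (Rle_dec x b) as [H2|H2]|].
      + apply Hfg; lra.
      + replace (RtoC 0 - RtoC 0) with (RtoC 0) by ring; rewrite Cmod_0.
        left; apply Rinv_0_lt_compat; pose proof (pos_INR n); lra.
      + replace (RtoC 0 - RtoC 0) with (RtoC 0) by ring; rewrite Cmod_0.
        left; apply Rinv_0_lt_compat; pose proof (pos_INR n); lra. }
  pose (G := fun n => proj1_sig (constructive_indefinite_description _ (Hc n))).
  pose (HG := fun n => proj2_sig (constructive_indefinite_description _ (Hc n))).
  pose (L := fun n => proj1_sig (constructive_indefinite_description _ (HG n))).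
  pose (HL := fun n => proj2_sig (constructive_indefinite_description _ (HG n))).
  fold G in HL; fold L in HL.
  destruct (filterlim_RInt (U := nat) (V := C_R_CompleteNormedModule) G a b
    eventually _
    (fun x => if Rle_dec a x then if Rle_dec x b then f x else RtoC 0 else RtoC 0) L)
    as [If [_ HI]].
  - intros n; apply (HL n).
  - apply filterlim_locally; intros eps.
    destruct (nfloor_ex (/ eps)) as [n0 [_ Hn0]].
    { left; apply Rinv_0_lt_compat, cond_pos. }
    exists n0; intros n Hn x; apply ball_Cmod.
    rewrite Cmod_minus_sym; eapply Rle_lt_trans; [apply (HL n)|].
    rewrite <- (Rinv_inv eps).
    apply Rinv_lt_contravar.
    + apply Rmult_lt_0_compat; [apply Rinv_0_lt_compat, cond_pos|].
      pose proof (pos_INR n); lra.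
    + apply le_INR in Hn; lra.
  - exists If; eapply is_CInt_ext; [exact Hab| |exact HI].
    intros x Hx; cbv beta.
    destruct (Rle_dec a x); [|lra]; destruct (Rle_dec x b); [reflexivity|lra].
Qed.

Definition Ccont (f : R -> C) (x : R) : Prop :=
  forall eps, (0 < eps)%R -> exists del, (0 < del)%R /\
    forall y, (Rabs (y - x) < del)%R -> (Cmod (f y - f x) < eps)%R.

Lemma Ccont_continuous (f : R -> C) (x : R) :
  Ccont f x -> continuous (U := C_R_NormedModule) f x.
Proof.
  intros H; apply filterlim_locally; intros eps.
  destruct (H eps (cond_pos eps)) as [del [Hd Hy]].
  exists (mkposreal del Hd); intros y Hb; apply ball_Cmod, Hy, Hb.
Qed.

Lemma Ccont_ex_CInt (f : R -> C) (a b : R) :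
  (forall x, Ccont f x) -> exists l, is_CInt f a b l.
Proof.
  intros H; apply (ex_RInt_continuous (V := C_R_CompleteNormedModule)).
  intros x _; apply Ccont_continuous, H.
Qed.

Lemma is_CInt_Chasles (f : R -> C) (a b c : R) (l m : C) :
  is_CInt f a b l -> is_CInt f b c m -> is_CInt f a c (l + m).
Proof. apply (is_RInt_Chasles (V := C_R_NormedModule)). Qed.

(** Cut the interval at each exceptional value. *)
Lemma is_CInt_ext_finite (L : list R) :
  forall (f g : R -> C) (a b : R) (l : C),
  (a <= b)%R ->
  (forall x, (a < x < b)%R -> ~ In x L -> f x = g x) ->
  is_CInt f a b l -> is_CInt g a b l.
Proof.
  induction L as [|c L IH]; intros f g a b l Hab H Hf.
  - eapply is_CInt_ext; [exact Hab| |exact Hf].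
    intros x Hx; apply H; [exact Hx|intros []].
  - destruct (Rlt_dec a c) as [H1|H1]; [destruct (Rlt_dec c b) as [H2|H2]|].
    + destruct (ex_RInt_Chasles_1 (V := C_R_CompleteNormedModule) f a c b)
        as [l1 Hl1]; [lra|exists l; exact Hf|].
      destruct (ex_RInt_Chasles_2 (V := C_R_CompleteNormedModule) f a c b)
        as [l2 Hl2]; [lra|exists l; exact Hf|].
      replace l with (l1 + l2)
        by (eapply is_CInt_eq; [eapply is_CInt_Chasles; eassumption|exact Hf]).
      apply (is_CInt_Chasles g a c b);
        [apply (IH f g a c l1)|apply (IH f g c b l2)]; try assumption; try lra.
      * intros x Hx HL; apply H; [lra|]; intros [E|E]; [lra|tauto].
      * intros x Hx HL; apply H; [lra|]; intros [E|E]; [lra|tauto].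
    + apply (IH f); try assumption.
      intros x Hx HL; apply H; [lra|]; intros [E|E]; [subst; tauto|tauto].
    + apply (IH f); try assumption.
      intros x Hx HL; apply H; [lra|]; intros [E|E]; [subst; tauto|tauto].
Qed.

Lemma scal_C (r : R) (z : C) : scal (V := C_R_NormedModule) r z = r * z.
Proof.
  apply injective_projections; simpl; unfold scal; simpl; unfold mult; simpl; ring.
Qed.

Lemma is_CInt_translate (f : R -> C) (a b v : R) (l : C) :
  is_CInt f (a + v) (b + v) l -> is_CInt (fun x => f (x + v)%R) a b l.
Proof.
  intros H.
  pose proof (is_RInt_comp_lin (V := C_R_NormedModule) f 1 v a b l) as H1.
  rewrite !Rmult_1_l in H1; specialize (H1 H).
  eapply (is_RInt_ext (V := C_R_NormedModule)); [|exact H1].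
  intros x _; simpl; rewrite (scal_one (V := C_R_NormedModule)).
  rewrite Rmult_1_l; reflexivity.
Qed.

Lemma is_CInt_close (f p : R -> C) (a b eps : R) (l m : C) :
  (a <= b)%R -> is_CInt f a b l -> is_CInt p a b m ->
  (forall x, (a <= x <= b)%R -> (Cmod (f x - p x) <= eps)%R) ->
  (Cmod (l - m) <= eps * (b - a))%R.
Proof.
  intros Hab Hf Hp H.
  apply (is_CInt_norm (fun x => f x - p x) a b eps); auto.
  apply is_CInt_minus; assumption.
Qed.

Lemma is_CInt_series (f : R -> C) (phi : nat -> R -> C) (c l : nat -> C)
    (a b K rho : R) :
  (a <= b)%R -> (0 <= rho < 1)%R ->
  (forall n, is_CInt (phi n) a b (l n)) ->
  (forall n x, (a <= x <= b)%R ->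
     (Cmod (f x - Csum (fun k => (c k * phi k x)%C) n) <= K * rho ^ n)%R) ->
  exists I, is_CInt f a b I /\ Climit (Csum (fun k => c k * l k)) I.
Proof.
  intros Hab Hr Hphi Hf.
  assert (HS : forall n, is_CInt (fun x => Csum (fun k => c k * phi k x) n) a b
    (Csum (fun k => c k * l k) n)).
  { intros n; apply is_CInt_Csum; intros k _; apply is_CInt_scal, Hphi. }
  destruct (is_CInt_uniform f a b Hab) as [I HI].
  - intros eps He; destruct (pow_small rho K eps Hr He) as [n Hn].
    exists (fun x => Csum (fun k => c k * phi k x) n), (Csum (fun k => c k * l k) n).
    split; [apply HS|]; intros x Hx; eapply Rle_trans; [apply Hf, Hx|].
    left; apply Hn; lia.
  - exists I; split; [exact HI|].
    apply Climit_geom with (K * (b - a))%R rho; [exact Hr|]; intros n.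
    rewrite Cmod_minus_sym.
    replace (K * (b - a) * rho ^ n)%R with (K * rho ^ n * (b - a))%R by ring.
    apply (is_CInt_close f (fun x => Csum (fun k => c k * phi k x) n)); auto.
Qed.

(** * Uniform approximation by polynomials in two variables *)

Inductive poly2 : (C -> C -> C) -> Prop :=
| poly2_const c : poly2 (fun _ _ => c)
| poly2_fst : poly2 (fun t _ => t)
| poly2_snd : poly2 (fun _ u => u)
| poly2_plus p r :
    poly2 p -> poly2 r -> poly2 (fun t u => p t u + r t u)
| poly2_mult p r :
    poly2 p -> poly2 r -> poly2 (fun t u => p t u * r t u).

(** This replaces joint analyticity: the class is closed under every
    construction of the integrand, and what is needed from analytic
    functions (Cauchy's theorem, Taylor expansion, isolated zeros) is
    elementary for polynomials and survives uniform limits. The second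
    variable serves as variable of integration. *)
Definition approx (K : C -> C -> Prop) (f : C -> C -> C) : Prop :=
  forall eps, (0 < eps)%R -> exists p, poly2 p /\
    forall t u, K t u -> (Cmod (f t u - p t u) <= eps)%R.

Definition bounded2 (K : C -> C -> Prop) : Prop :=
  exists B, forall t u, K t u -> (Cmod t <= B /\ Cmod u <= B)%R.

Lemma poly2_bounded (K : C -> C -> Prop) (p : C -> C -> C) :
  bounded2 K -> poly2 p ->
  exists B, (0 <= B)%R /\ forall t u, K t u -> (Cmod (p t u) <= B)%R.
Proof.
  intros [R HR] Hp; induction Hp as [c| | |p r _ [B1 [P1 H1]] _ [B2 [P2 H2]]
    |p r _ [B1 [P1 H1]] _ [B2 [P2 H2]]].
  - exists (Cmod c); split; [apply Cmod_ge_0|intros; lra].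
  - exists (Rabs R); split; [apply Rabs_pos|intros t u H].
    pose proof (Rle_abs R); destruct (HR t u H); lra.
  - exists (Rabs R); split; [apply Rabs_pos|intros t u H].
    pose proof (Rle_abs R); destruct (HR t u H); lra.
  - exists (B1 + B2)%R; split; [lra|intros t u H].
    eapply Rle_trans; [apply Cmod_triangle|].
    specialize (H1 t u H); specialize (H2 t u H); lra.
  - exists (B1 * B2)%R; split; [nra|intros t u H].
    rewrite Cmod_mult; apply Rmult_le_compat; try apply Cmod_ge_0; auto.
Qed.

Lemma approx_bounded (K : C -> C -> Prop) (f : C -> C -> C) :
  bounded2 K -> approx K f ->
  exists B, (0 < B)%R /\ forall t u, K t u -> (Cmod (f t u) <= B)%R.
Proof.
  intros HK Hf; destruct (Hf 1%R ltac:(lra)) as [p [Hp H]].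
  destruct (poly2_bounded K p HK Hp) as [B [HB HpB]].
  exists (B + 1)%R; split; [lra|intros t u Htu].
  pose proof (Cmod_triangle_inv (f t u) (p t u)).
  specialize (H t u Htu); specialize (HpB t u Htu); lra.
Qed.

Lemma approx_ext (K : C -> C -> Prop) (f g : C -> C -> C) :
  (forall t u, K t u -> f t u = g t u) -> approx K f -> approx K g.
Proof.
  intros E Hf eps He; destruct (Hf eps He) as [p [Hp H]].
  exists p; split; [exact Hp|]; intros t u Htu; rewrite <- E; auto.
Qed.

Lemma approx_subset (K K' : C -> C -> Prop) (f : C -> C -> C) :
  (forall t u, K' t u -> K t u) -> approx K f -> approx K' f.
Proof.
  intros S Hf eps He; destruct (Hf eps He) as [p [Hp H]].
  exists p; split; auto.
Qed.

Lemma approx_poly2 (K : C -> C -> Prop) (p : C -> C -> C) :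
  poly2 p -> approx K p.
Proof.
  intros Hp eps He; exists p; split; [exact Hp|]; intros t u _.
  replace (p t u - p t u) with (RtoC 0) by ring; rewrite Cmod_0; lra.
Qed.

Lemma approx_const (K : C -> C -> Prop) (c : C) : approx K (fun _ _ => c).
Proof. apply approx_poly2, poly2_const. Qed.

Lemma approx_fst (K : C -> C -> Prop) : approx K (fun t _ => t).
Proof. apply approx_poly2, poly2_fst. Qed.

Lemma approx_snd (K : C -> C -> Prop) : approx K (fun _ u => u).
Proof. apply approx_poly2, poly2_snd. Qed.

Lemma approx_plus (K : C -> C -> Prop) (f g : C -> C -> C) :
  approx K f -> approx K g -> approx K (fun t u => f t u + g t u).
Proof.
  intros Hf Hg eps He.
  destruct (Hf (eps / 2)%R ltac:(lra)) as [p [Hp H1]].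
  destruct (Hg (eps / 2)%R ltac:(lra)) as [r [Hr H2]].
  exists (fun t u => p t u + r t u); split; [apply poly2_plus; assumption|].
  intros t u H.
  replace (f t u + g t u - (p t u + r t u))
    with ((f t u - p t u) + (g t u - r t u)) by ring.
  eapply Rle_trans; [apply Cmod_triangle|].
  specialize (H1 t u H); specialize (H2 t u H); lra.
Qed.

Lemma approx_mult (K : C -> C -> Prop) (f g : C -> C -> C) :
  bounded2 K -> approx K f -> approx K g ->
  approx K (fun t u => f t u * g t u).
Proof.
  intros HK Hf Hg eps He.
  destruct (approx_bounded K f HK Hf) as [A [HA HfA]].
  assert (HD : exists p, poly2 p /\
    forall t u, K t u -> (Cmod (g t u - p t u) <= eps / 2 / A)%R).
  { apply Hg; apply Rdiv_lt_0_compat; lra. }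
  destruct HD as [r [Hr H2]].
  destruct (poly2_bounded K r HK Hr) as [B [HB HrB]].
  destruct (Hf (eps / 2 / (B + 1))%R) as [p [Hp H1]].
  { apply Rdiv_lt_0_compat; lra. }
  exists (fun t u => p t u * r t u); split; [apply poly2_mult; assumption|].
  intros t u H.
  specialize (H1 t u H); specialize (H2 t u H); specialize (HfA t u H);
    specialize (HrB t u H).
  replace (f t u * g t u - p t u * r t u)
    with (f t u * (g t u - r t u) + (f t u - p t u) * r t u) by ring.
  eapply Rle_trans; [apply Cmod_triangle|]; rewrite !Cmod_mult.
  replace eps with (A * (eps / 2 / A) + (eps / 2 / (B + 1)) * (B + 1))%R
    by (field; lra).
  apply Rplus_le_compat; apply Rmult_le_compat; try apply Cmod_ge_0; lra.
Qed.

Lemma approx_scal (K : C -> C -> Prop) (c : C) (f : C -> C -> C) :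
  bounded2 K -> approx K f -> approx K (fun t u => c * f t u).
Proof. intros HK Hf; apply approx_mult; auto using approx_const. Qed.

Lemma approx_minus (K : C -> C -> Prop) (f g : C -> C -> C) :
  bounded2 K -> approx K f -> approx K g ->
  approx K (fun t u => f t u - g t u).
Proof.
  intros HK Hf Hg.
  apply approx_ext with (fun t u => f t u + - (1) * g t u).
  - intros; ring.
  - apply approx_plus; auto using approx_scal.
Qed.

Lemma approx_pow (K : C -> C -> Prop) (f : C -> C -> C) (n : nat) :
  bounded2 K -> approx K f -> approx K (fun t u => f t u ^ n).
Proof.
  intros HK Hf; induction n as [|n IH]; simpl.
  - apply approx_const.
  - apply approx_mult; assumption.
Qed.

Lemma approx_Csum (K : C -> C -> Prop) (f : nat -> C -> C -> C) (n : nat) :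
  (forall k, (k < n)%nat -> approx K (f k)) ->
  approx K (fun t u => Csum (fun k => f k t u) n).
Proof.
  induction n as [|n IH]; intros H; simpl.
  - apply approx_const.
  - apply approx_plus; [apply IH; intros|]; apply H; lia.
Qed.

Lemma approx_Cprod (K : C -> C -> Prop) (f : nat -> C -> C -> C) (n : nat) :
  bounded2 K -> (forall k, (k < n)%nat -> approx K (f k)) ->
  approx K (fun t u => Cprod (fun k => f k t u) n).
Proof.
  intros HK; induction n as [|n IH]; intros H; simpl.
  - apply approx_const.
  - apply approx_mult; [exact HK|apply IH; intros|]; apply H; lia.
Qed.

Lemma approx_lim (K : C -> C -> Prop) (f : C -> C -> C) :
  (forall eps, (0 < eps)%R -> exists g, approx K g /\
    forall t u, K t u -> (Cmod (f t u - g t u) <= eps)%R) ->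
  approx K f.
Proof.
  intros H eps He.
  destruct (H (eps / 2)%R ltac:(lra)) as [g [Hg H1]].
  destruct (Hg (eps / 2)%R ltac:(lra)) as [p [Hp H2]].
  exists p; split; [exact Hp|]; intros t u Htu.
  replace (f t u - p t u) with ((f t u - g t u) + (g t u - p t u)) by ring.
  eapply Rle_trans; [apply Cmod_triangle|].
  specialize (H1 t u Htu); specialize (H2 t u Htu); lra.
Qed.

Lemma approx_lim_geom (K : C -> C -> Prop) (f : C -> C -> C)
    (g : nat -> C -> C -> C) (A rho : R) :
  (0 <= rho < 1)%R -> (forall n, approx K (g n)) ->
  (forall n t u, K t u -> (Cmod (g n t u - f t u) <= A * rho ^ n)%R) ->
  approx K f.
Proof.
  intros Hr Hg H; apply approx_lim; intros eps He.
  destruct (pow_small rho A eps Hr He) as [n Hn].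
  exists (g n); split; [apply Hg|]; intros t u Htu.
  rewrite Cmod_minus_sym; eapply Rle_trans; [apply H, Htu|].
  left; apply Hn; lia.
Qed.

(** Values in a bounded part of an open half-plane bounded by a line through
    0 lie, up to a scaling, in a disc [|1 - w| <= rho < 1], where the
    geometric series gives the inverse. *)
Lemma approx_inv (K : C -> C -> Prop) (f : C -> C -> C) (mu : C) (del : R) :
  bounded2 K -> approx K f -> (0 < del)%R -> (Cmod mu <= 1)%R ->
  (forall t u, K t u -> (del <= Re (mu * f t u))%R) ->
  approx K (fun t u => / f t u).
Proof.
  intros HK Hf Hd Hmu Hre.
  destruct (approx_bounded K f HK Hf) as [B0 [HB0 HfB0]].
  set (B := Rmax B0 del).
  assert (HB : (0 < B)%R) by (unfold B; pose proof (Rmax_l B0 del); lra).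
  assert (HdB : (del <= B)%R) by apply Rmax_r.
  assert (HfB : forall t u, K t u -> (Cmod (f t u) <= B)%R).
  { intros t u H; eapply Rle_trans; [apply HfB0, H|apply Rmax_l]. }
  (* [1 - 2 s del + s^2 B^2] is smallest at [s = del / B^2]. *)
  set (c := mu * RtoC (del / (B * B))%R).
  set (rho := sqrt (1 - del * del / (B * B))).
  assert (Hq : (0 < del * del / (B * B) <= 1)%R).
  { split; [apply Rdiv_lt_0_compat; nra|].
    apply Rmult_le_reg_r with (B * B)%R; [nra|].
    unfold Rdiv; rewrite Rmult_assoc, Rinv_l by nra; nra. }
  assert (Hrho : (0 <= rho < 1)%R).
  { split; [apply sqrt_pos|]; unfold rho.
    apply Rlt_le_trans with (sqrt 1); [apply sqrt_lt_1_alt|rewrite sqrt_1]; lra. }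
  assert (Hw : forall t u, K t u -> (Cmod (1 - c * f t u) <= rho)%R).
  { intros t u H; specialize (Hre t u H); specialize (HfB t u H).
    set (w := mu * f t u) in *.
    assert (Hwm : (Cmod w <= B)%R).
    { unfold w; rewrite Cmod_mult.
      pose proof (Cmod_ge_0 (f t u)); pose proof (Cmod_ge_0 mu); nra. }
    assert (Hw2 : (Re w ^ 2 + Im w ^ 2 <= B * B)%R).
    { rewrite <- Cmod2_alt; pose proof (Cmod_ge_0 w); nra. }
    unfold rho; rewrite <- (sqrt_pow2 (Cmod (1 - c * f t u))) by apply Cmod_ge_0.
    apply sqrt_le_1_alt.
    rewrite Cmod2_alt.
    set (s := (del / (B * B))%R) in *.
    replace (c * f t u) with (RtoC s * w) by (unfold c, w; ring).
    replace (Re (1 - s * w)) with (1 - s * Re w)%R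
      by (unfold Re; simpl; ring).
    replace (Im (1 - s * w)) with (- s * Im w)%R
      by (unfold Im; simpl; ring).
    replace (1 - del * del / (B * B))%R
      with (1 - 2 * s * del + s * s * (B * B))%R
      by (unfold s; field; lra).
    assert (0 < s)%R by (unfold s; apply Rdiv_lt_0_compat; nra).
    nra. }
  assert (Hf0 : forall t u, K t u -> (del <= Cmod (f t u))%R).
  { intros t u H; specialize (Hre t u H).
    pose proof (re_le_Cmod (mu * f t u)) as H1; rewrite Cmod_mult in H1.
    pose proof (Rle_abs (Re (mu * f t u))); pose proof (Cmod_ge_0 (f t u)).
    pose proof (Cmod_ge_0 mu); nra. }
  apply (approx_lim_geom K _
    (fun n t u => Csum (fun k => c * (1 - c * f t u) ^ k) n) (/ del) rho Hrho).
  - intros n; apply approx_Csum; intros k _; apply approx_scal; [exact HK|].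
    apply approx_pow; [exact HK|]; apply approx_minus; auto using approx_const.
    apply approx_scal; assumption.
  - intros n t u H; specialize (Hf0 t u H); specialize (Hw t u H).
    assert (Hnz : f t u <> 0) by (apply Cmod_gt_0; lra).
    replace (Csum (fun k => c * (1 - c * f t u) ^ k) n - / f t u)
      with (- ((1 - c * f t u) ^ n * / f t u)).
    + rewrite Cmod_opp, Cmod_mult, Cmod_pow, Cmod_inv, Rmult_comm by exact Hnz.
      apply Rmult_le_compat.
      * left; apply Rinv_0_lt_compat; lra.
      * apply pow_le, Cmod_ge_0.
      * apply Rinv_le_contravar; lra.
      * apply pow_incr; split; [apply Cmod_ge_0|exact Hw].
    + induction n as [|n IH]; simpl; [field; exact Hnz|].
      replace (Csum (fun k => c * (1 - c * f t u) ^ k) n)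
        with (/ f t u - (1 - c * f t u) ^ n * / f t u) by (rewrite Cmult_comm;
          rewrite Cmult_comm in IH; transitivity (/ f t u + - (/ f t u * (1 - c * f t u) ^ n)); [ring|rewrite IH; ring]).
      field; exact Hnz.
Qed.

Lemma approx_inv_mult (K : C -> C -> Prop) (f g : C -> C -> C) :
  bounded2 K ->
  (approx K (fun t u => / f t u) /\ forall t u, K t u -> f t u <> 0) ->
  (approx K (fun t u => / g t u) /\ forall t u, K t u -> g t u <> 0) ->
  approx K (fun t u => / (f t u * g t u)) /\
  forall t u, K t u -> f t u * g t u <> 0.
Proof.
  intros HK [F1 F2] [G1 G2]; split.
  - apply approx_ext with (fun t u => / f t u * / g t u).
    + intros t u Htu; field; auto.
    + apply approx_mult; auto.
  - intros t u Htu; apply Cmult_neq_0; auto.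
Qed.

Lemma approx_inv_Cprod (K : C -> C -> Prop) (f : nat -> C -> C -> C) (n : nat) :
  bounded2 K ->
  (forall j, (j < n)%nat -> approx K (fun t u => / f j t u) /\
     forall t u, K t u -> f j t u <> 0) ->
  approx K (fun t u => / Cprod (fun j => f j t u) n).
Proof.
  intros HK H; apply approx_ext with (fun t u => Cprod (fun j => / f j t u) n).
  - intros t u Htu; apply Cprod_inv; intros j Hj; apply H; assumption.
  - apply approx_Cprod; auto; intros j Hj; apply H, Hj.
Qed.

Lemma Cpow_diff_bound (a b : C) (M : R) (n : nat) :
  (Cmod a <= M -> Cmod b <= M ->
   Cmod (a ^ n - b ^ n) <= INR n * M ^ (n - 1) * Cmod (a - b))%R.
Proof.
  intros Ha Hb.
  assert (HM : (0 <= M)%R) by (pose proof (Cmod_ge_0 a); lra).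
  induction n as [|n IH].
  - simpl; replace (1 - 1) with (RtoC 0) by ring; rewrite Cmod_0; lra.
  - replace (a ^ S n - b ^ S n) with (a * (a ^ n - b ^ n) + (a - b) * b ^ n)
      by (simpl; ring).
    eapply Rle_trans; [apply Cmod_triangle|]; rewrite !Cmod_mult, Cmod_pow.
    rewrite S_INR; replace (S n - 1)%nat with n by lia.
    assert (H1 : (Cmod b ^ n <= M ^ n)%R)
      by (apply pow_incr; split; [apply Cmod_ge_0|exact Hb]).
    pose proof (Cmod_ge_0 (a - b)); pose proof (Cmod_ge_0 (a ^ n - b ^ n)).
    assert (H2 : (Cmod a * Cmod (a ^ n - b ^ n) <=
      INR n * M ^ n * Cmod (a - b))%R).
    { apply Rle_trans with (M * (INR n * M ^ (n - 1) * Cmod (a - b)))%R.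
      - apply Rmult_le_compat; try apply Cmod_ge_0; assumption.
      - destruct n as [|n]; [simpl; lra|].
        replace (S n - 1)%nat with n by lia; simpl; right; ring. }
    nra.
Qed.

(** The exponential is the uniform limit of [(1 + w / n) ^ n] on bounded sets. *)
Lemma approx_Cexp (K : C -> C -> Prop) (f : C -> C -> C) :
  bounded2 K -> approx K f -> approx K (fun t u => Cexp (f t u)).
Proof.
  intros HK Hf; destruct (approx_bounded K f HK Hf) as [B [HB HfB]].
  apply approx_lim; intros eps He.
  set (A := (exp B * (14 * B ^ 2))%R).
  assert (HA : (0 < A)%R).
  { unfold A; apply Rmult_lt_0_compat; [apply exp_pos|nra]. }
  destruct (nfloor_ex (Rmax B (A / eps))) as [n0 [_ Hn0]].
  { eapply Rle_trans; [|apply Rmax_l]; lra. }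
  set (n := S n0); assert (Hn : (Rmax B (A / eps) < INR n)%R)
    by (unfold n; rewrite S_INR; exact Hn0).
  pose proof (Rmax_l B (A / eps)) as M1; pose proof (Rmax_r B (A / eps)) as M2.
  assert (HnC : RtoC (INR n) <> 0) by (apply RtoC_neq_0; lra).
  exists (fun t u => (1 + / INR n * f t u) ^ n); split.
  - apply approx_pow; [exact HK|]; apply approx_plus; [apply approx_const|].
    apply approx_scal; assumption.
  - intros t u H; specialize (HfB t u H).
    set (v := / INR n * f t u).
    replace (f t u) with (INR n * v) by (unfold v; field; exact HnC).
    rewrite Cexp_INR.
    assert (Hv : (Cmod v <= B / INR n)%R).
    { unfold v; rewrite Cmod_mult, Cmod_inv, Cmod_R, Rabs_pos_eq, Rmult_comm
        by (exact HnC || lra).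
      apply Rmult_le_compat_r; [left; apply Rinv_0_lt_compat; lra|exact HfB]. }
    assert (Hv1 : (B / INR n < 1)%R).
    { apply Rmult_lt_reg_r with (INR n); [lra|].
      unfold Rdiv; rewrite Rmult_assoc, Rinv_l; lra. }
    pose proof (Cexp_quadratic v ltac:(lra)) as Hq.
    assert (B1 : (Cmod (Cexp v) <= exp (B / INR n))%R).
    { rewrite Cmod_Cexp.
      pose proof (re_le_Cmod v); pose proof (Rle_abs (Re v)).
      apply exp_le_exp; lra. }
    assert (B2 : (Cmod (1 + v) <= exp (B / INR n))%R).
    { eapply Rle_trans; [apply Cmod_triangle|]; rewrite Cmod_1.
      eapply Rle_trans; [|apply exp_ineq1_le]; lra. }
    eapply Rle_trans; [apply (Cpow_diff_bound _ _ _ n B1 B2)|].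
    replace (Cexp v - (1 + v)) with (Cexp v - 1 - v) by ring.
    assert (HE : (exp (B / INR n) ^ (n - 1) <= exp B)%R).
    { assert (Hp : forall k, (exp (B / INR n) ^ k = exp (INR k * (B / INR n)))%R).
      { intros k; induction k as [|k IH]; [simpl; rewrite Rmult_0_l, exp_0; ring|].
        rewrite S_INR, Rmult_plus_distr_r, exp_plus, <- IH, Rmult_1_l; simpl; ring. }
      rewrite Hp.
      assert (HB' : (INR (n - 1) * (B / INR n) <= B)%R).
      { rewrite minus_INR by (unfold n; lia).
        assert (0 < B / INR n)%R by (apply Rdiv_lt_0_compat; lra).
        replace B with (INR n * (B / INR n))%R at 2 by (field; lra).
        change (INR 1) with 1%R; nra. }
      apply exp_le_exp, HB'. }
    assert (HQ : (Cmod (Cexp v - 1 - v) <= 14 * (B / INR n) ^ 2)%R).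
    { eapply Rle_trans; [exact Hq|]; apply Rmult_le_compat_l; [lra|].
      apply pow_incr; split; [apply Cmod_ge_0|exact Hv]. }
    apply Rle_trans with (INR n * exp B * (14 * (B / INR n) ^ 2))%R.
    + apply Rmult_le_compat; [| |apply Rmult_le_compat_l; [lra|exact HE]|exact HQ].
      * apply Rmult_le_pos; [lra|apply pow_le; left; apply exp_pos].
      * apply Cmod_ge_0.
    + replace (INR n * exp B * (14 * (B / INR n) ^ 2))%R with (A / INR n)%R
        by (unfold A; field; lra).
      apply Rmult_le_reg_r with (INR n); [lra|].
      unfold Rdiv; rewrite Rmult_assoc, Rinv_l, Rmult_1_r by lra.
      replace A with (A / eps * eps)%R by (field; lra); nra.
Qed.

Lemma approx_Cexp_inv (K : C -> C -> Prop) (f : C -> C -> C) :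
  bounded2 K -> approx K f -> approx K (fun t u => / Cexp (f t u)).
Proof.
  intros HK Hf; apply approx_ext with (fun t u => Cexp (- (1) * f t u)).
  - intros t u _; replace (- (1) * f t u) with (- f t u) by ring; apply Cexp_opp.
  - apply approx_Cexp, approx_scal; auto.
Qed.

(** * Infinite products *)

Lemma Cprod_bound (d : nat -> C) (A rho : R) (n : nat) :
  (0 <= rho < 1)%R -> (forall k, (Cmod (d k) <= A * rho ^ k)%R) ->
  (Cmod (Cprod (fun k => 1 + d k)%C n) <= exp (A / (1 - rho)))%R.
Proof.
  intros Hr Hd.
  assert (HA : (0 <= A)%R).
  { pose proof (Hd O) as H0; simpl in H0; pose proof (Cmod_ge_0 (d O)); lra. }
  assert (H : (Cmod (Cprod (fun k => 1 + d k)%C n) <=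
    exp (A / (1 - rho) * (1 - rho ^ n)))%R).
  { induction n as [|n IH]; simpl.
    - rewrite Cmod_1, Rminus_diag, Rmult_0_r, exp_0; lra.
    - rewrite Cmod_mult.
      replace (A / (1 - rho) * (1 - rho * rho ^ n))%R
        with (A / (1 - rho) * (1 - rho ^ n) + A * rho ^ n)%R by (field; lra).
      rewrite exp_plus; apply Rmult_le_compat; try apply Cmod_ge_0; [exact IH|].
      eapply Rle_trans; [apply Cmod_triangle|]; rewrite Cmod_1.
      eapply Rle_trans; [|apply exp_ineq1_le]; specialize (Hd n); lra. }
  eapply Rle_trans; [exact H|].
  assert (HH : (A / (1 - rho) * (1 - rho ^ n) <= A / (1 - rho))%R).
  { assert (0 <= A / (1 - rho))%R.
    { apply Rmult_le_pos; [exact HA|left; apply Rinv_0_lt_compat; lra]. }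
    assert (0 <= rho ^ n)%R by (apply pow_le; lra); nra. }
  apply exp_le_exp, HH.
Qed.

Lemma Cprod_telescope (d : nat -> C) (n : nat) :
  Cprod (fun k => 1 + d k) n =
  1 + Csum (fun k => Cprod (fun k => 1 + d k) k * d k) n.
Proof. induction n as [|n IH]; simpl; [ring|].
  rewrite Cmult_plus_distr_l, Cmult_1_r; rewrite IH at 1; ring.
Qed.

(** Telescoping turns the product into a series with geometrically
    decreasing terms. *)
Lemma Cprod_converges (d : nat -> C) (A rho : R) :
  (0 <= rho < 1)%R -> (forall k, (Cmod (d k) <= A * rho ^ k)%R) ->
  let P := Cprod (fun k => 1 + d k) in
  Climit P (Clim P) /\
  forall n, (Cmod (P n - Clim P) <=
             exp (A / (1 - rho)) * A / (1 - rho) * rho ^ n)%R.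
Proof.
  intros Hr Hd P.
  set (e := fun k => P k * d k).
  destruct (Cseries_geom e (exp (A / (1 - rho)) * A) rho Hr) as [H1 H2].
  { intros k; unfold e; rewrite Cmod_mult, Rmult_assoc.
    apply Rmult_le_compat; try apply Cmod_ge_0; [|apply Hd].
    apply Cprod_bound; assumption. }
  assert (HP : Climit P (1 + Cseries e)).
  { apply Climit_ext with (fun n => 1 + Csum e n).
    - intros n; symmetry; apply Cprod_telescope.
    - apply Climit_plus; [apply Climit_const|exact H1]. }
  rewrite (Climit_Clim _ _ HP); split; [exact HP|].
  intros n; unfold P; rewrite Cprod_telescope.
  replace (1 + Csum (fun k => Cprod (fun k0 => 1 + d k0) k * d k) n
    - (1 + Cseries e)) with (Csum e n - Cseries e) by (unfold e, P; ring).
  apply H2.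
Qed.

Lemma approx_Cprod_inf (K : C -> C -> Prop) (d : nat -> C -> C -> C) (A rho : R) :
  bounded2 K -> (0 <= rho < 1)%R -> (forall k, approx K (d k)) ->
  (forall k t u, K t u -> (Cmod (d k t u) <= A * rho ^ k)%R) ->
  approx K (fun t u => Clim (Cprod (fun k => 1 + d k t u))).
Proof.
  intros HK Hr Hd HA.
  apply (approx_lim_geom K _ (fun n t u => Cprod (fun k => 1 + d k t u) n)
    (exp (A / (1 - rho)) * A / (1 - rho)) rho Hr).
  - intros n; apply approx_Cprod; [exact HK|]; intros k _.
    apply approx_plus; [apply approx_const|apply Hd].
  - intros n t u H; apply Cprod_converges; auto.
Qed.

Lemma approx_Cseries (K : C -> C -> Prop) (d : nat -> C -> C -> C) (A rho : R) :
  (0 <= rho < 1)%R -> (forall k, approx K (d k)) ->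
  (forall k t u, K t u -> (Cmod (d k t u) <= A * rho ^ k)%R) ->
  approx K (fun t u => Cseries (fun k => d k t u)).
Proof.
  intros Hr Hd HA.
  apply (approx_lim_geom K _ (fun n t u => Csum (fun k => d k t u) n)
    (A / (1 - rho)) rho Hr).
  - intros n; apply approx_Csum; intros k _; apply Hd.
  - intros n t u H; apply Cseries_geom; auto.
Qed.

(** * The infinite q-Pochhammer symbol *)

Lemma qpoch_inf_limit (a q : C) :
  (Cmod q < 1)%R -> Climit (qpoch a q) (qpoch_inf a q).
Proof.
  intros Hq.
  apply (Cprod_converges (fun k => - (a * q ^ k)) (Cmod a) (Cmod q)).
  - split; [apply Cmod_ge_0|exact Hq].
  - intros k; rewrite Cmod_opp, Cmod_mult, Cmod_pow; lra.
Qed.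

Lemma qpoch_S (a q : C) (n : nat) :
  qpoch a q (S n) = (1 - a) * qpoch (a * q) q n.
Proof.
  unfold qpoch; rewrite Cprod_Sl; simpl; f_equal; [ring|].
  apply Cprod_ext; intros k _; ring.
Qed.

Lemma qpoch_inf_shift (a q : C) :
  (Cmod q < 1)%R -> qpoch_inf a q = (1 - a) * qpoch_inf (a * q) q.
Proof.
  intros Hq; apply (Climit_unique (fun n => qpoch a q (n + 1))).
  - apply Climit_shift, qpoch_inf_limit, Hq.
  - apply Climit_ext with (fun n => (1 - a) * qpoch (a * q) q n).
    + intros n; rewrite Nat.add_1_r, qpoch_S; reflexivity.
    + apply Climit_scal, qpoch_inf_limit, Hq.
Qed.

Lemma qpoch_inf_split (a q : C) (n : nat) :
  (Cmod q < 1)%R -> qpoch_inf a q = qpoch a q n * qpoch_inf (a * q ^ n) q.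
Proof.
  intros Hq; induction n as [|n IH].
  - simpl; unfold qpoch; simpl; rewrite Cmult_1_l, Cmult_1_r; reflexivity.
  - rewrite IH; rewrite (qpoch_inf_shift (a * q ^ n)) by exact Hq.
    unfold qpoch; simpl.
    replace (a * q ^ n * q) with (a * (q * q ^ n)) by ring; ring.
Qed.

Lemma approx_qpoch_inf (K : C -> C -> Prop) (b : C -> C -> C) (q : C) :
  bounded2 K -> (Cmod q < 1)%R -> approx K b ->
  approx K (fun t u => qpoch_inf (b t u) q).
Proof.
  intros HK Hq Hb; destruct (approx_bounded K b HK Hb) as [B [HB HbB]].
  apply (approx_Cprod_inf K (fun k t u => - (b t u * q ^ k)) B (Cmod q)).
  - exact HK.
  - split; [apply Cmod_ge_0|exact Hq].
  - intros k; apply approx_ext with (fun t u => - q ^ k * b t u).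
    + intros; ring.
    + apply approx_scal; assumption.
  - intros k t u H; rewrite Cmod_opp, Cmod_mult, Cmod_pow.
    apply Rmult_le_compat_r; [apply pow_le, Cmod_ge_0|auto].
Qed.

(** All factors [1 - b q ^ k] lie in one half-plane at distance [del] from its
    boundary, so their inverses are again [1 + O(q ^ k)] and the product of
    the inverses converges. *)
Lemma approx_inv_qpoch_inf (K : C -> C -> Prop) (b : C -> C -> C) (q mu : C)
    (del : R) :
  bounded2 K -> (Cmod q < 1)%R -> approx K b ->
  (0 < del)%R -> (Cmod mu <= 1)%R ->
  (forall k t u, K t u -> (del <= Re (mu * (1 - b t u * q ^ k)))%R) ->
  approx K (fun t u => / qpoch_inf (b t u) q) /\
  forall t u, K t u -> qpoch_inf (b t u) q <> 0.
Proof.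
  intros HK Hq Hb Hd Hmu Hre.
  destruct (approx_bounded K b HK Hb) as [B [HB HbB]].
  assert (Hlow : forall k t u, K t u -> (del <= Cmod (1 - b t u * q ^ k))%R).
  { intros k t u H; specialize (Hre k t u H).
    set (x := 1 - b t u * q ^ k) in *.
    pose proof (re_le_Cmod (mu * x)) as H1; rewrite Cmod_mult in H1.
    pose proof (Rle_abs (Re (mu * x))); pose proof (Cmod_ge_0 x).
    pose proof (Cmod_ge_0 mu); nra. }
  assert (Hnz : forall k t u, K t u -> 1 - b t u * q ^ k <> 0).
  { intros k t u H; apply Cmod_gt_0; specialize (Hlow k t u H); lra. }
  set (d := fun (k : nat) t u => b t u * q ^ k * / (1 - b t u * q ^ k)).
  assert (Hd1 : forall k t u, K t u ->
    (Cmod (d k t u) <= B / del * Cmod q ^ k)%R).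
  { intros k t u H; unfold d.
    rewrite !Cmod_mult, Cmod_inv, Cmod_pow by auto.
    replace (B / del * Cmod q ^ k)%R with (B * Cmod q ^ k * / del)%R
      by (unfold Rdiv; ring).
    assert (0 <= Cmod q ^ k)%R by apply pow_le, Cmod_ge_0.
    apply Rmult_le_compat.
    - apply Rmult_le_pos; [apply Cmod_ge_0|assumption].
    - left; apply Rinv_0_lt_compat; specialize (Hlow k t u H); lra.
    - apply Rmult_le_compat_r; auto.
    - apply Rinv_le_contravar; auto. }
  assert (Hr : (0 <= Cmod q < 1)%R) by (split; [apply Cmod_ge_0|exact Hq]).
  assert (Hone : forall t u, K t u ->
    qpoch_inf (b t u) q * Clim (Cprod (fun k => 1 + d k t u)) = 1).
  { intros t u H.
    apply (Climit_unique
      (fun n => qpoch (b t u) q n * Cprod (fun k => 1 + d k t u) n)).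
    - apply Climit_mult; [apply qpoch_inf_limit, Hq|].
      apply (Cprod_converges _ (B / del) (Cmod q)); auto.
    - apply Climit_ext with (fun _ => RtoC 1); [|apply Climit_const].
      intros n; unfold qpoch; rewrite <- Cprod_mult.
      transitivity (Cprod (fun _ => RtoC 1) n);
        [rewrite Cprod_const, Cpow_1_l; reflexivity|].
      apply Cprod_ext; intros k _; unfold d; field; auto. }
  assert (Hnz2 : forall t u, K t u -> qpoch_inf (b t u) q <> 0).
  { intros t u H E; specialize (Hone t u H); rewrite E, Cmult_0_l in Hone.
    apply C1_nz; symmetry; exact Hone. }
  split; [|exact Hnz2].
  apply approx_ext with (fun t u => Clim (Cprod (fun k => 1 + d k t u))).
  - intros t u H.
    transitivity (/ qpoch_inf (b t u) q *
      (qpoch_inf (b t u) q * Clim (Cprod (fun k => 1 + d k t u))));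
      [field; auto|rewrite Hone by exact H; ring].
  - apply (approx_Cprod_inf K d (B / del) (Cmod q)); auto.
    intros k; unfold d.
    assert (Hbk : approx K (fun t u => b t u * q ^ k)).
    { apply approx_mult; auto using approx_const. }
    apply approx_mult; auto.
    apply (approx_inv K _ mu del); auto.
    apply approx_minus; auto using approx_const.
Qed.

Lemma approx_inv_qpoch_inf_small (K : C -> C -> Prop) (b : C -> C -> C) (q : C)
    (rho : R) :
  bounded2 K -> (Cmod q < 1)%R -> approx K b -> (rho < 1)%R ->
  (forall t u, K t u -> (Cmod (b t u) <= rho)%R) ->
  approx K (fun t u => / qpoch_inf (b t u) q) /\
  forall t u, K t u -> qpoch_inf (b t u) q <> 0.
Proof.
  intros HK Hq Hb Hr Hrho.
  apply (approx_inv_qpoch_inf K b q 1 (1 - rho)); auto.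
  - lra.
  - rewrite Cmod_1; lra.
  - intros k t u H; specialize (Hrho t u H).
    rewrite Cmult_1_l.
    pose proof (re_le_Cmod (b t u * q ^ k)) as H1.
    rewrite Cmod_mult, Cmod_pow in H1.
    assert (H2 : (0 <= Cmod q ^ k <= 1)%R).
    { apply Cmod_pow_unit; lra. }
    pose proof (Cmod_ge_0 (b t u)).
    pose proof (Rle_abs (Re (b t u * q ^ k))).
    assert (Re (1 - b t u * q ^ k) = 1 - Re (b t u * q ^ k))%R
      by (unfold Re; simpl; ring).
    nra.
Qed.

Lemma approx_inv_qpoch (K : C -> C -> Prop) (b : C -> C -> C) (q : C) (rho : R)
    (n : nat) :
  bounded2 K -> (Cmod q < 1)%R -> approx K b -> (rho < 1)%R ->
  (forall t u, K t u -> (Cmod (b t u) <= rho)%R) ->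
  approx K (fun t u => / qpoch (b t u) q n) /\
  forall t u, K t u -> qpoch (b t u) q n <> 0.
Proof.
  intros HK Hq Hb Hr Hrho.
  assert (Hb' : forall k, approx K (fun t u => 1 - b t u * q ^ k)).
  { intros k; apply approx_minus; auto using approx_const.
    apply approx_mult; auto using approx_const. }
  assert (Hre : forall k t u, K t u -> (1 - rho <= Re (1 * (1 - b t u * q ^ k)))%R).
  { intros k t u H; specialize (Hrho t u H).
    replace (Re (1 * (1 - b t u * q ^ k))) with (1 - Re (b t u * q ^ k))%R
      by (unfold Re; simpl; ring).
    pose proof (re_le_Cmod (b t u * q ^ k)) as HR.
    rewrite Cmod_mult, Cmod_pow in HR.
    assert (0 <= Cmod q ^ k <= 1)%R.
    { apply Cmod_pow_unit; lra. }
    pose proof (Rle_abs (Re (b t u * q ^ k))).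
    pose proof (Cmod_ge_0 (b t u)); nra. }
  assert (Hnz : forall k t u, K t u -> 1 - b t u * q ^ k <> 0).
  { intros k t u H E; specialize (Hre k t u H).
    rewrite E in Hre; unfold Re in Hre; simpl in Hre; lra. }
  split.
  - apply (approx_inv_Cprod K (fun k t u => 1 - b t u * q ^ k)); auto.
    intros k _; split; auto.
    apply (approx_inv K _ 1 (1 - rho)); auto; [lra|rewrite Cmod_1; lra].
  - intros t u H; apply Cprod_neq_0; auto.
Qed.

Lemma qpoch_inf_neq_0 (b q : C) :
  (Cmod q < 1)%R -> (Cmod b < 1)%R -> qpoch_inf b q <> 0.
Proof.
  intros Hq Hb.
  destruct (approx_inv_qpoch_inf_small (fun t u => t = 0 /\ u = 0)
    (fun _ _ => b) q (Cmod b)) as [_ H]; auto using approx_const.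
  - exists 0%R; intros t u [-> ->]; rewrite Cmod_0; lra.
  - intros; lra.
  - apply (H 0 0); split; reflexivity.
Qed.

(** * Primitives and monomials *)

(** Componentwise, so that the real rules of differentiation apply. *)
Definition RCderive (f : R -> C) (x : R) (l : C) : Prop :=
  is_derive (fun s => Re (f s)) x (Re l) /\ is_derive (fun s => Im (f s)) x (Im l).

Lemma RCderive_mult (f g : R -> C) (x : R) (l m : C) :
  RCderive f x l -> RCderive g x m ->
  RCderive (fun s => f s * g s) x (l * g x + f x * m).
Proof.
  intros [F1 F2] [G1 G2]; split.
  - pose proof (is_derive_minus _ _ _ _ _
      (is_derive_mult _ _ _ _ _ F1 G1 Rmult_comm)
      (is_derive_mult _ _ _ _ _ F2 G2 Rmult_comm)) as H.
    eapply is_derive_ext; [|evar_last; [exact H|]]; unfold Re, Im.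
    + intros t; reflexivity.
    + simpl; unfold minus, plus, opp, mult; simpl; ring.
  - pose proof (is_derive_plus _ _ _ _ _
      (is_derive_mult _ _ _ _ _ F1 G2 Rmult_comm)
      (is_derive_mult _ _ _ _ _ F2 G1 Rmult_comm)) as H.
    eapply is_derive_ext; [|evar_last; [exact H|]]; unfold Re, Im.
    + intros t; reflexivity.
    + simpl; unfold minus, plus, opp, mult; simpl; ring.
Qed.

Lemma RCderive_affine (w v : C) (x : R) : RCderive (fun s => w + s * v) x v.
Proof.
  unfold RCderive, Re, Im; split; simpl; auto_derive; trivial; ring.
Qed.

Lemma RCderive_const (c : C) (x : R) : RCderive (fun _ => c) x 0.
Proof.
  split; simpl; apply (is_derive_const (K := R_AbsRing) (V := R_NormedModule)).
Qed.

Lemma RCderive_pow (w v : C) (n : nat) (x : R) :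
  RCderive (fun s => (w + s * v) ^ S n) x (INR (S n) * v * (w + x * v) ^ n).
Proof.
  induction n as [|n IH].
  - replace (INR 1 * v * (w + x * v) ^ 0) with (v * 1 + (w + x * v) * 0)
      by (simpl; ring).
    apply (RCderive_mult (fun s => w + s * v) (fun _ => 1));
      [apply RCderive_affine|apply RCderive_const].
  - replace (INR (S (S n)) * v * (w + x * v) ^ S n)
      with (v * (w + x * v) ^ S n
            + (w + x * v) * (INR (S n) * v * (w + x * v) ^ n)).
    + apply (RCderive_mult (fun s => w + s * v) (fun s => (w + s * v) ^ S n));
        [apply RCderive_affine|exact IH].
    + rewrite (S_INR (S n)), RtoC_plus; simpl; ring.
Qed.

Lemma RCderive_Cexp (w : C) (x : R) :
  RCderive (fun s => Cexp (s * w)) x (w * Cexp (x * w)).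
Proof.
  unfold RCderive, Cexp, Re, Im; split; simpl; auto_derive; trivial; unfold Rminus; ring.
Qed.

(** The second derivative is there to make the integrand continuous. *)
Lemma is_CInt_primitive (F f f' : R -> C) (a b : R) :
  (forall x, RCderive F x (f x)) -> (forall x, RCderive f x (f' x)) ->
  is_CInt f a b (F b - F a).
Proof.
  intros HF Hf.
  apply (is_RInt_fct_extend_pair (U := R_NormedModule) (V := R_NormedModule)).
  - apply (is_RInt_derive (V := R_CompleteNormedModule) (fun x => Re (F x))).
    + intros x _; apply HF.
    + intros x _; apply (ex_derive_continuous (fun x => Re (f x))).
      exists (Re (f' x)); apply Hf.
  - apply (is_RInt_derive (V := R_CompleteNormedModule) (fun x => Im (F x))).
    + intros x _; apply HF.
    + intros x _; apply (ex_derive_continuous (fun x => Im (f x))).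
      exists (Im (f' x)); apply Hf.
Qed.

Lemma RCderive_scal (c : C) (f : R -> C) (x : R) (l : C) :
  RCderive f x l -> RCderive (fun s => c * f s) x (c * l).
Proof.
  intros H; replace (c * l) with (0 * f x + c * l) by ring.
  apply (RCderive_mult (fun _ => c)); [apply RCderive_const|exact H].
Qed.

Lemma is_CInt_line_pow (w v : C) (n : nat) (a b : R) :
  is_CInt (fun s => v * (w + s * v) ^ n) a b
    (/ INR (S n) * (w + b * v) ^ S n - / INR (S n) * (w + a * v) ^ S n).
Proof.
  assert (Hn : RtoC (INR (S n)) <> 0) by (apply RtoC_neq_0, not_0_INR; lia).
  assert (HD : exists f', forall x, RCderive (fun s => v * (w + s * v) ^ n) x (f' x)).
  { destruct n as [|n].
    - exists (fun _ => v * 0); intros x; apply RCderive_scal; simpl.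
      apply RCderive_const.
    - exists (fun x => v * (INR (S n) * v * (w + x * v) ^ n)); intros x.
      apply RCderive_scal, RCderive_pow. }
  destruct HD as [f' Hf'].
  apply (is_CInt_primitive (fun s => / INR (S n) * (w + s * v) ^ S n) _ f');
    [|exact Hf'].
  intros x.
  replace (v * (w + x * v) ^ n)
    with (/ INR (S n) * (INR (S n) * v * (w + x * v) ^ n)) by (field; exact Hn).
  apply RCderive_scal, RCderive_pow.
Qed.

(** The negative powers are written as powers of [Cexp (- (Ci * x))], since
    exponents are natural numbers. *)
Lemma is_CInt_circle (n m : nat) :
  is_CInt (fun x => Cexp (Ci * x) ^ n * Cexp (- (Ci * x)) ^ m) (- PI) PI
    (if Nat.eq_dec n m then RtoC (2 * PI)%R else RtoC 0).
Proof.
  pose proof PI_RGT_0 as Hpi.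
  assert (E : forall x : R, Cexp (x * (Ci * (INR n - INR m))) =
    Cexp (Ci * x) ^ n * Cexp (- (Ci * x)) ^ m).
  { intros x; rewrite <- !Cexp_INR, <- Cexp_plus; f_equal; ring. }
  destruct (Nat.eq_dec n m) as [->|Hnm].
  - apply is_CInt_ext with (fun _ => RtoC 1); [lra| |].
    + intros x _; rewrite <- E, <- Cexp_0; f_equal; ring.
    + pose proof (is_RInt_const (V := C_R_NormedModule) (- PI) PI (RtoC 1)) as H.
      replace (RtoC (2 * PI)%R) with
        (scal (V := C_R_NormedModule) (PI - - PI)%R (RtoC 1)); [exact H|].
      apply injective_projections; simpl;
        unfold scal; simpl; unfold mult; simpl; ring.
  - set (w := Ci * (INR n - INR m)) in *.
    assert (Hw : w <> 0).
    { unfold w; apply Cmult_neq_0.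
      - intros H; apply (f_equal Im) in H; simpl in H; lra.
      - rewrite <- RtoC_minus; apply RtoC_neq_0; intros H; apply Hnm, INR_eq; lra. }
    apply is_CInt_ext with (fun x : R => Cexp (x * w)); [lra|intros x _; apply E|].
    replace (RtoC 0) with (/ w * Cexp (PI * w) - / w * Cexp ((- PI)%R * w)).
    + apply (is_CInt_primitive (fun s : R => / w * Cexp (s * w)) _
        (fun x : R => w * Cexp (x * w))).
      * intros x; replace (Cexp (x * w)) with (/ w * (w * Cexp (x * w)))
          by (field; exact Hw).
        apply RCderive_scal, RCderive_Cexp.
      * intros x; apply RCderive_Cexp.
    + rewrite !E.
      assert (Hm : Cexp (Ci * (- PI)%R) = - (1)).
      { rewrite RtoC_opp; replace (Ci * - PI) with (- (Ci * PI)) by ring.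
        rewrite Cexp_opp, Cexp_PI; field. }
      rewrite !Cexp_opp, Hm, Cexp_PI; ring.
Qed.

Inductive monosum : (C -> C -> C) -> Prop :=
| monosum_0 : monosum (fun _ _ => 0)
| monosum_add c i j p :
    monosum p -> monosum (fun t u => c * t ^ i * u ^ j + p t u).

Definition is_monosum (p : C -> C -> C) : Prop :=
  exists r, monosum r /\ forall t u, p t u = r t u.

Lemma is_monosum_plus (p r : C -> C -> C) :
  is_monosum p -> is_monosum r -> is_monosum (fun t u => p t u + r t u).
Proof.
  intros [p' [Hp Ep]] [r' [Hr Er]]; revert p Ep.
  induction Hp as [|c i j p' Hp IH]; intros p Ep.
  - exists r'; split; [exact Hr|]; intros t u; rewrite Ep, Er; ring.
  - destruct (IH p' (fun _ _ => eq_refl)) as [s [Hs Es]].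
    exists (fun t u => c * t ^ i * u ^ j + s t u); split.
    + apply monosum_add, Hs.
    + intros t u; rewrite <- Es, Ep; ring.
Qed.

Lemma is_monosum_mult (p r : C -> C -> C) :
  is_monosum p -> is_monosum r -> is_monosum (fun t u => p t u * r t u).
Proof.
  assert (M : forall c i j r, is_monosum r ->
    is_monosum (fun t u => c * t ^ i * u ^ j * r t u)).
  { intros c i j r0 [r' [Hr Er]].
    revert r0 Er; induction Hr as [|d k l r' Hr IH]; intros r0 Er.
    - exists (fun _ _ => 0); split; [apply monosum_0|].
      intros t u; rewrite Er; ring.
    - destruct (IH r' (fun _ _ => eq_refl)) as [s [Hs Es]].
      exists (fun t u => (c * d) * t ^ (i + k) * u ^ (j + l) + s t u); split.
      + apply monosum_add, Hs.
      + intros t u; rewrite <- Es, Er, !Cpow_add_r; ring. }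
  intros [p' [Hp Ep]] Hr; revert p Ep.
  induction Hp as [|c i j p' Hp IH]; intros p Ep.
  - exists (fun _ _ => 0); split; [apply monosum_0|].
    intros t u; rewrite Ep; ring.
  - destruct (is_monosum_plus _ _ (M c i j r Hr) (IH p' (fun _ _ => eq_refl)))
      as [s [Hs Es]].
    exists s; split; [exact Hs|]; intros t u; rewrite <- Es, Ep; ring.
Qed.

(** Normal form: linear statements about polynomials reduce to monomials. *)
Lemma poly2_monosum (p : C -> C -> C) : poly2 p -> is_monosum p.
Proof.
  assert (M : forall c i j, is_monosum (fun t u => c * t ^ i * u ^ j)).
  { intros c i j; exists (fun t u => c * t ^ i * u ^ j + 0); split.
    - apply (monosum_add c i j (fun _ _ => 0)), monosum_0.
    - intros; ring. }
  intros Hp; induction Hp as [c| | |p r _ IHp _ IHr|p r _ IHp _ IHr].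
  - destruct (M c O O) as [s [Hs Es]]; exists s; split; [exact Hs|].
    intros t u; rewrite <- Es; simpl; ring.
  - destruct (M 1 1%nat O) as [s [Hs Es]]; exists s; split; [exact Hs|].
    intros t u; rewrite <- Es; simpl; ring.
  - destruct (M 1 O 1%nat) as [s [Hs Es]]; exists s; split; [exact Hs|].
    intros t u; rewrite <- Es; simpl; ring.
  - apply is_monosum_plus; assumption.
  - apply is_monosum_mult; assumption.
Qed.

Lemma poly2_pow_l (i : nat) : poly2 (fun t _ => t ^ i).
Proof.
  induction i as [|i IH]; simpl; [apply poly2_const|].
  apply (poly2_mult (fun t _ => t) (fun t _ => t ^ i)); [apply poly2_fst|exact IH].
Qed.

Lemma poly2_int (p : C -> C -> C) (a b : R) :
  poly2 p -> exists P, poly2 P /\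
    forall t u, is_CInt (fun x => p t (RtoC x)) a b (P t u).
Proof.
  intros Hp; destruct (poly2_monosum p Hp) as [r [Hr Er]].
  assert (H : exists P, poly2 P /\
    forall t u, is_CInt (fun x => r t (RtoC x)) a b (P t u)).
  { clear Er p Hp; induction Hr as [|c i j r Hr [P [HP HI]]].
    - exists (fun _ _ => 0); split; [apply poly2_const|intros; apply is_CInt_0].
    - pose proof (is_CInt_line_pow 0 1 j a b) as Hj.
      set (l := / INR (S j) * (0 + b * 1) ^ S j - / INR (S j) * (0 + a * 1) ^ S j)
        in Hj.
      exists (fun t u => c * l * t ^ i + P t u); split.
      + apply (poly2_plus (fun t _ => c * l * t ^ i)); [|exact HP].
        apply (poly2_mult (fun _ _ => c * l)); [apply poly2_const|apply poly2_pow_l].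
      + intros t u; apply is_CInt_plus; [|apply HI].
        replace (c * l * t ^ i) with (c * t ^ i * l) by ring.
        eapply (is_RInt_ext (V := C_R_NormedModule)); [|apply is_CInt_scal, Hj].
        intros x _; simpl.
        replace (0 + x * 1) with (RtoC x) by ring; ring. }
  destruct H as [P [HP HI]]; exists P; split; [exact HP|]; intros t u.
  eapply (is_RInt_ext (V := C_R_NormedModule)); [|apply HI].
  intros x _; symmetry; apply Er.
Qed.

(** * Integration preserves uniform approximability *)

(** Functions of one variable are functions of two whose second argument is
    frozen at 0. *)
Definition approx1 (D : C -> Prop) (f : C -> C) : Prop :=
  approx (fun t u => D t /\ u = 0) (fun t _ => f t).

Definition bounded1 (D : C -> Prop) : Prop :=
  exists B, forall t, D t -> (Cmod t <= B)%R.

Lemma bounded1_2 (D : C -> Prop) :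
  bounded1 D -> bounded2 (fun t u => D t /\ u = 0).
Proof.
  intros [B HB]; exists (Rmax B 0); intros t u [Ht ->]; split.
  - eapply Rle_trans; [apply HB, Ht|apply Rmax_l].
  - rewrite Cmod_0; apply Rmax_r.
Qed.

Lemma approx1_ext (D : C -> Prop) (f h : C -> C) :
  (forall t, D t -> f t = h t) -> approx1 D f -> approx1 D h.
Proof. intros H; apply approx_ext; intros t u [Ht _]; auto. Qed.

Lemma approx1_bounded (D : C -> Prop) (f : C -> C) :
  bounded1 D -> approx1 D f ->
  exists B, (0 < B)%R /\ forall t, D t -> (Cmod (f t) <= B)%R.
Proof.
  intros HD Hf.
  destruct (approx_bounded _ _ (bounded1_2 D HD) Hf) as [B [HB H]].
  exists B; split; [exact HB|]; intros t Ht; apply (H t 0); auto.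
Qed.

Lemma approx1_poly (D : C -> Prop) (f : C -> C) :
  approx1 D f -> forall eps, (0 < eps)%R -> exists p, poly2 p /\
    forall t, D t -> (Cmod (f t - p t (RtoC 0)) <= eps)%R.
Proof.
  intros Hf eps He; destruct (Hf eps He) as [p [Hp H]].
  exists p; split; [exact Hp|]; intros t Ht; apply H; auto.
Qed.

Lemma approx1_comp (D : C -> Prop) (f : C -> C) (K : C -> C -> Prop)
    (g : C -> C -> C) :
  bounded2 K -> approx1 D f -> approx K g ->
  (forall t u, K t u -> D (g t u)) -> approx K (fun t u => f (g t u)).
Proof.
  intros HK Hf Hg HD; apply approx_lim; intros eps He.
  destruct (approx1_poly D f Hf eps He) as [p [Hp H]].
  exists (fun t u => p (g t u) (RtoC 0)); split.
  - clear H; induction Hp as [c| | |p r _ IHp _ IHr|p r _ IHp _ IHr].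
    + apply approx_const.
    + exact Hg.
    + apply approx_const.
    + apply approx_plus; assumption.
    + apply approx_mult; assumption.
  - intros t u Htu; apply H, HD, Htu.
Qed.

Lemma approx_comp2 (K' K : C -> C -> Prop) (f g h : C -> C -> C) :
  bounded2 K -> approx K' f -> approx K g -> approx K h ->
  (forall t u, K t u -> K' (g t u) (h t u)) ->
  approx K (fun t u => f (g t u) (h t u)).
Proof.
  intros HK Hf Hg Hh HK'; apply approx_lim; intros eps He.
  destruct (Hf eps He) as [p [Hp H]].
  exists (fun t u => p (g t u) (h t u)); split.
  - clear H; induction Hp as [c| | |p r _ IHp _ IHr|p r _ IHp _ IHr].
    + apply approx_const.
    + exact Hg.
    + exact Hh.
    + apply approx_plus; assumption.
    + apply approx_mult; assumption.
  - intros t u Htu; apply H, HK', Htu.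
Qed.

Lemma approx_slice (K : C -> C -> Prop) (f : C -> C -> C) (D : C -> Prop) (t : C) :
  approx K f -> (forall u, D u -> K t u) -> approx1 D (fun u => f t u).
Proof.
  intros Hf HK eps He; destruct (Hf eps He) as [p [Hp H]].
  exists (fun u _ => p t u); split.
  - clear H; induction Hp as [c| | |p r _ IHp _ IHr|p r _ IHp _ IHr].
    + apply poly2_const.
    + apply poly2_const.
    + apply poly2_fst.
    + apply (poly2_plus _ _ IHp IHr).
    + apply (poly2_mult _ _ IHp IHr).
  - intros u v [Hu _]; apply H, HK, Hu.
Qed.

Lemma approx_is_CInt (K : C -> C -> Prop) (f : C -> C -> C) (a b : R) (t : C) :
  (a <= b)%R -> approx K f ->
  (forall x : R, (a <= x <= b)%R -> K t (RtoC x)) ->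
  is_CInt (fun x => f t (RtoC x)) a b (CInt (fun x => f t (RtoC x)) a b).
Proof.
  intros Hab Hf HK.
  destruct (is_CInt_uniform (fun x => f t (RtoC x)) a b Hab) as [l Hl].
  - intros eps He; destruct (Hf eps He) as [p [Hp H]].
    destruct (poly2_int p a b Hp) as [P [_ HI]].
    exists (fun x => p t (RtoC x)), (P t 0); split; [apply HI|].
    intros x Hx; apply H, HK, Hx.
  - rewrite (is_CInt_unique _ _ _ _ Hl); exact Hl.
Qed.

Lemma approx_int (K : C -> C -> Prop) (f : C -> C -> C) (D : C -> Prop) (a b : R) :
  (a <= b)%R -> approx K f ->
  (forall (t : C) (x : R), D t -> (a <= x <= b)%R -> K t (RtoC x)) ->
  approx1 D (fun t => CInt (fun x => f t (RtoC x)) a b).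
Proof.
  intros Hab Hf HK eps He.
  destruct (Hf (eps / (b - a + 1))%R) as [p [Hp H]].
  { apply Rdiv_lt_0_compat; lra. }
  destruct (poly2_int p a b Hp) as [P [HP HI]].
  exists P; split; [exact HP|]; intros t u [Ht ->].
  eapply Rle_trans.
  - eapply (is_CInt_close (fun x => f t (RtoC x)) (fun x => p t (RtoC x)) a b
      (eps / (b - a + 1))%R); auto.
    + apply (approx_is_CInt K); auto.
  - replace eps with (eps / (b - a + 1) * (b - a + 1))%R at 2 by (field; lra).
    apply Rmult_le_compat_l; [left; apply Rdiv_lt_0_compat; lra|lra].
Qed.

Lemma real_segment_bounded (a b : R) :
  bounded2 (fun t u => t = 0 /\ exists x, (a <= x <= b)%R /\ u = RtoC x).
Proof.
  exists (Rabs a + Rabs b)%R; intros t u [-> [x [Hx ->]]].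
  rewrite Cmod_0, Cmod_R; split.
  - pose proof (Rabs_pos a); pose proof (Rabs_pos b); lra.
  - unfold Rabs; destruct (Rcase_abs x), (Rcase_abs a), (Rcase_abs b); lra.
Qed.

(** * Cauchy theory for uniform limits of polynomials *)

Lemma approx1_line (D : C -> Prop) (h : C -> C) (w v : C) (a b : R) :
  approx1 D h -> (forall x, (a <= x <= b)%R -> D (w + x * v)) ->
  approx (fun t u => t = 0 /\ exists x, (a <= x <= b)%R /\ u = RtoC x)
    (fun _ u => h (w + u * v)).
Proof.
  intros Hh HD.
  pose proof (real_segment_bounded a b) as HK.
  apply approx1_comp with D; auto.
  - apply approx_plus; [apply approx_const|].
    apply approx_mult; auto using approx_snd, approx_const.
  - intros t u [_ [x [Hx ->]]]; auto.
Qed.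

Lemma approx1_is_CInt (D : C -> Prop) (h : C -> C) (w v : C) (a b : R) :
  (a <= b)%R -> approx1 D h -> (forall x, (a <= x <= b)%R -> D (w + x * v)) ->
  is_CInt (fun x => h (w + x * v)) a b (CInt (fun x => h (w + x * v)) a b).
Proof.
  intros Hab Hh HD.
  apply (approx_is_CInt _ (fun _ u => h (w + u * v)) a b 0 Hab
    (approx1_line D h w v a b Hh HD)).
  intros x Hx; split; [reflexivity|exists x; auto].
Qed.

Lemma monosum_parallelogram (r : C -> C -> C) (w v : C) :
  monosum r -> exists A B E F,
    is_CInt (fun x => Ci * r (w + v + x * Ci) 0) (- PI) PI A /\
    is_CInt (fun x => Ci * r (w + x * Ci) 0) (- PI) PI B /\
    is_CInt (fun x => v * r (w + PI * Ci + x * v) 0) 0 1 E /\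
    is_CInt (fun x => v * r (w - PI * Ci + x * v) 0) 0 1 F /\
    A - B = E - F.
Proof.
  intros Hr; induction Hr as [|c i j r Hr [A [B [E [F [HA [HB [HE [HF Heq]]]]]]]]].
  - exists (RtoC 0), (RtoC 0), (RtoC 0), (RtoC 0).
    assert (Z : forall z a b, is_CInt (fun _ : R => z * 0) a b (RtoC 0)).
    { intros z a b; replace (z * 0) with (RtoC 0) by ring; apply is_CInt_0. }
    repeat split; auto; ring.
  - pose proof (is_CInt_line_pow (w + v) Ci i (- PI) PI) as L1.
    pose proof (is_CInt_line_pow w Ci i (- PI) PI) as L2.
    pose proof (is_CInt_line_pow (w + PI * Ci) v i 0 1) as L3.
    pose proof (is_CInt_line_pow (w - PI * Ci) v i 0 1) as L4.
    set (k := c * 0 ^ j).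
    assert (M : forall z w v l a b, is_CInt (fun x : R => z * (w + x * v) ^ i) a b l ->
      forall m, is_CInt (fun x => z * r (w + x * v) 0) a b m ->
      is_CInt (fun x => z * (c * (w + x * v) ^ i * 0 ^ j + r (w + x * v) 0)) a b
        (k * l + m)).
    { intros z w0 v0 l a b Hl m Hm.
      eapply (is_RInt_ext (V := C_R_NormedModule));
        [|apply is_CInt_plus; [apply is_CInt_scal, Hl|apply Hm]].
      intros x _; simpl; unfold k; ring. }
    do 4 eexists; split; [|split; [|split; [|split]]].
    1-4: apply M; eassumption.
    match goal with |- k * ?l1 + A - (k * ?l2 + B) = k * ?l3 + E - (k * ?l4 + F) =>
      replace (k * l1 + A - (k * l2 + B)) with (k * (l1 - l2) + (A - B)) by ring;
      replace (k * l3 + E - (k * l4 + F)) with (k * (l3 - l4) + (E - F)) by ring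
    end.
    rewrite Heq; f_equal; f_equal.
    rewrite RtoC_opp.
    replace (w + PI * Ci + 1 * v) with (w + v + PI * Ci) by ring.
    replace (w - PI * Ci + 1 * v) with (w + v + - PI * Ci) by ring.
    replace (w + PI * Ci + 0 * v) with (w + PI * Ci) by ring.
    replace (w - PI * Ci + 0 * v) with (w + - PI * Ci) by ring.
    ring.
Qed.

(** Polynomials have primitives, so their integral over a closed polygon
    vanishes, and this passes to uniform limits. *)
Lemma cauchy_parallelogram (D : C -> Prop) (h : C -> C) (w v : C) :
  approx1 D h ->
  (forall x y, (0 <= x <= 1)%R -> (- PI <= y <= PI)%R -> D (w + x * v + y * Ci)) ->
  Ci * (CInt (fun x => h (w + v + x * Ci)) (- PI) PI
        - CInt (fun x => h (w + x * Ci)) (- PI) PI) =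
  v * (CInt (fun x => h (w + PI * Ci + x * v)) 0 1
       - CInt (fun x => h (w - PI * Ci + x * v)) 0 1).
Proof.
  intros Hh HD; pose proof PI_RGT_0 as Hpi.
  assert (D1 : forall x, (- PI <= x <= PI)%R -> D (w + v + x * Ci)).
  { intros x Hx; replace (w + v + x * Ci) with (w + 1%R * v + x * Ci) by ring.
    apply HD; lra. }
  assert (D2 : forall x, (- PI <= x <= PI)%R -> D (w + x * Ci)).
  { intros x Hx; replace (w + x * Ci) with (w + 0%R * v + x * Ci) by ring.
    apply HD; lra. }
  assert (D3 : forall x, (0 <= x <= 1)%R -> D (w + PI * Ci + x * v)).
  { intros x Hx; replace (w + PI * Ci + x * v) with (w + x * v + PI * Ci) by ring.
    apply HD; lra. }
  assert (D4 : forall x, (0 <= x <= 1)%R -> D (w - PI * Ci + x * v)).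
  { intros x Hx.
    replace (w - PI * Ci + x * v) with (w + x * v + (- PI)%R * Ci)
      by (rewrite RtoC_opp; ring).
    apply HD; lra. }
  pose proof (approx1_is_CInt D h (w + v) Ci (- PI) PI ltac:(lra) Hh D1) as I1.
  pose proof (approx1_is_CInt D h w Ci (- PI) PI ltac:(lra) Hh D2) as I2.
  pose proof (approx1_is_CInt D h (w + PI * Ci) v 0 1 ltac:(lra) Hh D3) as I3.
  pose proof (approx1_is_CInt D h (w - PI * Ci) v 0 1 ltac:(lra) Hh D4) as I4.
  set (A := CInt (fun x => h (w + v + x * Ci)) (- PI) PI) in *.
  set (B := CInt (fun x => h (w + x * Ci)) (- PI) PI) in *.
  set (E := CInt (fun x => h (w + PI * Ci + x * v)) 0 1) in *.
  set (F := CInt (fun x => h (w - PI * Ci + x * v)) 0 1) in *.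
  set (X := Ci * (A - B) - v * (E - F)).
  assert (HX : forall eps, (0 < eps)%R -> (Cmod X <= eps * (4 * PI + 2 * Cmod v))%R).
  { intros eps He; destruct (approx1_poly D h Hh eps He) as [p [Hp H]].
    destruct (poly2_monosum p Hp) as [r [Hr Er]].
    destruct (monosum_parallelogram r w v Hr)
      as [A' [B' [E' [F' [HA [HB [HE [HF Heq]]]]]]]].
    assert (M : forall z w0 v0 a b I I', (a <= b)%R ->
      (forall x, (a <= x <= b)%R -> D (w0 + x * v0)) ->
      is_CInt (fun x : R => h (w0 + x * v0)) a b I ->
      is_CInt (fun x => z * r (w0 + x * v0) 0) a b I' ->
      (Cmod (z * I - I') <= Cmod z * eps * (b - a))%R).
    { intros z w0 v0 a b I I' Hab HD0 HI HI'.
      eapply is_CInt_close; [exact Hab|apply is_CInt_scal, HI|exact HI'|].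
      intros x Hx; cbv beta.
      replace (z * h (w0 + x * v0) - z * r (w0 + x * v0) 0)
        with (z * (h (w0 + x * v0) - r (w0 + x * v0) 0)) by ring.
      rewrite Cmod_mult; apply Rmult_le_compat_l; [apply Cmod_ge_0|].
      rewrite <- Er; apply H; auto. }
    assert (Hle1 : (- PI <= PI)%R) by lra.
    assert (Hle2 : (0 <= 1)%R) by lra.
    pose proof (M _ _ _ _ _ _ _ Hle1 D1 I1 HA) as N1.
    pose proof (M _ _ _ _ _ _ _ Hle1 D2 I2 HB) as N2.
    pose proof (M _ _ _ _ _ _ _ Hle2 D3 I3 HE) as N3.
    pose proof (M _ _ _ _ _ _ _ Hle2 D4 I4 HF) as N4.
    rewrite Cmod_Ci in N1, N2.
    replace X with (((Ci * A - A') - (Ci * B - B')) - ((v * E - E') - (v * F - F'))).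
    - eapply Rle_trans; [apply Cmod_triangle|]; rewrite Cmod_opp.
      eapply Rle_trans; [apply Rplus_le_compat; apply Cmod_triangle|].
      rewrite !Cmod_opp; lra.
    - transitivity (X - ((A' - B') - (E' - F'))); [unfold X; ring|].
      rewrite Heq; ring. }
  assert (HX0 : X = 0).
  { apply Cmod_eq_0; apply Rle_antisym; [|apply Cmod_ge_0].
    apply Rnot_lt_le; intros Hlt.
    set (k := (4 * PI + 2 * Cmod v)%R) in *.
    assert (Hk : (0 < k)%R) by (unfold k; pose proof (Cmod_ge_0 v); lra).
    specialize (HX (Cmod X / 2 / k)%R ltac:(repeat apply Rdiv_lt_0_compat; lra)).
    replace (Cmod X / 2 / k * k)%R with (Cmod X / 2)%R in HX by (field; lra).
    lra. }
  replace (v * (E - F)) with (Ci * (A - B) - X) by (unfold X; ring).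
  rewrite HX0; ring.
Qed.

(** * Taylor coefficients *)

Definition disc (x : C) (r : R) (t : C) : Prop := (Cmod (t - x) <= r)%R.

Lemma disc_bounded (x : C) (r : R) : bounded1 (disc x r).
Proof.
  exists (Cmod x + r)%R; intros t Ht; unfold disc in Ht.
  pose proof (Cmod_triangle_inv t x); lra.
Qed.

Lemma disc_center (t0 : C) (r : R) : (0 <= r)%R -> disc t0 r t0.
Proof.
  intros Hr; unfold disc; replace (t0 - t0) with (RtoC 0) by ring.
  rewrite Cmod_0; exact Hr.
Qed.

(** Cauchy's formula for the Taylor coefficients at 0, over the circle of
    radius [r]. *)
Definition circle_coef (d : C -> C) (r : R) (n : nat) : C :=
  / (2 * PI * r ^ n) *
  CInt (fun x => d (r * Cexp (Ci * x)) * Cexp (- (Ci * x)) ^ n) (- PI) PI.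

Lemma Cmod_Cexp_imag (x : R) : Cmod (Cexp (Ci * x)) = 1%R.
Proof.
  rewrite Cmod_Cexp.
  replace (Re (Ci * x)) with 0%R by (unfold Re; simpl; ring); apply exp_0.
Qed.

Lemma disc_circle (r x : R) : (0 <= r)%R -> disc 0 r (r * Cexp (Ci * x)).
Proof.
  intros Hr; unfold disc.
  replace (r * Cexp (Ci * x) - 0) with (r * Cexp (Ci * x)) by ring.
  rewrite Cmod_mult, Cmod_Cexp_imag, Cmod_R, Rabs_pos_eq; lra.
Qed.

Lemma circle_coef_is_CInt (d : C -> C) (r : R) (n : nat) :
  (0 <= r)%R -> approx1 (disc 0 r) d ->
  is_CInt (fun x => d (r * Cexp (Ci * x)) * Cexp (- (Ci * x)) ^ n) (- PI) PI
    (CInt (fun x => d (r * Cexp (Ci * x)) * Cexp (- (Ci * x)) ^ n) (- PI) PI).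
Proof.
  intros Hr Hd; pose proof PI_RGT_0 as Hpi.
  pose proof (real_segment_bounded (- PI) PI) as HK.
  apply (approx_is_CInt
    (fun t u => t = 0 /\ exists x, (- PI <= x <= PI)%R /\ u = RtoC x)
    (fun _ u => d (r * Cexp (Ci * u)) * Cexp (- (Ci * u)) ^ n) (- PI) PI 0).
  - lra.
  - apply approx_mult; [exact HK| |].
    + apply approx1_comp with (disc 0 r); auto.
      * apply approx_scal, approx_Cexp, approx_scal; auto using approx_snd.
      * intros t u [_ [x [_ ->]]]; apply disc_circle, Hr.
    + apply approx_pow, approx_Cexp; auto.
      apply approx_ext with (fun _ u => - Ci * u); [intros; ring|].
      apply approx_scal; auto using approx_snd.
  - intros x Hx; split; [reflexivity|exists x; auto].
Qed.

Lemma circle_coef_scal (c : C) (d : C -> C) (r : R) (n : nat) :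
  (0 <= r)%R -> approx1 (disc 0 r) d ->
  circle_coef (fun v => c * d v) r n = c * circle_coef d r n.
Proof.
  intros Hr Hd; unfold circle_coef.
  pose proof (circle_coef_is_CInt d r n Hr Hd) as HI.
  rewrite (is_CInt_unique _ _ _ (c * CInt (fun x => d (r * Cexp (Ci * x)) *
    Cexp (- (Ci * x)) ^ n) (- PI) PI)); [ring|].
  eapply (is_RInt_ext (V := C_R_NormedModule)); [|apply is_CInt_scal, HI].
  intros x _; cbv beta; match goal with |- ?a = ?b => change (@eq C a b) end; ring.
Qed.

Lemma circle_coef_plus (d e : C -> C) (r : R) (n : nat) :
  (0 <= r)%R -> approx1 (disc 0 r) d -> approx1 (disc 0 r) e ->
  circle_coef (fun v => d v + e v) r n = circle_coef d r n + circle_coef e r n.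
Proof.
  intros Hr Hd He; unfold circle_coef.
  pose proof (circle_coef_is_CInt d r n Hr Hd) as HI.
  pose proof (circle_coef_is_CInt e r n Hr He) as HJ.
  rewrite (is_CInt_unique _ _ _ _
    (is_RInt_ext (V := C_R_NormedModule) _
      (fun x => (d (r * Cexp (Ci * x)) + e (r * Cexp (Ci * x))) *
        Cexp (- (Ci * x)) ^ n) _ _ _
      ltac:(intros x _; cbv beta; match goal with |- ?a = ?b => change (@eq C a b) end;
        symmetry; apply Cmult_plus_distr_r)
      (is_CInt_plus _ _ _ _ _ _ HI HJ))).
  apply Cmult_plus_distr_l.
Qed.

Lemma circle_coef_ext (d e : C -> C) (n : nat) :
  (forall v, Cmod v = 1%R -> d v = e v) -> circle_coef d 1 n = circle_coef e 1 n.
Proof.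
  intros H; unfold circle_coef; f_equal; f_equal.
  apply functional_extensionality; intros x; f_equal; apply H.
  rewrite Cmult_1_l; apply Cmod_Cexp_imag.
Qed.

Lemma circle_coef_close (d p : C -> C) (r eps : R) (n : nat) :
  (0 < r)%R -> approx1 (disc 0 r) d -> approx1 (disc 0 r) p ->
  (forall t, disc 0 r t -> (Cmod (d t - p t) <= eps)%R) ->
  (Cmod (circle_coef d r n - circle_coef p r n) <= eps / r ^ n)%R.
Proof.
  intros Hr Hd Hp H; pose proof PI_RGT_0 as Hpi.
  pose proof (circle_coef_is_CInt d r n ltac:(lra) Hd) as I1.
  pose proof (circle_coef_is_CInt p r n ltac:(lra) Hp) as I2.
  unfold circle_coef.
  match goal with |- (Cmod (?k * ?l - ?k * ?m) <= _)%R =>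
    replace (k * l - k * m) with (k * (l - m)) by ring;
    assert (Hlm : (Cmod (l - m) <= eps * (PI - - PI))%R)
  end.
  { eapply is_CInt_close; [|exact I1|exact I2|]; [lra|].
    intros x _; cbv beta.
    match goal with |- (Cmod (?a * ?c - ?b * ?c) <= _)%R =>
      replace (a * c - b * c) with ((a - b) * c) by ring end.
    rewrite Cmod_mult, Cmod_pow.
    replace (- (Ci * x)) with (Ci * (- x)%R) by (rewrite RtoC_opp; ring).
    rewrite Cmod_Cexp_imag, pow1, Rmult_1_r.
    apply H, disc_circle; lra. }
  assert (Hrn : (0 < r ^ n)%R) by (apply pow_lt, Hr).
  assert (E : 2 * PI * r ^ n = RtoC (2 * PI * r ^ n)%R).
  { rewrite !RtoC_mult, RtoC_pow; reflexivity. }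
  rewrite E, Cmod_mult, Cmod_inv, Cmod_R, Rabs_pos_eq
    by (try apply RtoC_neq_0; nra).
  replace (eps / r ^ n)%R with (/ (2 * PI * r ^ n) * (eps * (PI - - PI)))%R
    by (field; lra).
  apply Rmult_le_compat_l; [left; apply Rinv_0_lt_compat; nra|exact Hlm].
Qed.

Lemma circle_coef_poly (d : C -> C) (c : nat -> C) (r : R) (M n : nat) :
  (0 < r)%R ->
  (forall t, d t = Csum (fun k => c k * t ^ k) M) ->
  circle_coef d r n = if lt_dec n M then c n else 0.
Proof.
  intros Hr Hd; pose proof PI_RGT_0 as Hpi; unfold circle_coef.
  assert (Hrn : RtoC r ^ n <> 0) by (apply Cpow_nz, RtoC_neq_0; lra).
  assert (HpiC : RtoC PI <> 0) by (apply RtoC_neq_0; lra).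
  rewrite (is_CInt_unique _ _ _ (2 * PI * r ^ n * (if lt_dec n M then c n else 0))).
  - field; auto.
  - replace (2 * PI * r ^ n * (if lt_dec n M then c n else 0))
      with (Csum (fun k => c k * r ^ k *
              (if Nat.eq_dec k n then RtoC (2 * PI)%R else RtoC 0)) M).
    + eapply (is_RInt_ext (V := C_R_NormedModule)); [|apply is_CInt_Csum].
      * intros x _; simpl; symmetry; rewrite Hd, Cmult_comm.
        etransitivity; [symmetry; apply Csum_scal|].
        apply Csum_ext; intros k _; rewrite Cpow_mult_l.
        instantiate (1 := fun k x => c k * r ^ k *
          (Cexp (Ci * x) ^ k * Cexp (- (Ci * x)) ^ n)).
        cbv beta; ring.
      * intros k _; apply is_CInt_scal, is_CInt_circle.
    + clear Hd; induction M as [|M IH]; simpl.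
      * destruct (lt_dec n 0); [lia|ring].
      * rewrite IH, RtoC_mult; destruct (Nat.eq_dec M n) as [E|Hne];
          destruct (lt_dec n M), (lt_dec n (S M)); try lia; try ring.
        subst M; ring.
Qed.

Lemma circle_coef_sum (d : nat -> C -> C) (r : R) (n M : nat) :
  (0 < r)%R -> (forall i, (i < M)%nat -> approx1 (disc 0 r) (d i)) ->
  circle_coef (fun v => Csum (fun i => d i v) M) r n =
  Csum (fun i => circle_coef (d i) r n) M.
Proof.
  intros Hr; induction M as [|M IH]; intros Hd; simpl.
  - rewrite (circle_coef_poly _ (fun _ => 0) r O) by auto; reflexivity.
  - rewrite (circle_coef_plus (fun v => Csum (fun i => d i v) M) (d M)).
    + rewrite IH by (intros; apply Hd; lia); reflexivity.
    + lra.
    + apply (approx_Csum _ (fun i v _ => d i v)); intros i Hi; apply Hd; lia.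
    + apply Hd; lia.
Qed.

Lemma poly2_coefs (p : C -> C -> C) :
  poly2 p -> exists c M, forall m t, (M <= m)%nat ->
    p t (RtoC 0) = Csum (fun k => c k * t ^ k) m.
Proof.
  intros Hp; destruct (poly2_monosum p Hp) as [r [Hr Er]].
  assert (H : exists c M, forall m t, (M <= m)%nat ->
    r t (RtoC 0) = Csum (fun k => c k * t ^ k) m).
  { clear Er p Hp; induction Hr as [|a i j r Hr [c [M H]]].
    - exists (fun _ => 0), O; intros m t _.
      rewrite (Csum_ext _ (fun _ => 0)) by (intros; ring).
      rewrite Csum_0; reflexivity.
    - exists (fun k => (if Nat.eq_dec k i then a * 0 ^ j else 0) + c k), (max M (S i)).
      intros m t Hm; rewrite (H m t) by lia.
      rewrite (Csum_ext (fun k => ((if Nat.eq_dec k i then a * 0 ^ j else 0) + c k) * t ^ k)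
        (fun k => (if Nat.eq_dec k i then a * 0 ^ j * t ^ k else 0) + c k * t ^ k))
        by (intros k _; destruct (Nat.eq_dec k i); ring).
      rewrite Csum_plus; f_equal.
      assert (Hi : (i < m)%nat) by lia; clear -Hi.
      induction m as [|m IH]; [lia|]; simpl.
      destruct (Nat.eq_dec m i) as [->|Hne].
      + rewrite (Csum_ext _ (fun _ => 0)), Csum_0; [ring|].
        intros k Hk; destruct (Nat.eq_dec k i); [lia|reflexivity].
      + rewrite <- IH by lia; ring. }
  destruct H as [c [M H]]; exists c, M; intros m t Hm; rewrite Er; auto.
Qed.

(** The properties of [circle_coef] below hold for polynomials by
    orthogonality of the exponentials, and pass to uniform limits; this is
    the approximation used in each proof. *)
Lemma approx1_disc_poly (d : C -> C) (r eps : R) :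
  approx1 (disc 0 r) d -> (0 < eps)%R ->
  exists p c M, approx1 (disc 0 r) p /\
    (forall t, disc 0 r t -> (Cmod (d t - p t) <= eps)%R) /\
    forall m t, (M <= m)%nat -> p t = Csum (fun k => c k * t ^ k) m.
Proof.
  intros Hd He; destruct (approx1_poly _ _ Hd eps He) as [p [Hp H]].
  destruct (poly2_coefs p Hp) as [c [M Hc]].
  exists (fun t => p t (RtoC 0)), c, M; split; [|split; auto].
  apply approx_ext with p; [intros t u [_ ->]; reflexivity|].
  apply approx_poly2, Hp.
Qed.

Lemma Ceq_small (a b : C) (A : R) :
  (forall eps, (0 < eps)%R -> (Cmod (a - b) <= A * eps)%R) -> a = b.
Proof.
  intros H.
  assert (E : a - b = 0).
  { apply Cmod_eq_0, Rle_antisym; [|apply Cmod_ge_0].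
    apply Rnot_lt_le; intros Hlt.
    pose proof (Rabs_pos A); pose proof (Rle_abs A).
    specialize (H (Cmod (a - b) / 2 / (Rabs A + 1))%R
      ltac:(repeat apply Rdiv_lt_0_compat; lra)).
    set (e := (Cmod (a - b) / 2 / (Rabs A + 1))%R) in *.
    assert (He : ((Rabs A + 1) * e = Cmod (a - b) / 2)%R) by (unfold e; field; lra).
    assert (0 < e)%R by (unfold e; repeat apply Rdiv_lt_0_compat; lra).
    nra. }
  replace a with (a - b + b) by ring; rewrite E; ring.
Qed.

Lemma circle_coef_radius (d : C -> C) (r1 r2 : R) (n : nat) :
  (0 < r1 <= r2)%R -> approx1 (disc 0 r2) d ->
  circle_coef d r1 n = circle_coef d r2 n.
Proof.
  intros Hr Hd; apply (Ceq_small _ _ (/ r1 ^ n + / r2 ^ n)); intros eps He.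
  destruct (approx1_disc_poly d r2 eps Hd He) as [p [c [M [Hp [H Hc]]]]].
  assert (S : forall f, approx1 (disc 0 r2) f -> approx1 (disc 0 r1) f).
  { intros f; apply approx_subset; intros t u [Ht Hu]; split; [|exact Hu].
    unfold disc in *; lra. }
  pose proof (circle_coef_close d p r1 eps n ltac:(lra) (S _ Hd) (S _ Hp)) as H1.
  pose proof (circle_coef_close d p r2 eps n ltac:(lra) Hd Hp H) as H2.
  assert (E : circle_coef p r1 n = circle_coef p r2 n).
  { rewrite !(circle_coef_poly p c _ M) by (lra || auto); reflexivity. }
  replace (circle_coef d r1 n - circle_coef d r2 n) with
    ((circle_coef d r1 n - circle_coef p r1 n)
     - (circle_coef d r2 n - circle_coef p r2 n)) by (rewrite E; ring).
  eapply Rle_trans; [apply Cmod_triangle|]; rewrite Cmod_opp.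
  assert (H1' := H1 ltac:(intros t Ht; apply H; unfold disc in *; lra)).
  unfold Rdiv in *; lra.
Qed.

Lemma circle_coef_bound (d : C -> C) (r B : R) (n : nat) :
  (0 < r)%R -> approx1 (disc 0 r) d ->
  (forall t, disc 0 r t -> (Cmod (d t) <= B)%R) ->
  (Cmod (circle_coef d r n) <= B / r ^ n)%R.
Proof.
  intros Hr Hd HB.
  assert (E : circle_coef (fun _ => 0) r n = 0).
  { rewrite (circle_coef_poly _ (fun _ => 0) r O); auto. }
  replace (circle_coef d r n) with (circle_coef d r n - circle_coef (fun _ => 0) r n)
    by (rewrite E; ring).
  apply circle_coef_close; auto using approx_const.
  - apply (approx_const _ 0).
  - intros t Ht; replace (d t - 0) with (d t) by ring; auto.
Qed.

Lemma Csum_mult_pow (c : nat -> C) (k M : nat) (t : C) :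
  t ^ k * Csum (fun j => c j * t ^ j) M =
  Csum (fun j => (if lt_dec j k then 0 else c (j - k)%nat) * t ^ j) (k + M).
Proof.
  induction M as [|M IH].
  - transitivity (RtoC 0); [simpl; ring|]; symmetry.
    rewrite Nat.add_0_r, (Csum_ext _ (fun _ => 0)), Csum_0; [reflexivity|].
    intros j Hj; destruct (lt_dec j k); [ring|lia].
  - rewrite Nat.add_succ_r; simpl; rewrite <- IH.
    destruct (lt_dec (k + M) k); [lia|].
    replace (k + M - k)%nat with M by lia; rewrite Cpow_add_r; ring.
Qed.

Lemma approx1_disc_pow_mult (d : C -> C) (r : R) (k : nat) :
  approx1 (disc 0 r) d -> approx1 (disc 0 r) (fun t => t ^ k * d t).
Proof.
  intros Hd; pose proof (bounded1_2 _ (disc_bounded 0 r)) as HK.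
  apply approx_mult; auto.
  apply approx_pow; auto using approx_fst.
Qed.

(** Coefficients are compared after polynomial approximation, where
    multiplication by [t ^ k] shifts the list of coefficients. *)
Lemma circle_coef_shift (d : C -> C) (r : R) (k n : nat) :
  (0 < r)%R -> approx1 (disc 0 r) d ->
  circle_coef (fun t => t ^ k * d t) r n =
  if lt_dec n k then 0 else circle_coef d r (n - k).
Proof.
  intros Hr Hd.
  apply (Ceq_small _ _ (r ^ k / r ^ n + / r ^ (n - k))); intros eps He.
  destruct (approx1_disc_poly d r eps Hd He) as [p [c [M [Hp [H Hc]]]]].
  pose proof (circle_coef_close (fun t => t ^ k * d t) (fun t => t ^ k * p t) r
    (r ^ k * eps) n Hr (approx1_disc_pow_mult d r k Hd)
    (approx1_disc_pow_mult p r k Hp)) as H1.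
  pose proof (circle_coef_close d p r eps (n - k) Hr Hd Hp H) as H2.
  assert (E : circle_coef (fun t => t ^ k * p t) r n =
    if lt_dec n k then 0 else circle_coef p r (n - k)).
  { rewrite (circle_coef_poly _
      (fun j => if lt_dec j k then 0 else c (j - k)%nat) r (k + M)); auto.
    - rewrite (circle_coef_poly p c r M) by auto.
      destruct (lt_dec n k), (lt_dec n (k + M)), (lt_dec (n - k) M);
        try reflexivity; lia.
    - intros t; rewrite <- Csum_mult_pow, <- Hc by auto; reflexivity. }
  assert (P1 : (0 < / r ^ (n - k))%R) by (apply Rinv_0_lt_compat, pow_lt, Hr).
  assert (H1' : (Cmod (circle_coef (fun t => t ^ k * d t)%C r n -
    circle_coef (fun t => t ^ k * p t)%C r n) <= r ^ k * eps / r ^ n)%R).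
  { apply H1; intros t Ht.
    replace (t ^ k * d t - t ^ k * p t) with (t ^ k * (d t - p t)) by ring.
    rewrite Cmod_mult, Cmod_pow; apply Rmult_le_compat; auto using Cmod_ge_0.
    - apply pow_le, Cmod_ge_0.
    - apply pow_incr; split; [apply Cmod_ge_0|].
      unfold disc in Ht; replace (t - 0) with t in Ht by ring; exact Ht. }
  rewrite E in H1'.
  destruct (lt_dec n k) as [Hl|Hl].
  - eapply Rle_trans; [exact H1'|]; unfold Rdiv; nra.
  - replace (circle_coef (fun t => t ^ k * d t) r n - circle_coef d r (n - k))
      with ((circle_coef (fun t => t ^ k * d t) r n - circle_coef p r (n - k))
        - (circle_coef d r (n - k) - circle_coef p r (n - k))) by ring.
    eapply Rle_trans; [apply Cmod_triangle|]; rewrite Cmod_opp.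
    unfold Rdiv in *; lra.
Qed.

(** For a polynomial the remainder is a tail of its own expansion, which
    Cauchy's estimate bounds by a geometric series. A failure of the bound
    for [d] would leave room for an approximation error, so it would already
    occur for a polynomial. *)
Lemma taylor_remainder (d : C -> C) (r B : R) (y : C) (m : nat) :
  (0 < r)%R -> approx1 (disc 0 r) d ->
  (forall t, disc 0 r t -> (Cmod (d t) <= B)%R) -> (Cmod y < r)%R ->
  (Cmod (d y - Csum (fun k => circle_coef d r k * y ^ k)%C m) <=
   B / (1 - Cmod y / r) * (Cmod y / r) ^ m)%R.
Proof.
  intros Hr Hd HB Hy.
  set (X := (Cmod y / r)%R).
  assert (HX : (0 <= X < 1)%R).
  { unfold X; split.
    - apply Rmult_le_pos; [apply Cmod_ge_0|left; apply Rinv_0_lt_compat, Hr].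
    - apply Rmult_lt_reg_r with r; [exact Hr|].
      unfold Rdiv; rewrite Rmult_assoc, Rinv_l; lra. }
  assert (HXk : forall k, (0 <= X ^ k <= 1)%R).
  { intros k; apply pow_unit; lra. }
  assert (Hyk : forall k, (/ r ^ k * Cmod (y ^ k) = X ^ k)%R).
  { intros k; unfold X, Rdiv; rewrite Rpow_mult_distr, Cmod_pow, pow_inv; ring. }
  assert (Hyd : disc 0 r y).
  { unfold disc; replace (y - 0) with y by ring; lra. }
  apply Rnot_lt_le; intros Hlt.
  set (G := (B / (1 - X) * X ^ m)%R) in *.
  set (T := d y - Csum (fun k => circle_coef d r k * y ^ k) m) in *.
  set (A := (1 + INR m + / (1 - X))%R).
  assert (HA : (0 < A)%R).
  { unfold A; pose proof (pos_INR m).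
    assert (0 < / (1 - X))%R by (apply Rinv_0_lt_compat; lra); lra. }
  set (eps := ((Cmod T - G) / 2 / A)%R).
  assert (He : (0 < eps)%R) by (unfold eps; repeat apply Rdiv_lt_0_compat; lra).
  destruct (approx1_disc_poly d r eps Hd He) as [p [c [M [Hp [H Hc]]]]].
  assert (Hpc : forall k, (k < max M m)%nat -> circle_coef p r k = c k).
  { intros k Hk; rewrite (circle_coef_poly p c r (max M m)) by (auto; intros; apply Hc; lia).
    destruct (lt_dec k (max M m)); [reflexivity|lia]. }
  assert (HpB : forall t, disc 0 r t -> (Cmod (p t) <= B + eps)%R).
  { intros t Ht; specialize (H t Ht); specialize (HB t Ht).
    rewrite Cmod_minus_sym in H; pose proof (Cmod_triangle_inv (p t) (d t)); lra. }
  assert (N1 : (Cmod (p y - Csum (fun k => circle_coef p r k * y ^ k)%C m) <=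
    (B + eps) / (1 - X) * X ^ m)%R).
  { rewrite (Hc (max M m) y) by lia.
    rewrite (Csum_ext (fun k => c k * y ^ k) (fun k => circle_coef p r k * y ^ k))
      by (intros k Hk; rewrite Hpc; auto).
    replace (max M m) with (m + (max M m - m))%nat by lia.
    eapply Rle_trans; [apply (geom_sum_bound _ (B + eps) X)|].
    - exact HX.
    - intros k; rewrite Cmod_mult, <- Hyk, <- Rmult_assoc.
      apply Rmult_le_compat_r; [apply Cmod_ge_0|].
      apply circle_coef_bound; auto.
    - assert (0 <= B + eps)%R by (eapply Rle_trans; [apply Cmod_ge_0|apply (HpB y Hyd)]).
      apply Rmult_le_compat_l.
      + apply Rmult_le_pos; [lra|left; apply Rinv_0_lt_compat; lra].
      + pose proof (HXk (m + (max M m - m))%nat); lra. }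
  assert (N2 : (Cmod (Csum (fun k => circle_coef p r k * y ^ k)%C m
      - Csum (fun k => circle_coef d r k * y ^ k)%C m) <= INR m * eps)%R).
  { clear N1 Hlt; clearbody eps; clear T A HA; induction m as [|m IH].
    - simpl; replace (0 - 0) with (RtoC 0) by ring; rewrite Cmod_0; lra.
    - rewrite S_INR; simpl Csum.
      match goal with |- (Cmod (?a + ?x * ?z - (?b + ?w * ?z)) <= _)%R =>
        replace (a + x * z - (b + w * z)) with ((a - b) + (x - w) * z) by ring end.
      eapply Rle_trans; [apply Cmod_triangle|].
      assert (IH' := IH ltac:(intros k Hk; apply Hpc; lia)).
      assert ((Cmod ((circle_coef p r m - circle_coef d r m) * y ^ m) <= eps)%R).
      { rewrite Cmod_mult, Cmod_minus_sym.
        pose proof (circle_coef_close d p r eps m Hr Hd Hp H) as Hcl.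
        apply Rle_trans with (eps / r ^ m * Cmod (y ^ m))%R.
        - apply Rmult_le_compat_r; [apply Cmod_ge_0|exact Hcl].
        - unfold Rdiv; rewrite Rmult_assoc, Hyk; pose proof (HXk m); nra. }
      lra. }
  assert (N : (Cmod T <= eps + INR m * eps + (B + eps) / (1 - X) * X ^ m)%R).
  { unfold T.
    replace (d y - Csum (fun k => circle_coef d r k * y ^ k) m) with
      ((d y - p y) + (Csum (fun k => circle_coef p r k * y ^ k) m
      - Csum (fun k => circle_coef d r k * y ^ k) m)
      + (p y - Csum (fun k => circle_coef p r k * y ^ k) m)) by ring.
    eapply Rle_trans; [apply Cmod_triangle|].
    apply Rplus_le_compat; [|exact N1].
    eapply Rle_trans; [apply Cmod_triangle|].
    apply Rplus_le_compat; [apply H, Hyd|exact N2]. }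
  assert (N' : (eps + INR m * eps + (B + eps) / (1 - X) * X ^ m <= A * eps + G)%R).
  { unfold G, A, Rdiv; pose proof (HXk m).
    assert (0 < / (1 - X))%R by (apply Rinv_0_lt_compat; lra).
    assert (eps * / (1 - X) * X ^ m <= eps * / (1 - X))%R.
    { rewrite <- (Rmult_1_r (eps * / (1 - X))) at 2.
      apply Rmult_le_compat_l; [nra|lra]. }
    nra. }
  assert (A * eps = (Cmod T - G) / 2)%R by (unfold eps; field; lra).
  lra.
Qed.

(** Near 0 the first nonzero Taylor term dominates the remainder; if there
    is none, the expansion is 0. *)
Lemma isolated_zeros_0 (d : C -> C) (r : R) :
  (0 < r)%R -> approx1 (disc 0 r) d ->
  (forall t, (Cmod t < r)%R -> d t = 0) \/
  exists r', (0 < r' <= r)%R /\ forall t, (0 < Cmod t < r')%R -> d t <> 0.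
Proof.
  intros Hr Hd.
  destruct (approx1_bounded _ _ (disc_bounded 0 r) Hd) as [B [HB0 HB]].
  destruct (classic (exists n, circle_coef d r n <> 0)) as [Hex|Hno].
  - right.
    destruct (dec_inh_nat_subset_has_unique_least_element
      (fun n => circle_coef d r n <> 0)) as [n [[Hn Hmin] _]].
    { intros k; apply classic. }
    { exact Hex. }
    set (c := circle_coef d r n) in *.
    assert (Hc : (0 < Cmod c)%R) by (apply Cmod_gt_0, Hn).
    assert (Hrn : (0 < r ^ n)%R) by (apply pow_lt, Hr).
    set (s := (Cmod c * r ^ n / (2 * B))%R).
    assert (Hs : (0 < s)%R) by (unfold s; apply Rdiv_lt_0_compat; nra).
    exists (r * Rmin (/ 2) s)%R.
    pose proof (Rmin_l (/ 2) s) as M1; pose proof (Rmin_r (/ 2) s) as M2.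
    assert (M0 : (0 < Rmin (/ 2) s)%R) by (apply Rmin_pos; lra).
    split; [split; nra|].
    intros t [Ht0 Ht] E.
    set (X := (Cmod t / r)%R).
    assert (HtX : (Cmod t = r * X)%R) by (unfold X; field; lra).
    assert (HX : (0 < X < Rmin (/ 2) s)%R).
    { split; [unfold X; apply Rdiv_lt_0_compat; lra|].
      apply Rmult_lt_reg_l with r; [exact Hr|]; lra. }
    pose proof (taylor_remainder d r B t (S n) Hr Hd HB ltac:(nra)) as T.
    fold X in T; rewrite E in T.
    assert (S0 : Csum (fun k => circle_coef d r k * t ^ k) (S n) = c * t ^ n).
    { simpl; rewrite (Csum_ext _ (fun _ => 0)), Csum_0; [unfold c; ring|].
      intros k Hk; destruct (classic (circle_coef d r k = 0)) as [Z|Z].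
      - rewrite Z; ring.
      - specialize (Hmin k Z); lia. }
    rewrite S0 in T.
    replace (0 - c * t ^ n) with (- (c * t ^ n)) in T by ring.
    rewrite Cmod_opp, Cmod_mult, Cmod_pow, HtX, Rpow_mult_distr in T.
    assert (HXn : (0 < X ^ n)%R) by (apply pow_lt; lra).
    assert (Hinv : (B / (1 - X) <= 2 * B)%R).
    { apply Rmult_le_reg_r with (1 - X)%R; [lra|].
      unfold Rdiv; rewrite Rmult_assoc, Rinv_l by lra; nra. }
    assert (HsB : (2 * B * s = Cmod c * r ^ n)%R) by (unfold s; field; lra).
    simpl in T.
    assert (T1 : (B / (1 - X) * (X * X ^ n) <= 2 * B * (X * X ^ n))%R).
    { apply Rmult_le_compat_r; [nra|exact Hinv]. }
    assert (T2 : (2 * B * X < Cmod c * r ^ n)%R) by nra.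
    assert (T3 : (2 * B * X * X ^ n < Cmod c * r ^ n * X ^ n)%R)
      by (apply Rmult_lt_compat_r; lra).
    nra.
  - left; intros t Ht.
    apply Cmod_eq_0, Rle_antisym; [|apply Cmod_ge_0].
    apply Rnot_lt_le; intros Hlt.
    assert (HX : (0 <= Cmod t / r < 1)%R).
    { split.
      - apply Rmult_le_pos; [apply Cmod_ge_0|left; apply Rinv_0_lt_compat, Hr].
      - apply Rmult_lt_reg_r with r; [exact Hr|].
        unfold Rdiv; rewrite Rmult_assoc, Rinv_l; lra. }
    destruct (pow_small (Cmod t / r) (B / (1 - Cmod t / r)) (Cmod (d t)) HX Hlt)
      as [m Hm].
    pose proof (taylor_remainder d r B t m Hr Hd HB Ht) as T.
    rewrite (Csum_ext _ (fun _ => 0)), Csum_0 in T.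
    + replace (d t - 0) with (d t) in T by ring; specialize (Hm m ltac:(lia)); lra.
    + intros k _; destruct (classic (circle_coef d r k = 0)) as [Z|Z].
      * rewrite Z; ring.
      * exfalso; apply Hno; exists k; exact Z.
Qed.

Lemma isolated_zeros (d : C -> C) (x : C) (r : R) :
  (0 < r)%R -> approx1 (disc x r) d ->
  (forall t, (Cmod (t - x) < r)%R -> d t = 0) \/
  exists r', (0 < r' <= r)%R /\
    forall t, (0 < Cmod (t - x) < r')%R -> d t <> 0.
Proof.
  intros Hr Hd.
  destruct (isolated_zeros_0 (fun t => d (x + t)) r Hr) as [H|[r' [Hr' H]]].
  - apply (approx1_comp (disc x r) d _ (fun t _ => x + t)); auto.
    + apply bounded1_2, disc_bounded.
    + apply approx_plus; [apply approx_const|apply approx_fst].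
    + intros t u [Ht _]; unfold disc in *.
      replace (x + t - x) with (t - 0) by ring; exact Ht.
  - left; intros t Ht; rewrite <- (H (t - x) Ht); f_equal; ring.
  - right; exists r'; split; [exact Hr'|]; intros t Ht.
    specialize (H (t - x) Ht).
    replace (x + (t - x)) with t in H by ring; exact H.
Qed.

Lemma is_series_Climit (a : nat -> C) (l : C) :
  is_series (K := C_AbsRing) (V := C_NormedModule) a l -> Climit (Csum a) l.
Proof.
  intros H eps He.
  assert (He2 : (0 < eps / 2)%R) by lra.
  pose proof (proj1 (filterlim_locally (sum_n a) l) H (mkposreal _ He2)) as [n0 Hn].
  exists (S n0); intros n Hn0; destruct n as [|n]; [lia|].
  specialize (Hn n ltac:(lia)); rewrite sum_n_Csum in Hn.
  destruct Hn as [H1 H2].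
  eapply Rle_lt_trans; [apply Cmod_le_Re_Im|].
  change (Rabs (Re (Csum a (S n) - l)) < eps / 2)%R in H1.
  change (Rabs (Im (Csum a (S n) - l)) < eps / 2)%R in H2.
  lra.
Qed.

(** The terms are bounded at distance [3 r / 4] from the center, so on the
    disc of radius [r / 2] they decrease like powers of [2 / 3]. *)
Lemma pseries_approx1 (c : nat -> C) (x : C) (r : R) (f : C -> C) :
  (0 < r)%R ->
  (forall y, (Cmod (y - x) < r)%R ->
     is_pseries (K := C_AbsRing) (V := C_NormedModule) c (y - x) (f y)) ->
  approx1 (disc x (r / 2)) f.
Proof.
  intros Hr H.
  assert (Hpow : forall (z : C) k, scal (K := C_AbsRing) (V := C_NormedModule)
    (pow_n (K := C_AbsRing) z k) (c k) = c k * z ^ k).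
  { intros z k; rewrite Cmult_comm.
    change (scal (K := C_AbsRing) (V := C_NormedModule)
      (pow_n (K := C_AbsRing) z k) (c k))
      with (pow_n (K := C_AbsRing) z k * c k); f_equal. }
  assert (HL : forall y, (Cmod (y - x) < r)%R ->
    Climit (Csum (fun k => c k * (y - x) ^ k)) (f y)).
  { intros y Hy; specialize (H y Hy); unfold is_pseries in H.
    apply is_series_Climit in H.
    eapply Climit_ext; [|exact H].
    intros n; apply Csum_ext; intros k _; apply Hpow. }
  set (y1 := x + RtoC (3 * r / 4)%R).
  assert (Ey1 : y1 - x = RtoC (3 * r / 4)%R) by (unfold y1; ring).
  assert (Hy1 : Climit (Csum (fun k => c k * (y1 - x) ^ k)) (f y1)).
  { apply HL; rewrite Ey1, Cmod_R, Rabs_pos_eq; lra. }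
  destruct (Hy1 1%R ltac:(lra)) as [n0 Hn0].
  assert (HM : exists M, (0 <= M)%R /\ forall k, (Cmod (c k * (y1 - x) ^ k) <= M)%R).
  { pose proof (finite_bound (fun k => Cmod (c k * (y1 - x) ^ k)) n0) as HF.
    destruct HF as [M [HM HF]]; exists (M + 2)%R; split; [lra|]; intros k.
    destruct (lt_dec k n0) as [Hk|Hk]; [specialize (HF k Hk); lra|].
    pose proof (Hn0 k ltac:(lia)) as E1; pose proof (Hn0 (S k) ltac:(lia)) as E2.
    simpl in E2.
    set (S := Csum (fun k => c k * (y1 - x) ^ k) k) in *.
    replace (c k * (y1 - x) ^ k) with
      ((S + c k * (y1 - x) ^ k - f y1) - (S - f y1)) by ring.
    eapply Rle_trans; [apply Cmod_triangle|]; rewrite Cmod_opp; lra. }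
  destruct HM as [M [HM0 HM]].
  apply (approx_lim_geom _ _
    (fun n t _ => Csum (fun k => c k * (t - x) ^ k) n) (M / (1 - 2 / 3)) (2 / 3)).
  - lra.
  - intros n; pose proof (bounded1_2 _ (disc_bounded x (r / 2))) as HK.
    apply approx_Csum; intros k _; apply approx_scal, approx_pow; auto.
    apply approx_minus; auto using approx_fst, approx_const.
  - intros n t u [Ht _]; unfold disc in Ht.
    assert (Hb : forall k, (Cmod (c k * (t - x) ^ k) <= M * (2 / 3) ^ k)%R).
    { intros k; specialize (HM k).
      rewrite Ey1, Cmod_mult, Cmod_pow, Cmod_R, Rabs_pos_eq in HM by lra.
      rewrite Cmod_mult, Cmod_pow.
      apply Rle_trans with (Cmod (c k) * (3 * r / 4) ^ k * (2 / 3) ^ k)%R.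
      - rewrite Rmult_assoc, <- Rpow_mult_distr.
        apply Rmult_le_compat_l; [apply Cmod_ge_0|].
        apply pow_incr; split; [apply Cmod_ge_0|lra].
      - apply Rmult_le_compat_r; [apply pow_le; lra|exact HM]. }
    destruct (Cseries_geom _ M (2 / 3)%R ltac:(lra) Hb) as [S1 S2].
    rewrite <- (Climit_unique _ _ _ S1 (HL t ltac:(lra))); apply S2.
Qed.

Definition continuous_at (f : C -> C) (t0 : C) : Prop :=
  forall eps, (0 < eps)%R -> exists del, (0 < del)%R /\
    forall t, (Cmod (t - t0) < del)%R -> (Cmod (f t - f t0) < eps)%R.

Lemma poly2_lipschitz (D : C -> Prop) (p : C -> C -> C) :
  bounded1 D -> poly2 p -> exists L, (0 <= L)%R /\
    forall t x, D t -> D x -> (Cmod (p t (RtoC 0) - p x (RtoC 0)) <= L * Cmod (t - x))%R.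
Proof.
  intros HD Hp; pose proof (bounded1_2 D HD) as HK.
  induction Hp as [c| | |p r Hp [L1 [P1 H1]] Hr [L2 [P2 H2]]
    |p r Hp [L1 [P1 H1]] Hr [L2 [P2 H2]]].
  - exists 0%R; split; [lra|]; intros t x _ _; rewrite Rmult_0_l.
    replace (c - c) with (RtoC 0) by ring; rewrite Cmod_0; lra.
  - exists 1%R; split; [lra|]; intros; lra.
  - exists 0%R; split; [lra|]; intros t x _ _; rewrite Rmult_0_l.
    replace (0 - 0) with (RtoC 0) by ring; rewrite Cmod_0; lra.
  - exists (L1 + L2)%R; split; [lra|]; intros t x Ht Hx.
    specialize (H1 t x Ht Hx); specialize (H2 t x Ht Hx).
    replace (p t (RtoC 0) + r t (RtoC 0) - (p x (RtoC 0) + r x (RtoC 0))) with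
      ((p t (RtoC 0) - p x (RtoC 0)) + (r t (RtoC 0) - r x (RtoC 0))) by ring.
    eapply Rle_trans; [apply Cmod_triangle|]; lra.
  - destruct (poly2_bounded _ p HK Hp) as [A [HA HpA]].
    destruct (poly2_bounded _ r HK Hr) as [B [HB HrB]].
    exists (A * L2 + L1 * B)%R; split; [nra|]; intros t x Ht Hx.
    specialize (H1 t x Ht Hx); specialize (H2 t x Ht Hx).
    specialize (HpA t (RtoC 0) (conj Ht eq_refl)).
    specialize (HrB x (RtoC 0) (conj Hx eq_refl)).
    replace (p t (RtoC 0) * r t (RtoC 0) - p x (RtoC 0) * r x (RtoC 0)) with
      (p t (RtoC 0) * (r t (RtoC 0) - r x (RtoC 0)) +
       (p t (RtoC 0) - p x (RtoC 0)) * r x (RtoC 0)) by ring.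
    eapply Rle_trans; [apply Cmod_triangle|]; rewrite !Cmod_mult.
    replace ((A * L2 + L1 * B) * Cmod (t - x))%R with
      (A * (L2 * Cmod (t - x)) + L1 * Cmod (t - x) * B)%R by ring.
    apply Rplus_le_compat; apply Rmult_le_compat; auto using Cmod_ge_0.
Qed.

Lemma approx1_continuous (D : C -> Prop) (f : C -> C) (x : C) (eps : R) :
  bounded1 D -> approx1 D f -> D x -> (0 < eps)%R ->
  exists del, (0 < del)%R /\
    forall t, D t -> (Cmod (t - x) < del)%R -> (Cmod (f t - f x) < eps)%R.
Proof.
  intros HD Hf Dx He.
  destruct (approx1_poly D f Hf (eps / 4)%R ltac:(lra)) as [p [Hp H]].
  destruct (poly2_lipschitz D p HD Hp) as [L [HL HpL]].
  exists (eps / 4 / (L + 1))%R; split; [repeat apply Rdiv_lt_0_compat; lra|].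
  intros t Dt Ht; pose proof (H t Dt); pose proof (H x Dx); specialize (HpL t x Dt Dx).
  assert (L * Cmod (t - x) <= eps / 4)%R.
  { replace (eps / 4)%R with ((L + 1) * (eps / 4 / (L + 1)))%R by (field; lra).
    apply Rmult_le_compat; auto using Cmod_ge_0; lra. }
  replace (f t - f x) with ((f t - p t (RtoC 0)) + (p t (RtoC 0) - p x (RtoC 0))
    - (f x - p x (RtoC 0))) by ring.
  eapply Rle_lt_trans; [apply Cmod_triangle|]; rewrite Cmod_opp.
  eapply Rle_lt_trans; [apply Rplus_le_compat_r, Cmod_triangle|]; lra.
Qed.

Lemma approx1_disc_continuous (f : C -> C) (x : C) (r : R) :
  (0 < r)%R -> approx1 (disc x r) f -> continuous_at f x.
Proof.
  intros Hr Hf eps He.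
  destruct (approx1_continuous (disc x r) f x eps (disc_bounded x r) Hf)
    as [del [Hd H]]; [apply disc_center; lra|exact He|].
  exists (Rmin r del); split; [apply Rmin_pos; auto|]; intros t Ht.
  pose proof (Rmin_l r del); pose proof (Rmin_r r del).
  apply H; unfold disc; lra.
Qed.

Lemma continuous_at_Climit (f : C -> C) (t0 : C) (u : nat -> C) :
  continuous_at f t0 -> Climit u t0 -> Climit (fun n => f (u n)) (f t0).
Proof.
  intros Hf Hu eps He; destruct (Hf eps He) as [del [Hd H]].
  destruct (Hu del Hd) as [n0 Hn]; exists n0; intros n Hn0; apply H, Hn, Hn0.
Qed.

Lemma ball_Cmod_inv (x y : C) (eps : R) :
  ball (M := C_R_NormedModule) x eps y -> (Cmod (y - x) < 2 * eps)%R.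
Proof.
  intros [H1 H2].
  change (Rabs (Re (y - x)) < eps)%R in H1; change (Rabs (Im (y - x)) < eps)%R in H2.
  eapply Rle_lt_trans; [apply Cmod_le_Re_Im|lra].
Qed.

Lemma open_Cmod (D : C -> Prop) :
  open D <-> forall x, D x -> exists r, (0 < r)%R /\
    forall y, (Cmod (y - x) < r)%R -> D y.
Proof.
  split; intros H x Hx.
  - destruct (H x Hx) as [eps He]; exists eps; split; [apply cond_pos|].
    intros y Hy; apply He; apply ball_Cmod, Hy.
  - destruct (H x Hx) as [r [Hr Hy]].
    assert (Hr2 : (0 < r / 2)%R) by lra.
    exists (mkposreal _ Hr2); intros y Hb; apply Hy.
    apply ball_Cmod_inv in Hb; simpl in Hb; lra.
Qed.

(** * Newton interpolation *)

(** Polynomial functions of degree less than [n], in Horner form, which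
    makes division by [X - a] an induction. *)
Fixpoint polydeg (n : nat) (f : C -> C) : Prop :=
  match n with
  | O => forall X, f X = 0
  | S n' => exists c f1, polydeg n' f1 /\ forall X, f X = c + X * f1 X
  end.

Lemma polydeg_ext (n : nat) (f h : C -> C) :
  (forall X, f X = h X) -> polydeg n f -> polydeg n h.
Proof.
  destruct n as [|n]; simpl; intros E H.
  - intros X; rewrite <- E; apply H.
  - destruct H as [c [f1 [H1 H2]]]; exists c, f1; split; [exact H1|].
    intros X; rewrite <- E; apply H2.
Qed.

Lemma polydeg_0 (n : nat) : polydeg n (fun _ => 0).
Proof.
  induction n as [|n IH]; simpl; [reflexivity|].
  exists 0, (fun _ => 0); split; [exact IH|]; intros; ring.
Qed.

Lemma polydeg_plus (n : nat) (f h : C -> C) :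
  polydeg n f -> polydeg n h -> polydeg n (fun X => f X + h X).
Proof.
  revert f h; induction n as [|n IH]; simpl; intros f h Hf Hh.
  - intros X; rewrite Hf, Hh; ring.
  - destruct Hf as [c [f1 [F1 F2]]], Hh as [d [h1 [H1 H2]]].
    exists (c + d), (fun X => f1 X + h1 X); split; [apply IH; assumption|].
    intros X; rewrite F2, H2; ring.
Qed.

Lemma polydeg_scal (n : nat) (a : C) (f : C -> C) :
  polydeg n f -> polydeg n (fun X => a * f X).
Proof.
  revert f; induction n as [|n IH]; simpl; intros f Hf.
  - intros X; rewrite Hf; ring.
  - destruct Hf as [c [f1 [F1 F2]]].
    exists (a * c), (fun X => a * f1 X); split; [apply IH, F1|].
    intros X; rewrite F2; ring.
Qed.

Lemma polydeg_le (n m : nat) (f : C -> C) :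
  (n <= m)%nat -> polydeg n f -> polydeg m f.
Proof.
  revert m f; induction n as [|n IH]; intros m f Hm Hf.
  - apply polydeg_ext with (fun _ => 0); [intros; symmetry; apply Hf|apply polydeg_0].
  - destruct m as [|m]; [lia|].
    destruct Hf as [c [f1 [F1 F2]]]; exists c, f1; split; [|exact F2].
    apply IH; [lia|exact F1].
Qed.

Lemma polydeg_div (n : nat) (f : C -> C) (a : C) :
  polydeg (S n) f -> exists f1, polydeg n f1 /\
    forall X, f X = f a + (X - a) * f1 X.
Proof.
  revert f; induction n as [|n IH]; intros f [c [h [Hh Hf]]].
  - exists (fun _ => 0); split; [intros X; reflexivity|].
    intros X; rewrite !Hf, !Hh; ring.
  - destruct (IH h Hh) as [h1 [H1 H2]].
    exists (fun X => h X + a * h1 X); split.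
    + apply polydeg_plus; [exact Hh|]; apply polydeg_scal.
      apply polydeg_le with n; [lia|exact H1].
    + intros X; rewrite !Hf, (H2 X); ring.
Qed.

(** The factor of index [j] is replaced by 1, so that the product still runs
    over an initial segment. *)
Definition node_prod (x : nat -> C) (i j : nat) : C :=
  Cprod (fun k => if Nat.eq_dec k j then 1 else x j - x k) (S i).

(** The divided difference of order [i] in Lagrange's symmetric form. *)
Definition divided_difference (x y : nat -> C) (i : nat) : C :=
  Csum (fun j => y j / node_prod x i j) (S i).

Definition distinct (x : nat -> C) (n : nat) : Prop :=
  forall i j, (i < n)%nat -> (j < n)%nat -> i <> j -> x i <> x j.

Lemma distinct_shift (x : nat -> C) (n : nat) :
  distinct x (S n) -> distinct (fun k => x (S k)) n.
Proof. intros H i j Hi Hj Hij; apply H; lia. Qed.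

Lemma distinct_le (x : nat -> C) (n m : nat) :
  (n <= m)%nat -> distinct x m -> distinct x n.
Proof. intros Hnm H i j Hi Hj Hij; apply H; lia. Qed.

Lemma node_prod_neq_0 (x : nat -> C) (i j : nat) :
  distinct x (S i) -> (j <= i)%nat -> node_prod x i j <> 0.
Proof.
  intros H Hj; apply Cprod_neq_0; intros k Hk.
  destruct (Nat.eq_dec k j) as [E|E]; [apply C1_nz|].
  intros Z; apply (H j k); try lia.
  replace (x j) with (x j - x k + x k) by ring; rewrite Z; ring.
Qed.

Lemma node_prod_shift (x : nat -> C) (i j : nat) :
  node_prod x (S i) (S j) = (x (S j) - x O) * node_prod (fun k => x (S k)) i j.
Proof.
  unfold node_prod; rewrite Cprod_Sl; simpl (Nat.eq_dec 0 (S j)); f_equal.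
  apply Cprod_ext; intros k _.
  destruct (Nat.eq_dec k j), (Nat.eq_dec (S k) (S j)); try lia; reflexivity.
Qed.

Lemma node_prod_S (x : nat -> C) (i j : nat) :
  (j <= i)%nat -> node_prod x (S i) j = node_prod x i j * (x j - x (S i)).
Proof.
  intros Hj; unfold node_prod.
  change (Cprod (fun k => if Nat.eq_dec k j then 1 else x j - x k) (S (S i)))
    with (Cprod (fun k => if Nat.eq_dec k j then 1 else x j - x k) (S i) *
      (if Nat.eq_dec (S i) j then 1 else x j - x (S i))).
  destruct (Nat.eq_dec (S i) j); [lia|reflexivity].
Qed.

(** Inserting the factors [x_j - x_0] and [x_j - x_(i+1)] into the sum gives
    the recursion of divided differences, whose two lower terms cancel. *)
Lemma divided_difference_one (x : nat -> C) (i : nat) :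
  distinct x (S (S i)) -> divided_difference x (fun _ => 1) (S i) = 0.
Proof.
  revert x; induction i as [i IH] using lt_wf_ind; intros x Hx.
  assert (Hd : x (S i) - x O <> 0) by (apply Cdiff_neq_0, Hx; lia).
  assert (Hrec : (x (S i) - x O) * divided_difference x (fun _ => 1) (S i) =
    divided_difference (fun k => x (S k)) (fun _ => 1) i
    - divided_difference x (fun _ => 1) i).
  { assert (S1 : Csum (fun j => (x j - x O) * (1 / node_prod x (S i) j)) (S (S i))
      = divided_difference (fun k => x (S k)) (fun _ => 1) i).
    { rewrite Csum_Sl; replace (x O - x O) with (RtoC 0) by ring.
      rewrite Cmult_0_l, Cplus_0_l; apply Csum_ext; intros j Hj.
      rewrite node_prod_shift.
      assert (N1 : x (S j) - x O <> 0) by (apply Cdiff_neq_0, Hx; lia).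
      assert (N2 : node_prod (fun k => x (S k)) i j <> 0)
        by (apply node_prod_neq_0; [apply distinct_shift, Hx|lia]).
      field; auto. }
    assert (S2 : Csum (fun j => (x j - x (S i)) * (1 / node_prod x (S i) j)) (S (S i))
      = divided_difference x (fun _ => 1) i).
    { change (Csum (fun j => (x j - x (S i)) * (1 / node_prod x (S i) j)) (S (S i)))
        with (Csum (fun j => (x j - x (S i)) * (1 / node_prod x (S i) j)) (S i)
          + (x (S i) - x (S i)) * (1 / node_prod x (S i) (S i))).
      replace (x (S i) - x (S i)) with (RtoC 0) by ring.
      rewrite Cmult_0_l, Cplus_0_r; apply Csum_ext; intros j Hj.
      rewrite node_prod_S by lia.
      assert (N1 : x j - x (S i) <> 0) by (apply Cdiff_neq_0, Hx; lia).
      assert (N2 : node_prod x i j <> 0).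
      { apply node_prod_neq_0; [apply distinct_le with (S (S i)); [lia|exact Hx]|lia]. }
      field; auto. }
    rewrite <- S1, <- S2; unfold divided_difference; rewrite <- Csum_scal.
    match goal with |- _ = ?a - ?b => replace (a - b) with (a + - (1) * b) by ring end.
    rewrite <- Csum_scal, <- Csum_plus; apply Csum_ext; intros; ring. }
  assert (Hz : divided_difference (fun k => x (S k)) (fun _ => 1) i
    - divided_difference x (fun _ => 1) i = 0).
  { destruct i as [|i].
    - unfold divided_difference, node_prod; simpl; ring.
    - rewrite !IH; try lia; [ring| |apply distinct_shift, Hx].
      apply distinct_le with (S (S (S i))); [lia|exact Hx]. }
  rewrite Hz in Hrec.
  replace (divided_difference x (fun _ => 1) (S i)) with
    (/ (x (S i) - x O) * ((x (S i) - x O) * divided_difference x (fun _ => 1) (S i)))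
    by (field; exact Hd).
  rewrite Hrec; ring.
Qed.

(** Divide by [X - x_0] and interpolate the quotient at the remaining nodes. *)
Lemma newton_interpolation (n : nat) (f : C -> C) (x : nat -> C) :
  polydeg n f -> distinct x n ->
  forall X, f X = Csum (fun i => divided_difference x (fun j => f (x j)) i *
    Cprod (fun k => X - x k) i) n.
Proof.
  revert f x; induction n as [|n IH]; intros f x Hf Hx X; [apply Hf|].
  destruct (polydeg_div n f (x O) Hf) as [f1 [H1 H2]].
  rewrite Csum_Sl, H2.
  rewrite (IH f1 (fun k => x (S k)) H1 (distinct_shift _ _ Hx) X).
  f_equal.
  - unfold divided_difference, node_prod; simpl; field.
  - rewrite <- Csum_scal; apply Csum_ext; intros i Hi.
    rewrite Cprod_Sl.
    assert (E : divided_difference (fun k => x (S k)) (fun j => f1 (x (S j))) i =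
      divided_difference x (fun j => f (x j)) (S i)
      - f (x O) * divided_difference x (fun _ => 1) (S i)).
    { unfold divided_difference.
      rewrite (Csum_Sl (fun j => f (x j) / node_prod x (S i) j)).
      rewrite (Csum_Sl (fun j => 1 / node_prod x (S i) j)).
      match goal with |- _ = ?a + ?b - ?c * (?d + ?e) =>
        replace (a + b - c * (d + e)) with (b + - c * e) by (unfold Cdiv; ring) end.
      rewrite <- Csum_scal, <- Csum_plus; apply Csum_ext; intros j Hj.
      rewrite node_prod_shift.
      assert (N1 : x (S j) - x O <> 0) by (apply Cdiff_neq_0, Hx; lia).
      assert (N2 : node_prod (fun k => x (S k)) i j <> 0).
      { apply node_prod_neq_0; [|lia]; apply distinct_shift.
        apply distinct_le with (S n); [lia|exact Hx]. }
      rewrite (H2 (x (S j))); field; auto. }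
    rewrite E, divided_difference_one; [ring|].
    apply distinct_le with (S n); [lia|exact Hx].
Qed.

(** * Elementary symmetric functions *)

(** The sum in [sigma] over an arbitrary list, as induction on the list
    requires. *)
Definition esym (a : nat -> C) (m : nat) (l : list nat) : C :=
  fold_right Cplus 0 (map (fun js => fold_right Cmult 1 (map a js)) (combs m l)).

Lemma fold_Cplus_app (l1 l2 : list C) :
  fold_right Cplus 0 (l1 ++ l2) = fold_right Cplus 0 l1 + fold_right Cplus 0 l2.
Proof. induction l1 as [|x l IH]; simpl; [ring|rewrite IH; ring]. Qed.

Lemma esym_0 (a : nat -> C) (l : list nat) : esym a 0 l = 1.
Proof. unfold esym; destruct l; simpl; ring. Qed.

Lemma esym_nil (a : nat -> C) (m : nat) : esym a (S m) nil = 0.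
Proof. reflexivity. Qed.

Lemma esym_cons (a : nat -> C) (m : nat) (x : nat) (l : list nat) :
  esym a (S m) (x :: l) = a x * esym a m l + esym a (S m) l.
Proof.
  unfold esym.
  change (combs (S m) (x :: l)) with (map (cons x) (combs m l) ++ combs (S m) l).
  rewrite map_app, fold_Cplus_app; f_equal.
  induction (combs m l) as [|js L IH]; simpl; [ring|rewrite IH; ring].
Qed.

Lemma approx_esym (K : C -> C -> Prop) (a : C -> nat -> C) (m : nat) (l : list nat) :
  bounded2 K -> (forall j, approx K (fun t _ => a t j)) ->
  approx K (fun t _ => esym (a t) m l).
Proof.
  intros HK Ha; unfold esym.
  induction (combs m l) as [|js L IH]; simpl; [apply approx_const|].
  apply (approx_plus K (fun t _ => fold_right Cmult 1 (map (a t) js))); auto.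
  induction js as [|j js IHj]; simpl; [apply approx_const|].
  apply (approx_mult K (fun t _ => a t j)); auto.
Qed.

Lemma esym_product (a : nat -> C) (l : list nat) (X : C) (M : nat) :
  (length l <= M)%nat ->
  fold_right (fun j acc => (1 + a j * X) * acc) 1 l =
  Csum (fun m => esym a m l * X ^ m) (S M).
Proof.
  revert M; induction l as [|x l IH]; intros M HM.
  - rewrite Csum_Sl, esym_0, (Csum_ext _ (fun _ => 0)), Csum_0; [simpl; ring|].
    intros k _; rewrite esym_nil; ring.
  - simpl in HM; destruct M as [|M]; [lia|]; simpl fold_right.
    rewrite Csum_Sl, esym_0.
    rewrite (Csum_ext _ (fun m => a x * X * (esym a m l * X ^ m)
      + esym a (S m) l * X ^ S m)) by (intros m _; rewrite esym_cons; simpl; ring).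
    rewrite Csum_plus, Csum_scal, <- IH by lia.
    assert (E : fold_right (fun j acc => (1 + a j * X) * acc) 1 l =
      1 + Csum (fun m => esym a (S m) l * X ^ S m) (S M)).
    { rewrite (IH (S M)) by lia; rewrite Csum_Sl, esym_0; simpl; ring. }
    simpl (X ^ 0).
    set (F := fold_right _ _ l) in *.
    transitivity (F + a x * X * F); [ring|].
    rewrite E at 1; ring.
Qed.

Lemma sigma_product (N : nat) (a : nat -> C) (X : C) :
  Cprod (fun j => 1 - a j * X) (2 * N) =
  Csum (fun m => (- (1)) ^ m * Defs.sigma N a m * X ^ m) (S (2 * N)).
Proof.
  transitivity (fold_right (fun j acc => (1 + a j * - X) * acc) 1 (seq 0 (2 * N))).
  - induction (2 * N)%nat as [|n IH]; [reflexivity|].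
    rewrite seq_S, fold_right_app; simpl; rewrite IH.
    generalize (seq 0 n); intros L; clear IH.
    replace (1 - a n * X) with (1 + a n * - X) by ring.
    generalize (1 + a n * - X); intros c.
    induction L as [|j L IH]; simpl; [ring|].
    rewrite Cmult_1_r in *; rewrite <- IH; ring.
  - rewrite (esym_product a _ (- X) (2 * N)) by (rewrite length_seq; lia).
    apply Csum_ext; intros m _; unfold Defs.sigma, esym.
    replace (- X) with (- (1) * X) by ring; rewrite Cpow_mult_l; ring.
Qed.

(** [u] is the Chebyshev polynomial of the second kind of degree [k - 1], up
    to the scaling by 2 of its variable. *)
Lemma chebyshev_exists (k : nat) :
  exists u, polydeg k u /\
    forall z : C, z <> 0 -> (z - / z) * u (z + / z) = z ^ k - / z ^ k.
Proof.
  assert (H : (exists u, polydeg k u /\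
      forall z : C, z <> 0 -> (z - / z) * u (z + / z) = z ^ k - / z ^ k) /\
    (exists u, polydeg (S k) u /\
      forall z : C, z <> 0 -> (z - / z) * u (z + / z) = z ^ S k - / z ^ S k)).
  { induction k as [|k [[u [Hu Eu]] [v [Hv Ev]]]]; split.
    - exists (fun _ => 0); split; [apply polydeg_0|]; intros z Hz; simpl; field; exact Hz.
    - exists (fun _ => 1); split.
      + exists 1, (fun _ => 0); split; [apply polydeg_0|]; intros; ring.
      + intros z Hz; simpl; field; exact Hz.
    - exists v; auto.
    - exists (fun X => X * v X + - (1) * u X); split.
      + apply polydeg_plus.
        * exists 0, v; split; [exact Hv|]; intros; ring.
        * apply polydeg_scal, polydeg_le with k; [lia|exact Hu].
      + intros z Hz.
        replace ((z - / z) * ((z + / z) * v (z + / z) + - (1) * u (z + / z)))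
          with ((z + / z) * ((z - / z) * v (z + / z)) - (z - / z) * u (z + / z))
          by ring.
        rewrite Eu, Ev by exact Hz.
        assert (Hzk : z ^ k <> 0) by (apply Cpow_nz, Hz).
        simpl; field; auto. }
  apply H.
Qed.

(** The right-hand side is odd under [z -> 1/z], hence a combination of the
    [z^k - z^-k] with [k <= N], and each of these is [z - 1/z] times a
    Chebyshev polynomial in [z + 1/z]. This is the factor that the first
    difference of [primitive] produces. *)
Lemma difference_polynomial (N : nat) (a : nat -> C) :
  exists P, polydeg N P /\ forall z : C, z <> 0 ->
    (z - / z) * P (z + / z) =
    z ^ N * Cprod (fun j => 1 - a j / z) (2 * N)
    - / z ^ N * Cprod (fun j => 1 - a j * z) (2 * N).
Proof.
  assert (Hm : forall m, (m < S (2 * N))%nat -> exists u, polydeg N u /\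
    forall z : C, z <> 0 -> (z - / z) * u (z + / z) = z ^ N / z ^ m - z ^ m / z ^ N).
  { intros m Hm; destruct (le_ge_dec m N) as [Hle|Hge].
    - destruct (chebyshev_exists (N - m)) as [u [Hu Eu]].
      exists u; split; [apply polydeg_le with (N - m)%nat; [lia|exact Hu]|].
      intros z Hz; rewrite Eu by exact Hz.
      replace N with ((N - m) + m)%nat at 3 4 by lia; rewrite Cpow_add_r.
      field; split; apply Cpow_nz, Hz.
    - destruct (chebyshev_exists (m - N)) as [u [Hu Eu]].
      exists (fun X => - (1) * u X); split.
      + apply polydeg_scal, polydeg_le with (m - N)%nat; [lia|exact Hu].
      + intros z Hz.
        replace ((z - / z) * (- (1) * u (z + / z)))
          with (- ((z - / z) * u (z + / z))) by ring.
        rewrite Eu by exact Hz.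
        replace m with ((m - N) + N)%nat at 3 4 by lia; rewrite Cpow_add_r.
        field; split; apply Cpow_nz, Hz. }
  assert (HM : forall M, (M <= S (2 * N))%nat -> exists P, polydeg N P /\
    forall z : C, z <> 0 -> (z - / z) * P (z + / z) =
      Csum (fun m => (- (1)) ^ m * Defs.sigma N a m * (z ^ N / z ^ m - z ^ m / z ^ N)) M).
  { induction M as [|M IH]; intros HM.
    - exists (fun _ => 0); split; [apply polydeg_0|]; intros; simpl; ring.
    - destruct (IH ltac:(lia)) as [P [HP EP]].
      destruct (Hm M ltac:(lia)) as [u [Hu Eu]].
      exists (fun X => P X + (- (1)) ^ M * Defs.sigma N a M * u X); split.
      + apply polydeg_plus; [exact HP|apply polydeg_scal, Hu].
      + intros z Hz; simpl Csum; rewrite <- EP, <- Eu by exact Hz; ring. }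
  destruct (HM _ (le_n _)) as [P [HP EP]]; exists P; split; [exact HP|].
  intros z Hz; rewrite EP by exact Hz.
  rewrite (Cprod_ext (fun j => 1 - a j / z) (fun j => 1 - a j * / z)) by reflexivity.
  rewrite !sigma_product.
  rewrite <- !Csum_scal.
  match goal with |- _ = ?x - ?y => replace (x - y) with (x + - (1) * y) by ring end.
  rewrite <- Csum_scal, <- Csum_plus; apply Csum_ext; intros m _.
  rewrite Cpow_inv by exact Hz; field; split; apply Cpow_nz, Hz.
Qed.

(** * The coefficients are divided differences *)

Section Nodes.

Context (q x : C) (Hq0 : q <> 0) (Hq1 : (Cmod q < 1)%R) (Hx0 : x <> 0)
  (Hx1 : (Cmod x < 1)%R).

Let xi (j : nat) : C := q ^ j * x.
Let node (j : nat) : C := xi j + / xi j.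

Lemma xi_neq_0 (j : nat) : xi j <> 0.
Proof. apply Cmult_neq_0; [apply Cpow_nz, Hq0|exact Hx0]. Qed.

Lemma Cmod_xi (j : nat) : (Cmod (xi j) < 1)%R.
Proof.
  unfold xi; rewrite Cmod_mult, Cmod_pow.
  assert (0 <= Cmod q ^ j <= 1)%R.
  { apply Cmod_pow_unit; lra. }
  pose proof (Cmod_ge_0 x); nra.
Qed.

Lemma one_minus_neq_0 (y : C) : (Cmod y < 1)%R -> 1 - y <> 0.
Proof.
  intros Hy E; replace y with (1 - (1 - y)) in Hy by ring.
  rewrite E in Hy; replace (1 - 0) with (RtoC 1) in Hy by ring.
  rewrite Cmod_1 in Hy; lra.
Qed.

Lemma node_diff (j k : nat) :
  node j - node k = - (xi j - xi k) * (1 - xi j * xi k) / (xi j * xi k).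
Proof. unfold node; field; split; apply xi_neq_0. Qed.

Lemma xi_inj (j k : nat) : xi j = xi k -> j = k.
Proof.
  assert (H : forall j k, (j < k)%nat -> xi j <> xi k).
  { intros a b Hab E.
    assert (Hb : xi b = q ^ (b - a) * xi a).
    { unfold xi; rewrite Cmult_assoc, <- Cpow_add_r; do 2 f_equal; lia. }
    rewrite Hb in E; apply (f_equal Cmod) in E.
    rewrite Cmod_mult, Cmod_pow in E.
    assert (0 < Cmod (xi a))%R by (apply Cmod_gt_0, xi_neq_0).
    assert (Cmod q ^ (b - a) < 1)%R.
    { apply pow_lt_1_compat; [split; [apply Cmod_ge_0|exact Hq1]|lia]. }
    nra. }
  intros E; destruct (lt_eq_lt_dec j k) as [[L|L]|L]; [|exact L|].
  - destruct (H j k L E).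
  - destruct (H k j L (eq_sym E)).
Qed.

Lemma node_distinct (n : nat) : distinct node n.
Proof.
  intros j k _ _ Hjk E.
  assert (Z : node j - node k = 0) by (rewrite E; ring).
  rewrite node_diff in Z; revert Z.
  apply Cmult_neq_0; [apply Cmult_neq_0|].
  - replace (- (xi j - xi k)) with (xi k - xi j) by ring.
    apply Cdiff_neq_0; intros E'; apply Hjk; symmetry; apply xi_inj, E'.
  - apply one_minus_neq_0; rewrite Cmod_mult.
    pose proof (Cmod_xi j); pose proof (Cmod_xi k).
    pose proof (Cmod_ge_0 (xi j)); pose proof (Cmod_ge_0 (xi k)); nra.
  - intros E'; apply C1_nz; rewrite <- (Cinv_r (xi j * xi k)), E'; [ring|].
    apply Cmult_neq_0; apply xi_neq_0.
Qed.

(** Induction on [i - j]. Each difference of nodes splits into [1 - q^(j-k)]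
    and [1 - q^(j+k) x^2] by [node_diff]; the nodes before [j] give the
    symbols with subscript [j], those after [j] the other two. *)
Lemma coefficient_denominator (i j : nat) :
  (j <= i)%nat ->
  qpoch q q (i - j) * qpoch q q j * qpoch (q ^ (2 * j) * x ^ 2) q (i - j + 1)
    * qpoch (q ^ j * x ^ 2) q j =
  node_prod node i j * (x * q ^ i * (- (1)) ^ j * - (xi j - / xi j)
    * q ^ (j * (j + 1) / 2) * Cprod (fun k => - xi k) i).
Proof.
  intros Hij; replace i with (j + (i - j))%nat by lia.
  generalize (i - j)%nat; clear i Hij; intros d.
  replace (j + d - j)%nat with d by lia.
  induction d as [|d IH].
  - rewrite Nat.add_0_r.
    assert (E1 : node_prod node j j = Cprod (fun k => node j - node k) j).
    { unfold node_prod; simpl; destruct (Nat.eq_dec j j) as [_|]; [|lia].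
      rewrite Cmult_1_r; apply Cprod_ext; intros k Hk.
      destruct (Nat.eq_dec k j); [lia|reflexivity]. }
    rewrite E1.
    assert (E2 : qpoch q q j * qpoch (q ^ j * x ^ 2) q j =
      Cprod (fun k => node j - node k) j * ((- (1)) ^ j * q ^ (j * (j + 1) / 2)
        * Cprod (fun k => - xi k) j)).
    { rewrite <- Cprod_qpow_triangle, <- (Cprod_const (- (1)) j).
      unfold qpoch; rewrite (Cprod_rev (fun k => 1 - q * q ^ k)).
      rewrite (Cprod_rev (fun k => q ^ S k)).
      rewrite <- !Cprod_mult; apply Cprod_ext; intros k Hk.
      rewrite node_diff.
      set (m := (j - 1 - k)%nat).
      assert (Ej : q ^ j = q ^ k * (q * q ^ m)).
      { change (q * q ^ m) with (q ^ S m); rewrite <- Cpow_add_r.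
        f_equal; unfold m; lia. }
      pose proof (xi_neq_0 j) as Nj; pose proof (xi_neq_0 k) as Nk.
      unfold xi in *; rewrite Ej in *; simpl; field.
      repeat split; try exact Hq0; try exact Hx0; try (apply Cpow_nz, Hq0). }
    replace (qpoch (q ^ (2 * j) * x ^ 2) q (0 + 1)) with (1 - xi j ^ 2).
    + change (qpoch q q 0) with (RtoC 1).
      transitivity ((1 - xi j ^ 2) * (qpoch q q j * qpoch (q ^ j * x ^ 2) q j));
        [ring|].
      rewrite E2.
      replace (- (xi j - / xi j)) with ((1 - xi j ^ 2) / xi j)
        by (field; apply xi_neq_0).
      replace (x * q ^ j) with (xi j) by (unfold xi; ring).
      field; apply xi_neq_0.
    + unfold qpoch, xi; simpl.
      replace (q ^ (j + (j + 0))) with (q ^ j * q ^ j)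
        by (rewrite <- Cpow_add_r; f_equal; lia); ring.
  - rewrite (Nat.add_succ_r j d), node_prod_S by lia.
    change (Cprod (fun k => - xi k) (S (j + d)))
      with (Cprod (fun k => - xi k) (j + d) * - xi (j + d)).
    assert (E1 : qpoch q q (S d) = qpoch q q d * (1 - q ^ S d)) by reflexivity.
    assert (E2 : qpoch (q ^ (2 * j) * x ^ 2) q (S d + 1) =
      qpoch (q ^ (2 * j) * x ^ 2) q (d + 1) * (1 - xi j * xi (S (j + d)))).
    { replace (S d + 1)%nat with (S (d + 1)) by lia.
      change (qpoch (q ^ (2 * j) * x ^ 2) q (S (d + 1))) with
        (qpoch (q ^ (2 * j) * x ^ 2) q (d + 1) *
          (1 - q ^ (2 * j) * x ^ 2 * q ^ (d + 1))).
      replace (q ^ (2 * j) * x ^ 2 * q ^ (d + 1)) with (xi j * xi (S (j + d)));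
        [reflexivity|]; unfold xi.
      replace (S (j + d))%nat with (j + (d + 1))%nat by lia.
      replace (2 * j)%nat with (j + j)%nat by lia.
      rewrite !Cpow_add_r; ring. }
    rewrite E1, E2.
    transitivity ((qpoch q q d * qpoch q q j *
      qpoch (q ^ (2 * j) * x ^ 2) q (d + 1) * qpoch (q ^ j * x ^ 2) q j)
      * ((1 - q ^ S d) * (1 - xi j * xi (S (j + d))))); [ring|].
    rewrite IH, node_diff.
    assert (Exi : xi (S (j + d)) = q ^ S d * xi j).
    { unfold xi; rewrite Cmult_assoc, <- Cpow_add_r; do 2 f_equal; lia. }
    assert (Exi' : xi (S (j + d)) = q * xi (j + d)) by (unfold xi; simpl; ring).
    pose proof (xi_neq_0 j) as Nj; pose proof (xi_neq_0 (j + d)) as Nd.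
    pose proof (xi_neq_0 (S (j + d))) as NS.
    set (W := node_prod node (j + d) j); set (Pi := Cprod (fun k => - xi k) (j + d)).
    set (t := q ^ (j * (j + 1) / 2)); set (e := (- (1)) ^ j).
    replace (q ^ S (j + d)) with (q * q ^ (j + d)) by reflexivity.
    transitivity (W * (x * q ^ (j + d) * e * - (xi j - / xi j) * t * Pi) *
      ((- (xi j - xi (S (j + d))) * (1 - xi j * xi (S (j + d)))
        / (xi j * xi (S (j + d)))) * - xi (S (j + d)))).
    + f_equal; rewrite Exi; field; split; [exact Nj|].
      apply Cpow_nz, Hq0.
    + set (Dn := - (xi j - xi (S (j + d))) * (1 - xi j * xi (S (j + d)))
        / (xi j * xi (S (j + d)))).
      rewrite Exi'; ring.
Qed.

(** The two products expand with the same elementary symmetric functions;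
    reversing the order of summation in one of them replaces [m] by [2 N -
    m]. *)
Lemma alternating_difference (N : nat) (a : nat -> C) (P : C -> C) (y : C) :
  (forall z : C, z <> 0 -> (z - / z) * P (z + / z) =
    z ^ N * Cprod (fun j => 1 - a j / z) (2 * N)
    - / z ^ N * Cprod (fun j => 1 - a j * z) (2 * N)) ->
  y <> 0 ->
  Csum (fun m => (- (1)) ^ m * (Defs.sigma N a m - Defs.sigma N a (2 * N - m))
    * (y ^ m / y ^ N)) (S (2 * N)) = - (y - / y) * P (y + / y).
Proof.
  intros HP Hy.
  replace (- (y - / y) * P (y + / y)) with (- ((y - / y) * P (y + / y))) by ring.
  rewrite HP by exact Hy.
  rewrite (Cprod_ext (fun j => 1 - a j / y) (fun j => 1 - a j * / y)) by reflexivity.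
  rewrite !sigma_product.
  rewrite (Csum_rev (fun m => (- (1)) ^ m * Defs.sigma N a m * (/ y) ^ m)).
  rewrite <- !Csum_scal.
  match goal with |- _ = - (?u - ?v) => replace (- (u - v)) with (v + - (1) * u) by ring end.
  rewrite <- Csum_scal, <- Csum_plus; apply Csum_ext; intros m Hm.
  replace (S (2 * N) - 1 - m)%nat with (2 * N - m)%nat by lia.
  assert (E1 : (- (1)) ^ (2 * N - m) = (- (1)) ^ m).
  { assert (Em : forall k, (- (1)) ^ k * (- (1)) ^ k = 1).
    { intros k; rewrite <- Cpow_mult_l; replace (- (1) * - (1)) with (RtoC 1) by ring.
      apply Cpow_1_l. }
    assert (E2N : (- (1)) ^ (2 * N - m) * (- (1)) ^ m = 1).
    { rewrite <- Cpow_add_r; replace (2 * N - m + m)%nat with (N + N)%nat by lia.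
      rewrite Cpow_add_r; apply Em. }
    transitivity ((- (1)) ^ (2 * N - m) * ((- (1)) ^ m * (- (1)) ^ m)).
    - rewrite Em; ring.
    - rewrite Cmult_assoc, E2N; ring. }
  assert (E2 : y ^ N * (/ y) ^ (2 * N - m) = y ^ m / y ^ N).
  { rewrite Cpow_inv by exact Hy.
    assert (E : y ^ N * y ^ N = y ^ m * y ^ (2 * N - m)).
    { rewrite <- !Cpow_add_r; f_equal; lia. }
    pose proof (Cpow_nz y N Hy); pose proof (Cpow_nz y (2 * N - m) Hy).
    transitivity (y ^ N * y ^ N / (y ^ N * y ^ (2 * N - m))); [field; auto|].
    rewrite E; field; auto. }
  rewrite E1.
  transitivity ((- (1)) ^ m * Defs.sigma N a m * (y ^ m / y ^ N)
    - (- (1)) ^ m * Defs.sigma N a (2 * N - m) * (y ^ m / y ^ N)); [ring|].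
  rewrite <- E2 at 2; unfold Cdiv; ring.
Qed.

(** The sum over [m] in [g] is a value of the difference polynomial and its
    denominators are products of differences of the nodes [q^j a + 1/(q^j
    a)]. So [g] is, up to normalization, a divided difference, and the sum
    is Newton's formula in the basis [(a z; q)_i (a / z; q)_i]. *)
Lemma g_interpolation (N : nat) (a : nat -> C) (P : C -> C) (z : C) :
  polydeg N P ->
  (forall z : C, z <> 0 -> (z - / z) * P (z + / z) =
    z ^ N * Cprod (fun j => 1 - a j / z) (2 * N)
    - / z ^ N * Cprod (fun j => 1 - a j * z) (2 * N)) ->
  z <> 0 ->
  Csum (fun i => g N q a i x * (qpoch (x * z) q i * qpoch (x / z) q i)) N
  = P (z + / z).
Proof.
  intros HP EP Hz.
  rewrite (newton_interpolation N P node HP (node_distinct N) (z + / z)).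
  apply Csum_ext; intros i Hi.
  assert (E1 : qpoch (x * z) q i * qpoch (x / z) q i =
    Cprod (fun k => - xi k) i * Cprod (fun k => z + / z - node k) i).
  { unfold qpoch; rewrite <- !Cprod_mult; apply Cprod_ext; intros k _.
    pose proof (xi_neq_0 k) as Nk.
    transitivity (1 - xi k * (z + / z) + xi k * xi k).
    - unfold xi; field; exact Hz.
    - unfold node; field; auto. }
  assert (E2 : g N q a i x * Cprod (fun k => - xi k) i =
    divided_difference node (fun j => P (node j)) i).
  { unfold g, divided_difference; rewrite sum_n_Csum.
    rewrite <- Csum_scal, Cmult_comm, <- Csum_scal; apply Csum_ext; intros j Hj.
    rewrite sum_n_Csum.
    pose proof (coefficient_denominator i j ltac:(lia)) as HD.
    set (D := qpoch q q (i - j) * qpoch q q j *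
      qpoch (q ^ (2 * j) * x ^ 2) q (i - j + 1) * qpoch (q ^ j * x ^ 2) q j) in *.
    rewrite (Csum_ext _ (fun m => (- (1)) ^ j * q ^ (j * (j + 1) / 2) / D *
      ((- (1)) ^ m * (Defs.sigma N a m - Defs.sigma N a (2 * N - m)) *
        (xi j ^ m / xi j ^ N))))
      by (intros m _; rewrite Cpow_add_r; unfold xi, Cdiv; ring).
    rewrite Csum_scal, (alternating_difference N a P (xi j) EP (xi_neq_0 j)).
    fold (node j).
    assert (NW : node_prod node i j <> 0).
    { apply node_prod_neq_0; [apply node_distinct|lia]. }
    assert (NP : Cprod (fun k => - xi k) i <> 0).
    { apply Cprod_neq_0; intros k _ E; apply (xi_neq_0 k).
      replace (xi k) with (- - xi k) by ring; rewrite E; ring. }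
    assert (Nxi : - (xi j - / xi j) <> 0).
    { replace (- (xi j - / xi j)) with ((1 - xi j * xi j) * / xi j)
        by (field; apply xi_neq_0).
      apply Cmult_neq_0.
      - apply one_minus_neq_0; rewrite Cmod_mult.
        pose proof (Cmod_xi j); pose proof (Cmod_ge_0 (xi j)); nra.
      - intros E; apply C1_nz; rewrite <- (Cinv_r (xi j)), E by apply xi_neq_0; ring. }
    assert (Ne : (- (1)) ^ j <> 0).
    { apply Cpow_nz; intros E; apply C1_nz.
      replace (RtoC 1) with (- - (1)) by ring; rewrite E; ring. }
    assert (Nt : q ^ (j * (j + 1) / 2) <> 0) by apply Cpow_nz, Hq0.
    assert (Nq : q ^ i <> 0) by apply Cpow_nz, Hq0.
    rewrite HD; set (A := - (xi j - / xi j)) in *.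
    field; repeat split; assumption. }
  rewrite E1, <- E2; ring.
Qed.

End Nodes.

(** * The integrand and its first difference *)

(** The theta function [(z^N, z^-N; p) / (z^(N/2) - z^(-N/2))] at [z = e^w],
    with the removable singularities at [z^N = 1] removed. *)
Definition theta_w (N : nat) (lq w : C) : C :=
  - Cexp (INR N * w / 2) *
  (qpoch_inf (qpow lq (INR N / 2) * Cexp w ^ N) (qpow lq (INR N / 2)) *
   qpoch_inf (/ Cexp w ^ N) (qpow lq (INR N / 2))).

Definition denom (N : nat) (q : C) (a : nat -> C) (z : C) : C :=
  Cprod (fun j => qpoch_inf (a j * z) q * qpoch_inf (a j / z) q) (2 * N).

Definition Phi_reg (N : nat) (lq : C) (a : nat -> C) (w : C) : C :=
  (Cexp w - / Cexp w) * theta_w N lq w * / denom N (Cexp lq) a (Cexp w).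

(** The function [F] whose first difference [F(z) - F(q z)] is the integrand
    times a symmetric Laurent polynomial. *)
Definition primitive (N : nat) (lq : C) (a : nat -> C) (w : C) : C :=
  Cexp w ^ N * theta_w N lq w *
  / Cprod (fun j => qpoch_inf (a j * Cexp w) (Cexp lq) *
                    qpoch_inf (Cexp lq * a j / Cexp w) (Cexp lq)) (2 * N).

Definition shift_first (q : C) (a : nat -> C) (i : nat) (j : nat) : C :=
  match j with
  | O => a O * q ^ i
  | S _ => a j
  end.

Lemma params_set_first (lq : C) (s : nat -> C) (i : nat) :
  params lq (set_first s (s O + INR i)) = shift_first (Cexp lq) (params lq s) i.
Proof.
  apply functional_extensionality; intros [|j]; [|reflexivity].
  unfold params, set_first, shift_first, qpow.
  rewrite <- Cexp_INR, <- Cexp_plus; f_equal; ring.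
Qed.

Section Integrand.

Context (N : nat) (lq : C) (HN : (1 <= N)%nat) (Hlq : (Re lq < 0)%R).

Let q := Cexp lq.
Let p := qpow lq (INR N / 2).

Lemma Cmod_q : (Cmod q < 1)%R.
Proof. unfold q; rewrite Cmod_Cexp, <- exp_0; apply exp_increasing, Hlq. Qed.

Lemma q_neq_0 : q <> 0.
Proof. apply Cexp_neq_0. Qed.

Lemma INR_N_pos : (0 < INR N)%R.
Proof. apply lt_0_INR; lia. Qed.

Lemma Cmod_p : (Cmod p < 1)%R.
Proof.
  unfold p, qpow; rewrite Cmod_Cexp, <- exp_0; apply exp_increasing.
  replace (lq * (INR N / 2)) with (lq * RtoC (INR N / 2)%R)
    by (rewrite RtoC_div by lra; reflexivity).
  replace (Re (lq * RtoC (INR N / 2)%R)) with (Re lq * (INR N / 2))%R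
    by (unfold Re; simpl; ring).
  pose proof INR_N_pos; nra.
Qed.

Lemma p_neq_0 : p <> 0.
Proof. apply Cexp_neq_0. Qed.

Lemma C2_neq_0 : RtoC 2 <> 0.
Proof. apply RtoC_neq_0; lra. Qed.

Lemma p_square : p * p = q ^ N.
Proof.
  unfold p, q, qpow; rewrite <- Cexp_plus, <- Cexp_INR; f_equal.
  field.
Qed.

(** The factor [1 - z^N] of the first symbol cancels the denominator
    [z^(N/2) - z^(-N/2)]. *)
Lemma Phi_regular (a : nat -> C) (w : C) :
  Cexp w ^ N <> 1 -> Phi N lq a w = Phi_reg N lq a w.
Proof.
  intros Hz; unfold Phi, Phi_reg, theta_w; fold p; fold q.
  rewrite (qpoch_inf_shift (Cexp w ^ N) p) by apply Cmod_p.
  rewrite (Cmult_comm (Cexp w ^ N) p).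
  set (Z := Cexp w ^ N) in *; set (e := Cexp (INR N * w / 2)).
  assert (He : e <> 0) by apply Cexp_neq_0.
  assert (HZ : Z = e * e).
  { unfold Z, e; rewrite <- Cexp_INR, <- Cexp_plus; f_equal; field. }
  rewrite Cexp_opp; fold e.
  assert (Hd : e - / e <> 0).
  { intros E; apply Hz; rewrite HZ.
    replace (e * e) with ((e - / e) * e + 1) by (field; exact He).
    rewrite E; ring. }
  unfold denom, Cdiv.
  set (Dn := / Cprod _ _); set (A := qpoch_inf (p * Z) p);
    set (B := qpoch_inf (/ Z) p).
  assert (E : (1 - Z) * / (e - / e) = - e).
  { rewrite HZ; replace (1 - e * e) with (- e * (e - / e)) by (field; exact He).
    rewrite <- Cmult_assoc, Cinv_r by exact Hd; ring. }
  transitivity ((Cexp w - / Cexp w) * ((1 - Z) * / (e - / e)) * (A * B) * Dn);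
    [ring|rewrite E; ring].
Qed.

(** Since [q^N = p^2], the step moves two factors from one symbol to the
    other. *)
Lemma theta_w_shift (w : C) :
  theta_w N lq (w + lq) = / (q ^ N * Cexp w ^ N * Cexp w ^ N) * theta_w N lq w.
Proof.
  unfold theta_w; fold p.
  set (Z := Cexp w ^ N).
  assert (HZ : Z <> 0) by (apply Cpow_nz, Cexp_neq_0).
  assert (E1 : Cexp (w + lq) ^ N = p * p * Z).
  { rewrite Cexp_plus, Cpow_mult_l; fold q; rewrite p_square; unfold Z; ring. }
  assert (E2 : Cexp (INR N * (w + lq) / 2) = Cexp (INR N * w / 2) * p).
  { unfold p, qpow; rewrite <- Cexp_plus; f_equal; field. }
  rewrite E1, E2, <- p_square.
  rewrite (qpoch_inf_split (p * Z) p 2) by apply Cmod_p.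
  rewrite (qpoch_inf_split (/ (p * p * Z)) p 2) by apply Cmod_p.
  unfold qpoch; simpl.
  pose proof p_neq_0 as Hp.
  replace (p * Z * (p * (p * 1))) with (p * (p * p * Z)) by ring.
  replace (/ (p * p * Z) * (p * (p * 1))) with (/ Z) by (field; auto).
  field; auto.
Qed.

Lemma denom_neq_0 (a : nat -> C) (z : C) :
  (forall j, (j < 2 * N)%nat ->
     qpoch_inf (a j * z) q <> 0 /\ qpoch_inf (a j / z) q <> 0) ->
  denom N q a z <> 0.
Proof.
  intros H; apply Cprod_neq_0; intros j Hj.
  destruct (H j Hj); apply Cmult_neq_0; assumption.
Qed.

(** In [F(z)] and in [F(q z)] one of the two families of symbols has lost
    its first factors compared with the integrand. They reappear as [prod (1
    - a_j / z)] and [prod (1 - a_j z)], and the theta function times its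
    power of [z] contributes [z^N] and [z^-N]. *)
Lemma primitive_difference (a : nat -> C) (P : C -> C) (w : C) :
  (forall z : C, z <> 0 -> (z - / z) * P (z + / z) =
    z ^ N * Cprod (fun j => 1 - a j / z) (2 * N)
    - / z ^ N * Cprod (fun j => 1 - a j * z) (2 * N)) ->
  (forall j, (j < 2 * N)%nat ->
     qpoch_inf (a j * Cexp w) q <> 0 /\ qpoch_inf (a j / Cexp w) q <> 0) ->
  primitive N lq a w - primitive N lq a (w + lq) =
  Phi_reg N lq a w * P (Cexp w + / Cexp w).
Proof.
  intros HP Hnz; pose proof Cmod_q as Hq; pose proof q_neq_0 as Hq0.
  set (z := Cexp w) in *.
  assert (Hz : z <> 0) by apply Cexp_neq_0.
  assert (HZ : z ^ N <> 0) by (apply Cpow_nz, Hz).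
  assert (HqN : q ^ N <> 0) by (apply Cpow_nz, Hq0).
  assert (HD : denom N q a z <> 0) by (apply denom_neq_0, Hnz).
  assert (E1 : primitive N lq a w =
    z ^ N * Cprod (fun j => 1 - a j / z) (2 * N) * theta_w N lq w * / denom N q a z).
  { unfold primitive; fold q; fold z.
    assert (E : denom N q a z = Cprod (fun j => 1 - a j / z) (2 * N) *
      Cprod (fun j => qpoch_inf (a j * z) q * qpoch_inf (q * a j / z) q) (2 * N)).
    { unfold denom; rewrite <- Cprod_mult; apply Cprod_ext; intros j _.
      rewrite (qpoch_inf_shift (a j / z)) by exact Hq.
      replace (a j / z * q) with (q * a j / z) by (unfold Cdiv; ring); ring. }
    rewrite E in *.
    set (A := Cprod (fun j => 1 - a j / z) (2 * N)) in *.
    set (B := Cprod (fun j => qpoch_inf (a j * z) q *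
      qpoch_inf (q * a j / z) q) (2 * N)) in *.
    assert (A <> 0) by (intros E'; apply HD; rewrite E'; ring).
    assert (B <> 0) by (intros E'; apply HD; rewrite E'; ring).
    field; auto. }
  assert (E2 : primitive N lq a (w + lq) =
    / z ^ N * Cprod (fun j => 1 - a j * z) (2 * N) * theta_w N lq w
      * / denom N q a z).
  { unfold primitive; fold q; rewrite theta_w_shift, Cexp_plus; fold q; fold z.
    rewrite (Cprod_ext (fun j => qpoch_inf (a j * (z * q)) q * qpoch_inf (q * a j / (z * q)) q)
      (fun j => qpoch_inf (a j * z * q) q * qpoch_inf (a j / z) q)).
    2: { intros j _; f_equal; f_equal; [ring|field; auto]. }
    assert (E : denom N q a z = Cprod (fun j => 1 - a j * z) (2 * N) *
      Cprod (fun j => qpoch_inf (a j * z * q) q * qpoch_inf (a j / z) q) (2 * N)).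
    { unfold denom; rewrite <- Cprod_mult; apply Cprod_ext; intros j _.
      rewrite (qpoch_inf_shift (a j * z)) by exact Hq; ring. }
    rewrite E in *.
    set (A := Cprod (fun j => 1 - a j * z) (2 * N)) in *.
    set (B := Cprod (fun j => qpoch_inf (a j * z * q) q *
      qpoch_inf (a j / z) q) (2 * N)) in *.
    assert (A <> 0) by (intros E'; apply HD; rewrite E'; ring).
    assert (B <> 0) by (intros E'; apply HD; rewrite E'; ring).
    rewrite Cpow_mult_l; field; auto. }
  rewrite E1, E2; unfold Phi_reg; fold q; fold z.
  transitivity (((z - / z) * P (z + / z)) * theta_w N lq w * / denom N q a z).
  - rewrite HP by exact Hz; ring.
  - ring.
Qed.

Lemma Phi_reg_shift (a : nat -> C) (i : nat) (w : C) :
  (forall j, (j < 2 * N)%nat ->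
     qpoch_inf (a j * Cexp w) q <> 0 /\ qpoch_inf (a j / Cexp w) q <> 0) ->
  Phi_reg N lq (shift_first q a i) w =
  qpoch (a O * Cexp w) q i * qpoch (a O / Cexp w) q i * Phi_reg N lq a w.
Proof.
  intros Hnz; pose proof Cmod_q as Hq; unfold Phi_reg; fold q.
  set (z := Cexp w) in *.
  pose proof (denom_neq_0 a z Hnz) as HD.
  assert (E : denom N q a z = qpoch (a O * z) q i * qpoch (a O / z) q i *
    denom N q (shift_first q a i) z).
  { unfold denom; replace (2 * N)%nat with (S (2 * N - 1)) by lia.
    rewrite !Cprod_Sl; simpl shift_first.
    rewrite (qpoch_inf_split (a O * z) q i), (qpoch_inf_split (a O / z) q i)
      by exact Hq.
    replace (a O * q ^ i * z) with (a O * z * q ^ i) by ring.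
    replace (a O * q ^ i / z) with (a O / z * q ^ i) by (unfold Cdiv; ring).
    ring. }
  rewrite E in *.
  set (A := qpoch (a O * z) q i * qpoch (a O / z) q i) in *.
  set (B := denom N q (shift_first q a i) z) in *.
  assert (A <> 0) by (intros E'; apply HD; rewrite E'; ring).
  assert (B <> 0) by (intros E'; apply HD; rewrite E'; ring).
  assert (z <> 0) by apply Cexp_neq_0.
  field; auto.
Qed.

Lemma approx_theta_w (K : C -> C -> Prop) (f : C -> C -> C) :
  bounded2 K -> approx K f -> approx K (fun t u => theta_w N lq (f t u)).
Proof.
  intros HK Hf; pose proof Cmod_p as Hp; unfold theta_w; fold p.
  assert (HE : approx K (fun t u => Cexp (f t u) ^ N)).
  { apply approx_pow, approx_Cexp; auto. }
  assert (HE' : approx K (fun t u => / Cexp (f t u) ^ N)).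
  { apply approx_ext with (fun t u => Cexp (- (1) * f t u) ^ N).
    - intros t u _; replace (- (1) * f t u) with (- f t u) by ring.
      rewrite Cexp_opp, Cpow_inv by apply Cexp_neq_0; reflexivity.
    - apply approx_pow, approx_Cexp, approx_scal; auto. }
  apply approx_mult; auto.
  - apply approx_ext with (fun t u => - (1) * Cexp (INR N * / 2 * f t u)).
    + intros t u _; replace (INR N * f t u / 2) with (INR N * / 2 * f t u)
        by (unfold Cdiv; ring); ring.
    + apply approx_scal, approx_Cexp, approx_scal; auto.
  - apply approx_mult; auto; apply approx_qpoch_inf; auto.
    apply approx_scal; auto.
Qed.

(** In the strip [|q| <= |z| <= 1] both [a_j z] and [q a_j / z] have modulus
    less than 1. *)
Lemma approx_primitive (a : nat -> C) (D : C -> Prop) :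
  (forall j, (j < 2 * N)%nat -> (Cmod (a j) < 1)%R) ->
  bounded1 D -> (forall w, D w -> (Re lq <= Re w <= 0)%R) ->
  approx1 D (primitive N lq a).
Proof.
  intros Ha HD0 HD; pose proof (bounded1_2 D HD0) as HK.
  pose proof Cmod_q as Hq.
  unfold approx1, primitive; fold q.
  apply approx_mult; auto.
  - apply approx_mult; auto.
    + apply approx_pow, approx_Cexp; auto using approx_fst.
    + apply (approx_theta_w _ (fun t _ => t)); auto using approx_fst.
  - apply (approx_inv_Cprod _ (fun j t _ => qpoch_inf (a j * Cexp t) q *
      qpoch_inf (q * a j / Cexp t) q)); auto.
    intros j Hj; specialize (Ha j Hj).
    apply (approx_inv_mult _ (fun t _ => qpoch_inf (a j * Cexp t) q)
      (fun t _ => qpoch_inf (q * a j / Cexp t) q)); auto.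
    + apply (approx_inv_qpoch_inf_small _ (fun t _ => a j * Cexp t) q (Cmod (a j)));
        auto.
      * apply approx_scal, approx_Cexp; auto using approx_fst.
      * intros t u [Ht _]; rewrite Cmod_mult, Cmod_Cexp.
        assert (exp (Re t) <= 1)%R.
        { rewrite <- exp_0; destruct (HD t Ht) as [_ [H|H]];
            [left; apply exp_increasing, H|rewrite H; lra]. }
        pose proof (Cmod_ge_0 (a j)); nra.
    + apply (approx_inv_qpoch_inf_small _ (fun t _ => q * a j / Cexp t) q (Cmod (a j)));
        auto.
      * apply approx_mult; auto using approx_const.
        apply approx_Cexp_inv; auto using approx_fst.
      * intros t u [Ht _].
        replace (q * a j / Cexp t) with (a j * Cexp (lq - t)).
        -- rewrite Cmod_mult, Cmod_Cexp.
           assert (exp (Re (lq - t)) <= 1)%R.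
           { replace (Re (lq - t)) with (Re lq - Re t)%R by (unfold Re; simpl; ring).
             rewrite <- exp_0; destruct (HD t Ht) as [[H|H] _].
             - left; apply exp_increasing; lra.
             - rewrite H, Rminus_diag; lra. }
           pose proof (Cmod_ge_0 (a j)); nra.
        -- unfold Cminus; rewrite Cexp_plus, Cexp_opp; fold q.
           unfold Cdiv; ring.
Qed.

Definition unit_segment (w : C) : Prop :=
  exists x, (- PI <= x <= PI)%R /\ w = x * Ci.

Lemma unit_segment_bounded : bounded1 unit_segment.
Proof.
  exists PI; intros w [x [Hx ->]].
  rewrite Cmod_mult, Cmod_Ci, Cmod_R, Rmult_1_r; apply Rabs_le; lra.
Qed.

Lemma unit_segment_Cmod (w : C) : unit_segment w -> Cmod (Cexp w) = 1%R.
Proof. intros [x [_ ->]]; rewrite Cmult_comm; apply Cmod_Cexp_imag. Qed.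

Lemma denom_circle_neq_0 (a : nat -> C) (z : C) :
  (forall j, (j < 2 * N)%nat -> (Cmod (a j) < 1)%R) -> Cmod z = 1%R ->
  forall j, (j < 2 * N)%nat ->
     qpoch_inf (a j * z) q <> 0 /\ qpoch_inf (a j / z) q <> 0.
Proof.
  intros Ha Hz j Hj; specialize (Ha j Hj).
  assert (Hz0 : z <> 0) by (apply Cmod_gt_0; lra).
  split; apply qpoch_inf_neq_0; try apply Cmod_q.
  - rewrite Cmod_mult, Hz; lra.
  - rewrite Cmod_div, Hz by exact Hz0; lra.
Qed.

(** Only finitely many points of the circle are excluded in [Phi_regular]. *)
Lemma circle_exceptional (x : R) :
  (- PI <= x <= PI)%R -> Cexp (x * Ci) ^ N = 1 ->
  In x (map (fun k => ((INR k - INR N) * PI / INR N)%R) (seq 0 (2 * N + 1))).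
Proof.
  intros Hx E; pose proof PI_RGT_0 as Hpi; pose proof INR_N_pos as HNp.
  rewrite <- Cexp_INR in E.
  replace (INR N * (x * Ci)) with (0%R, (INR N * x)%R) in E
    by (apply injective_projections; simpl; ring).
  apply (f_equal Im) in E; unfold Cexp, Re, Im in E; simpl in E.
  rewrite exp_0, Rmult_1_l in E.
  destruct (sin_eq_0_0 _ E) as [k Hk].
  assert (Hk1 : (- INR N <= IZR k <= INR N)%R).
  { split; apply Rmult_le_reg_r with PI; try lra; rewrite <- Hk; nra. }
  rewrite INR_IZR_INZ, <- opp_IZR in Hk1.
  destruct Hk1 as [Hk1 Hk2]; apply le_IZR in Hk1; apply le_IZR in Hk2.
  apply in_map_iff; exists (Z.to_nat (k + Z.of_nat N)); split.
  - rewrite INR_IZR_INZ, Z2Nat.id, plus_IZR, <- INR_IZR_INZ by lia.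
    apply Rmult_eq_reg_l with (INR N); [|lra].
    rewrite Hk; field; lra.
  - apply in_seq; lia.
Qed.

Lemma int_circle_reg (a : nat -> C) :
  (forall j, (j < 2 * N)%nat -> (Cmod (a j) < 1)%R) ->
  is_CInt (fun x => Phi_reg N lq a (x * Ci)) (- PI) PI (2 * PI * int_circle N lq a).
Proof.
  intros Ha; pose proof PI_RGT_0 as Hpi; pose proof Cmod_q as Hq.
  pose proof unit_segment_bounded as HB; pose proof (bounded1_2 _ HB) as HK.
  assert (HA : approx1 unit_segment (Phi_reg N lq a)).
  { unfold approx1, Phi_reg, denom; fold q.
    apply approx_mult; auto.
    - apply approx_mult; auto.
      + apply approx_minus; auto.
        * apply approx_Cexp; auto using approx_fst.
        * apply approx_Cexp_inv; auto using approx_fst.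
      + apply (approx_theta_w _ (fun t _ => t)); auto using approx_fst.
    - apply (approx_inv_Cprod _ (fun j t _ => qpoch_inf (a j * Cexp t) q *
        qpoch_inf (a j / Cexp t) q)); auto.
      intros j Hj; specialize (Ha j Hj).
      apply (approx_inv_mult _ (fun t _ => qpoch_inf (a j * Cexp t) q)
        (fun t _ => qpoch_inf (a j / Cexp t) q)); auto.
      + apply (approx_inv_qpoch_inf_small _ (fun t _ => a j * Cexp t) q (Cmod (a j)));
          auto.
        * apply approx_scal, approx_Cexp; auto using approx_fst.
        * intros t u [Ht _]; rewrite Cmod_mult, unit_segment_Cmod by exact Ht; lra.
      + apply (approx_inv_qpoch_inf_small _ (fun t _ => a j / Cexp t) q (Cmod (a j)));
          auto.
        * apply approx_mult; auto using approx_const.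
          apply approx_Cexp_inv; auto using approx_fst.
        * intros t u [Ht _]; rewrite Cmod_div, unit_segment_Cmod
            by (exact Ht || apply Cexp_neq_0); lra. }
  assert (HI : is_CInt (fun x => Phi_reg N lq a (0 + x * Ci)) (- PI) PI
    (CInt (fun x => Phi_reg N lq a (0 + x * Ci)) (- PI) PI)).
  { apply (approx1_is_CInt unit_segment); [lra|exact HA|].
    intros x Hx; exists x; split; [exact Hx|ring]. }
  assert (HI2 : is_CInt (fun t => Phi N lq a (0%R, t)) (- PI) PI
    (CInt (fun x => Phi_reg N lq a (0 + x * Ci)) (- PI) PI)).
  { apply (is_CInt_ext_finite
      (map (fun k => ((INR k - INR N) * PI / INR N)%R) (seq 0 (2 * N + 1)))
      (fun x => Phi_reg N lq a (0 + x * Ci))); [lra| |exact HI].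
    intros x Hx Hnot.
    replace (0%R, x) with (x * Ci) by (apply injective_projections; simpl; ring).
    replace (0 + x * Ci) with (x * Ci) by ring.
    symmetry; apply Phi_regular; intros E; apply Hnot.
    apply circle_exceptional; [lra|exact E]. }
  unfold int_circle; rewrite (is_CInt_unique _ _ _ _ HI2).
  set (J := CInt (fun x => Phi_reg N lq a (0 + x * Ci)) (- PI) PI : C) in *.
  replace (2 * PI * (J / (2 * PI))) with J by (field; apply RtoC_neq_0; lra).
  eapply is_CInt_ext; [lra| |exact HI].
  intros x _; simpl; f_equal; ring.
Qed.

Lemma Cmod_shift_first (a : nat -> C) (i j : nat) :
  (Cmod (a j) < 1)%R -> (Cmod (shift_first q a i j) < 1)%R.
Proof.
  intros Ha; destruct j as [|j]; simpl; [|exact Ha].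
  rewrite Cmod_mult, Cmod_pow.
  assert (0 <= Cmod q ^ i <= 1)%R.
  { apply Cmod_pow_unit, Cmod_q. }
  pose proof (Cmod_ge_0 (a O)); nra.
Qed.

Lemma g_sum_Phi_reg (a : nat -> C) (w : C) :
  a O <> 0 -> (Cmod (a O) < 1)%R ->
  (forall j, (j < 2 * N)%nat ->
     qpoch_inf (a j * Cexp w) q <> 0 /\ qpoch_inf (a j / Cexp w) q <> 0) ->
  Csum (fun i => g N q a i (a O) * Phi_reg N lq (shift_first q a i) w) N =
  primitive N lq a w - primitive N lq a (w + lq).
Proof.
  intros Ha0 Ha1 Hnz.
  destruct (difference_polynomial N a) as [P [HP EP]].
  rewrite (primitive_difference a P w EP Hnz).
  rewrite <- (g_interpolation q (a O) q_neq_0 Cmod_q Ha0 Ha1 N a P (Cexp w) HP EP)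
    by apply Cexp_neq_0.
  rewrite <- Csum_scal; apply Csum_ext; intros i _.
  rewrite Phi_reg_shift by exact Hnz; ring.
Qed.

(** The first difference moves the circle across a strip in which the
    primitive has no pole; what is left are the two sides of the strip,
    along the cut. *)
Lemma g_sum_circle (a : nat -> C) :
  a O <> 0 -> (forall j, (j < 2 * N)%nat -> (Cmod (a j) < 1)%R) ->
  2 * PI * Csum (fun i => g N q a i (a O) * int_circle N lq (shift_first q a i)) N =
  Ci * lq * (CInt (fun x => primitive N lq a (PI * Ci + x * lq)) 0 1
    - CInt (fun x => primitive N lq a (- (PI * Ci) + x * lq)) 0 1).
Proof.
  intros Ha0 Ha; pose proof PI_RGT_0 as Hpi.
  set (D := fun w => (Re lq <= Re w <= 0)%R /\ (Cmod w <= Cmod lq + PI)%R).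
  assert (HD : approx1 D (primitive N lq a)).
  { apply approx_primitive; auto.
    - exists (Cmod lq + PI)%R; intros t [_ H]; exact H.
    - intros w [H _]; exact H. }
  assert (HDin : forall x y, (0 <= x <= 1)%R -> (- PI <= y <= PI)%R ->
    D (0 + x * lq + y * Ci)).
  { intros x y Hx Hy; split.
    - replace (Re (0 + x * lq + y * Ci)) with (x * Re lq)%R
        by (unfold Re; simpl; ring); nra.
    - replace (0 + x * lq + y * Ci) with (x * lq + y * Ci) by ring.
      eapply Rle_trans; [apply Cmod_triangle|].
      rewrite !Cmod_mult, Cmod_Ci, !Cmod_R, (Rabs_pos_eq x) by lra.
      assert (Rabs y <= PI)%R by (apply Rabs_le; lra).
      pose proof (Cmod_ge_0 lq); nra. }
  pose proof (cauchy_parallelogram D (primitive N lq a) 0 lq HD HDin) as HC.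
  assert (I1 : is_CInt (fun x => primitive N lq a (0 + x * Ci)) (- PI) PI
    (CInt (fun x => primitive N lq a (0 + x * Ci)) (- PI) PI)).
  { apply (approx1_is_CInt D); auto; [lra|].
    intros x Hx; replace (0 + x * Ci) with (0 + 0%R * lq + x * Ci) by ring.
    apply HDin; lra. }
  assert (I2 : is_CInt (fun x => primitive N lq a (0 + lq + x * Ci)) (- PI) PI
    (CInt (fun x => primitive N lq a (0 + lq + x * Ci)) (- PI) PI)).
  { apply (approx1_is_CInt D); auto; [lra|].
    intros x Hx; replace (0 + lq + x * Ci) with (0 + 1%R * lq + x * Ci) by ring.
    apply HDin; lra. }
  set (A := CInt (fun x => primitive N lq a (0 + x * Ci)) (- PI) PI) in *.
  set (B := CInt (fun x => primitive N lq a (0 + lq + x * Ci)) (- PI) PI) in *.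
  assert (E : 2 * PI * Csum (fun i => g N q a i (a O) *
      int_circle N lq (shift_first q a i)) N = A - B).
  { eapply is_CInt_eq; [|apply is_CInt_minus; [exact I1|exact I2]].
    rewrite <- Csum_scal.
    apply is_CInt_ext with (fun x => Csum (fun i => g N q a i (a O) *
      Phi_reg N lq (shift_first q a i) (x * Ci)) N); [lra| |].
    - intros x Hx.
      replace (0 + x * Ci) with (x * Ci) by ring.
      replace (0 + lq + x * Ci) with (x * Ci + lq) by ring.
      apply g_sum_Phi_reg; auto.
      + apply Ha; lia.
      + apply denom_circle_neq_0; auto.
        rewrite Cmult_comm; apply Cmod_Cexp_imag.
    - apply is_CInt_Csum; intros i _.
      replace (2 * PI * (g N q a i (a O) * int_circle N lq (shift_first q a i)))
        with (g N q a i (a O) * (2 * PI * int_circle N lq (shift_first q a i))) by ring.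
      apply is_CInt_scal, int_circle_reg; intros j Hj.
      apply Cmod_shift_first, Ha, Hj. }
  rewrite E.
  transitivity (Ci * (Ci * (B - A))).
  { replace (Ci * (Ci * (B - A))) with (Ci * Ci * (B - A)) by ring.
    replace (Ci * Ci) with (- (1)) by (apply injective_projections; simpl; ring).
    ring. }
  rewrite HC.
  replace (fun x : R => primitive N lq a (0 + PI * Ci + x * lq))
    with (fun x : R => primitive N lq a (PI * Ci + x * lq))
    by (apply functional_extensionality; intros x; f_equal; ring).
  replace (fun x : R => primitive N lq a (0 - PI * Ci + x * lq))
    with (fun x : R => primitive N lq a (- (PI * Ci) + x * lq))
    by (apply functional_extensionality; intros x; f_equal; ring).
  ring.
Qed.

Lemma Cexp_2PI_nat (k : nat) (w : C) : Cexp (w + 2 * INR k * PI * Ci) = Cexp w.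
Proof.
  rewrite Cexp_plus.
  replace (2 * INR k * PI * Ci) with (INR k * (Ci * PI + Ci * PI)) by ring.
  rewrite Cexp_INR, Cexp_plus, Cexp_PI.
  replace (- (1) * - (1)) with (RtoC 1) by ring; rewrite Cpow_1_l; ring.
Qed.

Lemma primitive_periodic (a : nat -> C) (w : C) :
  Nat.Even N ->
  primitive N lq a (PI * Ci + w) = primitive N lq a (- (PI * Ci) + w).
Proof.
  intros [k Hk].
  assert (E1 : Cexp (PI * Ci + w) = Cexp (- (PI * Ci) + w)).
  { replace (PI * Ci + w) with ((- (PI * Ci) + w) + 2 * INR 1 * PI * Ci)
      by (simpl; ring).
    apply Cexp_2PI_nat. }
  assert (E2 : Cexp (INR N * (PI * Ci + w) / 2) =
    Cexp (INR N * (- (PI * Ci) + w) / 2)).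
  { replace (INR N * (PI * Ci + w) / 2) with
      (INR N * (- (PI * Ci) + w) / 2 + 2 * INR k * PI * Ci).
    - apply Cexp_2PI_nat.
    - assert (EN : INR N = (2 * INR k)%R) by (rewrite Hk, mult_INR; reflexivity).
      rewrite EN, RtoC_mult; field. }
  unfold primitive, theta_w; rewrite E1, E2; reflexivity.
Qed.

Lemma g_sum_even (a : nat -> C) :
  Nat.Even N -> a O <> 0 -> (forall j, (j < 2 * N)%nat -> (Cmod (a j) < 1)%R) ->
  Csum (fun i => g N q a i (a O) * I_int N lq (shift_first q a i)) N = 0.
Proof.
  intros HE Ha0 Ha; pose proof PI_RGT_0 as Hpi.
  pose proof (g_sum_circle a Ha0 Ha) as H.
  replace (CInt (fun x => primitive N lq a (PI * Ci + x * lq)) 0 1)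
    with (CInt (fun x => primitive N lq a (- (PI * Ci) + x * lq)) 0 1) in H.
  2: { f_equal; apply functional_extensionality; intros x; symmetry.
       apply primitive_periodic, HE. }
  rewrite (Csum_ext _ (fun i => g N q a i (a O) * int_circle N lq (shift_first q a i))).
  2: { intros i _; unfold I_int; apply Nat.even_spec in HE; rewrite HE; reflexivity. }
  set (S := Csum _ N) in *.
  assert (Hpi2 : 2 * PI <> 0) by (apply Cmult_neq_0; [apply C2_neq_0|apply RtoC_neq_0; lra]).
  replace S with (/ (2 * PI) * (2 * PI * S)).
  - rewrite H; ring.
  - field; apply RtoC_neq_0; lra.
Qed.

End Integrand.

(** * Factorization of the integrand along the cut *)

(** The quasi-periodic part of the integrand: a quotient of theta functions
    in base [q] and [p]. *)
Definition quasi_periodic (N : nat) (lq : C) (a : nat -> C) (w : C) : C :=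
  Cexp w * theta_w N lq w *
  / Cprod (fun j => qpoch_inf (a j * Cexp w) (Cexp lq) *
                    qpoch_inf (Cexp lq / (a j * Cexp w)) (Cexp lq)) (2 * N).

(** The other part of the integrand, in the variable [v = 1/z]; it is
    analytic for [|v| < 1 / max |a_j|], a neighborhood of infinity that
    contains the unit circle. *)
Definition analytic_part (N : nat) (q : C) (a : nat -> C) (v : C) : C :=
  (1 - v * v) *
  Cprod (fun j => qpoch_inf (q * v / a j) q * / qpoch_inf (a j * v) q) (2 * N).

(** The corresponding part of [primitive]; it is analytic in a larger disc,
    by the factor [1/|q|]. *)
Definition primitive_part (N : nat) (q : C) (a : nat -> C) (v : C) : C :=
  Cprod (fun j => qpoch_inf (q * v / a j) q * / qpoch_inf (q * a j * v) q) (2 * N).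

(** The integrand is multiplied by this factor, up to terms that tend to 1,
    when [z] is replaced by [z / q]; the tail converges when its modulus is
    less than 1. *)
Definition multiplier (N : nat) (q : C) (a : nat -> C) : C :=
  q ^ (N - 1) / Cprod a (2 * N).

(** Multiplying the first parameter by [q ^ i] multiplies the quasi-periodic
    part by this constant and [z ^ i]. *)
Definition shift_const (q x : C) (i : nat) : C := Cprod (fun k => - (x * q ^ k)) i.

Lemma qpoch_inf_factor_neq_0 (b q : C) (k : nat) :
  (Cmod q < 1)%R -> qpoch_inf b q <> 0 -> 1 - b * q ^ k <> 0.
Proof.
  intros Hq Hb E; apply Hb; rewrite (qpoch_inf_split b q (S k)) by exact Hq.
  unfold qpoch; simpl; rewrite E; ring.
Qed.

Lemma Cpow_opp_even (z : C) (n : nat) : (- z) ^ (2 * n) = z ^ (2 * n).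
Proof.
  rewrite !Cpow_mult_r; f_equal; simpl; ring.
Qed.

Section Factorization.

Context (N : nat) (lq : C) (HN : (1 <= N)%nat) (Hlq : (Re lq < 0)%R).

Let q := Cexp lq.

Lemma Phi_reg_factorization (a : nat -> C) (w : C) :
  (forall j, (j < 2 * N)%nat -> a j <> 0) ->
  (forall j, (j < 2 * N)%nat -> qpoch_inf (a j * Cexp w) q <> 0 /\
     qpoch_inf (a j / Cexp w) q <> 0 /\ qpoch_inf (q / (a j * Cexp w)) q <> 0) ->
  Phi_reg N lq a w = quasi_periodic N lq a w * analytic_part N q a (/ Cexp w).
Proof.
  intros Ha H; unfold Phi_reg, quasi_periodic, analytic_part, denom; fold q.
  set (z := Cexp w) in *.
  assert (Hz : z <> 0) by apply Cexp_neq_0.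
  rewrite (Cprod_mult (fun j => qpoch_inf (a j * z) q)
    (fun j => qpoch_inf (a j / z) q)).
  rewrite (Cprod_mult (fun j => qpoch_inf (a j * z) q)
    (fun j => qpoch_inf (q / (a j * z)) q)).
  rewrite (Cprod_mult (fun j => qpoch_inf (q * / z / a j) q)
    (fun j => / qpoch_inf (a j * / z) q)).
  rewrite Cprod_inv by (intros j Hj; apply (H j Hj)).
  rewrite (Cprod_ext (fun j => qpoch_inf (q * / z / a j) q)
    (fun j => qpoch_inf (q / (a j * z)) q)).
  2: { intros j Hj; f_equal; field; auto. }
  assert (N1 : Cprod (fun j => qpoch_inf (a j * z) q) (2 * N) <> 0)
    by (apply Cprod_neq_0; intros j Hj; exact (proj1 (H j Hj))).
  assert (N2 : Cprod (fun j => qpoch_inf (a j / z) q) (2 * N) <> 0)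
    by (apply Cprod_neq_0; intros j Hj; exact (proj1 (proj2 (H j Hj)))).
  assert (N3 : Cprod (fun j => qpoch_inf (q / (a j * z)) q) (2 * N) <> 0)
    by (apply Cprod_neq_0; intros j Hj; exact (proj2 (proj2 (H j Hj)))).
  change (fun j => qpoch_inf (a j * / z) q) with (fun j => qpoch_inf (a j / z) q).
  set (A := Cprod (fun j => qpoch_inf (a j * z) q) (2 * N)) in *.
  set (B := Cprod (fun j => qpoch_inf (a j / z) q) (2 * N)) in *.
  set (D := Cprod (fun j => qpoch_inf (q / (a j * z)) q) (2 * N)) in *.
  field; auto.
Qed.

Lemma primitive_factorization (a : nat -> C) (w : C) :
  (forall j, (j < 2 * N)%nat -> a j <> 0) ->
  (forall j, (j < 2 * N)%nat -> qpoch_inf (a j * Cexp w) q <> 0 /\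
     qpoch_inf (q * a j / Cexp w) q <> 0 /\ qpoch_inf (q / (a j * Cexp w)) q <> 0) ->
  primitive N lq a w =
  quasi_periodic N lq a w * Cexp w ^ (N - 1) * primitive_part N q a (/ Cexp w).
Proof.
  intros Ha H; unfold primitive, quasi_periodic, primitive_part; fold q.
  set (z := Cexp w) in *.
  assert (Hz : z <> 0) by apply Cexp_neq_0.
  replace (z ^ N) with (z * z ^ (N - 1))
    by (change (z * z ^ (N - 1)) with (z ^ S (N - 1)); f_equal; lia).
  rewrite (Cprod_mult (fun j => qpoch_inf (a j * z) q)
    (fun j => qpoch_inf (q * a j / z) q)).
  rewrite (Cprod_mult (fun j => qpoch_inf (a j * z) q)
    (fun j => qpoch_inf (q / (a j * z)) q)).
  rewrite (Cprod_mult (fun j => qpoch_inf (q * / z / a j) q)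
    (fun j => / qpoch_inf (q * a j * / z) q)).
  rewrite Cprod_inv by (intros j Hj; apply (H j Hj)).
  rewrite (Cprod_ext (fun j => qpoch_inf (q * / z / a j) q)
    (fun j => qpoch_inf (q / (a j * z)) q)).
  2: { intros j Hj; f_equal; field; auto. }
  assert (N1 : Cprod (fun j => qpoch_inf (a j * z) q) (2 * N) <> 0)
    by (apply Cprod_neq_0; intros j Hj; exact (proj1 (H j Hj))).
  assert (N2 : Cprod (fun j => qpoch_inf (q * a j / z) q) (2 * N) <> 0)
    by (apply Cprod_neq_0; intros j Hj; exact (proj1 (proj2 (H j Hj)))).
  assert (N3 : Cprod (fun j => qpoch_inf (q / (a j * z)) q) (2 * N) <> 0)
    by (apply Cprod_neq_0; intros j Hj; exact (proj2 (proj2 (H j Hj)))).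
  change (fun j => qpoch_inf (q * a j * / z) q) with (fun j => qpoch_inf (q * a j / z) q).
  set (A := Cprod (fun j => qpoch_inf (a j * z) q) (2 * N)) in *.
  set (B := Cprod (fun j => qpoch_inf (q * a j / z) q) (2 * N)) in *.
  set (D := Cprod (fun j => qpoch_inf (q / (a j * z)) q) (2 * N)) in *.
  field; auto.
Qed.

(** The factor [1 - b] of the first symbol becomes [1 - 1/b] in the second. *)
Lemma theta_step (b : C) :
  b <> 0 -> qpoch_inf b q <> 0 ->
  qpoch_inf (b * q) q * qpoch_inf (q / (b * q)) q =
  - / b * (qpoch_inf b q * qpoch_inf (q / b) q).
Proof.
  intros Hb Hnz; pose proof (Cmod_q lq Hlq) as Hq.
  pose proof (q_neq_0 lq) as Hq0; fold q in Hq, Hq0.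
  assert (Hb1 : 1 - b <> 0).
  { pose proof (qpoch_inf_factor_neq_0 b q 0 Hq Hnz) as H; simpl in H.
    rewrite Cmult_1_r in H; exact H. }
  rewrite (qpoch_inf_shift b) by exact Hq.
  replace (q / (b * q)) with (/ b) by (field; auto).
  rewrite (qpoch_inf_shift (/ b)) by exact Hq.
  replace (/ b * q) with (q / b) by (unfold Cdiv; ring).
  field; exact Hb.
Qed.

Lemma quasi_periodic_shift (a : nat -> C) (w : C) :
  (forall j, (j < 2 * N)%nat -> a j <> 0) ->
  (forall j, (j < 2 * N)%nat -> qpoch_inf (a j * Cexp w) q <> 0 /\
     qpoch_inf (q / (a j * Cexp w)) q <> 0) ->
  quasi_periodic N lq a w = multiplier N q a * quasi_periodic N lq a (w + lq).
Proof.
  intros Ha H; unfold quasi_periodic, multiplier; fold q.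
  rewrite (theta_w_shift N lq HN Hlq), Cexp_plus; fold q.
  set (z := Cexp w) in *.
  assert (Hz : z <> 0) by apply Cexp_neq_0.
  assert (Hq0 : q <> 0) by apply Cexp_neq_0.
  rewrite (Cprod_ext (fun j => qpoch_inf (a j * (z * q)) q * qpoch_inf (q / (a j * (z * q))) q)
    (fun j => (- / z * / a j) * (qpoch_inf (a j * z) q * qpoch_inf (q / (a j * z)) q))).
  2: { intros j Hj.
       replace (a j * (z * q)) with (a j * z * q) by ring.
       rewrite theta_step; [|apply Cmult_neq_0; auto|exact (proj1 (H j Hj))].
       replace (- / (a j * z)) with (- / z * / a j) by (field; auto); ring. }
  rewrite (Cprod_mult (fun j => - / z * / a j)).
  rewrite (Cprod_mult (fun j => - / z) (fun j => / a j)).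
  rewrite Cprod_const, Cprod_inv, Cpow_opp_even, Cpow_inv by auto.
  assert (HX : Cprod (fun j => qpoch_inf (a j * z) q * qpoch_inf (q / (a j * z)) q)
    (2 * N) <> 0).
  { apply Cprod_neq_0; intros j Hj; exact (Cmult_neq_0 _ _ (proj1 (H j Hj)) (proj2 (H j Hj))). }
  set (X := Cprod (fun j => qpoch_inf (a j * z) q * qpoch_inf (q / (a j * z)) q) (2 * N))
    in *.
  assert (HA : Cprod a (2 * N) <> 0) by (apply Cprod_neq_0; auto).
  change (Cprod (fun x => a x) (2 * N)) with (Cprod a (2 * N)).
  set (A := Cprod a (2 * N)) in *.
  replace (2 * N)%nat with (N + N)%nat by lia; rewrite Cpow_add_r.
  replace (q ^ N) with (q * q ^ (N - 1))
    by (change (q * q ^ (N - 1)) with (q ^ S (N - 1)); f_equal; lia).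
  assert (z ^ N <> 0) by (apply Cpow_nz, Hz).
  assert (q ^ (N - 1) <> 0) by (apply Cpow_nz, Hq0).
  field; auto.
Qed.

Lemma quasi_periodic_shift_first (a : nat -> C) (i : nat) (w : C) :
  a O <> 0 ->
  (forall j, (j < 2 * N)%nat -> qpoch_inf (a j * Cexp w) q <> 0 /\
     qpoch_inf (q / (a j * Cexp w)) q <> 0) ->
  quasi_periodic N lq (shift_first q a i) w =
  shift_const q (a O) i * Cexp w ^ i * quasi_periodic N lq a w.
Proof.
  intros Ha H; unfold quasi_periodic; fold q.
  set (z := Cexp w) in *.
  pose proof (Cmod_q lq Hlq) as Hq; fold q in Hq.
  assert (Hz : z <> 0) by apply Cexp_neq_0.
  assert (Hq0 : q <> 0) by apply Cexp_neq_0.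
  replace (2 * N)%nat with (S (2 * N - 1)) in * by lia.
  rewrite !Cprod_Sl; simpl shift_first.
  set (R := Cprod (fun k => qpoch_inf (a (S k) * z) q * qpoch_inf (q / (a (S k) * z)) q)
    (2 * N - 1)).
  assert (HR : R <> 0).
  { apply Cprod_neq_0; intros k Hk; destruct (H (S k) ltac:(lia)) as [H1 H2].
    exact (Cmult_neq_0 _ _ H1 H2). }
  assert (HaiN : forall k, a O * q ^ k <> 0)
    by (intros k; apply Cmult_neq_0; auto; apply Cpow_nz, Hq0).
  assert (H0 : forall k, qpoch_inf (a O * q ^ k * z) q <> 0).
  { intros k E; apply (proj1 (H O ltac:(lia))).
    rewrite (qpoch_inf_split (a O * z) q k) by exact Hq.
    replace (a O * z * q ^ k) with (a O * q ^ k * z) by ring; rewrite E; ring. }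
  assert (E : shift_const q (a O) i * z ^ i *
    (qpoch_inf (a O * q ^ i * z) q * qpoch_inf (q / (a O * q ^ i * z)) q) =
    qpoch_inf (a O * z) q * qpoch_inf (q / (a O * z)) q).
  { induction i as [|i IH].
    - simpl; unfold shift_const; simpl; rewrite !Cmult_1_r, !Cmult_1_l; reflexivity.
    - rewrite <- IH.
      replace (a O * q ^ S i * z) with (a O * q ^ i * z * q) by (simpl; ring).
      rewrite theta_step; [|apply Cmult_neq_0; auto|apply H0].
      unfold shift_const; simpl.
      specialize (HaiN i); set (b := a O * q ^ i) in *; field; auto. }
  destruct (H O ltac:(lia)) as [H1 H2].
  rewrite <- E.
  assert (HE : qpoch_inf (a O * q ^ i * z) q * qpoch_inf (q / (a O * q ^ i * z)) q <> 0).
  { intros E0; rewrite E0, Cmult_0_r in E; revert E; apply not_eq_sym.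
    intros E'; revert E'; apply Cmult_neq_0; auto. }
  assert (HS : shift_const q (a O) i <> 0).
  { apply Cprod_neq_0; intros k _ E'; apply (HaiN k).
    replace (a O * q ^ k) with (- - (a O * q ^ k)) by ring; rewrite E'; ring. }
  assert (HZ : z ^ i <> 0) by (apply Cpow_nz, Hz).
  set (X := qpoch_inf (a O * q ^ i * z) q * qpoch_inf (q / (a O * q ^ i * z)) q) in *.
  field; auto.
Qed.

Lemma analytic_part_shift_first (a : nat -> C) (i : nat) (v : C) :
  a O <> 0 -> v <> 0 ->
  qpoch_inf (a O * v) q <> 0 ->
  shift_const q (a O) i * analytic_part N q (shift_first q a i) v =
  v ^ i * (qpoch (a O * v) q i * qpoch (a O / v) q i) * analytic_part N q a v.
Proof.
  intros Ha Hv H0; unfold analytic_part.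
  pose proof (Cmod_q lq Hlq) as Hq; fold q in Hq.
  assert (Hq0 : q <> 0) by apply Cexp_neq_0.
  replace (2 * N)%nat with (S (2 * N - 1)) by lia.
  rewrite !Cprod_Sl; simpl shift_first.
  set (R := Cprod (fun k => qpoch_inf (q * v / a (S k)) q * / qpoch_inf (a (S k) * v) q)
    (2 * N - 1)).
  assert (HaiN : forall k, a O * q ^ k <> 0)
    by (intros k; apply Cmult_neq_0; auto; apply Cpow_nz, Hq0).
  assert (Hk : forall k, qpoch_inf (a O * q ^ k * v) q <> 0).
  { intros k E; apply H0; rewrite (qpoch_inf_split (a O * v) q k) by exact Hq.
    replace (a O * v * q ^ k) with (a O * q ^ k * v) by ring; rewrite E; ring. }
  assert (E : shift_const q (a O) i *
      (qpoch_inf (q * v / (a O * q ^ i)) q * / qpoch_inf (a O * q ^ i * v) q) =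
    v ^ i * (qpoch (a O * v) q i * qpoch (a O / v) q i) *
      (qpoch_inf (q * v / a O) q * / qpoch_inf (a O * v) q)).
  { induction i as [|i IH].
    - unfold shift_const, qpoch; simpl; rewrite !Cmult_1_r, !Cmult_1_l; reflexivity.
    - assert (E1 : qpoch_inf (q * v / (a O * q ^ S i)) q =
        (1 - v / (a O * q ^ i)) * qpoch_inf (q * v / (a O * q ^ i)) q).
      { replace (q * v / (a O * q ^ S i)) with (v / (a O * q ^ i)).
        - rewrite (qpoch_inf_shift (v / (a O * q ^ i))) by exact Hq; do 2 f_equal.
          unfold Cdiv; ring.
        - simpl; field; repeat split; auto; apply Cpow_nz, Hq0. }
      assert (E2 : qpoch_inf (a O * q ^ i * v) q =
        (1 - a O * q ^ i * v) * qpoch_inf (a O * q ^ S i * v) q).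
      { rewrite qpoch_inf_shift by exact Hq; do 2 f_equal; simpl; ring. }
      rewrite E1.
      assert (E3 : / qpoch_inf (a O * q ^ S i * v) q =
        (1 - a O * q ^ i * v) * / qpoch_inf (a O * q ^ i * v) q).
      { rewrite E2; field; split; [apply Hk|].
        intros E'; apply (Hk i); rewrite E2, E'; ring. }
      rewrite E3.
      change (shift_const q (a O) (S i)) with
        (shift_const q (a O) i * - (a O * q ^ i)).
      change (qpoch (a O * v) q (S i)) with (qpoch (a O * v) q i * (1 - a O * v * q ^ i)).
      change (qpoch (a O / v) q (S i)) with (qpoch (a O / v) q i * (1 - a O / v * q ^ i)).
      transitivity ((shift_const q (a O) i *
        (qpoch_inf (q * v / (a O * q ^ i)) q * / qpoch_inf (a O * q ^ i * v) q)) *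
        (- (a O * q ^ i) * (1 - v / (a O * q ^ i)) * (1 - a O * q ^ i * v))).
      + ring.
      + rewrite IH.
        replace (- (a O * q ^ i) * (1 - v / (a O * q ^ i)) * (1 - a O * q ^ i * v))
          with (v * (1 - a O / v * q ^ i) * (1 - a O * v * q ^ i)).
        * simpl; ring.
        * specialize (HaiN i); field; split; [apply Cpow_nz, Hq0|auto]. }
  match goal with |- ?S * (?m * (?x * R)) = _ =>
    transitivity ((S * x) * (m * R)); [ring|rewrite E; ring] end.
Qed.

(** The quasi-periodic parts of the shifted integrands differ by powers of
    [z] only. So [g_interpolation] and the first difference can be read off
    on the factors that are analytic at infinity. *)
Lemma g_sum_analytic_part (a : nat -> C) (v : C) :
  (forall j, (j < 2 * N)%nat -> a j <> 0 /\ (Cmod (a j) < 1)%R) ->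
  v <> 0 -> (Cmod v <= 1)%R ->
  Csum (fun i => g N q a i (a O) * shift_const q (a O) i *
    (v ^ (N - 1 - i) * analytic_part N q (shift_first q a i) v)) N =
  primitive_part N q a v - Cprod a (2 * N) * primitive_part N q a (v / q).
Proof.
  intros Ha Hv Hv1.
  pose proof (Cmod_q lq Hlq) as Hq; fold q in Hq.
  assert (Hq0 : q <> 0) by apply Cexp_neq_0.
  assert (Hav : forall j, (j < 2 * N)%nat -> qpoch_inf (a j * v) q <> 0).
  { intros j Hj; apply qpoch_inf_neq_0; [exact Hq|].
    rewrite Cmod_mult; destruct (Ha j Hj) as [_ H].
    pose proof (Cmod_ge_0 (a j)); pose proof (Cmod_ge_0 v); nra. }
  destruct (Ha O ltac:(lia)) as [Ha0 Ha1].
  destruct (difference_polynomial N a) as [P [HP EP]].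
  rewrite (Csum_ext _ (fun i => v ^ (N - 1) * analytic_part N q a v *
    (g N q a i (a O) * (qpoch (a O * v) q i * qpoch (a O / v) q i)))).
  2: { intros i Hi.
       transitivity (g N q a i (a O) * v ^ (N - 1 - i) *
         (shift_const q (a O) i * analytic_part N q (shift_first q a i) v)); [ring|].
       rewrite analytic_part_shift_first by (auto; apply Hav; lia).
       replace (N - 1)%nat with ((N - 1 - i) + i)%nat at 2 by lia.
       rewrite Cpow_add_r; ring. }
  rewrite Csum_scal.
  rewrite (g_interpolation q (a O) Hq0 Hq Ha0 Ha1 N a P v HP EP Hv).
  unfold analytic_part.
  set (R := Cprod (fun j => qpoch_inf (q * v / a j) q * / qpoch_inf (a j * v) q) (2 * N)).
  assert (HvN : v ^ N <> 0) by (apply Cpow_nz, Hv).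
  assert (E : v ^ (N - 1) * (1 - v * v) * P (v + / v) =
    Cprod (fun j => 1 - a j * v) (2 * N)
    - Cprod a (2 * N) * Cprod (fun j => 1 - v / a j) (2 * N)).
  { transitivity (- v ^ N * ((v - / v) * P (v + / v))).
    - replace (v ^ N) with (v * v ^ (N - 1))
        by (change (v * v ^ (N - 1)) with (v ^ S (N - 1)); f_equal; lia).
      field; exact Hv.
    - rewrite EP by exact Hv.
      assert (E2 : v ^ N * v ^ N * Cprod (fun j => 1 - a j / v) (2 * N) =
        Cprod a (2 * N) * Cprod (fun j => 1 - v / a j) (2 * N)).
      { rewrite <- Cpow_add_r; replace (N + N)%nat with (2 * N)%nat by lia.
        rewrite <- Cpow_opp_even, <- Cprod_const, <- !Cprod_mult.
        apply Cprod_ext; intros j Hj; field; split; [apply Ha, Hj|exact Hv]. }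
      rewrite <- E2; field; exact HvN. }
  transitivity (v ^ (N - 1) * (1 - v * v) * P (v + / v) * R); [ring|].
  rewrite E.
  assert (E1 : Cprod (fun j => 1 - a j * v) (2 * N) * R = primitive_part N q a v).
  { unfold R, primitive_part; rewrite <- Cprod_mult; apply Cprod_ext; intros j Hj.
    pose proof (Hav j Hj) as Hj0; rewrite (qpoch_inf_shift (a j * v)) in Hj0 |- * by exact Hq.
    replace (q * a j * v) with (a j * v * q) by ring.
    field; split; intros E'; apply Hj0; rewrite E'; ring. }
  assert (E2 : Cprod (fun j => 1 - v / a j) (2 * N) * R = primitive_part N q a (v / q)).
  { unfold R, primitive_part; rewrite <- Cprod_mult; apply Cprod_ext; intros j Hj.
    assert (a j <> 0) by apply Ha, Hj.
    replace (q * (v / q) / a j) with (v / a j) by (field; auto).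
    replace (q * a j * (v / q)) with (a j * v) by (field; auto).
    rewrite (qpoch_inf_shift (v / a j)) by exact Hq.
    replace (v / a j * q) with (q * v / a j) by (unfold Cdiv; ring); ring. }
  rewrite <- E1, <- E2; ring.
Qed.

Lemma Cprod_shift_first (a : nat -> C) (i : nat) :
  Cprod (shift_first q a i) (2 * N) = Cprod a (2 * N) * q ^ i.
Proof.
  replace (2 * N)%nat with (S (2 * N - 1)) by lia.
  rewrite !Cprod_Sl; simpl; ring.
Qed.

End Factorization.

(** * Analytic dependence on the first exponent *)

Definition strip_rect (t0 : C) (r A B : R) (t u : C) : Prop :=
  disc t0 r t /\ exists y, (A <= y <= B)%R /\ u = RtoC y.

Lemma strip_rect_bounded (t0 : C) (r A B : R) : bounded2 (strip_rect t0 r A B).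
Proof.
  exists (Rmax (Cmod t0 + r) (Rabs A + Rabs B)); intros t u [Ht [y [Hy ->]]]; split.
  - eapply Rle_trans; [|apply Rmax_l]; unfold disc in Ht.
    pose proof (Cmod_triangle_inv t t0); lra.
  - eapply Rle_trans; [|apply Rmax_r]; rewrite Cmod_R.
    unfold Rabs; destruct (Rcase_abs y), (Rcase_abs A), (Rcase_abs B); lra.
Qed.

Section Cut.

Context (N : nat) (lq : C) (HN : (1 <= N)%nat) (Hlq : (Re lq < 0)%R)
  (Him : Im lq = 0%R) (s : nat -> C).

Let q := Cexp lq.

Lemma lq_real : lq = RtoC (Re lq).
Proof. apply injective_projections; [reflexivity|exact Him]. Qed.

Lemma Re_lq_mult (c : C) : Re (lq * c) = (Re lq * Re c)%R.
Proof. rewrite lq_real at 1; unfold Re; simpl; ring. Qed.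

Lemma Im_lq_mult (c : C) : Im (lq * c) = (Re lq * Im c)%R.
Proof. rewrite lq_real at 1; unfold Re, Im; simpl; ring. Qed.

(** All factors [1 + q^k e^f] lie in the half-plane of [Cexp_half_plane],
    since [q] is positive. *)
Lemma approx_inv_qpoch_neg (K : C -> C -> Prop) (f : C -> C -> C) (phi : R) :
  bounded2 K -> approx K f -> (Rabs phi < PI)%R ->
  (forall t u, K t u -> (Rabs (Im (f t u) - phi) <= (PI - Rabs phi) / 2)%R) ->
  approx K (fun t u => / qpoch_inf (- Cexp (f t u)) q) /\
  forall t u, K t u -> qpoch_inf (- Cexp (f t u)) q <> 0.
Proof.
  intros HK Hf Hphi H.
  apply (approx_inv_qpoch_inf K (fun t u => - Cexp (f t u)) q
    (Cexp (- (Ci * RtoC (phi / 2)%R))) (cos (phi / 2))); auto.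
  - apply Cmod_q, Hlq.
  - apply approx_ext with (fun t u => - (1) * Cexp (f t u)); [intros; ring|].
    apply approx_scal, approx_Cexp; auto.
  - apply cos_gt_0; unfold Rabs in *; destruct (Rcase_abs phi); lra.
  - replace (- (Ci * RtoC (phi / 2)%R)) with (Ci * RtoC (- (phi / 2))%R)
      by (rewrite RtoC_opp; ring).
    rewrite Cmod_Cexp_imag; lra.
  - intros k t u Htu.
    replace (1 - - Cexp (f t u) * q ^ k) with (1 + Cexp (f t u + INR k * lq)).
    + apply Cexp_half_plane; auto.
      replace (Im (f t u + INR k * lq)) with (Im (f t u)); [auto|].
      rewrite lq_real; unfold Im; simpl; ring.
    + rewrite Cexp_plus, Cexp_INR; fold q; ring.
Qed.

Definition log_param (t : C) (j : nat) : C := lq * set_first s t j.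

Definition param (t : C) : nat -> C := params lq (set_first s t).

Lemma param_Cexp (t : C) (j : nat) : param t j = Cexp (log_param t j).
Proof. reflexivity. Qed.

Lemma param_neq_0 (t : C) (j : nat) : param t j <> 0.
Proof. apply Cexp_neq_0. Qed.

(** The second condition keeps the poles of the integrand off the two sides
    of the cut. *)
Definition admissible (t : C) : Prop :=
  forall j, (j < 2 * N)%nat ->
    (Cmod (param t j) < 1)%R /\ (Rabs (Im (log_param t j)) < PI)%R.

Lemma admissible_shift (t : C) (i : nat) :
  admissible t -> admissible (t + INR i).
Proof.
  intros H j Hj; specialize (H j Hj); rewrite param_Cexp in *.
  destruct j as [|j]; [|exact H]; unfold log_param in *; simpl set_first in *.
  rewrite Cmod_Cexp in *; rewrite Re_lq_mult, Im_lq_mult in *.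
  replace (Re (t + INR i)) with (Re t + INR i)%R by (unfold Re; simpl; ring).
  replace (Im (t + INR i)) with (Im t) by (unfold Im; simpl; ring).
  split; [|apply H].
  eapply Rle_lt_trans; [|apply H]; pose proof (pos_INR i).
  destruct (Req_dec (INR i) 0) as [E|E].
  - rewrite E, Rplus_0_r; lra.
  - left; apply exp_increasing; nra.
Qed.

(** The bound leaves half of the distance to the cut; [Cexp_half_plane] asks
    for it. *)
Definition off_cut (t0 : C) (r : R) : Prop :=
  forall t, disc t0 r t -> forall j, (j < 2 * N)%nat ->
    (Rabs (Im (log_param t j) - Im (log_param t0 j)) <=
     (PI - Rabs (Im (log_param t0 j))) / 2)%R.

(** Radius 0 gives the statements about a single exponent as special cases of
    the uniform ones. *)
Lemma off_cut_center (t : C) : admissible t -> off_cut t 0.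
Proof.
  intros Ht t' Ht' j Hj; unfold disc in Ht'.
  replace t' with t.
  - rewrite Rminus_diag, Rabs_R0; destruct (Ht j Hj) as [_ H]; lra.
  - replace t' with (t' - t + t) by ring.
    rewrite (Cmod_eq_0 (t' - t)); [ring|].
    pose proof (Cmod_ge_0 (t' - t)); lra.
Qed.

Lemma admissible_nbhd (t0 : C) :
  admissible t0 -> exists r rho, (0 < r)%R /\ (0 < rho < 1)%R /\
    forall t, disc t0 r t -> forall j, (j < 2 * N)%nat ->
      (Cmod (param t j) <= rho)%R /\
      (Rabs (Im (log_param t j) - Im (log_param t0 j)) <=
       (PI - Rabs (Im (log_param t0 j))) / 2)%R.
Proof.
  intros H.
  destruct (H O ltac:(lia)) as [H1 H2].
  rewrite param_Cexp, Cmod_Cexp in H1; unfold log_param in H1, H2; simpl set_first in H1, H2.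
  rewrite Re_lq_mult in H1; rewrite Im_lq_mult in H2.
  assert (Hre : (0 < Re t0)%R).
  { apply Rnot_le_lt; intros Hle.
    assert (1 <= exp (Re lq * Re t0))%R; [|lra].
    rewrite <- exp_0; apply exp_le_exp; nra. }
  set (phi := (Re lq * Im t0)%R) in *.
  set (r := Rmin (Re t0 / 2) ((PI - Rabs phi) / 2 / - Re lq)).
  assert (Hr : (0 < r)%R).
  { unfold r; apply Rmin_pos; [lra|repeat apply Rdiv_lt_0_compat; lra]. }
  destruct (finite_max (fun j => Cmod (param t0 (S j))) (2 * N - 1) 1)
    as [m [Hm1 Hm2]].
  { intros j Hj; apply (H (S j)); lia. }
  set (e := exp (Re lq * (Re t0 / 2))).
  assert (He : (0 < e < 1)%R).
  { split; [apply exp_pos|]; unfold e; rewrite <- exp_0; apply exp_increasing; nra. }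
  exists r, (Rmax m e); split; [exact Hr|]; split.
  - split; [eapply Rlt_le_trans; [apply He|apply Rmax_r]|].
    apply Rmax_lub_lt; lra.
  - intros t Ht j Hj; unfold disc in Ht.
    pose proof (Rmin_l (Re t0 / 2) ((PI - Rabs phi) / 2 / - Re lq)) as M1.
    pose proof (Rmin_r (Re t0 / 2) ((PI - Rabs phi) / 2 / - Re lq)) as M2.
    fold r in M1, M2.
    destruct j as [|j].
    + rewrite param_Cexp, Cmod_Cexp; unfold log_param; simpl set_first.
      rewrite Re_lq_mult, !Im_lq_mult; split.
      * eapply Rle_trans; [|apply Rmax_r].
        pose proof (re_le_Cmod (t - t0)) as HR.
        replace (Re (t - t0)) with (Re t - Re t0)%R in HR by (unfold Re; simpl; ring).
        assert (Re t0 / 2 <= Re t)%R.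
        { unfold Rabs in HR; destruct (Rcase_abs (Re t - Re t0)); lra. }
        unfold e; apply exp_le_exp; nra.
      * fold phi.
        pose proof (Im_le_Cmod (t - t0)) as HI.
        replace (Im (t - t0)) with (Im t - Im t0)%R in HI by (unfold Im; simpl; ring).
        replace (Re lq * Im t - phi)%R with (Re lq * (Im t - Im t0))%R
          by (unfold phi; ring).
        rewrite Rabs_mult, (Rabs_left (Re lq)) by exact Hlq.
        replace ((PI - Rabs phi) / 2)%R
          with (- Re lq * ((PI - Rabs phi) / 2 / - Re lq))%R by (field; lra).
        apply Rmult_le_compat_l; lra.
    + split.
      * eapply Rle_trans; [|apply Rmax_l].
        apply (Hm2 j); lia.
      * unfold log_param; simpl set_first; rewrite Rminus_diag, Rabs_R0.
        pose proof (proj2 (H (S j) Hj)) as H3; unfold log_param in H3; simpl set_first in H3.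
        lra.
Qed.

Lemma approx_log_param (K : C -> C -> Prop) (j : nat) :
  bounded2 K -> approx K (fun t _ => log_param t j).
Proof.
  intros HK; unfold log_param; destruct j as [|j]; simpl set_first.
  - apply approx_scal; auto using approx_fst.
  - apply approx_const.
Qed.

Lemma Cexp_cut (u : C) : Cexp (u + PI * Ci) = - Cexp u.
Proof.
  rewrite Cexp_plus; replace (PI * Ci) with (Ci * PI) by ring.
  rewrite Cexp_PI; ring.
Qed.

Lemma param_mult_cut (t u : C) (j : nat) :
  param t j * Cexp (u + PI * Ci) = - Cexp (log_param t j + u).
Proof. rewrite Cexp_cut, param_Cexp, Cexp_plus; ring. Qed.

Lemma param_div_cut (t u : C) (j : nat) :
  param t j / Cexp (u + PI * Ci) = - Cexp (log_param t j + - (1) * u).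
Proof.
  rewrite Cexp_cut, param_Cexp, Cexp_plus.
  replace (- (1) * u) with (- u) by ring; rewrite Cexp_opp.
  pose proof (Cexp_neq_0 u) as H; field; exact H.
Qed.

Lemma q_div_param_cut (t u : C) (j : nat) :
  q / (param t j * Cexp (u + PI * Ci)) =
  - Cexp (lq + - (1) * log_param t j + - (1) * u).
Proof.
  rewrite param_mult_cut, !Cexp_plus.
  replace (- (1) * u) with (- u) by ring.
  replace (- (1) * log_param t j) with (- log_param t j) by ring.
  rewrite !Cexp_opp; fold q.
  pose proof (Cexp_neq_0 u); pose proof (Cexp_neq_0 (log_param t j)).
  field; auto.
Qed.

(** On the cut [z] is negative, so each argument is minus the exponential of
    a number whose imaginary part is that of [log_param t j] up to sign. *)
Lemma approx_inv_cut_factors (t0 : C) (r A B : R) (j : nat) :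
  (Rabs (Im (log_param t0 j)) < PI)%R ->
  (forall t, disc t0 r t -> (Rabs (Im (log_param t j) - Im (log_param t0 j)) <=
     (PI - Rabs (Im (log_param t0 j))) / 2)%R) ->
  let K := strip_rect t0 r A B in
  (approx K (fun t u => / qpoch_inf (param t j * Cexp (u + PI * Ci)) q) /\
   forall t u, K t u -> qpoch_inf (param t j * Cexp (u + PI * Ci)) q <> 0) /\
  (approx K (fun t u => / qpoch_inf (param t j / Cexp (u + PI * Ci)) q) /\
   forall t u, K t u -> qpoch_inf (param t j / Cexp (u + PI * Ci)) q <> 0) /\
  (approx K (fun t u => / qpoch_inf (q / (param t j * Cexp (u + PI * Ci))) q) /\
   forall t u, K t u -> qpoch_inf (q / (param t j * Cexp (u + PI * Ci))) q <> 0).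
Proof.
  intros H1 H2 K; pose proof (strip_rect_bounded t0 r A B) as HK.
  pose proof (approx_log_param K j HK) as HL.
  assert (X : forall b f phi, approx K f -> (forall t u, b t u = - Cexp (f t u)) ->
    (Rabs phi < PI)%R ->
    (forall t u, K t u -> (Rabs (Im (f t u) - phi) <= (PI - Rabs phi) / 2)%R) ->
    approx K (fun t u => / qpoch_inf (b t u) q) /\
    forall t u, K t u -> qpoch_inf (b t u) q <> 0).
  { intros b f phi Hf Hb Hphi Hd.
    destruct (approx_inv_qpoch_neg K f phi HK Hf Hphi Hd) as [X1 X2]; split.
    - apply approx_ext with (fun t u => / qpoch_inf (- Cexp (f t u)) q); [|exact X1].
      intros t u _; rewrite Hb; reflexivity.
    - intros t u Htu; rewrite Hb; apply X2, Htu. }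
  split; [|split].
  - apply (X _ (fun t u => log_param t j + u) (Im (log_param t0 j))); auto.
    + apply approx_plus; auto using approx_snd.
    + intros t u; apply param_mult_cut.
    + intros t u [Ht [y [_ ->]]]; rewrite Im_add_real; auto.
  - apply (X _ (fun t u => log_param t j + - (1) * u) (Im (log_param t0 j))); auto.
    + apply approx_plus; auto; apply approx_scal; auto using approx_snd.
    + intros t u; apply param_div_cut.
    + intros t u [Ht [y [_ ->]]].
      replace (- (1) * RtoC y) with (RtoC (- y)%R) by (rewrite RtoC_opp; ring).
      rewrite Im_add_real; auto.
  - apply (X _ (fun t u => lq + - (1) * log_param t j + - (1) * u)
      (- Im (log_param t0 j))%R); rewrite ?Rabs_Ropp; auto.
    + apply approx_plus; [apply approx_plus; [apply approx_const|]|];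
        apply approx_scal; auto using approx_snd.
    + intros t u; apply q_div_param_cut.
    + intros t u [Ht [y [_ ->]]].
      replace (- (1) * RtoC y) with (RtoC (- y)%R) by (rewrite RtoC_opp; ring).
      rewrite Im_add_real.
      replace (Im (lq + - (1) * log_param t j)) with (- Im (log_param t j))%R.
      * replace (- Im (log_param t j) - - Im (log_param t0 j))%R
          with (- (Im (log_param t j) - Im (log_param t0 j)))%R by ring.
        rewrite Rabs_Ropp; auto.
      * rewrite lq_real at 1; unfold Im; simpl; ring.
Qed.

Lemma cut_factors_neq_0 (t : C) (y : R) :
  admissible t -> forall j, (j < 2 * N)%nat ->
  qpoch_inf (param t j * Cexp (y + PI * Ci)) q <> 0 /\
  qpoch_inf (param t j / Cexp (y + PI * Ci)) q <> 0 /\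
  qpoch_inf (q / (param t j * Cexp (y + PI * Ci))) q <> 0.
Proof.
  intros H j Hj; destruct (H j Hj) as [_ H2].
  destruct (approx_inv_cut_factors t 0 y y j H2) as [[_ X1] [[_ X2] [_ X3]]].
  - intros t' Ht'; apply (off_cut_center t H t' Ht' j Hj).
  - assert (K : strip_rect t 0 y y t (RtoC y)).
    { split; [apply disc_center; lra|exists y; split; [lra|reflexivity]]. }
    repeat split; [apply X1|apply X2|apply X3]; exact K.
Qed.

Lemma approx_Phi_reg_cut (t0 : C) (r A B : R) :
  admissible t0 ->
  off_cut t0 r ->
  approx (strip_rect t0 r A B) (fun t u => Phi_reg N lq (param t) (u + PI * Ci)).
Proof.
  intros H0 H; pose proof (strip_rect_bounded t0 r A B) as HK.
  set (K := strip_rect t0 r A B) in *.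
  assert (Hu : approx K (fun _ u => u + PI * Ci)).
  { apply approx_plus; [apply approx_snd|apply approx_const]. }
  unfold Phi_reg, denom; fold q.
  apply approx_mult; auto.
  - apply approx_mult; auto.
    + apply approx_minus; auto; [apply approx_Cexp|apply approx_Cexp_inv]; auto.
    + apply (approx_theta_w N lq HN Hlq _ (fun _ u => u + PI * Ci)); auto.
  - apply (approx_inv_Cprod _ (fun j t u =>
      qpoch_inf (param t j * Cexp (u + PI * Ci)) q *
      qpoch_inf (param t j / Cexp (u + PI * Ci)) q)); auto.
    intros j Hj.
    destruct (approx_inv_cut_factors t0 r A B j) as [X1 [X2 _]].
    + apply (H0 j Hj).
    + intros t Ht; apply (H t Ht j Hj).
    + apply (approx_inv_mult _ (fun t u => qpoch_inf (param t j * Cexp (u + PI * Ci)) q)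
        (fun t u => qpoch_inf (param t j / Cexp (u + PI * Ci)) q)); auto.
Qed.

Lemma approx_quasi_periodic_cut (t0 : C) (r A B : R) :
  admissible t0 ->
  off_cut t0 r ->
  approx (strip_rect t0 r A B)
    (fun t u => quasi_periodic N lq (param t) (u + PI * Ci)).
Proof.
  intros H0 H; pose proof (strip_rect_bounded t0 r A B) as HK.
  set (K := strip_rect t0 r A B) in *.
  assert (Hu : approx K (fun _ u => u + PI * Ci)).
  { apply approx_plus; [apply approx_snd|apply approx_const]. }
  unfold quasi_periodic; fold q.
  apply approx_mult; auto.
  - apply approx_mult; auto.
    + apply approx_Cexp; auto.
    + apply (approx_theta_w N lq HN Hlq _ (fun _ u => u + PI * Ci)); auto.
  - apply (approx_inv_Cprod _ (fun j t u =>
      qpoch_inf (param t j * Cexp (u + PI * Ci)) q *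
      qpoch_inf (q / (param t j * Cexp (u + PI * Ci))) q)); auto.
    intros j Hj.
    destruct (approx_inv_cut_factors t0 r A B j) as [X1 [_ X3]].
    + apply (H0 j Hj).
    + intros t Ht; apply (H t Ht j Hj).
    + apply (approx_inv_mult _ (fun t u => qpoch_inf (param t j * Cexp (u + PI * Ci)) q)
        (fun t u => qpoch_inf (q / (param t j * Cexp (u + PI * Ci))) q)); auto.
Qed.

Lemma approx_param (K : C -> C -> Prop) (j : nat) :
  bounded2 K -> approx K (fun t _ => param t j).
Proof.
  intros HK; apply (approx_Cexp K (fun t _ => log_param t j)); auto.
  apply approx_log_param, HK.
Qed.

Lemma approx1_int_circle (t0 : C) (r rho : R) :
  (rho < 1)%R ->
  (forall t, disc t0 r t -> forall j, (j < 2 * N)%nat -> (Cmod (param t j) <= rho)%R) ->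
  approx1 (disc t0 r) (fun t => int_circle N lq (param t)).
Proof.
  intros Hrho H; pose proof PI_RGT_0 as Hpi.
  pose proof (Cmod_q lq Hlq) as Hq.
  pose proof (strip_rect_bounded t0 r (- PI) PI) as HK.
  set (K := strip_rect t0 r (- PI) PI) in *.
  assert (Hu : approx K (fun _ u => u * Ci)).
  { apply approx_mult; auto using approx_snd, approx_const. }
  assert (Hmod : forall t u, K t u -> Cmod (Cexp (u * Ci)) = 1%R).
  { intros t u [_ [y [_ ->]]]; rewrite Cmult_comm; apply Cmod_Cexp_imag. }
  assert (HP : approx K (fun t u => Phi_reg N lq (param t) (u * Ci))).
  { unfold Phi_reg, denom; fold q.
    apply approx_mult; auto.
    - apply approx_mult; auto.
      + apply approx_minus; auto; [apply approx_Cexp|apply approx_Cexp_inv]; auto.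
      + apply (approx_theta_w N lq HN Hlq _ (fun _ u => u * Ci)); auto.
    - apply (approx_inv_Cprod _ (fun j t u => qpoch_inf (param t j * Cexp (u * Ci)) q *
        qpoch_inf (param t j / Cexp (u * Ci)) q)); auto.
      intros j Hj; pose proof (approx_param K j HK) as Hp.
      apply (approx_inv_mult _ (fun t u => qpoch_inf (param t j * Cexp (u * Ci)) q)
        (fun t u => qpoch_inf (param t j / Cexp (u * Ci)) q)); auto.
      + apply (approx_inv_qpoch_inf_small _ (fun t u => param t j * Cexp (u * Ci)) q rho);
          auto.
        * apply approx_mult; auto; apply approx_Cexp; auto.
        * intros t u Htu; rewrite Cmod_mult, (Hmod t u Htu).
          destruct Htu as [Ht _]; specialize (H t Ht j Hj); lra.
      + apply (approx_inv_qpoch_inf_small _ (fun t u => param t j / Cexp (u * Ci)) q rho);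
          auto.
        * apply approx_mult; auto; apply approx_Cexp_inv; auto.
        * intros t u Htu; rewrite Cmod_div, (Hmod t u Htu) by apply Cexp_neq_0.
          destruct Htu as [Ht _]; specialize (H t Ht j Hj); lra. }
  pose proof (approx_int K _ (disc t0 r) (- PI) PI ltac:(lra) HP) as HI.
  assert (HD : approx1 (disc t0 r) (fun t => / (2 * PI) *
    CInt (fun x => Phi_reg N lq (param t) (RtoC x * Ci)) (- PI) PI)).
  { apply approx_scal; [apply bounded1_2, disc_bounded|apply HI].
    intros t x Ht Hx; split; [exact Ht|exists x; auto]. }
  eapply approx_ext; [|exact HD].
  intros t u [Ht _]; cbv beta.
  assert (Hc := int_circle_reg N lq HN Hlq (param t)
    ltac:(intros j Hj; specialize (H t Ht j Hj); lra)).
  rewrite (is_CInt_unique _ _ _ _ Hc); field; apply RtoC_neq_0; lra.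
Qed.

Definition coef (t : C) (m : nat) : C :=
  circle_coef (analytic_part N q (param t)) 1 m.

Lemma q_div_param (t : C) (j : nat) : q / param t j = Cexp (lq + - (1) * log_param t j).
Proof.
  rewrite Cexp_plus; replace (- (1) * log_param t j) with (- log_param t j) by ring.
  rewrite Cexp_opp; reflexivity.
Qed.

Lemma approx_analytic_part (t0 : C) (r rho R0 : R) :
  (rho < 1)%R ->
  (forall t, disc t0 r t -> forall j, (j < 2 * N)%nat ->
     (Cmod (param t j) * R0 <= rho)%R) ->
  approx (fun t v => disc t0 r t /\ disc 0 R0 v)
    (fun t v => analytic_part N q (param t) v).
Proof.
  intros Hrho H; pose proof (Cmod_q lq Hlq) as Hq.
  set (K := fun t v => disc t0 r t /\ disc 0 R0 v).
  assert (HK : bounded2 K).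
  { destruct (disc_bounded t0 r) as [B1 HB1], (disc_bounded 0 R0) as [B2 HB2].
    exists (Rmax B1 B2); intros t v [Ht Hv]; split.
    - eapply Rle_trans; [apply HB1, Ht|apply Rmax_l].
    - eapply Rle_trans; [apply HB2, Hv|apply Rmax_r]. }
  unfold analytic_part; apply approx_mult; auto.
  - apply approx_minus; auto using approx_const.
    apply approx_mult; auto using approx_snd.
  - apply (approx_Cprod K (fun j t v => qpoch_inf (q * v / param t j) q *
      / qpoch_inf (param t j * v) q)); auto.
    intros j Hj; apply approx_mult; auto.
    + apply approx_qpoch_inf; auto.
      apply approx_ext with (fun t v => Cexp (lq + - (1) * log_param t j) * v).
      * intros t v _; rewrite <- q_div_param; unfold Cdiv; ring.
      * apply approx_mult; auto using approx_snd.
        apply approx_Cexp, approx_plus; auto using approx_const.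
        apply approx_scal, approx_log_param; auto.
    + apply (approx_inv_qpoch_inf_small K (fun t v => param t j * v) q rho); auto.
      * apply approx_mult; auto using approx_snd, approx_param.
      * intros t v [Ht Hv]; rewrite Cmod_mult.
        eapply Rle_trans; [|apply (H t Ht j Hj)].
        apply Rmult_le_compat_l; [apply Cmod_ge_0|].
        unfold disc in Hv; replace (v - 0) with v in Hv by ring; exact Hv.
Qed.

(** The integrand factor is analytic beyond the unit circle, so its Taylor
    coefficients decay geometrically, uniformly in the exponent. *)
Lemma coef_uniform (t0 : C) (r rho : R) :
  (0 < r)%R -> (0 < rho < 1)%R ->
  (forall t, disc t0 r t -> forall j, (j < 2 * N)%nat -> (Cmod (param t j) <= rho)%R) ->
  exists M sig, (0 <= sig < 1)%R /\
    (forall m, approx1 (disc t0 r) (fun t => coef t m)) /\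
    (forall t m, disc t0 r t -> (Cmod (coef t m) <= M * sig ^ m)%R) /\
    (forall t v n, disc t0 r t -> (Cmod v <= 1)%R ->
      (Cmod (analytic_part N q (param t) v -
         Csum (fun k => (coef t k * v ^ k)%C) n) <= M * sig ^ n)%R).
Proof.
  intros Hr Hrho H.
  set (sig := ((1 + rho) / 2)%R).
  assert (Hsig : (0 < sig < 1)%R) by (unfold sig; lra).
  set (R0 := (/ sig)%R).
  assert (HR0 : (1 < R0)%R).
  { unfold R0; rewrite <- Rinv_1; apply Rinv_lt_contravar; lra. }
  assert (Hrs : (rho * R0 < 1)%R).
  { apply Rmult_lt_reg_r with sig; [lra|].
    unfold R0; rewrite Rmult_assoc, Rinv_l; unfold sig; lra. }
  assert (HA : approx (fun t v => disc t0 r t /\ disc 0 R0 v)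
    (fun t v => analytic_part N q (param t) v)).
  { apply approx_analytic_part with (rho * R0)%R; auto.
    intros t Ht j Hj; apply Rmult_le_compat_r; [lra|auto]. }
  assert (HK : bounded2 (fun t v => disc t0 r t /\ disc 0 R0 v)).
  { destruct (disc_bounded t0 r) as [B1 HB1], (disc_bounded 0 R0) as [B2 HB2].
    exists (Rmax B1 B2); intros t v [Ht Hv]; split.
    - eapply Rle_trans; [apply HB1, Ht|apply Rmax_l].
    - eapply Rle_trans; [apply HB2, Hv|apply Rmax_r]. }
  destruct (approx_bounded _ _ HK HA) as [B [HB HAB]].
  assert (HS : forall t, disc t0 r t -> approx1 (disc 0 R0) (analytic_part N q (param t))).
  { intros t Ht; apply (approx_slice _ _ (disc 0 R0) t HA); auto. }
  assert (Hcoef : forall t m, disc t0 r t ->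
    coef t m = circle_coef (analytic_part N q (param t)) R0 m).
  { intros t m Ht; apply circle_coef_radius; [lra|auto]. }
  assert (Hpow : forall m, (/ R0 ^ m = sig ^ m)%R).
  { intros m; unfold R0; rewrite <- pow_inv, Rinv_inv; reflexivity. }
  exists (B / (1 - sig))%R, sig; split; [lra|]; split; [|split].
  - intros m.
    pose proof PI_RGT_0 as Hpi.
    pose proof (strip_rect_bounded t0 r (- PI) PI) as HK2.
    assert (HF : approx (strip_rect t0 r (- PI) PI)
      (fun t u => analytic_part N q (param t) (Cexp (Ci * u)) * Cexp (- (Ci * u)) ^ m)).
    { apply approx_mult; auto.
      - apply (approx_comp2 (fun t v => disc t0 r t /\ disc 0 R0 v) _
          (fun t v => analytic_part N q (param t) v) (fun t _ => t)
          (fun _ u => Cexp (Ci * u))); auto using approx_fst.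
        + apply approx_Cexp, approx_scal; auto using approx_snd.
        + intros t u [Ht [y [_ ->]]]; split; [exact Ht|].
          unfold disc; replace (Cexp (Ci * y) - 0) with (Cexp (Ci * y)) by ring.
          rewrite Cmod_Cexp_imag; lra.
      - apply approx_pow, approx_Cexp; auto.
        apply approx_ext with (fun _ u => - Ci * u); [intros; ring|].
        apply approx_scal; auto using approx_snd. }
    assert (HI := approx_int _ _ (disc t0 r) (- PI) PI ltac:(lra) HF
      ltac:(intros t x Ht Hx; split; [exact Ht|exists x; auto])).
    apply approx_ext with (fun t _ => / (2 * PI) *
      CInt (fun x => analytic_part N q (param t) (Cexp (Ci * RtoC x)) *
        Cexp (- (Ci * RtoC x)) ^ m) (- PI) PI).
    + intros t u _; unfold coef, circle_coef.
      rewrite Cpow_1_l, Cmult_1_r; f_equal; f_equal.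
      apply functional_extensionality; intros x.
      rewrite Cmult_1_l; reflexivity.
    + apply approx_scal; [apply bounded1_2, disc_bounded|exact HI].
  - intros t m Ht; rewrite Hcoef by exact Ht.
    eapply Rle_trans; [apply (circle_coef_bound _ R0 B); auto; lra|].
    unfold Rdiv; rewrite Hpow; apply Rmult_le_compat_r; [apply pow_le; lra|].
    assert (1 <= / (1 - sig))%R.
    { rewrite <- Rinv_1 at 1; apply Rinv_le_contravar; lra. }
    nra.
  - intros t v n Ht Hv.
    rewrite (Csum_ext (fun k => coef t k * v ^ k)
      (fun k => circle_coef (analytic_part N q (param t)) R0 k * v ^ k))
      by (intros k _; rewrite Hcoef by exact Ht; reflexivity).
    eapply Rle_trans; [apply (taylor_remainder _ R0 B); auto; lra|].
    assert (Hx : (0 <= Cmod v / R0 <= sig)%R).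
    { unfold Rdiv, R0; rewrite Rinv_inv; pose proof (Cmod_ge_0 v); nra. }
    apply Rmult_le_compat.
    + apply Rmult_le_pos; [lra|left; apply Rinv_0_lt_compat; lra].
    + apply pow_le; lra.
    + apply Rmult_le_compat_l; [lra|apply Rinv_le_contravar; lra].
    + apply pow_incr; exact Hx.
Qed.

(** * The tail as a series *)

(** The variable [1/z] at the point [z = - e^u] of the cut, on its upper
    side. *)
Definition cut_var (u : C) : C := / Cexp (u + PI * Ci).

(** Integrals over one period of the quasi-periodic part, against the powers
    of [1/z]. *)
Definition moment (t : C) (m : nat) : C :=
  CInt (fun y => quasi_periodic N lq (param t) (RtoC y + PI * Ci) * cut_var y ^ m)
    0 (- Re lq).

Definition kappa (t : C) : C := multiplier N q (param t).

(** The tail is the integral over a half-line of a quasi-periodic function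
    times [sum_m coef_m v^m]. On the [k]-th period the [m]-th term carries
    the factor [(kappa q^m)^k], and the geometric series over [k] gives the
    denominator. The formula makes sense whatever the modulus of [kappa]. *)
Definition tail_series (t : C) : C :=
  Cseries (fun m => coef t m * moment t m / (1 - kappa t * q ^ m)).

Definition nonpole (t : C) : Prop := forall m, 1 - kappa t * q ^ m <> 0.

Lemma Cmod_cut_var (y : R) : Cmod (cut_var y) = exp (- y).
Proof.
  unfold cut_var; rewrite Cexp_cut.
  rewrite Cmod_inv by apply Copp_neq_0, Cexp_neq_0.
  rewrite Cmod_opp, Cmod_Cexp.
  replace (Re y) with y by reflexivity; rewrite exp_Ropp; reflexivity.
Qed.

Lemma Cmod_cut_var_le (y : R) : (0 <= y)%R -> (Cmod (cut_var y) <= 1)%R.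
Proof.
  intros Hy; rewrite Cmod_cut_var, <- exp_0.
  apply exp_le_exp; lra.
Qed.

Lemma approx_cut_var (K : C -> C -> Prop) :
  bounded2 K -> approx K (fun _ u => cut_var u).
Proof.
  intros HK; apply approx_Cexp_inv; auto.
  apply approx_plus; [apply approx_snd|apply approx_const].
Qed.

Lemma moment_uniform (t0 : C) (r : R) :
  admissible t0 ->
  off_cut t0 r ->
  exists M, (0 <= M)%R /\
    (forall m, approx1 (disc t0 r) (fun t => moment t m)) /\
    (forall t m, disc t0 r t -> (Cmod (moment t m) <= M)%R) /\
    (forall t m, disc t0 r t ->
       is_CInt (fun y => quasi_periodic N lq (param t) (RtoC y + PI * Ci) * cut_var y ^ m)
         0 (- Re lq) (moment t m)) /\
    (forall t (y : R), disc t0 r t -> (0 <= y <= - Re lq)%R ->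
       (Cmod (quasi_periodic N lq (param t) (RtoC y + PI * Ci)) <= M)%R).
Proof.
  intros H0 H.
  set (K := strip_rect t0 r 0 (- Re lq)).
  pose proof (strip_rect_bounded t0 r 0 (- Re lq)) as HK; fold K in HK.
  pose proof (approx_quasi_periodic_cut t0 r 0 (- Re lq) H0 H) as HQ; fold K in HQ.
  destruct (approx_bounded K _ HK HQ) as [B [HB HQB]].
  assert (HQm : forall m, approx K (fun t u =>
    quasi_periodic N lq (param t) (u + PI * Ci) * cut_var u ^ m)).
  { intros m; apply approx_mult, approx_pow; auto using approx_cut_var. }
  assert (HKin : forall (t : C) (y : R), disc t0 r t -> (0 <= y <= - Re lq)%R ->
    K t (RtoC y)).
  { intros t y Ht Hy; split; [exact Ht|exists y; auto]. }
  assert (HI : forall t m, disc t0 r t ->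
    is_CInt (fun y => quasi_periodic N lq (param t) (RtoC y + PI * Ci) * cut_var y ^ m)
         0 (- Re lq) (moment t m)).
  { intros t m Ht.
    apply (approx_is_CInt K (fun t u => quasi_periodic N lq (param t) (u + PI * Ci) *
      cut_var u ^ m) 0 (- Re lq) t); [lra|apply HQm|].
    intros y Hy; apply HKin; auto. }
  exists (B * (1 - Re lq))%R; split; [nra|]; split; [|split; [|split]].
  - intros m.
    apply (approx_int K (fun t u => quasi_periodic N lq (param t) (u + PI * Ci) *
      cut_var u ^ m) (disc t0 r) 0 (- Re lq)); [lra|apply HQm|].
    intros t y Ht Hy; apply HKin; auto.
  - intros t m Ht.
    apply Rle_trans with (B * (- Re lq - 0))%R; [|nra].
    eapply is_CInt_norm; [|intros y Hy|apply (HI t m Ht)]; [lra|].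
    cbv beta; rewrite Cmod_mult, Cmod_pow.
    rewrite <- (Rmult_1_r B); apply Rmult_le_compat; auto using Cmod_ge_0.
    + apply pow_le, Cmod_ge_0.
    + rewrite <- (pow1 m); apply pow_incr; split; [apply Cmod_ge_0|].
      apply Cmod_cut_var_le; lra.
  - exact HI.
  - intros t y Ht Hy; eapply Rle_trans; [apply HQB, HKin; auto|nra].
Qed.

Let ell := (- Re lq)%R.

Lemma ell_pos : (0 < ell)%R.
Proof. unfold ell; lra. Qed.

Lemma RtoC_ell : RtoC ell = - lq.
Proof. rewrite lq_real at 1; unfold ell; rewrite RtoC_opp; reflexivity. Qed.

Lemma cut_var_period (y : C) (k : nat) :
  cut_var (y + INR k * ell) = q ^ k * cut_var y.
Proof.
  unfold cut_var; rewrite RtoC_ell.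
  replace (y + INR k * - lq + PI * Ci) with ((y + PI * Ci) + INR k * - lq) by ring.
  rewrite Cexp_plus, Cexp_INR, Cexp_opp, Cpow_inv by apply Cexp_neq_0; fold q.
  pose proof (Cexp_neq_0 (y + PI * Ci)) as H.
  assert (q ^ k <> 0) by (apply Cpow_nz, Cexp_neq_0).
  field; auto.
Qed.

Lemma quasi_periodic_period (t : C) (y : R) (k : nat) :
  admissible t ->
  quasi_periodic N lq (param t) ((y + INR k * ell)%R + PI * Ci) =
  kappa t ^ k * quasi_periodic N lq (param t) (y + PI * Ci).
Proof.
  intros Ht; induction k as [|k IH].
  - simpl; rewrite Rmult_0_l, Rplus_0_r; ring.
  - rewrite (quasi_periodic_shift N lq HN Hlq).
    + replace ((y + INR (S k) * ell)%R + PI * Ci + lq)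
        with ((y + INR k * ell)%R + PI * Ci).
      * rewrite IH; simpl; unfold kappa; fold q; ring.
      * rewrite S_INR, !RtoC_plus, !RtoC_mult, RtoC_plus, RtoC_ell; ring.
    + intros j _; apply param_neq_0.
    + intros j Hj.
      destruct (cut_factors_neq_0 t (y + INR (S k) * ell) Ht j Hj)
        as [H1 [_ H3]]; auto.
Qed.

Lemma Phi_reg_cut (t : C) (y : R) :
  admissible t ->
  Phi_reg N lq (param t) (y + PI * Ci) =
  quasi_periodic N lq (param t) (y + PI * Ci) *
  analytic_part N q (param t) (cut_var y).
Proof.
  intros Ht; apply Phi_reg_factorization.
  - intros j _; apply param_neq_0.
  - intros j Hj; apply (cut_factors_neq_0 t y Ht j Hj).
Qed.

(** The uniform bounds above on a disc around the exponent, evaluated at its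
    center. *)
Lemma admissible_bounds (t : C) :
  admissible t -> exists M sig, (0 <= M)%R /\ (0 <= sig < 1)%R /\
    (forall m, (Cmod (coef t m) <= M * sig ^ m)%R) /\
    (forall v n, (Cmod v <= 1)%R ->
      (Cmod (analytic_part N q (param t) v -
         Csum (fun k => (coef t k * v ^ k)%C) n) <= M * sig ^ n)%R) /\
    (forall m, (Cmod (moment t m) <= M)%R) /\
    (forall m, is_CInt (fun y => quasi_periodic N lq (param t) (RtoC y + PI * Ci)
         * cut_var y ^ m) 0 ell (moment t m)) /\
    (forall y : R, (0 <= y <= ell)%R ->
       (Cmod (quasi_periodic N lq (param t) (RtoC y + PI * Ci)) <= M)%R).
Proof.
  intros Ht; destruct (admissible_nbhd t Ht)
    as [r [rho [Hr [Hrho Hn]]]].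
  assert (Hd : disc t r t) by (apply disc_center; lra).
  destruct (coef_uniform t r rho Hr Hrho) as [M1 [sig [Hs [_ [C2 C3]]]]].
  { intros t' Ht' j Hj; apply Hn; auto. }
  destruct (moment_uniform t r Ht) as [M2 [HM2 [_ [D2 [D3 D4]]]]].
  { intros t' Ht' j Hj; apply Hn; auto. }
  exists (Rmax M1 M2), sig.
  pose proof (Rmax_l M1 M2); pose proof (Rmax_r M1 M2).
  assert (Hsm : forall m, (0 <= sig ^ m)%R) by (intros; apply pow_le; lra).
  split; [lra|]; split; [exact Hs|]; split; [|split; [|split; [|split]]].
  - intros m; eapply Rle_trans; [apply C2, Hd|]; apply Rmult_le_compat_r; auto.
  - intros v n Hv; eapply Rle_trans; [apply C3; auto|].
    apply Rmult_le_compat_r; auto.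
  - intros m; eapply Rle_trans; [apply D2, Hd|lra].
  - intros m; apply D3, Hd.
  - intros y Hy; eapply Rle_trans; [apply D4; auto|lra].
Qed.

(** Translating by [k] periods multiplies [1/z] by [q^k], hence the [m]-th
    Taylor coefficient by [q^(k m)]. *)
Lemma period_integral (t : C) (k : nat) :
  admissible t -> exists I,
    is_CInt (fun y => Phi_reg N lq (param t) (RtoC y + PI * Ci))
      (INR k * ell) (INR (S k) * ell) (kappa t ^ k * I) /\
    Climit (Csum (fun m => coef t m * (q ^ k) ^ m * moment t m)) I.
Proof.
  intros Ht; pose proof ell_pos as Hell.
  destruct (admissible_bounds t Ht) as [M [sig [HM [Hs [C1 [C2 [D1 [D2 D3]]]]]]]].
  assert (Hq : (Cmod (q ^ k) <= 1)%R).
  { rewrite Cmod_pow; apply (Cmod_pow_unit q k (Cmod_q lq Hlq)). }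
  destruct (is_CInt_series
    (fun y => quasi_periodic N lq (param t) (RtoC y + PI * Ci) *
       analytic_part N q (param t) (q ^ k * cut_var y))
    (fun m y => quasi_periodic N lq (param t) (RtoC y + PI * Ci) * cut_var y ^ m)
    (fun m => coef t m * (q ^ k) ^ m) (moment t) 0 ell (M * M) sig)
    as [I [HS1 HS2]]; auto.
  - lra.
  - intros n y Hy.
    set (Q := quasi_periodic N lq (param t) (RtoC y + PI * Ci)).
    replace (Csum (fun m => coef t m * (q ^ k) ^ m * (Q * cut_var y ^ m)) n)
      with (Q * Csum (fun m => coef t m * (q ^ k * cut_var y) ^ m) n).
    + match goal with |- (Cmod (Q * ?a - Q * ?b) <= _)%R =>
        replace (Q * a - Q * b) with (Q * (a - b)) by ring end.
      rewrite Cmod_mult, Rmult_assoc.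
      apply Rmult_le_compat; auto using Cmod_ge_0; [apply D3, Hy|].
      apply C2; rewrite Cmod_mult.
      pose proof (Cmod_cut_var_le y ltac:(lra)).
      pose proof (Cmod_ge_0 (q ^ k)); pose proof (Cmod_ge_0 (cut_var y)); nra.
    + rewrite <- Csum_scal; apply Csum_ext; intros m _.
      rewrite Cpow_mult_l; ring.
  - exists I; split; [|exact HS2].
    assert (HT : is_CInt (fun y => kappa t ^ k *
      (quasi_periodic N lq (param t) (RtoC (y + - (INR k * ell))%R + PI * Ci) *
       analytic_part N q (param t) (q ^ k * cut_var (y + - (INR k * ell))%R)))
      (INR k * ell) (INR (S k) * ell) (kappa t ^ k * I)).
    { apply is_CInt_scal.
      apply (is_CInt_translate (fun y =>
        quasi_periodic N lq (param t) (RtoC y + PI * Ci) *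
        analytic_part N q (param t) (q ^ k * cut_var y))).
      replace (INR k * ell + - (INR k * ell))%R with 0%R by ring.
      replace (INR (S k) * ell + - (INR k * ell))%R with ell
        by (rewrite S_INR; ring).
      exact HS1. }
    eapply (is_RInt_ext (V := C_R_NormedModule)); [|exact HT].
    intros y _; cbv beta.
    rewrite Phi_reg_cut by exact Ht.
    set (y' := (y + - (INR k * ell))%R).
    assert (Ey : y = (y' + INR k * ell)%R) by (unfold y'; ring).
    rewrite Ey, quasi_periodic_period by exact Ht.
    rewrite RtoC_plus, RtoC_mult, cut_var_period.
    match goal with |- ?a = ?b => change (@eq C a b) end; ring.
Qed.

Lemma Phi_reg_period_bound (t : C) :
  admissible t -> exists B, (0 <= B)%R /\
    forall k y, (INR k * ell <= y <= INR (S k) * ell)%R ->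
      (Cmod (Phi_reg N lq (param t) (RtoC y + PI * Ci)) <= B * Cmod (kappa t) ^ k)%R.
Proof.
  intros Ht; pose proof ell_pos as Hell.
  destruct (admissible_bounds t Ht) as [M [sig [HM [Hs [C1 [C2 [D1 [D2 D3]]]]]]]].
  exists (M * M)%R; split; [nra|]; intros k y Hy.
  rewrite S_INR in Hy; rewrite Phi_reg_cut by exact Ht.
  set (y' := (y - INR k * ell)%R).
  assert (Ey : y = (y' + INR k * ell)%R) by (unfold y'; ring).
  assert (Hy' : (0 <= y' <= ell)%R) by (unfold y'; lra).
  assert (Hy0 : (0 <= y)%R).
  { pose proof (pos_INR k); nra. }
  assert (HAb : (Cmod (analytic_part N q (param t) (cut_var y)) <= M)%R).
  { pose proof (C2 (cut_var y) O (Cmod_cut_var_le y Hy0)) as C0.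
    set (X := analytic_part N q (param t) (cut_var y)) in *.
    change (Cmod (X - 0) <= M * 1)%R in C0.
    replace (X - 0) with X in C0 by ring; lra. }
  rewrite Ey at 1; rewrite quasi_periodic_period by exact Ht.
  rewrite !Cmod_mult, Cmod_pow.
  replace (M * M * Cmod (kappa t) ^ k)%R with (Cmod (kappa t) ^ k * M * M)%R by ring.
  assert (0 <= Cmod (kappa t) ^ k)%R by apply pow_le, Cmod_ge_0.
  apply Rmult_le_compat; [| |apply Rmult_le_compat_l; [assumption|apply D3, Hy']|].
  - apply Rmult_le_pos; [assumption|apply Cmod_ge_0].
  - apply Cmod_ge_0.
  - exact HAb.
Qed.

Lemma small_kappa_nonpole (t : C) : (Cmod (kappa t) < 1)%R -> nonpole t.
Proof.
  intros Hk m E.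
  assert (E' : kappa t * q ^ m = 1).
  { replace (kappa t * q ^ m) with (1 - (1 - kappa t * q ^ m)) by ring.
    rewrite E; ring. }
  apply (f_equal Cmod) in E'; rewrite Cmod_mult, Cmod_pow, Cmod_1 in E'.
  assert (0 <= Cmod q ^ m <= 1)%R.
  { apply Cmod_pow_unit, (Cmod_q lq Hlq). }
  pose proof (Cmod_ge_0 (kappa t)); nra.
Qed.

(** Let [T_k] be the series whose [m]-th term carries the extra factor [q^(k
    m)]. Then the integral over the [k]-th period is [kappa^k (T_k - kappa
    T_(k+1))], and the sum over [k] telescopes. *)
Lemma tail_partial (t : C) :
  admissible t -> (Cmod (kappa t) < 1)%R ->
  exists K, (0 <= K)%R /\ forall n, exists l,
    is_CInt (fun y => Phi_reg N lq (param t) (RtoC y + PI * Ci)) 0 (INR n * ell) l /\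
    (Cmod (l - tail_series t) <= K * Cmod (kappa t) ^ n)%R.
Proof.
  intros Ht Hk; pose proof ell_pos as Hell.
  destruct (admissible_bounds t Ht) as [M [sig [HM [Hs [C1 [C2 [D1 [D2 D3]]]]]]]].
  pose proof (small_kappa_nonpole t Hk) as Hnp.
  set (kap := kappa t) in *.
  assert (Hqm : forall m, (0 <= Cmod q ^ m <= 1)%R).
  { intros m; apply Cmod_pow_unit, (Cmod_q lq Hlq). }
  assert (Hden : forall m, (1 - Cmod kap <= Cmod (1 - kap * q ^ m))%R).
  { intros m; pose proof (Cmod_triangle_inv 1 (kap * q ^ m)) as H.
    rewrite Cmod_1, Cmod_mult, Cmod_pow in H; specialize (Hqm m).
    pose proof (Cmod_ge_0 kap); nra. }
  set (b := fun k m => coef t m * (q ^ k) ^ m * moment t m / (1 - kap * q ^ m)).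
  set (K0 := (M * M / (1 - Cmod kap))%R).
  assert (Hb : forall k m, (Cmod (b k m) <= K0 * sig ^ m)%R).
  { intros k m; unfold b; rewrite Cmod_div by apply Hnp.
    rewrite !Cmod_mult, !Cmod_pow, <- pow_mult; specialize (Hqm (k * m)%nat).
    unfold K0, Rdiv.
    replace (M * M * / (1 - Cmod kap) * sig ^ m)%R
      with ((M * sig ^ m) * 1 * M * / (1 - Cmod kap))%R by ring.
    repeat apply Rmult_le_compat; auto using Cmod_ge_0;
      try (repeat apply Rmult_le_pos; auto using Cmod_ge_0; lra); try lra.
    - left; apply Rinv_0_lt_compat; specialize (Hden m); lra.
    - apply Rinv_le_contravar; [lra|apply Hden]. }
  set (T := fun k => Cseries (b k)).
  assert (HT : forall k, Climit (Csum (b k)) (T k)).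
  { intros k; apply (Cseries_geom (b k) K0 sig); auto. }
  assert (HTb : forall k, (Cmod (T k) <= K0 / (1 - sig))%R).
  { intros k; destruct (Cseries_geom (b k) K0 sig Hs (Hb k)) as [_ H].
    specialize (H O); simpl in H; rewrite Rmult_1_r in H.
    replace (0 - Cseries (b k)) with (- T k) in H by (unfold T; ring).
    rewrite Cmod_opp in H; exact H. }
  assert (HT0 : T O = tail_series t).
  { unfold T, tail_series, Cseries; f_equal.
    apply functional_extensionality; intros n; apply Csum_ext; intros m _.
    unfold b; simpl; rewrite Cpow_1_l; fold q; unfold kap; f_equal; ring. }
  assert (HS : forall k I,
    Climit (Csum (fun m => coef t m * (q ^ k) ^ m * moment t m)) I ->
    I = T k - kap * T (S k)).
  { intros k I HS; apply (Climit_unique _ _ _ HS).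
    apply Climit_ext with
      (fun n => Csum (b k) n + (- kap) * Csum (b (S k)) n).
    - intros n; rewrite <- Csum_scal, <- Csum_plus; apply Csum_ext; intros m _.
      unfold b; rewrite (Cpow_mult_l q (q ^ k) m : (q ^ S k) ^ m = _).
      field; apply Hnp.
    - replace (T k - kap * T (S k)) with (T k + (- kap) * T (S k))
        by ring.
      apply Climit_plus, Climit_scal; apply HT. }
  exists (K0 / (1 - sig))%R; split.
  { eapply Rle_trans; [apply Cmod_ge_0|apply (HTb O)]. }
  assert (HI : forall n, is_CInt
    (fun y => Phi_reg N lq (param t) (RtoC y + PI * Ci)) 0 (INR n * ell)
    (T O - kap ^ n * T n)).
  { induction n as [|n IH].
    - simpl; rewrite Rmult_0_l.
      replace (T O - 1 * T O) with (RtoC 0) by ring.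
      apply (is_RInt_point (V := C_R_NormedModule)).
    - destruct (period_integral t n Ht) as [I [HS1 HS2]].
      apply HS in HS2.
      replace (T O - kap ^ S n * T (S n))
        with ((T O - kap ^ n * T n) + kap ^ n * I) by (rewrite HS2; simpl; ring).
      eapply is_CInt_Chasles; [exact IH|exact HS1]. }
  intros n; exists (T O - kap ^ n * T n); split; [apply HI|].
  rewrite <- HT0.
  replace (T O - kap ^ n * T n - T O) with (- (T n * kap ^ n)) by ring.
  rewrite Cmod_opp, Cmod_mult, Cmod_pow.
  apply Rmult_le_compat_r; [apply pow_le, Cmod_ge_0|apply HTb].
Qed.

Lemma Phi_reg_cut_Ccont (t : C) (y : R) :
  admissible t -> Ccont (fun y => Phi_reg N lq (param t) (RtoC y + PI * Ci)) y.
Proof.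
  intros Ht eps He.
  set (D := fun u => exists y', (y - 1 <= y' <= y + 1)%R /\ u = RtoC y').
  assert (HA : approx1 D (fun u => Phi_reg N lq (param t) (u + PI * Ci))).
  { apply (approx_slice _ _ _ t
      (approx_Phi_reg_cut t 0 (y - 1) (y + 1) Ht (off_cut_center t Ht))).
    intros u Hu; split; [apply disc_center; lra|exact Hu]. }
  destruct (fun HD => approx1_continuous D _ (RtoC y) eps HD HA) as [del [Hd Hc]].
  - destruct (real_segment_bounded (y - 1) (y + 1)) as [B HB].
    exists B; intros u Hu; apply (HB 0 u (conj eq_refl Hu)).
  - exists y; split; [lra|reflexivity].
  - exact He.
  - exists (Rmin 1 del); split; [apply Rmin_pos; lra|]; intros y' Hy'.
    pose proof (Rmin_l 1 del); pose proof (Rmin_r 1 del).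
    apply Hc; [|rewrite <- RtoC_minus, Cmod_R; lra].
    exists y'; split; [|reflexivity].
    assert (Hlt : (Rabs (y' - y) < 1)%R) by lra.
    apply Rabs_def2 in Hlt; lra.
Qed.

(** Up to a whole number of periods this is [tail_partial]; on the remaining
    part of a period the integrand is already small. *)
Lemma tail_limit (t : C) :
  admissible t -> (Cmod (kappa t) < 1)%R ->
  forall eps, (0 < eps)%R -> exists X0, forall X, (X0 <= X)%R -> exists l,
    is_CInt (fun y => Phi_reg N lq (param t) (RtoC y + PI * Ci)) 0 X l /\
    (Cmod (l - tail_series t) < eps)%R.
Proof.
  intros Ht Hk eps He; pose proof ell_pos as Hell.
  destruct (tail_partial t Ht Hk) as [K [HK HI]].
  destruct (Phi_reg_period_bound t Ht) as [B [HB HPB]].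
  destruct (pow_small (Cmod (kappa t)) (K + B * ell) eps
    ltac:(split; [apply Cmod_ge_0|exact Hk]) He) as [n0 Hn0].
  exists (INR n0 * ell)%R; intros X HX.
  assert (HX0 : (0 <= X / ell)%R).
  { apply Rmult_le_pos; [|left; apply Rinv_0_lt_compat, Hell].
    pose proof (pos_INR n0); nra. }
  destruct (nfloor_ex (X / ell) HX0) as [n [Hn1 Hn2]].
  assert (E : X = (X / ell * ell)%R) by (field; lra).
  assert (Hn : (n0 <= n)%nat).
  { apply INR_le; apply Rnot_lt_le; intros Hlt.
    assert (H1 : (n < n0)%nat) by (apply INR_lt, Hlt).
    apply le_INR in H1; rewrite S_INR in H1.
    assert (X < INR n0 * ell)%R; [|lra].
    rewrite E; apply Rmult_lt_compat_r; lra. }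
  destruct (HI n) as [l [Hl1 Hl2]].
  destruct (Ccont_ex_CInt (fun y => Phi_reg N lq (param t) (RtoC y + PI * Ci))
    (INR n * ell) X) as [l' Hl'].
  { intros y; apply Phi_reg_cut_Ccont, Ht. }
  assert (HXn : (INR n * ell <= X <= INR (S n) * ell)%R).
  { rewrite S_INR, E; split; apply Rmult_le_compat_r; lra. }
  exists (l + l'); split; [eapply is_CInt_Chasles; eassumption|].
  assert (Hl'b : (Cmod l' <= B * Cmod (kappa t) ^ n * ell)%R).
  { eapply Rle_trans.
    - eapply (is_CInt_norm _ (INR n * ell) X (B * Cmod (kappa t) ^ n)); [lra| |exact Hl'].
      intros y Hy; apply HPB; lra.
    - apply Rmult_le_compat_l; [|rewrite S_INR in HXn; lra].
      apply Rmult_le_pos; [exact HB|apply pow_le, Cmod_ge_0]. }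
  replace (l + l' - tail_series t) with ((l - tail_series t) + l') by ring.
  eapply Rle_lt_trans; [apply Cmod_triangle|].
  specialize (Hn0 n Hn); lra.
Qed.

Lemma odd_opp_pow (z : C) : Nat.Odd N -> (- z) ^ N = - z ^ N.
Proof.
  intros [k ->]; rewrite Nat.add_1_r; rewrite !Cpow_S, Cpow_opp_even; ring.
Qed.

Lemma Cexp_odd_PI : Nat.Odd N -> Cexp (INR N * (Ci * PI)) = - (1).
Proof.
  intros H; rewrite Cexp_INR, Cexp_PI, odd_opp_pow, Cpow_1_l by exact H; reflexivity.
Qed.

Lemma Cexp_below (u : C) : Cexp (u - PI * Ci) = Cexp (u + PI * Ci).
Proof.
  replace (u + PI * Ci) with (u - PI * Ci + 2 * INR 1 * PI * Ci) by (simpl; ring).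
  symmetry; apply Cexp_2PI_nat.
Qed.

(** The half-integer power of [z] changes sign across the cut. *)
Lemma theta_w_below (u : C) :
  Nat.Odd N -> theta_w N lq (u - PI * Ci) = - theta_w N lq (u + PI * Ci).
Proof.
  intros H; unfold theta_w; rewrite Cexp_below.
  replace (INR N * (u + PI * Ci) / 2) with
    (INR N * (u - PI * Ci) / 2 + INR N * (Ci * PI)) by field.
  rewrite (Cexp_plus (INR N * (u - PI * Ci) / 2)), Cexp_odd_PI by exact H; ring.
Qed.

Lemma Phi_reg_below (a : nat -> C) (u : C) :
  Nat.Odd N -> Phi_reg N lq a (u - PI * Ci) = - Phi_reg N lq a (u + PI * Ci).
Proof.
  intros H; unfold Phi_reg; rewrite theta_w_below, Cexp_below by exact H; ring.
Qed.

Lemma primitive_below (a : nat -> C) (u : C) :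
  Nat.Odd N -> primitive N lq a (u - PI * Ci) = - primitive N lq a (u + PI * Ci).
Proof.
  intros H; unfold primitive; rewrite theta_w_below, Cexp_below by exact H; ring.
Qed.

Lemma Phi_cut (a : nat -> C) (y : R) :
  Nat.Odd N -> Phi N lq a (y, PI) = Phi_reg N lq a (y + PI * Ci) /\
  Phi N lq a (y, (- PI)%R) = - Phi_reg N lq a (y + PI * Ci).
Proof.
  intros H.
  assert (E : Cexp (y + PI * Ci) ^ N <> 1).
  { rewrite Cexp_cut, odd_opp_pow, Cexp_RtoC, <- RtoC_pow, <- RtoC_opp by exact H.
    intros E; apply (f_equal Re) in E; unfold Re in E; simpl in E.
    assert (0 < exp y ^ N)%R by (apply pow_lt, exp_pos); lra. }
  replace (y, PI) with (y + PI * Ci) by (apply injective_projections; simpl; ring).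
  replace (y, (- PI)%R) with (y - PI * Ci) by (apply injective_projections; simpl; ring).
  split.
  - apply Phi_regular; auto.
  - rewrite <- Phi_reg_below by exact H; apply Phi_regular; auto.
    rewrite Cexp_below; exact E.
Qed.

(** Substituting [x = e^y]. The sign tells the two sides of the cut apart. *)
Lemma is_tail_side (t : C) (sgn : C) (phi : R) :
  Nat.Odd N -> admissible t -> (Cmod (kappa t) < 1)%R -> Cmod sgn = 1%R ->
  (forall y : R, Phi N lq (param t) (y, phi) =
     sgn * Phi_reg N lq (param t) (y + PI * Ci)) ->
  tail_side N lq (param t) phi = sgn * tail_series t.
Proof.
  intros Hodd Ht Hk Hsgn Hphi; unfold tail_side.
  apply (is_RInt_gen_unique (V := C_R_CompleteNormedModule)).
  intros P [eps HP].
  destruct (tail_limit t Ht Hk eps (cond_pos eps)) as [X0 HX0].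
  exists (fun x => x = 1%R) (fun x => (Rmax 1 (exp X0) < x)%R).
  - reflexivity.
  - exists (Rmax 1 (exp X0)); auto.
  - intros x X -> HX; simpl.
    pose proof (Rmax_l 1 (exp X0)); pose proof (Rmax_r 1 (exp X0)).
    destruct (HX0 (ln X)) as [l [Hl1 Hl2]].
    { rewrite <- (ln_exp X0); left; apply ln_increasing; [apply exp_pos|lra]. }
    exists (sgn * l); split.
    + assert (HC := is_RInt_comp (V := C_R_CompleteNormedModule)
        (fun y => Phi_reg N lq (param t) (RtoC y + PI * Ci)) ln Rinv 1 X).
      rewrite ln_1 in HC.
      assert (HC' := HC
        ltac:(intros x Hx; apply Ccont_continuous, Phi_reg_cut_Ccont, Ht)).
      clear HC.
      rewrite Rmin_left, Rmax_right in HC' by lra.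
      assert (HC := HC' ltac:(intros x Hx; split;
        [apply is_derive_ln; lra|apply (continuous_Rinv x); lra])).
      change (RInt (V := C_R_CompleteNormedModule)
        (fun y => Phi_reg N lq (param t) (RtoC y + PI * Ci)) 0 (ln X))
        with (CInt (fun y => Phi_reg N lq (param t) (RtoC y + PI * Ci)) 0 (ln X)) in HC.
      rewrite (is_CInt_unique _ _ _ _ Hl1) in HC.
      eapply is_CInt_ext; [| |apply (is_CInt_scal sgn _ _ _ _ HC)]; [lra|].
      intros x Hx; cbv beta; rewrite Hphi.
      change (sgn * (scal (V := C_R_NormedModule) (/ x)%R
        (Phi_reg N lq (param t) (ln x + PI * Ci))) =
        sgn * Phi_reg N lq (param t) (ln x + PI * Ci) / x).
      unfold Cdiv; rewrite <- Cmult_assoc; f_equal.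
      rewrite <- RtoC_inv by lra.
      apply injective_projections; simpl; unfold scal; simpl; unfold mult; simpl; ring.
    + apply HP, ball_Cmod.
      replace (sgn * l - sgn * tail_series t) with (sgn * (l - tail_series t)) by ring.
      rewrite Cmod_mult, Hsgn, Rmult_1_l; exact Hl2.
Qed.

Lemma Cprod_param (t : C) (n : nat) :
  Cprod (param t) n = Cexp (Csum (log_param t) n).
Proof.
  induction n as [|n IH]; simpl; [symmetry; apply Cexp_0|].
  rewrite IH, Cexp_plus; reflexivity.
Qed.

Lemma kappa_Cexp (t : C) :
  kappa t = Cexp (INR (N - 1) * lq + - (1) * Csum (log_param t) (2 * N)).
Proof.
  unfold kappa, multiplier; rewrite Cprod_param, Cexp_plus, Cexp_INR.
  replace (- (1) * Csum (log_param t) (2 * N))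
    with (- Csum (log_param t) (2 * N)) by ring.
  rewrite Cexp_opp; reflexivity.
Qed.

(** [|kappa| = q^(N - 1 - sum_j Re s_j)] and [0 < q < 1]. *)
Lemma tail_converges_kappa (t : C) :
  tail_converges N (set_first s t) -> (Cmod (kappa t) < 1)%R.
Proof.
  intros H; unfold tail_converges in H.
  rewrite kappa_Cexp, Cmod_Cexp.
  apply Rlt_le_trans with (exp 0); [apply exp_increasing|rewrite exp_0; lra].
  assert (E : forall n, Re (Csum (log_param t) (S n)) =
    (Re lq * sum_n (fun j => Re (set_first s t j)) n)%R).
  { induction n as [|n IH].
    - rewrite sum_O; simpl Csum; rewrite Cplus_0_l.
      apply (Re_lq_mult).
    - rewrite sum_Sn.
      change (Csum (log_param t) (S (S n)))
        with (Csum (log_param t) (S n) + log_param t (S n)).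
      change (Re (Csum (log_param t) (S n) + log_param t (S n)))
        with (Re (Csum (log_param t) (S n)) + Re (log_param t (S n)))%R.
      rewrite IH; unfold log_param; rewrite Re_lq_mult.
      unfold plus; simpl; ring. }
  replace (2 * N)%nat with (S (2 * N - 1)) by lia.
  replace (Re (INR (N - 1) * lq + - (1) * Csum (log_param t) (S (2 * N - 1))))
    with (INR (N - 1) * Re lq - Re (Csum (log_param t) (S (2 * N - 1))))%R
    by (unfold Re; simpl; ring).
  rewrite E, minus_INR by lia; simpl (INR 1).
  nra.
Qed.

(** The circle together with the series for the tail. Both sides of the tail
    contribute the same amount, because the integrand changes sign across
    the cut. *)
Definition I_cont (t : C) : C :=
  int_circle N lq (param t) + tail_series t / (PI * Ci).

Lemma I_int_cont (t : C) :
  Nat.Odd N -> admissible t -> tail_converges N (set_first s t) ->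
  I_int N lq (param t) = I_cont t /\ nonpole t.
Proof.
  intros Hodd Ht Htail; pose proof PI_RGT_0 as Hpi.
  pose proof (tail_converges_kappa t Htail) as Hk.
  split; [|apply small_kappa_nonpole, Hk].
  unfold I_int, I_cont, int_tail.
  assert (E : Nat.even N = false).
  { rewrite <- Nat.negb_odd; apply Nat.odd_spec in Hodd; rewrite Hodd; reflexivity. }
  rewrite E.
  rewrite (is_tail_side t 1 PI), (is_tail_side t (- (1)) (- PI)); auto.
  - f_equal; field; split; [|apply RtoC_neq_0; lra].
    intros E'; apply (f_equal Im) in E'; unfold Im in E'; simpl in E'; lra.
  - apply Cmod_m1.
  - intros y; rewrite (proj2 (Phi_cut (param t) y Hodd)); ring.
  - apply Cmod_1.
  - intros y; rewrite (proj1 (Phi_cut (param t) y Hodd)); ring.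
Qed.

(** * The difference equation for the continued integral *)

Lemma param_shift (t : C) (i : nat) :
  param (t + INR i) = shift_first q (param t) i.
Proof.
  apply functional_extensionality; intros [|j]; [|reflexivity].
  unfold param, params, set_first, shift_first, qpow.
  unfold q; rewrite <- Cexp_INR, <- Cexp_plus; f_equal; ring.
Qed.

Let A (t : C) : C := Cprod (param t) (2 * N).

Lemma A_neq_0 (t : C) : A t <> 0.
Proof. apply Cprod_neq_0; intros; apply param_neq_0. Qed.

Lemma kappa_shift (t : C) (i : nat) :
  (i < N)%nat -> kappa (t + INR i) = q ^ (N - 1 - i) / A t.
Proof.
  intros Hi; unfold kappa, multiplier; rewrite param_shift; fold q.
  unfold q; rewrite (Cprod_shift_first N lq HN); fold q; fold (A t).
  replace (N - 1)%nat with ((N - 1 - i) + i)%nat at 1 by lia.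
  rewrite Cpow_add_r.
  assert (q ^ i <> 0) by (apply Cpow_nz, Cexp_neq_0).
  pose proof (A_neq_0 t); field; auto.
Qed.

Definition pcoef (t : C) (m : nat) : C :=
  circle_coef (primitive_part N q (param t)) 1 m.

Lemma Cmod_real_q : Cmod q = exp (Re lq).
Proof. apply Cmod_Cexp. Qed.

Lemma q_exp : q = RtoC (exp (Re lq)).
Proof. unfold q; rewrite lq_real; apply Cexp_RtoC. Qed.

(** The radius of analyticity exceeds [1/|q|], so the expansion at [v / q]
    converges geometrically on the whole unit disc. *)
Lemma primitive_part_analytic (t : C) :
  admissible t -> exists M sig, (0 <= sig < 1)%R /\
    approx1 (disc 0 (exp ell)) (primitive_part N q (param t)) /\
    forall v n, (Cmod v <= 1)%R ->
      (Cmod (primitive_part N q (param t) (v / q) -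
        Csum (fun k => (pcoef t k / q ^ k * v ^ k)%C) n) <= M * sig ^ n)%R.
Proof.
  intros Ht; pose proof (Cmod_q lq Hlq) as Hq; fold q in Hq.
  destruct (finite_max (fun j => Cmod (param t j)) (2 * N) 1) as [rho0 [Hr0 Hr1]].
  { intros j Hj; apply (Ht j Hj). }
  set (rho := Rmax rho0 0).
  assert (Hrho : (0 <= rho < 1)%R)
    by (unfold rho; split; [apply Rmax_r|apply Rmax_lub_lt; lra]).
  set (sig := ((1 + rho) / 2)%R).
  assert (Hsig : (0 < sig < 1)%R) by (unfold sig; lra).
  assert (Hee : (1 < exp ell)%R).
  { rewrite <- exp_0; apply exp_increasing; unfold ell; lra. }
  assert (Eq : Cmod q = (/ exp ell)%R).
  { rewrite Cmod_real_q; unfold ell; rewrite exp_Ropp, Rinv_inv; reflexivity. }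
  set (R0 := (exp ell / sig)%R).
  assert (HR0 : (exp ell < R0)%R).
  { unfold R0; apply Rmult_lt_reg_r with sig; [lra|].
    unfold Rdiv; rewrite Rmult_assoc, Rinv_l by lra; nra. }
  assert (HA : approx1 (disc 0 R0) (primitive_part N q (param t))).
  { pose proof (bounded1_2 _ (disc_bounded 0 R0)) as HK.
    unfold approx1, primitive_part.
    apply (approx_Cprod _ (fun j v _ => qpoch_inf (q * v / param t j) q *
      / qpoch_inf (q * param t j * v) q)); auto.
    intros j Hj; apply approx_mult; auto.
    - apply (approx_qpoch_inf _ (fun v _ => q * v / param t j)); auto.
      apply approx_ext with (fun v _ => (q / param t j) * v).
      + intros v u _; unfold Cdiv; ring.
      + apply approx_scal; auto using approx_fst.
    - apply (approx_inv_qpoch_inf_small _ (fun v _ => q * param t j * v) q (rho / sig));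
        auto.
      + apply approx_scal; auto using approx_fst.
      + apply Rmult_lt_reg_r with sig; [lra|].
        unfold Rdiv; rewrite Rmult_assoc, Rinv_l; unfold sig; lra.
      + intros v u [Hv _]; unfold disc in Hv; replace (v - 0) with v in Hv by ring.
        rewrite !Cmod_mult, Eq.
        replace (rho / sig)%R with (/ exp ell * rho * R0)%R
          by (unfold R0; field; lra).
        assert (Cmod (param t j) <= rho)%R.
        { eapply Rle_trans; [apply Hr1, Hj|apply Rmax_l]. }
        assert (0 < / exp ell)%R by (apply Rinv_0_lt_compat; lra).
        apply Rmult_le_compat; auto using Cmod_ge_0.
        * apply Rmult_le_pos; [lra|apply Cmod_ge_0].
        * apply Rmult_le_compat_l; lra. }
  destruct (approx1_bounded _ _ (disc_bounded 0 R0) HA) as [B [HB HAB]].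
  exists (B / (1 - sig))%R, sig; split; [lra|]; split.
  - eapply approx_subset; [|exact HA]; intros v u [Hv Hu]; split; [|exact Hu].
    unfold disc in *; lra.
  - intros v n Hv.
    assert (Hq0 : q <> 0) by apply Cexp_neq_0.
    assert (Hvq : (Cmod (v / q) = Cmod v * exp ell)%R).
    { rewrite Cmod_div, Eq by exact Hq0; unfold Rdiv; rewrite Rinv_inv; reflexivity. }
    rewrite (Csum_ext (fun k => pcoef t k / q ^ k * v ^ k)
      (fun k => circle_coef (primitive_part N q (param t)) R0 k * (v / q) ^ k)).
    2: { intros k _; unfold pcoef; rewrite (circle_coef_radius _ 1 R0) by (auto; lra).
         unfold Cdiv; rewrite Cpow_mult_l, Cpow_inv by exact Hq0; ring. }
    pose proof (Cmod_ge_0 v).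
    eapply Rle_trans; [apply (taylor_remainder _ R0 B); auto; try lra|].
    + rewrite Hvq; nra.
    + assert (Hx : (0 <= Cmod (v / q) / R0 <= sig)%R).
      { rewrite Hvq; unfold R0.
        replace (Cmod v * exp ell / (exp ell / sig))%R with (Cmod v * sig)%R
          by (field; lra); nra. }
      apply Rmult_le_compat.
      * apply Rmult_le_pos; [lra|left; apply Rinv_0_lt_compat; lra].
      * apply pow_le; lra.
      * apply Rmult_le_compat_l; [lra|apply Rinv_le_contravar; lra].
      * apply pow_incr; exact Hx.
Qed.

Lemma approx1_analytic_part (t : C) :
  admissible t -> approx1 (disc 0 1) (analytic_part N q (param t)).
Proof.
  intros Ht.
  destruct (admissible_nbhd t Ht) as [r [rho [Hr [Hrho Hn]]]].
  apply (approx_slice (fun t' v => disc t 0 t' /\ disc 0 1 v)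
    (fun t' v => analytic_part N q (param t') v) (disc 0 1) t).
  - apply (approx_analytic_part t 0 rho 1); [lra|].
    intros t' Ht' j Hj; rewrite Rmult_1_r; apply Hn; auto.
    unfold disc in *; lra.
  - intros v Hv; split; [apply disc_center; lra|exact Hv].
Qed.

Lemma circle_coef_dilate (d : C -> C) (n : nat) :
  approx1 (disc 0 (exp ell)) d ->
  circle_coef (fun v => d (v / q)) 1 n = circle_coef d 1 n / q ^ n.
Proof.
  intros Hd.
  assert (Hee : (1 < exp ell)%R).
  { rewrite <- exp_0; apply exp_increasing; unfold ell; lra. }
  rewrite (circle_coef_radius d 1 (exp ell)) by (auto; lra).
  assert (Eq : / q = RtoC (exp ell)).
  { rewrite q_exp, <- RtoC_inv by (pose proof (exp_pos (Re lq)); lra).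
    unfold ell; rewrite exp_Ropp; reflexivity. }
  unfold circle_coef.
  assert (HF : (fun x : R => d (1 * Cexp (Ci * x) / q) * Cexp (- (Ci * x)) ^ n) =
    (fun x : R => d (exp ell * Cexp (Ci * x)) * Cexp (- (Ci * x)) ^ n)).
  { apply functional_extensionality; intros x; do 2 f_equal.
    unfold Cdiv; rewrite Eq; ring. }
  rewrite HF, <- Eq, Cpow_1_l, Cpow_inv by apply Cexp_neq_0.
  assert (q ^ n <> 0) by (apply Cpow_nz, Cexp_neq_0).
  assert (RtoC PI <> 0) by (apply RtoC_neq_0; pose proof PI_RGT_0; lra).
  match goal with |- ?a * ?I = _ => set (J := I : C) end.
  field; auto.
Qed.

(** Comparison of the coefficients of [v ^ m] in [g_sum_analytic_part]. *)
Lemma coef_equation (t : C) (m : nat) :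
  admissible t ->
  Csum (fun i => g N q (param t) i (param t O) * shift_const q (param t O) i *
    (if lt_dec m (N - 1 - i) then 0 else coef (t + INR i) (m - (N - 1 - i)))) N =
  pcoef t m * (1 - A t / q ^ m).
Proof.
  intros Ht; set (a := param t).
  assert (Hapx : forall i, approx1 (disc 0 1) (analytic_part N q (shift_first q a i))).
  { intros i; unfold a; rewrite <- param_shift; apply approx1_analytic_part.
    apply admissible_shift, Ht. }
  destruct (primitive_part_analytic t Ht) as [M [sig [_ [HP _]]]].
  assert (Hee : (1 < exp ell)%R).
  { rewrite <- exp_0; apply exp_increasing; unfold ell; lra. }
  assert (HP1 : approx1 (disc 0 1) (primitive_part N q a)).
  { eapply approx_subset; [|exact HP]; intros v u [Hv Hu]; split; [|exact Hu].
    unfold disc in *; lra. }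
  assert (HP2 : approx1 (disc 0 1) (fun v => primitive_part N q a (v / q))).
  { apply (approx1_comp (disc 0 (exp ell)) (primitive_part N q a) _ (fun v _ => v / q)).
    - apply bounded1_2, disc_bounded.
    - exact HP.
    - apply approx_ext with (fun v _ => / q * v); [intros; unfold Cdiv; ring|].
      apply approx_scal; [apply bounded1_2, disc_bounded|apply approx_fst].
    - intros v u [Hv _]; unfold disc in *; replace (v - 0) with v in Hv by ring.
      replace (v / q - 0) with (v / q) by ring.
      rewrite Cmod_div, Cmod_real_q by apply Cexp_neq_0.
      unfold Rdiv; rewrite <- exp_Ropp; fold ell.
      pose proof (Cmod_ge_0 v); nra. }
  transitivity (circle_coef (fun v => Csum (fun i =>
    g N q a i (a O) * shift_const q (a O) i *
      (v ^ (N - 1 - i) * analytic_part N q (shift_first q a i) v)) N) 1 m).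
  - rewrite (circle_coef_sum (fun i v => g N q a i (a O) * shift_const q (a O) i *
      (v ^ (N - 1 - i) * analytic_part N q (shift_first q a i) v))).
    + apply Csum_ext; intros i Hi.
      rewrite circle_coef_scal by (try lra; apply approx1_disc_pow_mult, Hapx).
      f_equal; rewrite circle_coef_shift by (try lra; apply Hapx).
      unfold coef; rewrite param_shift; reflexivity.
    + lra.
    + intros i Hi; apply approx_scal; [apply bounded1_2, disc_bounded|].
      apply approx1_disc_pow_mult, Hapx.
  - rewrite (circle_coef_ext _ (fun v => primitive_part N q a v
      + - A t * primitive_part N q a (v / q))).
    + rewrite circle_coef_plus.
      * rewrite circle_coef_scal by (try lra; exact HP2).
        rewrite circle_coef_dilate by exact HP.
        unfold pcoef; fold a; unfold Cdiv; ring.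
      * lra.
      * exact HP1.
      * apply (approx_scal _ (- A t) (fun v _ => primitive_part N q a (v / q)));
          [apply bounded1_2, disc_bounded|exact HP2].
    + intros v Hv.
      etransitivity; [apply (g_sum_analytic_part N lq HN Hlq a v)|].
      * intros j Hj; split; [apply param_neq_0|apply Ht, Hj].
      * intros E; rewrite E, Cmod_0 in Hv; lra.
      * lra.
      * unfold A; fold a; fold q; ring.
Qed.

Lemma Cexp_cut_pow (y : R) (i k : nat) :
  (i <= k)%nat ->
  Cexp (y + PI * Ci) ^ k * cut_var y ^ (k - i) = Cexp (y + PI * Ci) ^ i.
Proof.
  intros H; unfold cut_var; pose proof (Cexp_neq_0 (y + PI * Ci)) as Hz.
  rewrite Cpow_inv by exact Hz.
  replace k with (i + (k - i))%nat at 1 by lia; rewrite Cpow_add_r.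
  assert (Cexp (y + PI * Ci) ^ (k - i) <> 0) by (apply Cpow_nz, Hz).
  field; auto.
Qed.

(** With the powers of [z] from [shift_const] absorbed into the moments, all
    [N] series have the same moments and the same denominators, and
    [coef_equation] sums the coefficients to those of the primitive times
    the denominator. The denominator cancels, and what remains is the
    integral of the primitive over a single period. *)
Lemma g_sum_tail (t : C) :
  admissible t -> nonpole (t + INR (N - 1)) -> exists I,
    is_CInt (fun y => primitive N lq (param t) (RtoC y + PI * Ci + lq)) 0 ell I /\
    Csum (fun i => g N q (param t) i (param t O) * tail_series (t + INR i)) N = - I.
Proof.
  intros Ht Hnp; set (a := param t).
  assert (Hell : (0 < ell)%R) by (unfold ell; lra).
  assert (Hq0 : q <> 0) by apply Cexp_neq_0.
  pose proof (A_neq_0 t) as HA0.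
  assert (Hden : forall m, 1 - q ^ m / A t <> 0).
  { intros m; specialize (Hnp m); rewrite kappa_shift in Hnp by lia.
    replace (N - 1 - (N - 1))%nat with O in Hnp by lia.
    replace (q ^ 0 / A t * q ^ m) with (q ^ m / A t) in Hnp
      by (simpl; unfold Cdiv; ring); exact Hnp. }
  pose proof (off_cut_center t Ht) as Hzero.
  set (Qd := fun (y : R) m => quasi_periodic N lq a (y + PI * Ci) *
    Cexp (y + PI * Ci) ^ (N - 1) * cut_var y ^ m).
  set (Rm := fun m => CInt (fun y => Qd y m) 0 ell : C).
  assert (HRm : forall m, is_CInt (fun y => Qd y m) 0 ell (Rm m)).
  { intros m.
    apply (approx_is_CInt (strip_rect t 0 0 ell)
      (fun t' u => quasi_periodic N lq (param t') (u + PI * Ci) *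
        Cexp (u + PI * Ci) ^ (N - 1) * cut_var u ^ m) 0 ell t); [lra| |].
    - pose proof (strip_rect_bounded t 0 0 ell) as HK.
      apply approx_mult; auto.
      + apply approx_mult; auto.
        * apply approx_quasi_periodic_cut; auto.
        * apply approx_pow, approx_Cexp; auto.
          apply approx_plus; [apply approx_snd|apply approx_const].
      + apply approx_pow; auto; apply approx_cut_var; auto.
    - intros y Hy; split; [apply disc_center; lra|exists y; auto]. }
  assert (Hmom : forall i m, (i < N)%nat -> moment (t + INR i) m =
    shift_const q (a O) i * Rm (m + (N - 1 - i))%nat).
  { intros i m Hi; apply is_CInt_unique.
    eapply is_CInt_ext; [|intros y _|apply is_CInt_scal, HRm]; [fold ell; lra|].
    cbv beta; rewrite param_shift; fold a; unfold q.
    rewrite (quasi_periodic_shift_first N lq HN Hlq a i); fold q.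
    - unfold Qd; rewrite Cpow_add_r.
      rewrite <- (Cexp_cut_pow y i (N - 1)) by lia; ring.
    - apply param_neq_0.
    - intros j Hj; destruct (cut_factors_neq_0 t y Ht j Hj)
        as [H1 [_ H3]]; auto. }
  (* The [i]-th series re-indexed by [N - 1 - i], so that its moments no
     longer depend on [i]. *)
  set (f := fun i m => if lt_dec m (N - 1 - i) then RtoC 0 else
    shift_const q (a O) i * coef (t + INR i) (m - (N - 1 - i)) * Rm m
      / (1 - q ^ m / A t)).
  assert (Hf : forall i, (i < N)%nat -> Climit (Csum (f i)) (tail_series (t + INR i))).
  { intros i Hi; pose proof (admissible_shift t i Ht) as Hti.
    set (d := (N - 1 - i)%nat).
    set (b := fun m => coef (t + INR i) m * moment (t + INR i) m
      / (1 - kappa (t + INR i) * q ^ m)).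
    assert (Eb : forall m, b m = f i (m + d)%nat).
    { intros m; unfold b, f; fold d; destruct (lt_dec (m + d) d) as [|_]; [lia|].
      replace (m + d - d)%nat with m by lia.
      rewrite Hmom, kappa_shift by exact Hi; fold d.
      rewrite Cpow_add_r; unfold Cdiv.
      replace (q ^ d * / A t * q ^ m) with (q ^ m * q ^ d * / A t) by ring; ring. }
    assert (Hs : forall n, Csum (f i) (n + d) = Csum b n).
    { induction n as [|n IH].
      - simpl; rewrite (Csum_ext _ (fun _ => 0)), Csum_0; [reflexivity|].
        intros k Hk; unfold f; fold d; destruct (lt_dec k d); [reflexivity|lia].
      - simpl; rewrite IH, Eb; reflexivity. }
    destruct (admissible_bounds (t + INR i) Hti)
      as [M [sig [HM [Hsig [C1 [_ [D1 _]]]]]]].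
    assert (Hnz : forall m, 1 - kappa (t + INR i) * q ^ m <> 0).
    { intros m; rewrite kappa_shift by exact Hi; fold d.
      replace (q ^ d / A t * q ^ m) with (q ^ (d + m) / A t)
        by (rewrite Cpow_add_r; unfold Cdiv; ring); apply Hden. }
    destruct (inv_one_minus_pow_bound (kappa (t + INR i)) q (Cmod_q lq Hlq) Hnz)
      as [K [HK Hinv]].
    assert (Hb : Climit (Csum b) (Cseries b)).
    { apply (Cseries_geom b (M * M * K) sig Hsig); intros m.
      unfold b, Cdiv; rewrite !Cmod_mult.
      replace (M * M * K * sig ^ m)%R with (M * sig ^ m * M * K)%R by ring.
      repeat apply Rmult_le_compat; auto using Cmod_ge_0.
      apply Rmult_le_pos; apply Cmod_ge_0. }
    apply (Climit_shift (Csum (f i)) _ d).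
    apply Climit_ext with (Csum b); [intros n; symmetry; apply Hs|exact Hb]. }
  assert (HL : Climit (fun n => Csum (fun i => g N q a i (a O) * Csum (f i) n) N)
    (Csum (fun i => g N q a i (a O) * tail_series (t + INR i)) N)).
  { apply Climit_Csum; intros i Hi; apply Climit_scal, Hf, Hi. }
  destruct (primitive_part_analytic t Ht) as [M [sig [Hsig [_ HP]]]].
  assert (HQ : exists B, (0 <= B)%R /\ forall y, (0 <= y <= ell)%R ->
    (Cmod (Qd y O) <= B)%R).
  { pose proof (strip_rect_bounded t 0 0 ell) as HK.
    destruct (approx_bounded (strip_rect t 0 0 ell) (fun t' u =>
      quasi_periodic N lq (param t') (u + PI * Ci) * Cexp (u + PI * Ci) ^ (N - 1)) HK)
      as [B [HB HB2]].
    - apply approx_mult; auto.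
      + apply (approx_quasi_periodic_cut t 0 0 ell Ht Hzero).
      + apply approx_pow, approx_Cexp; auto.
        apply approx_plus; [apply approx_snd|apply approx_const].
    - exists B; split; [lra|]; intros y Hy; unfold Qd; simpl (cut_var y ^ 0).
      rewrite Cmult_1_r; apply HB2; split; [apply disc_center; lra|exists y; auto]. }
  destruct HQ as [B [HB HQB]].
  destruct (is_CInt_series
    (fun y => Qd y O * primitive_part N q a (cut_var y / q)) (fun m y => Qd y m)
    (fun m => pcoef t m / q ^ m) Rm 0 ell (B * M) sig) as [I0 [HI1 HI2]]; auto.
  { lra. }
  { intros n y Hy.
    replace (Csum (fun k => pcoef t k / q ^ k * Qd y k) n) with
      (Qd y O * Csum (fun k => pcoef t k / q ^ k * cut_var y ^ k) n).
    - match goal with |- (Cmod (?Q * ?u - ?Q * ?v) <= _)%R =>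
        replace (Q * u - Q * v) with (Q * (u - v)) by ring end.
      rewrite Cmod_mult, Rmult_assoc; apply Rmult_le_compat; auto using Cmod_ge_0.
      apply HP, Cmod_cut_var_le; lra.
    - rewrite <- Csum_scal; apply Csum_ext; intros k _; unfold Qd; simpl; ring. }
  exists (A t * I0); split.
  - eapply is_CInt_ext; [lra| |apply is_CInt_scal, HI1].
    intros y _; cbv beta.
    set (w := RtoC y + PI * Ci).
    assert (Hnz := cut_factors_neq_0 t y Ht).
    assert (Hnz' := cut_factors_neq_0 t (y - ell) Ht).
    assert (Ew : w + lq = RtoC (y - ell) + PI * Ci).
    { rewrite RtoC_minus; unfold w, ell; rewrite RtoC_opp, <- lq_real; ring. }
    assert (Hq := quasi_periodic_shift N lq HN Hlq a w
      ltac:(intros j _; apply param_neq_0)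
      ltac:(intros j Hj; split; apply (Hnz j Hj))).
    rewrite (primitive_factorization N lq HN a (w + lq)).
    + fold q; unfold Qd; fold w; rewrite Hq; unfold multiplier; fold q; fold (A t).
      change (Cprod a (2 * N)) with (A t).
      unfold cut_var; fold w; rewrite Cexp_plus; fold q.
      assert (Cexp w <> 0) by apply Cexp_neq_0.
      replace (/ Cexp w / q) with (/ (Cexp w * q)) by (field; auto).
      rewrite Cpow_mult_l; simpl (_ ^ 0).
      assert (q ^ (N - 1) <> 0) by (apply Cpow_nz, Hq0).
      set (X := quasi_periodic N lq a (w + lq)).
      set (Y := primitive_part N q a (/ (Cexp w * q))).
      field; auto.
    + intros j _; apply param_neq_0.
    + intros j Hj; rewrite Ew; destruct (Hnz' j Hj) as [X1 [X2 X3]].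
      split; [exact X1|split; [|exact X3]].
      intros E; apply X2; rewrite qpoch_inf_shift by (apply Cmod_q, Hlq).
      replace (param t j / Cexp (RtoC (y - ell) + PI * Ci) * q) with
        (q * a j / Cexp (RtoC (y - ell) + PI * Ci)) by (unfold a, Cdiv; ring).
      fold q in E; rewrite E; ring.
  - apply (Climit_unique _ _ _ HL).
    apply Climit_ext with (fun n => - A t * Csum (fun m => pcoef t m / q ^ m * Rm m) n).
    + intros n; rewrite <- Csum_scal.
      rewrite (Csum_ext (fun i => g N q a i (a O) * Csum (f i) n)
        (fun i => Csum (fun m => g N q a i (a O) * f i m) n))
        by (intros i _; symmetry; apply Csum_scal).
      rewrite Csum_swap; apply Csum_ext; intros m _.
      pose proof (coef_equation t m Ht) as HC; fold a in HC.
      assert (Hqm : q ^ m <> 0) by (apply Cpow_nz, Hq0).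
      specialize (Hden m).
      rewrite (Csum_ext _ (fun i => Rm m / (1 - q ^ m / A t) *
        (g N q a i (a O) * shift_const q (a O) i *
        (if lt_dec m (N - 1 - i) then 0 else coef (t + INR i) (m - (N - 1 - i)))))).
      * rewrite Csum_scal, HC.
        replace (1 - A t / q ^ m) with (- (A t / q ^ m) * (1 - q ^ m / A t))
          by (field; auto).
        field; repeat split; auto.
        intros E; apply Hden; replace (1 - q ^ m / A t) with ((A t - q ^ m) / A t)
          by (field; exact HA0).
        rewrite E; unfold Cdiv; ring.
      * intros i _; unfold f; destruct (lt_dec m (N - 1 - i)); unfold Cdiv; ring.
    + replace (- (A t * I0)) with (- A t * I0) by ring; apply Climit_scal, HI2.
Qed.

(** Circle and tail contributions are integrals of the primitive along the
    cut over the same period, with opposite signs. *)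
Lemma g_sum_I_cont (t : C) :
  Nat.Odd N -> admissible t -> nonpole (t + INR (N - 1)) ->
  Csum (fun i => g N q (param t) i (param t O) * I_cont (t + INR i)) N = 0.
Proof.
  intros Hodd Ht Hnp; pose proof PI_RGT_0 as Hpi.
  destruct (g_sum_tail t Ht Hnp) as [I [HI1 HI2]].
  pose proof (g_sum_circle N lq HN Hlq (param t) (param_neq_0 t O)
    ltac:(intros j Hj; apply (Ht j Hj))) as HC; fold q in HC.
  set (P := CInt (fun x => primitive N lq (param t) (PI * Ci + x * lq)) 0 1 : C) in *.
  assert (HlC : RtoC (Re lq) = lq) by (symmetry; apply lq_real).
  assert (Hlq0 : lq <> 0).
  { intros E; rewrite E in Hlq; simpl in Hlq; lra. }
  assert (HP : is_CInt (fun x => primitive N lq (param t) (PI * Ci + x * lq)) 0 1 P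
    /\ lq * P = - I).
  { assert (HI3 : is_CInt (fun x => lq * primitive N lq (param t) (PI * Ci + x * lq))
      0 1 (- I)).
    { assert (HS := is_RInt_swap (V := C_R_NormedModule) _ _ _ _ HI1).
      assert (HL := is_RInt_comp_lin (V := C_R_NormedModule)
        (fun y => primitive N lq (param t) (RtoC y + PI * Ci + lq)) (Re lq) ell 0 1
        (- I)).
      replace (Re lq * 0 + ell)%R with ell in HL by ring.
      replace (Re lq * 1 + ell)%R with 0%R in HL by (unfold ell; ring).
      eapply (is_RInt_ext (V := C_R_NormedModule)); [|exact (HL HS)].
      intros x _; cbv beta.
      replace (RtoC (Re lq * x + ell) + PI * Ci + lq) with (PI * Ci + x * lq).
      - rewrite scal_C, HlC; reflexivity.
      - rewrite RtoC_plus, RtoC_mult, HlC; unfold ell; rewrite RtoC_opp, HlC; ring. }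
    assert (HP0 : is_CInt (fun x => primitive N lq (param t) (PI * Ci + x * lq)) 0 1
      (/ lq * - I)).
    { eapply (is_RInt_ext (V := C_R_NormedModule)); [|apply (is_CInt_scal (/ lq)), HI3].
      intros x _; cbv beta; match goal with |- ?a = ?b => change (@eq C a b) end.
      field; exact Hlq0. }
    unfold P; rewrite (is_CInt_unique _ _ _ _ HP0); split; [exact HP0|].
    field; exact Hlq0. }
  destruct HP as [HP0 HP].
  assert (HM : CInt (fun x => primitive N lq (param t) (- (PI * Ci) + x * lq)) 0 1
    = - (1) * P).
  { apply is_CInt_unique.
    eapply (is_RInt_ext (V := C_R_NormedModule)); [|apply (is_CInt_scal (- (1))), HP0].
    intros x _; cbv beta; match goal with |- ?a = ?b => change (@eq C a b) end.
    replace (- (PI * Ci) + x * lq) with (x * lq - PI * Ci) by ring.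
    rewrite primitive_below by assumption.
    replace (PI * Ci + x * lq) with (x * lq + PI * Ci) by ring; ring. }
  rewrite HM in HC.
  set (J := Csum (fun i => g N q (param t) i (param t O) *
    int_circle N lq (shift_first q (param t) i)) N) in *.
  assert (Hpi0 : RtoC PI <> 0) by (apply RtoC_neq_0; lra).
  assert (HCi : Ci <> 0).
  { intros E; apply (f_equal Im) in E; unfold Im in E; simpl in E; lra. }
  assert (HJ : J = - Ci * I / PI).
  { replace J with (/ (2 * PI) * (2 * PI * J)) by (field; exact Hpi0).
    rewrite HC.
    replace (Ci * lq * (P - - (1) * P)) with (2 * Ci * (lq * P)) by ring.
    rewrite HP; field; exact Hpi0. }
  rewrite (Csum_ext _ (fun i => g N q (param t) i (param t O) *
    int_circle N lq (shift_first q (param t) i) +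
    / (PI * Ci) * (g N q (param t) i (param t O) * tail_series (t + INR i)))).
  2: { intros i _; unfold I_cont; rewrite param_shift; unfold Cdiv; ring. }
  rewrite Csum_plus, Csum_scal, HI2; fold J; rewrite HJ.
  replace (- Ci) with (/ Ci) by (rewrite Ci_inv; ring).
  field; auto.
Qed.

(** * Analytic continuation in the first exponent *)

Lemma kappa_plus (t d : C) : kappa (t + d) = kappa t * Cexp (- (lq * d)).
Proof.
  rewrite !kappa_Cexp, <- Cexp_plus; f_equal.
  assert (E : forall n, Csum (log_param (t + d)) (S n) =
    Csum (log_param t) (S n) + lq * d).
  { induction n as [|n IH].
    - simpl; unfold log_param; simpl; ring.
    - change (Csum (log_param (t + d)) (S (S n)))
        with (Csum (log_param (t + d)) (S n) + log_param (t + d) (S n)).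
      rewrite IH; simpl; unfold log_param; simpl; ring. }
  replace (2 * N)%nat with (S (2 * N - 1)) by lia; rewrite E; ring.
Qed.

Lemma approx1_kappa (t0 : C) (r : R) : approx1 (disc t0 r) kappa.
Proof.
  pose proof (bounded1_2 _ (disc_bounded t0 r)) as HK.
  apply approx_ext with (fun t _ =>
    Cexp (INR (N - 1) * lq + - (1) * Csum (log_param t) (2 * N))).
  - intros t u _; symmetry; apply kappa_Cexp.
  - apply approx_Cexp; auto; apply approx_plus; [apply approx_const|].
    apply approx_scal; auto.
    apply (approx_Csum _ (fun j t _ => log_param t j)).
    intros j _; apply approx_log_param, HK.
Qed.

(** [|kappa|] is strictly monotone along the real direction, so none of the
    functions [1 - kappa q^m] vanishes identically near a point. *)
Lemma poles_isolated (t0 : C) (n : nat) :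
  exists r, (0 < r)%R /\ forall t, (0 < Cmod (t - t0) < r)%R ->
    forall m, (m < n)%nat -> 1 - kappa t * q ^ m <> 0.
Proof.
  induction n as [|n [r [Hr IH]]].
  - exists 1%R; split; [lra|]; intros; lia.
  - destruct (isolated_zeros (fun t => 1 - kappa t * q ^ n) t0 1) as [H|[r' [Hr' H]]].
    + lra.
    + pose proof (bounded1_2 _ (disc_bounded t0 1)) as HK.
      apply (approx_minus _ (fun _ _ => 1) (fun t _ => kappa t * q ^ n));
        auto using approx_const.
      apply (approx_mult _ (fun t _ => kappa t)); auto using approx_const.
      apply approx1_kappa.
    + exfalso.
      assert (H0 := H t0 ltac:(replace (t0 - t0) with (RtoC 0) by ring;
        rewrite Cmod_0; lra)).
      assert (H1 := H (t0 + (1 / 2)%R) ltac:(replace (t0 + (1 / 2)%R - t0)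
        with (RtoC (1 / 2)) by ring; rewrite Cmod_R, Rabs_pos_eq; lra)).
      cbv beta in H0, H1; rewrite kappa_plus in H1.
      assert (E0 : kappa t0 * q ^ n = 1).
      { replace (kappa t0 * q ^ n) with (1 - (1 - kappa t0 * q ^ n)) by ring.
        rewrite H0; ring. }
      assert (E1 : Cexp (- (lq * (1 / 2)%R)) = 1).
      { transitivity (kappa t0 * q ^ n * Cexp (- (lq * (1 / 2)%R)));
          [rewrite E0; ring|].
        transitivity (1 - (1 - kappa t0 * Cexp (- (lq * (1 / 2)%R)) * q ^ n)); [ring|].
        rewrite H1; ring. }
      apply (f_equal Cmod) in E1; rewrite Cmod_Cexp, Cmod_1 in E1.
      replace (Re (- (lq * (1 / 2)%R))) with (- Re lq / 2)%R in E1
        by (unfold Re; simpl; field).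
      assert (exp 0 < exp (- Re lq / 2))%R by (apply exp_increasing; lra).
      rewrite exp_0 in *; lra.
    + exists (Rmin r r'); split; [apply Rmin_pos; lra|]; intros t Ht m Hm.
      pose proof (Rmin_l r r'); pose proof (Rmin_r r r').
      destruct (Nat.eq_dec m n) as [->|E]; [apply H; lra|apply IH; [lra|lia]].
Qed.

(** On a small disc only finitely many of the denominators [1 - kappa q^m]
    can vanish. Their product [B] clears the poles, and the rest of the
    series is uniformly approximable. *)
Lemma I_cont_meromorphic (t0 : C) :
  admissible t0 -> exists r F B, (0 < r)%R /\
    approx1 (disc t0 r) F /\ approx1 (disc t0 r) B /\
    forall t, disc t0 r t -> admissible t /\
      (nonpole t -> B t <> 0 /\ B t * I_cont t = F t) /\ (t <> t0 -> nonpole t).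
Proof.
  intros Ht0; pose proof PI_RGT_0 as Hpi.
  pose proof (Cmod_q lq Hlq) as Hq; fold q in Hq.
  destruct (admissible_nbhd t0 Ht0) as [r0 [rho [Hr0 [Hrho Hn]]]].
  destruct (coef_uniform t0 r0 rho Hr0 Hrho) as [M1 [sig [Hs [C1 [C2 _]]]]].
  { intros t Ht j Hj; apply Hn; auto. }
  destruct (moment_uniform t0 r0 Ht0) as [M2 [HM2 [D1 [D2 _]]]].
  { intros t Ht j Hj; apply Hn; auto. }
  assert (Hadm : forall t, disc t0 r0 t -> admissible t).
  { intros t Ht j Hj; destruct (Hn t Ht j Hj) as [X1 X2].
    destruct (Ht0 j Hj) as [_ X3]; split; [lra|].
    unfold Rabs in *; destruct (Rcase_abs (Im (log_param t j))),
      (Rcase_abs (Im (log_param t0 j))),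
      (Rcase_abs (Im (log_param t j) - Im (log_param t0 j))); lra. }
  pose proof (approx1_kappa t0 r0) as Hkap.
  destruct (approx1_bounded _ _ (disc_bounded t0 r0) Hkap) as [Kk [HKk HkB]].
  (* From [n] on the denominators stay in the half-plane [Re >= 1/2]. *)
  destruct (pow_small (Cmod q) Kk (/ 2)) as [n Hsm].
  { split; [apply Cmod_ge_0|exact Hq]. }
  { lra. }
  pose proof (bounded1_2 _ (disc_bounded t0 r0)) as HK.
  set (K := fun t u : C => disc t0 r0 t /\ u = 0) in *.
  assert (Hfac : forall m, approx K (fun t _ => 1 - kappa t * q ^ m)).
  { intros m; apply approx_minus; auto using approx_const.
    apply (approx_mult _ (fun t _ => kappa t)); auto using approx_const. }
  assert (Hfar : forall m t, disc t0 r0 t ->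
    (/ 2 <= Re (1 * (1 - kappa t * q ^ (n + m))))%R).
  { intros m t Ht; specialize (Hsm (n + m)%nat ltac:(lia)).
    pose proof (re_le_Cmod (kappa t * q ^ (n + m))) as HR.
    rewrite Cmod_mult, Cmod_pow in HR.
    assert (Cmod (kappa t) * Cmod q ^ (n + m) <= Kk * Cmod q ^ (n + m))%R.
    { apply Rmult_le_compat_r; [apply pow_le, Cmod_ge_0|apply HkB, Ht]. }
    replace (Re (1 * (1 - kappa t * q ^ (n + m))))
      with (1 - Re (kappa t * q ^ (n + m)))%R by (unfold Re; simpl; ring).
    pose proof (Rle_abs (Re (kappa t * q ^ (n + m)))); lra. }
  assert (Hfar1 : forall m t, disc t0 r0 t ->
    (/ 2 <= Cmod (1 - kappa t * q ^ (n + m)))%R).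
  { intros m t Ht; specialize (Hfar m t Ht); rewrite Cmult_1_l in Hfar.
    pose proof (re_le_Cmod (1 - kappa t * q ^ (n + m))) as HR.
    pose proof (Rle_abs (Re (1 - kappa t * q ^ (n + m)))); lra. }
  set (b := fun t m => coef t m * moment t m / (1 - kappa t * q ^ m)).
  set (W := fun t => Cseries (fun m => b t (n + m)%nat)).
  assert (HM1 : (0 <= M1)%R).
  { pose proof (C2 t0 O (disc_center t0 r0 ltac:(lra))) as X; simpl in X.
    pose proof (Cmod_ge_0 (coef t0 O)); lra. }
  assert (HWb : forall t m, disc t0 r0 t ->
    (Cmod (b t (n + m)%nat) <= M1 * M2 * 2 * sig ^ m)%R).
  { intros t m Ht; unfold b, Cdiv; rewrite !Cmod_mult, Cmod_inv.
    - replace (M1 * M2 * 2 * sig ^ m)%R with (M1 * sig ^ m * M2 * / / 2)%R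
        by (rewrite Rinv_inv; ring).
      specialize (Hfar1 m t Ht).
      apply Rmult_le_compat.
      + apply Rmult_le_pos; apply Cmod_ge_0.
      + left; apply Rinv_0_lt_compat; lra.
      + apply Rmult_le_compat; auto using Cmod_ge_0.
        eapply Rle_trans; [apply C2, Ht|]; apply Rmult_le_compat_l; [exact HM1|].
        rewrite pow_add; assert (0 <= sig ^ m)%R by (apply pow_le; lra).
        assert (0 <= sig ^ n <= 1)%R by (apply pow_unit; lra).
        nra.
      + apply Rinv_le_contravar; lra.
    - apply Cmod_gt_0; specialize (Hfar1 m t Ht); lra. }
  assert (HW : approx K (fun t _ => W t)).
  { apply (approx_Cseries K (fun m t _ => b t (n + m)%nat) (M1 * M2 * 2) sig Hs).
    - intros m; unfold b; apply approx_mult; auto.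
      + apply approx_mult; auto; [apply (C1 (n + m)%nat)|apply (D1 (n + m)%nat)].
      + apply (approx_inv K _ 1 (/ 2)); auto; [lra|rewrite Cmod_1; lra|].
        intros t u [Ht _]; apply Hfar, Ht.
    - intros m t u [Ht _]; apply HWb, Ht. }
  set (B := fun t => Cprod (fun m => 1 - kappa t * q ^ m) n).
  set (Bm := fun m t => Cprod (fun k => if Nat.eq_dec k m then 1
    else 1 - kappa t * q ^ k) n).
  set (F := fun t => B t * int_circle N lq (param t) +
    / (PI * Ci) * (Csum (fun m => coef t m * moment t m * Bm m t) n + B t * W t)).
  assert (HB : approx K (fun t _ => B t)).
  { apply (approx_Cprod K (fun m t _ => 1 - kappa t * q ^ m)); auto. }
  assert (HF : approx K (fun t _ => F t)).
  { unfold F; apply approx_plus.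
    - apply approx_mult; auto.
      apply (approx1_int_circle t0 r0 rho); [lra|].
      intros t Ht j Hj; apply Hn; auto.
    - apply approx_scal; auto; apply approx_plus; [|apply approx_mult; auto].
      apply (approx_Csum K (fun m t _ => coef t m * moment t m * Bm m t)).
      intros m _; apply approx_mult; auto.
      + apply approx_mult; auto; [apply (C1 m)|apply (D1 m)].
      + apply (approx_Cprod K (fun k t _ => if Nat.eq_dec k m then 1
          else 1 - kappa t * q ^ k)); auto.
        intros k _; destruct (Nat.eq_dec k m); auto using approx_const. }
  assert (HBF : forall t, disc t0 r0 t -> nonpole t -> B t <> 0 /\ B t * I_cont t = F t).
  { intros t Ht Hnp; split; [apply Cprod_neq_0; intros m _; apply Hnp|].
    assert (HT : tail_series t = Csum (b t) n + W t).
    { apply Cseries_unique.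
      apply (Climit_shift _ _ n).
      apply Climit_ext with (fun k => Csum (b t) n + Csum (fun m => b t (n + m)%nat) k).
      - intros k; rewrite <- Csum_add, Nat.add_comm; reflexivity.
      - apply Climit_plus; [apply Climit_const|].
        apply (Cseries_geom _ (M1 * M2 * 2) sig Hs); intros m; apply HWb, Ht. }
    unfold I_cont, F; rewrite HT.
    replace (Csum (fun m => coef t m * moment t m * Bm m t) n) with (B t * Csum (b t) n).
    - unfold Cdiv; ring.
    - rewrite <- Csum_scal; apply Csum_ext; intros m Hm.
      unfold B; rewrite <- (Cprod_remove _ n m Hm); fold (Bm m t).
      unfold b; field; apply Hnp. }
  destruct (poles_isolated t0 n) as [r1 [Hr1 Hiso]].
  set (r := Rmin r0 (r1 / 2)).
  assert (Hr : (0 < r)%R) by (unfold r; apply Rmin_pos; lra).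
  assert (Hrr0 : (r <= r0)%R) by apply Rmin_l.
  assert (Hrr1 : (r <= r1 / 2)%R) by apply Rmin_r.
  assert (Hsub : forall t, disc t0 r t -> disc t0 r0 t)
    by (unfold disc; intros; lra).
  exists r, F, B; split; [exact Hr|]; split; [|split].
  - eapply approx_subset; [|exact HF]; intros t u [X1 X2]; split; auto.
  - eapply approx_subset; [|exact HB]; intros t u [X1 X2]; split; auto.
  - intros t Ht; split; [apply Hadm, Hsub, Ht|split; [apply HBF, Hsub, Ht|]].
    intros Hne m; destruct (le_gt_dec n m) as [Hm|Hm].
    + replace m with (n + (m - n))%nat by lia.
      apply Cmod_gt_0; specialize (Hfar1 (m - n)%nat t (Hsub t Ht)); fold q; lra.
    + apply Hiso; [|lia]; unfold disc in Ht; split; [|lra].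
      apply Cmod_gt_0, Cdiff_neq_0, Hne.
Qed.

Lemma I_cont_continuous (t0 : C) :
  admissible t0 -> nonpole t0 -> continuous_at I_cont t0.
Proof.
  intros Ht0 Hnp.
  destruct (I_cont_meromorphic t0 Ht0) as [r [F [B [Hr [HF [HB H]]]]]].
  assert (Hc : disc t0 r t0) by (apply disc_center; lra).
  destruct (proj1 (proj2 (H t0 Hc)) Hnp) as [HB0 _].
  set (B0 := B t0) in *.
  assert (HB0' : (0 < Cmod B0)%R) by (apply Cmod_gt_0, HB0).
  destruct (approx1_disc_continuous B t0 r Hr HB (Cmod B0 / 2)%R ltac:(lra))
    as [del [Hdel Hd]].
  set (r' := Rmin r (del / 2)).
  assert (Hr' : (0 < r')%R) by (unfold r'; apply Rmin_pos; lra).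
  assert (Hr1 : (r' <= r)%R) by apply Rmin_l.
  assert (Hr2 : (r' <= del / 2)%R) by apply Rmin_r.
  assert (Hsub : forall t, disc t0 r' t -> disc t0 r t) by (unfold disc; intros; lra).
  pose proof (bounded1_2 _ (disc_bounded t0 r')) as HK.
  apply (approx1_disc_continuous I_cont t0 r' Hr').
  apply (approx1_ext (disc t0 r') (fun t => F t * / B t)).
  - intros t Ht; destruct (H t (Hsub t Ht)) as [_ [X1 X2]].
    assert (Hnt : nonpole t).
    { destruct (classic (t = t0)) as [->|E]; auto. }
    destruct (X1 Hnt) as [Y1 Y2]; rewrite <- Y2; field; exact Y1.
  - apply (approx_mult _ (fun t _ => F t) (fun t _ => / B t)); auto.
    + eapply approx_subset; [|exact HF]; intros t u [X1 X2]; split; auto.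
    + apply (approx_inv _ (fun t _ => B t) (RtoC (Cmod B0) / B0) (Cmod B0 / 2)); auto.
      * eapply approx_subset; [|exact HB]; intros t u [X1 X2]; split; auto.
      * lra.
      * rewrite Cmod_div, Cmod_R, Rabs_pos_eq by (try exact HB0; lra).
        right; field; lra.
      * intros t u [Ht _].
        assert (Hdt : (Cmod (B t - B0) < Cmod B0 / 2)%R).
        { apply Hd; unfold disc in Ht; lra. }
        replace (RtoC (Cmod B0) / B0 * B t)
          with (RtoC (Cmod B0) + RtoC (Cmod B0) / B0 * (B t - B0))
          by (field; exact HB0).
        set (Z := RtoC (Cmod B0) / B0 * (B t - B0)).
        assert (HZ : (Cmod Z < Cmod B0 / 2)%R).
        { unfold Z; rewrite Cmod_mult, Cmod_div, Cmod_R, Rabs_pos_eq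
            by (try exact HB0; lra).
          replace (Cmod B0 / Cmod B0)%R with 1%R by (field; lra); lra. }
        replace (Re (RtoC (Cmod B0) + Z)) with (Cmod B0 + Re Z)%R by reflexivity.
        pose proof (re_le_Cmod Z) as HR; unfold Rabs in HR.
        destruct (Rcase_abs (Re Z)); lra.
Qed.

Lemma set_first_admissible (t : C) :
  (forall j, (j < 2 * N)%nat ->
     (Cmod (params lq s j) < 1)%R /\ (Rabs (Im (lq * s j)) < PI)%R) ->
  (Cmod (qpow lq t) < 1)%R -> (Rabs (Im (lq * t)) < PI)%R -> admissible t.
Proof.
  intros H H1 H2 [|j] Hj; [split; assumption|apply (H (S j) Hj)].
Qed.

Lemma tail_converges_nbhd (t : C) :
  tail_converges N (set_first s t) -> exists r, (0 < r)%R /\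
    forall y, (Cmod (y - t) < r)%R -> tail_converges N (set_first s y).
Proof.
  intros H; unfold tail_converges in *.
  assert (E : forall y n, sum_n (fun j => Re (set_first s y j)) n =
    (Re y - Re t + sum_n (fun j => Re (set_first s t j)) n)%R).
  { intros y; induction n as [|n IH].
    - rewrite !sum_O; simpl; ring.
    - rewrite !sum_Sn, IH; unfold plus; simpl; ring. }
  exists (INR N - 1 - sum_n (fun j => Re (set_first s t j)) (2 * N - 1))%R.
  split; [lra|]; intros y Hy; rewrite E.
  pose proof (re_le_Cmod (y - t)) as HR.
  replace (Re (y - t)) with (Re y - Re t)%R in HR by (unfold Re; simpl; ring).
  pose proof (Rle_abs (Re y - Re t)); lra.
Qed.

(** Identity theorem. The exponents near which [f] agrees with [I_cont] off
    the poles, and those around which it differs from it everywhere, form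
    open sets that cover the connected domain. The first is not empty, since
    it contains the exponents at which the tail converges. Close to a common
    point the two conditions contradict each other, so the second set does
    not meet the domain. *)
Lemma continuation_unique (D : C -> Prop) (f : C -> C) :
  Nat.Odd N ->
  (forall j, (j < 2 * N)%nat ->
     (Cmod (params lq s j) < 1)%R /\ (Rabs (Im (lq * s j)) < PI)%R) ->
  I_continuation N lq s D f ->
  forall t, D t -> admissible t /\ continuous_at f t /\
    exists r, (0 < r)%R /\ forall y, (Cmod (y - t) < r)%R ->
      nonpole y -> f y = I_cont y.
Proof.
  intros Hodd Hs [HDo [HDc [HDd [[t1 [HD1 Htail1]] [Hana Hf]]]]].
  pose proof (proj1 (open_Cmod D) HDo) as HDo'.
  assert (Hadm : forall t, D t -> admissible t).
  { intros t Ht; destruct (HDd t Ht); apply set_first_admissible; auto. }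
  assert (Hfap : forall t, D t -> exists r, (0 < r)%R /\ approx1 (disc t r) f).
  { intros t Ht; destruct (Hana t Ht) as [c [r Hc]].
    exists (r / 2)%R; split; [pose proof (cond_pos r); lra|].
    apply (pseries_approx1 c t r f (cond_pos r)); exact Hc. }
  set (U := fun x => exists r, (0 < r)%R /\ forall y, (Cmod (y - x) < r)%R ->
    nonpole y -> f y = I_cont y).
  set (V := fun x => exists r, (0 < r)%R /\ forall y, (0 < Cmod (y - x) < r)%R ->
    nonpole y /\ f y <> I_cont y).
  assert (HU : open U).
  { apply open_Cmod; intros x [r [Hr H]]; exists (r / 2)%R; split; [lra|].
    intros z Hz; exists (r / 2)%R; split; [lra|]; intros y Hy; apply H.
    pose proof (Cmod_triangle (y - z) (z - x)) as T.
    replace (y - z + (z - x)) with (y - x) in T by ring; lra. }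
  assert (HV : open V).
  { apply open_Cmod; intros x [r [Hr H]]; exists r; split; [lra|].
    intros z Hz; destruct (classic (z = x)) as [->|E]; [exists r; auto|].
    assert (Hzx : (0 < Cmod (z - x))%R) by (apply Cmod_gt_0, Cdiff_neq_0, E).
    exists (Rmin (Cmod (z - x)) (r - Cmod (z - x))).
    split; [apply Rmin_pos; lra|]; intros y Hy; apply H.
    pose proof (Rmin_l (Cmod (z - x)) (r - Cmod (z - x))).
    pose proof (Rmin_r (Cmod (z - x)) (r - Cmod (z - x))).
    pose proof (Cmod_triangle (y - z) (z - x)) as T.
    replace (y - z + (z - x)) with (y - x) in T by ring.
    pose proof (Cmod_triangle_inv (z - x) (z - y)) as T2.
    replace (z - x - (z - y)) with (y - x) in T2 by ring.
    rewrite (Cmod_minus_sym z y) in T2; lra. }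
  assert (HUV : forall x, D x -> U x \/ V x).
  { intros x Hx.
    destruct (Hfap x Hx) as [r1 [Hr1 Hf1]].
    destruct (I_cont_meromorphic x (Hadm x Hx)) as [r2 [F [B [Hr2 [HF [HB H]]]]]].
    set (r := Rmin r1 r2).
    assert (Hr : (0 < r)%R) by (unfold r; apply Rmin_pos; lra).
    assert (L1 : (r <= r1)%R) by apply Rmin_l.
    assert (L2 : (r <= r2)%R) by apply Rmin_r.
    pose proof (bounded1_2 _ (disc_bounded x r)) as HK.
    destruct (isolated_zeros (fun t => f t * B t - F t) x r Hr) as [Hz|[r' [Hr' Hz]]].
    - apply (approx_minus _ (fun t _ => f t * B t) (fun t _ => F t)); auto.
      + apply (approx_mult _ (fun t _ => f t) (fun t _ => B t)); auto.
        * eapply approx_subset; [|exact Hf1]; intros t u [X1 X2]; split; auto.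
          unfold disc in *; lra.
        * eapply approx_subset; [|exact HB]; intros t u [X1 X2]; split; auto.
          unfold disc in *; lra.
      + eapply approx_subset; [|exact HF]; intros t u [X1 X2]; split; auto.
        unfold disc in *; lra.
    - left; exists r; split; [exact Hr|]; intros y Hy Hnp.
      destruct (H y ltac:(unfold disc; lra)) as [_ [X1 _]].
      destruct (X1 Hnp) as [Y1 Y2]; specialize (Hz y Hy); cbv beta in Hz.
      rewrite <- Y2 in Hz.
      replace (f y) with (/ B y * (f y * B y - B y * I_cont y) + I_cont y)
        by (field; exact Y1).
      rewrite Hz; ring.
    - right; exists r'; split; [lra|]; intros y Hy.
      destruct (H y ltac:(unfold disc; lra)) as [_ [X1 X2]].
      assert (Hnp : nonpole y).
      { apply X2; intros E; rewrite E in Hy.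
        replace (x - x) with (RtoC 0) in Hy by ring; rewrite Cmod_0 in Hy; lra. }
      split; [exact Hnp|]; intros E; apply (Hz y Hy).
      destruct (X1 Hnp) as [Y1 Y2]; rewrite <- Y2, E; ring. }
  assert (HU1 : exists x, D x /\ U x).
  { exists t1; split; [exact HD1|].
    destruct (HDo' t1 HD1) as [r1 [Hr1 H1]].
    destruct (tail_converges_nbhd t1 Htail1) as [r2 [Hr2 H2]].
    exists (Rmin r1 r2); split; [apply Rmin_pos; lra|]; intros y Hy _.
    pose proof (Rmin_l r1 r2); pose proof (Rmin_r r1 r2).
    assert (HDy : D y) by (apply H1; lra).
    assert (Hty : tail_converges N (set_first s y)) by (apply H2; lra).
    rewrite (Hf y HDy Hty).
    apply (I_int_cont y Hodd (Hadm y HDy) Hty). }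
  intros t Ht; split; [apply Hadm, Ht|]; split.
  { destruct (Hfap t Ht) as [r [Hr Hfr]]; apply (approx1_disc_continuous f t r Hr Hfr). }
  destruct (HUV t Ht) as [HUt|HVt]; [exact HUt|].
  exfalso.
  destruct (HDc U V HU HV HUV HU1 (ex_intro _ t (conj Ht HVt)))
    as [x [_ [[r1 [Hr1 H1]] [r2 [Hr2 H2]]]]].
  (* At the point [x + e] the two sets make opposite claims. *)
  set (e := (Rmin r1 r2 / 2)%R).
  assert (He : (0 < e)%R) by (unfold e; pose proof (Rmin_pos r1 r2 Hr1 Hr2); lra).
  pose proof (Rmin_l r1 r2); pose proof (Rmin_r r1 r2).
  assert (Hd : Cmod (x + e - x) = e).
  { replace (x + e - x) with (RtoC e) by ring; rewrite Cmod_R, Rabs_pos_eq; lra. }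
  destruct (H2 (x + e)) as [X1 X2]; [rewrite Hd; unfold e in *; lra|].
  apply X2, H1; [rewrite Hd; unfold e in *; lra|exact X1].
Qed.

(** * The limit at the given exponents *)

Lemma g_continuous (t0 : C) (i : nat) :
  admissible t0 -> continuous_at (fun t => g N q (param t) i (param t O)) t0.
Proof.
  intros Ht0; pose proof (Cmod_q lq Hlq) as Hq; fold q in Hq.
  destruct (admissible_nbhd t0 Ht0) as [r [rho [Hr [Hrho Hn]]]].
  apply (approx1_disc_continuous (fun t => g N q (param t) i (param t O)) t0 r Hr).
  pose proof (bounded1_2 _ (disc_bounded t0 r)) as HK.
  set (K := fun t u : C => disc t0 r t /\ u = 0) in *.
  assert (Hp : forall j, approx K (fun t _ => param t j)).
  { intros j; apply (approx_param K j HK). }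
  assert (Hx : approx K (fun t _ => param t O)) by apply Hp.
  assert (Hxi : approx K (fun t _ => / param t O)).
  { apply (approx_Cexp_inv K (fun t _ => log_param t O)); auto.
    apply approx_log_param, HK. }
  assert (Hx1 : forall t u, K t u -> (Cmod (param t O) <= rho)%R).
  { intros t u [Ht _]; apply (Hn t Ht O); lia. }
  assert (Hq0 : q <> 0) by apply Cexp_neq_0.
  assert (Hsig : forall m, approx K (fun t _ => Defs.sigma N (param t) m)).
  { intros m; apply (approx_esym K param m (seq 0 (2 * N))); auto. }
  assert (Hqk : forall k, (0 <= Cmod q ^ k <= 1)%R).
  { intros k; apply Cmod_pow_unit; lra. }
  assert (Hb : forall k t u, K t u -> (Cmod (q ^ k * param t O ^ 2) <= rho)%R).
  { intros k t u H; specialize (Hx1 t u H); specialize (Hqk k).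
    rewrite Cmod_mult, !Cmod_pow; pose proof (Cmod_ge_0 (param t O)); simpl.
    assert (Cmod (param t O) * (Cmod (param t O) * 1) <= rho * 1)%R
      by (apply Rmult_le_compat; lra).
    nra. }
  assert (HD : forall j, approx K (fun t _ => / (qpoch q q (i - j) * qpoch q q j
    * qpoch (q ^ (2 * j) * param t O ^ 2) q (i - j + 1)
    * qpoch (q ^ j * param t O ^ 2) q j))).
  { intros j.
    assert (HC : forall n, approx K (fun _ _ => / qpoch q q n) /\
      forall t u, K t u -> qpoch q q n <> 0).
    { intros n; apply (approx_inv_qpoch K (fun _ _ => q) q (Cmod q)); auto.
      - apply approx_const.
      - intros; lra. }
    assert (HP : forall k n, approx K (fun t _ => / qpoch (q ^ k * param t O ^ 2) q n) /\
      forall t u, K t u -> qpoch (q ^ k * param t O ^ 2) q n <> 0).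
    { intros k n.
      apply (approx_inv_qpoch K (fun t _ => q ^ k * param t O ^ 2) q rho); [exact HK|exact Hq| |lra|exact (Hb k)].
      apply approx_scal; [exact HK|apply (approx_pow K (fun t _ => param t O)); auto]. }
    apply (approx_inv_mult K (fun t _ => qpoch q q (i - j) * qpoch q q j
      * qpoch (q ^ (2 * j) * param t O ^ 2) q (i - j + 1))
      (fun t _ => qpoch (q ^ j * param t O ^ 2) q j)); auto.
    apply (approx_inv_mult K (fun t _ => qpoch q q (i - j) * qpoch q q j)
      (fun t _ => qpoch (q ^ (2 * j) * param t O ^ 2) q (i - j + 1))); auto.
    apply (approx_inv_mult K (fun t _ => qpoch q q (i - j))
      (fun t _ => qpoch q q j)); auto. }
  set (term := fun (j m : nat) (t : C) =>
    (- (1)) ^ (j + m) * (Defs.sigma N (param t) m - Defs.sigma N (param t) (2 * N - m))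
    * ((q ^ j * param t O) ^ m * (/ q ^ j * / param t O) ^ N * q ^ (j * (j + 1) / 2)
       * / (qpoch q q (i - j) * qpoch q q j
          * qpoch (q ^ (2 * j) * param t O ^ 2) q (i - j + 1)
          * qpoch (q ^ j * param t O ^ 2) q j))).
  apply approx_ext with (fun t _ => param t O * q ^ i *
    Csum (fun j => Csum (fun m => term j m t) (S (2 * N))) (S i)).
  - intros t u _; unfold g; rewrite sum_n_Csum; f_equal.
    apply Csum_ext; intros j _; rewrite sum_n_Csum; apply Csum_ext; intros m _.
    assert (q ^ j <> 0) by (apply Cpow_nz, Hq0).
    assert (param t O <> 0) by apply param_neq_0.
    unfold term; replace (/ q ^ j * / param t O) with (/ (q ^ j * param t O))
      by (field; auto).
    rewrite Cpow_inv by (apply Cmult_neq_0; auto); reflexivity.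
  - apply approx_mult; auto; [apply approx_mult; auto using approx_const|].
    apply (approx_Csum K (fun j t _ => Csum (fun m => term j m t) (S (2 * N)))).
    intros j _; apply (approx_Csum K (fun m t _ => term j m t)).
    intros m _; unfold term; apply approx_mult; auto.
    + apply approx_mult; auto using approx_const, approx_minus.
    + apply approx_mult; auto; apply approx_mult; auto using approx_const.
      apply approx_mult; auto; apply approx_pow; auto; apply approx_mult;
        auto using approx_const.
Qed.

Lemma set_first_set_first (u : C) : set_first (set_first s u) = set_first s.
Proof.
  apply functional_extensionality; intros t; apply functional_extensionality.
  intros [|j]; reflexivity.
Qed.

(** Where the tail converges the function is [I_cont] itself; otherwise it
    is the given continuation, by uniqueness. *)
Lemma I_value_I_cont (i : nat) (v : C) :
  Nat.Odd N ->
  (forall j, (j < 2 * N)%nat ->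
     (Cmod (params lq s j) < 1)%R /\ (Rabs (Im (lq * s j)) < PI)%R) ->
  admissible (s O + INR i) ->
  I_value N lq (set_first s (s O + INR i)) v ->
  exists f, f (s O + INR i) = v /\ continuous_at f (s O + INR i) /\
    exists r, (0 < r)%R /\ forall y, (Cmod (y - (s O + INR i)) < r)%R ->
      nonpole y -> f y = I_cont y.
Proof.
  intros Hodd Hs Hadm [[[He|Ht] Hv]|[_ [D [f [HD [HDs Hv]]]]]].
  - destruct (Nat.Even_Odd_False N He Hodd).
  - destruct (I_int_cont (s O + INR i) Hodd Hadm Ht) as [E Hnp].
    exists I_cont; split; [rewrite Hv; symmetry; exact E|]; split.
    + apply (I_cont_continuous); auto.
    + exists 1%R; split; [lra|auto].
  - assert (HD' : I_continuation N lq s D f).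
    { unfold I_continuation in *; rewrite set_first_set_first in HD; exact HD. }
    destruct (continuation_unique D f Hodd Hs HD' _ HDs)
      as [_ [Hc Hr]].
    exists f; split; [symmetry; exact Hv|]; split; assumption.
Qed.

(** The exponents [s_0 + i] may be poles of the formula for [I_cont] at
    which the continuation is regular. Poles are isolated, so the equation
    holds at [s_0 + y] for small [y <> 0], and [y] tends to 0. *)
Lemma g_sum_odd (I : nat -> C) :
  Nat.Odd N ->
  (forall j, (j < 2 * N)%nat ->
     (Cmod (params lq s j) < 1)%R /\ (Rabs (Im (lq * s j)) < PI)%R) ->
  (forall i, (i < N)%nat -> I_value N lq (set_first s (s O + INR i)) (I i)) ->
  Csum (fun i => g N q (params lq s) i (params lq s O) * I i) N = 0.
Proof.
  intros Hodd Hs HI.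
  assert (Es : param (s O) = params lq s).
  { apply functional_extensionality; intros [|j]; reflexivity. }
  assert (Hadm0 : admissible (s O)).
  { intros j Hj; rewrite Es; unfold log_param.
    replace (set_first s (s O) j) with (s j) by (destruct j; reflexivity).
    apply Hs, Hj. }
  assert (Hadm : forall i, admissible (s O + INR i)).
  { intros i; apply (admissible_shift), Hadm0. }
  assert (HF : forall i, exists f, (i < N)%nat -> f (s O + INR i) = I i /\
    continuous_at f (s O + INR i) /\
    exists r, (0 < r)%R /\ forall y, (Cmod (y - (s O + INR i)) < r)%R ->
      nonpole y -> f y = I_cont y).
  { intros i; destruct (lt_dec i N) as [Hi|Hi].
    - destruct (I_value_I_cont i (I i) Hodd Hs (Hadm i) (HI i Hi)) as [f Hf].
      exists f; auto.
    - exists (fun _ => 0); intros Hi'; contradiction. }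
  pose (f := fun i => proj1_sig (constructive_indefinite_description _ (HF i))).
  assert (Hf : forall i, (i < N)%nat -> f i (s O + INR i) = I i /\
    continuous_at (f i) (s O + INR i) /\
    exists r, (0 < r)%R /\ forall y, (Cmod (y - (s O + INR i)) < r)%R ->
      nonpole y -> f i y = I_cont y).
  { intros i; unfold f.
    exact (proj2_sig (constructive_indefinite_description _ (HF i))). }
  (* A sequence of exponents that tends to [s_0] and avoids it. *)
  set (u := fun n : nat => s O + (/ (INR n + 1))%R).
  set (H := fun t => Csum (fun i => g N q (param t) i (param t O) * f i (t + INR i)) N).
  assert (HL : Climit (fun n => H (u n))
    (Csum (fun i => g N q (params lq s) i (params lq s O) * I i) N)).
  { apply (Climit_Csum (fun i n => g N q (param (u n)) i (param (u n) O) *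
      f i (u n + INR i))).
    intros i Hi; destruct (Hf i Hi) as [E [Hc _]]; rewrite <- E, <- Es.
    apply Climit_mult.
    - apply (continuous_at_Climit (fun t => g N q (param t) i (param t O)) (s O) u).
      + apply g_continuous, Hadm0.
      + apply Climit_inv_nat.
    - apply (continuous_at_Climit (f i) (s O + INR i) (fun n => u n + INR i) Hc).
      apply Climit_ext with (fun n => (s O + INR i) + (/ (INR n + 1))%R).
      + intros n; unfold u; ring.
      + apply Climit_inv_nat. }
  destruct (finite_radius (fun i y => y <> 0 ->
    nonpole (s O + y + INR i) /\ f i (s O + y + INR i) = I_cont (s O + y + INR i) /\
    admissible (s O + y)) N) as [r [Hr Hrad]].
  { intros i Hi; destruct (Hf i Hi) as [_ [_ [r1 [Hr1 H1]]]].
    destruct (I_cont_meromorphic _ (Hadm i))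
      as [r2 [F [B [Hr2 [_ [_ H2]]]]]].
    destruct (I_cont_meromorphic _ Hadm0)
      as [r3 [F' [B' [Hr3 [_ [_ H3]]]]]].
    exists (Rmin r1 (Rmin r2 r3)); split; [repeat apply Rmin_pos; lra|].
    intros y Hy Hy0.
    pose proof (Rmin_l r1 (Rmin r2 r3)); pose proof (Rmin_r r1 (Rmin r2 r3)).
    pose proof (Rmin_l r2 r3); pose proof (Rmin_r r2 r3).
    assert (E1 : s O + y + INR i - (s O + INR i) = y) by ring.
    assert (Hnp : nonpole (s O + y + INR i)).
    { apply H2; [unfold disc; rewrite E1; lra|].
      intros E; apply Hy0; rewrite <- E1, E; ring. }
    split; [exact Hnp|]; split; [apply H1; [rewrite E1; lra|exact Hnp]|].
    apply H3; unfold disc; replace (s O + y - s O) with y by ring; lra. }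
  apply (Climit_unique _ _ _ HL).
  destruct (Climit_inv_nat 0 r Hr) as [n0 Hn0].
  apply (Climit_shift _ _ n0).
  apply Climit_ext with (fun _ => RtoC 0); [|apply Climit_const].
  intros n; set (y := RtoC (/ (INR (n + n0) + 1))).
  assert (Hy : (Cmod y < r)%R).
  { specialize (Hn0 (n + n0)%nat ltac:(lia)); cbv beta in Hn0.
    replace (0 + RtoC (/ (INR (n + n0) + 1)) - 0) with y in Hn0 by (unfold y; ring).
    exact Hn0. }
  assert (Hy0 : y <> 0).
  { apply RtoC_neq_0, Rgt_not_eq, Rinv_0_lt_compat.
    pose proof (pos_INR (n + n0)); lra. }
  unfold H; change (u (n + n0)%nat) with (s O + y).
  rewrite (Csum_ext _ (fun i => g N q (param (s O + y)) i (param (s O + y) O) *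
    I_cont (s O + y + INR i))).
  - symmetry; apply (g_sum_I_cont); auto.
    + apply (Hrad O y); auto.
    + apply (Hrad (N - 1)%nat y); auto; lia.
  - intros i Hi; f_equal; apply (Hrad i y Hi Hy Hy0).
Qed.

End Cut.

Theorem theorem3p1 :
  forall (N : nat) (lq : C) (s : nat -> C) (I : nat -> C),
    (2 <= N)%nat ->
    (Re lq < 0)%R ->
    (forall j, (j < 2 * N)%nat -> (Cmod (params lq s j) < 1)%R) ->
    (Nat.Odd N ->
       Im lq = 0%R /\
       (forall j, (j < 2 * N)%nat -> (Rabs (Im (lq * s j)) < PI)%R) /\
       tail_converges N s) ->
    (forall i, (i < N)%nat ->
       I_value N lq (set_first s (s O + INR i)) (I i)) ->
    sum_n (fun i => g N (Cexp lq) (params lq s) i (params lq s O) * I i) (N - 1)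
    = RtoC 0.
Proof.
  intros N lq s I HN Hlq Ha Hodd HI.
  rewrite sum_n_Csum; replace (S (N - 1)) with N by lia.
  assert (HN1 : (1 <= N)%nat) by lia.
  destruct (Nat.Even_or_Odd N) as [He|Ho].
  - rewrite (Csum_ext _ (fun i => g N (Cexp lq) (params lq s) i (params lq s O) *
      I_int N lq (shift_first (Cexp lq) (params lq s) i))).
    + apply g_sum_even; auto; apply Cexp_neq_0.
    + intros i Hi; f_equal; rewrite <- params_set_first.
      destruct (HI i Hi) as [[_ Hv]|[Ho _]]; [exact Hv|].
      destruct (Nat.Even_Odd_False N He Ho).
  - destruct (Hodd Ho) as [Him [Hs _]].
    apply (g_sum_odd N lq HN1 Hlq Him s I Ho); auto.
Qed.
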